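(* Let $c_*\in(0,1)$ and the solitary wave profiles $(U_c,N_c,V_c)$, $c\in\mathbb{R}^2$, $|c|<c_*$, be as in the context, and write $V_c=(V_{c,1},V_{c,2})$. There exists $\tilde c_*\in(0,c_* )$ such that, for all $c\in\mathbb{R}^2$ with $|c|<\tilde c_*$, all $m\in\mathbb{N}^2$ and all $y\in\mathbb{R}^2$ with $|y|\geqslant 4$, $$|\partial^m N_c(y)| \lesssim_m e^{-|y|} + \frac{|c|^2}{|y|^{|m|+2}} \qquad\text{and}\qquad |\partial^m V_{c,1}(y)| + |\partial^m V_{c,2}(y)| \lesssim_m \frac{|c|}{|y|^{|m|+2}}.$$ Besides, if the velocity vector is $c\,e_1$ with $c\in\mathbb{R}$, $|c|<\tilde c_*$ (and $U_c,N_c$ denote the corresponding profiles), the following expansion holds for all integers $K\geqslant 3$ and all $|y|\geqslant 4$: $$\left| N_c(y) + \frac{c^2}{4\pi\nu^2}\sum_{n=0}^K \frac{1}{|z|^{2n+2}}\int_{\mathbb{R}^2}\left(2 - \frac{4(n+1)(z_1-\zeta_1)^2}{|z|^2}\right)(2z\cdot\zeta - |\zeta|^2)^n\,|U_c|^2(\nu\zeta_1,\zeta_2)\,\mathrm{d}\zeta\right| \lesssim \frac{c^2K3^K}{|y|^{K+1}} + e^{-|y|} + c^2 C_{c,K}\, e^{-\frac{\nu^2}{8}|y|^{1/K}},$$ where $\nu = \sqrt{1-c^2}$, $z = (z_1,z_2) = (\nu^{-1}y_1, y_2)$ and $C_{c,K} = (2K+5)!\,(1+8\nu^{-2})^{2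K+3}$.
   Context: $Q$ denotes the unique positive radial solution in $H^1(\mathbb{R}^2)$ of $\Delta Q = Q - Q^3$; $e_1=(1,0)$. For $c\in\mathbb{R}^2$, $|c|<1$, and $j=1,2$, define the Fourier multipliers $$S_c f = \mathcal{F}^{-1}\left[\frac{(c\cdot\xi)^2}{|\xi|^2-(c\cdot\xi)^2}\hat f(\xi)\right],\qquad T_{c,j}f = \mathcal{F}^{-1}\left[\frac{(c\cdot\xi)\xi_j}{|\xi|^2-(c\cdot\xi)^2}\hat f(\xi)\right].$$ The solitary wave profiles: $c_*\in(0,1)$ and, for each $c\in\mathbb{R}^2$ with $|c|<c_*$, $U_c:\mathbb{R}^2\to\mathbb{C}$, $N_c:\mathbb{R}^2\to\mathbb{R}$, $V_c:\mathbb{R}^2\to\mathbb{R}^2$ belong to $H^s$ for all $s\geqslant 0$, satisfy $$\Delta U_c = U_c + N_cU_c,\qquad N_c = -|U_c|^2 - S_c(|U_c|^2),\qquad V_c = -\big(T_{c,1}(|U_c|^2),\,T_{c,2}(|U_c|^2)\big),$$ and are close to the NLS soliton in the sense that $\|U_c-Q\|_{H^2}\lesssim|c|^2$, $\|N_c+Q^2\|_{H^2}\lesssim|c|^2$, $\|V_c\|_{H^2\times H^2}\lesssim|c|$. (They give the travelling waves $u(t,x)=\sqrt\omega\,U_c(\sqrt\omega(x-ct))e^{i(c\cdot x/2-|c|^2t/4+\omega t)}$, $n=\omega N_c(\sqrt\omega(x-ct))$, $v=\omega V_c(\sqrt\omega(x-ct))$ of the Zakharov system $\partial_tu=i\Delta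 u-inu$, $\partial_tn=-\nabla\cdot v$, $\partial_tv=-\nabla n-\nabla(|u|^2)$.) For $m=(m_1,m_2)\in\mathbb{N}^2$, $\partial^m=\partial_{y_1}^{m_1}\partial_{y_2}^{m_2}$ and $|m|=m_1+m_2$. $A\lesssim B$ means $A\leqslant CB$ with a constant $C>0$ independent of all parameters (in particular of $c$, $K$, $y$); $A\lesssim_m B$ means the constant may depend on $m$ only. *)

(* Defs.v *)
From HB Require Import structures.
From mathcomp Require Import all_boot all_order all_algebra.
From mathcomp Require Import all_classical all_reals all_analysis.
From mathcomp Require Import complex.

Set Implicit Arguments.
Unset Strict Implicit.
Unset Printing Implicit Defensive.

Import Order.TTheory GRing.Theory Num.Theory.
Import numFieldNormedType.Exports.

Local Open Scope classical_set_scope.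
Local Open Scope complex_scope.
Local Open Scope ring_scope.

(* Points of the plane are pairs.  The library norm on R * R is the sup norm,
   hence the separate Euclidean norm. *)
Definition dotp (R : realType) (x y : R * R) : R := x.1 * y.1 + x.2 * y.2.
Definition enorm (R : realType) (x : R * R) : R := Num.sqrt (dotp x x).

Notation leb2 R := ((@lebesgue_measure R) \x (@lebesgue_measure R))%E.

Definition pcoord (R : realType) (j : 'I_2) (x : R * R) : R :=
  if j == ord0 then x.1 else x.2.

Definition evec (R : realType) (j : 'I_2) : R * R :=
  if j == ord0 then (1, 0) else (0, 1).

Definition partial (R : realType) (j : 'I_2) (f : R * R -> R) : R * R -> R :=
  'D_(evec R j) f.

(* The head of s is the index of the last partial derivative taken. *)
Definition partials (R : realType) (s : seq 'I_2) (f : R * R -> R)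
    : R * R -> R :=
  foldr (@partial R) f s.

Definition mdeg (m : nat * nat) : nat := (m.1 + m.2)%N.

Definition pderiv (R : realType) (m : nat * nat) (f : R * R -> R)
    : R * R -> R :=
  partials (nseq m.1 ord0 ++ nseq m.2 ord_max) f.

(* The value of 'D_v f y is meaningful only where f is derivable, hence the
   derivability requirement. *)
Definition Cn (R : realType) (n : nat) (f : R * R -> R) : Prop :=
  forall s : seq 'I_2, (size s <= n)%N ->
    continuous (partials s f) /\
    ((size s < n)%N -> forall j y, derivable (partials s f) y (evec R j)).

Definition smooth (R : realType) (f : R * R -> R) : Prop :=
  forall n, Cn n f.

Definition laplacian (R : realType) (f : R * R -> R) (y : R * R) : R :=
  pderiv (2, 0)%N f y + pderiv (0, 2)%N f y.

Definition reF (R : realType) (f : R * R -> R[i]) (y : R * R) : R :=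
  complex.Re (f y).
Definition imF (R : realType) (f : R * R -> R[i]) (y : R * R) : R :=
  complex.Im (f y).

Definition laplacianC (R : realType) (f : R * R -> R[i]) (y : R * R) : R[i] :=
  laplacian (reF f) y +i* laplacian (imF f) y.

Definition sqmod (R : realType) (f : R * R -> R[i]) (y : R * R) : R :=
  ComplexField.Normc.normc (f y) ^+ 2.

Definition test_function (R : realType) (phi : R * R -> R) : Prop :=
  smooth phi /\ exists r : R, forall y, r < enorm y -> phi y = 0.

Definition weak_partial (R : realType) (m : nat * nat)
    (f g : R * R -> R) : Prop :=
  forall phi, test_function phi ->
    \int[leb2 R]_x (f x * pderiv m phi x)
    = (-1) ^+ mdeg m * \int[leb2 R]_x (g x * phi x).

Definition L2 (R : realType) (f : R * R -> R) : Prop :=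
  f \in Lfun (leb2 R) 2%:E.

Definition weak_partials (R : realType) (k : nat) (f : R * R -> R)
    (g : nat * nat -> R * R -> R) : Prop :=
  L2 f /\ forall m, (mdeg m <= k)%N -> L2 (g m) /\ weak_partial m f (g m).

Definition in_H (R : realType) (k : nat) (f : R * R -> R) : Prop :=
  exists g, weak_partials k f g.

(* The squared H^k norm, the sum over |m| <= k of the squared L^2 norms of the
   weak derivatives of f.  These are unique almost everywhere, so the infimum
   ranges over one value if f is in H^k; it is +oo otherwise. *)
Definition sobolev_sq (R : realType) (k : nat) (f : R * R -> R) : \bar R :=
  ereal_inf [set s | exists2 g, weak_partials k f g &
    s = (\sum_(i < k.+1) \sum_(j < k.+1 | (i + j <= k)%N)
           \int[leb2 R]_x (g (nat_of_ord i, nat_of_ord j) x ^+ 2)%:E)%E].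

Definition sobolev (R : realType) (k : nat) (f : R * R -> R) : \bar R :=
  (sobolev_sq k f `^ 2^-1)%E.

Definition sobolevC (R : realType) (k : nat) (f : R * R -> R[i]) : \bar R :=
  ((sobolev_sq k (reF f) + sobolev_sq k (imF f)) `^ 2^-1)%E.

Definition sobolev2 (R : realType) (k : nat) (f : R * R -> R * R) : \bar R :=
  ((sobolev_sq k (fst \o f) + sobolev_sq k (snd \o f)) `^ 2^-1)%E.

(* H^s for all s >= 0, i.e. H^k for all natural k since the scale is decreasing
   in s.  Elements of this space are identified with their smooth
   representatives. *)
Definition in_Hinfty (R : realType) (f : R * R -> R) : Prop :=
  smooth f /\ forall k, in_H k f.

Definition cintegral (R : realType) (f : R * R -> R[i]) : R[i] :=
  (\int[leb2 R]_x reF f x) +i* (\int[leb2 R]_x imF f x).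

Definition expi (R : realType) (t : R) : R[i] := cos t +i* sin t.

Definition fourier (R : realType) (f : R * R -> R[i]) (xi : R * R) : R[i] :=
  cintegral (fun x => f x * expi (- dotp x xi)).

Definition inv_fourier (R : realType) (g : R * R -> R[i]) (x : R * R) : R[i] :=
  (((2 * pi) ^+ 2)^-1)%:C * cintegral (fun xi => g xi * expi (dotp x xi)).

(* The operators S_c and T_{c,j} are applied only to |U_c|^2, which is
   integrable with integrable Fourier transform when U_c is in H^s for all s;
   the symbols are bounded for |c| < 1, so the integrals below converge
   absolutely.  The value of the symbols at xi = 0 is immaterial. *)
Definition S_op (R : realType) (c : R * R) (f : R * R -> R) : R * R -> R[i] :=
  inv_fourier (fun xi =>
    (dotp c xi ^+ 2 / (enorm xi ^+ 2 - dotp c xi ^+ 2))%:C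
    * fourier (fun x => (f x)%:C) xi).

Definition T_op (R : realType) (c : R * R) (j : 'I_2) (f : R * R -> R)
    : R * R -> R[i] :=
  inv_fourier (fun xi =>
    (dotp c xi * pcoord j xi / (enorm xi ^+ 2 - dotp c xi ^+ 2))%:C
    * fourier (fun x => (f x)%:C) xi).

(* Q is the positive radial H^1 solution of Delta Q = Q - Q^3; its uniqueness
   is a theorem and is not part of the definition. *)
Definition nls_soliton (R : realType) (Q : R * R -> R) : Prop :=
  [/\ in_H 1 Q, Cn 2 Q,
      (forall y, 0 < Q y),
      (forall x y, enorm x = enorm y -> Q x = Q y) &
      forall y, laplacian Q y = Q y - Q y ^+ 3].

Record solitary_profiles (R : realType) (cs : R) (Q : R * R -> R)
    (U : R * R -> R * R -> R[i]) (N : R * R -> R * R -> R)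
    (V : R * R -> R * R -> R * R) : Prop := SolitaryProfiles {
  profiles_regular : forall c, enorm c < cs ->
    [/\ in_Hinfty (reF (U c)), in_Hinfty (imF (U c)), in_Hinfty (N c),
        in_Hinfty (fst \o V c) & in_Hinfty (snd \o V c)];
  profile_U_eq : forall c, enorm c < cs -> forall y,
    laplacianC (U c) y = U c y + (N c y)%:C * U c y;
  profile_N_eq : forall c, enorm c < cs -> forall y,
    (N c y)%:C = - (sqmod (U c) y)%:C - S_op c (sqmod (U c)) y;
  profile_V_eq : forall c, enorm c < cs -> forall j y,
    (pcoord j (V c y))%:C = - T_op c j (sqmod (U c)) y;
  profiles_close : exists2 C : R, 0 < C & forall c, enorm c < cs ->
    [/\ (sobolevC 2 (fun y => (U c y - (Q y)%:C)%R) <= (C * enorm c ^+ 2)%:E)%E,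
        (sobolev 2 (fun y => (N c y + Q y ^+ 2)%R) <= (C * enorm c ^+ 2)%:E)%E &
        (sobolev2 2 (V c) <= (C * enorm c)%:E)%E]
}.

(* The partial sum in the multipole expansion of N at velocity (c, 0), without
   its prefactor. *)
Definition expansion_sum (R : realType) (nu : R) (U : R * R -> R[i])
    (K : nat) (z : R * R) : R :=
  \sum_(0 <= n < K.+1)
    (enorm z ^+ (2 * n + 2)%N)^-1 *
    \int[leb2 R]_zeta
      ((2 - 4 * n.+1%:R * (z.1 - zeta.1) ^+ 2 / enorm z ^+ 2)
       * (2 * dotp z zeta - enorm zeta ^+ 2) ^+ n
       * sqmod U (nu * zeta.1, zeta.2)).

Definition expansion_const (R : realType) (nu : R) (K : nat) : R :=
  ((2 * K + 5)%N`!)%:R * (1 + 8 * nu ^- 2) ^+ (2 * K + 3)%N.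

(* Main.v *)
(* Write f = |U_c|^2.  For small c the profile equation gives
   Delta f >= 2 (1 + N_c) f with N_c close to 0 outside a fixed ball, so
   comparison with exponentials on half planes gives f <= C e^{-6|y|/5}
   uniformly in c; the Landau inequality between consecutive derivatives then
   yields |D^s f| <= C e^{-|y|}, once the D^s f are known to be uniformly
   bounded.  That bound comes from (1 + |xi|^2) F[U_c] = - F[N_c U_c], which
   controls the L^1 norm of F[U_c] and then, inductively, all its weighted sup
   norms.
   By Fourier inversion D^m N_c + D^m f and D^m V_c are oscillatory integrals of
   F[f] against symbols xi_i xi_j xi^m / A(xi), A(xi) = |xi|^2 - (c.xi)^2.
   Inserting e^{-t A(xi)} costs O(t) and turns them into convolutions of f with
   kernels k_t; integration by parts in xi gives
   |k_t(w)| <= C min(t^{-a/2}, |w|^{-a}) with a = |m| + 2, and t = |y|^{-2a}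
   proves the far-field bounds.
   For c = (c, 0) and m = 0 the kernel is explicit up to Gaussian terms: after
   the dilation w_1 -> w_1 / nu it is the second derivative of log|w|.  Taking
   t = exp(- nu |y|^{1/K} / 4), the geometric expansion of |z - zeta|^{-2} for
   |zeta| <= |y|^{1/K} gives the series, and the exponential decay of f
   controls the remaining zeta. *)
Require Import Defs.
From HB Require Import structures.
From mathcomp Require Import all_boot all_order all_algebra.
From mathcomp Require Import all_classical all_reals all_analysis.
From mathcomp Require Import measurable_realfun complex.
From mathcomp Require Import ring lra zify.

Set Implicit Arguments.
Unset Strict Implicit.
Unset Printing Implicit Defensive.

Import Order.TTheory GRing.Theory Num.Theory.
Import numFieldNormedType.Exports.

Local Open Scope classical_set_scope.
Local Open Scope complex_scope.
Local Open Scope ring_scope.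

(** * Integration on the plane *)

(** The obstacle is uniformity in [c]: smoothness is assumed for each [c] separately, and only the
    H^2 distance to the soliton is controlled uniformly. At [c = 0] that distance is zero, so [Q] is
    the real part of a profile and inherits boundedness and decay without any study of its equation.
    Higher norms are uniform by absorption. Let [m1] and [m2] be the sup norms of F[U_c] weighted by
    1 + |xi|^2 and by its square. The equation bounds [m1] directly; interpolation bounds the L^1
    norm of F[U_c] by (m1^3 m2)^{1/4}; the equation then bounds [m2] by a multiple of m1 (m1^3
    m2)^{1/2}, and since [m2] is finite for each [c] this bounds it in terms of [m1]. The symbols
    are not smooth at 0, so integration by parts in xi cannot be repeated on the kernels themselves.
    The t-derivative of the damped symbol has no denominator A, and it is there that one integrates
    by parts. The damping parameter is a function of y, so no limit t -> 0 of the kernels is taken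
    and no singular integral occurs. *)

Definition itg d (T : measurableType d) (R : realType)
  (mu : {measure set T -> \bar R}) (f : T -> R) :=
  mu.-integrable setT (EFin \o f).

Section itg_theory.
Context d (T : measurableType d) (R : realType).
Variable mu : {measure set T -> \bar R}.
Implicit Types f g : T -> R.

Lemma itg_meas f : itg mu f -> measurable_fun setT f.
Proof. by case/integrableP => /measurable_EFinP. Qed.

Lemma itg_le f g : measurable_fun setT f -> (forall x, `|f x| <= g x) ->
  itg mu g -> itg mu f.
Proof.
move=> mf fg; apply: le_integrable => //; first exact/measurable_EFinP.
by move=> x _; rewrite /= lee_fin (le_trans (fg x))// ler_norm.
Qed.

Lemma itgD f g : itg mu f -> itg mu g -> itg mu (fun x => f x + g x).
Proof. by move=> If Ig; apply: (eq_integrable _ _ _ _ (integrableD measurableT If Ig)). Qed.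

Lemma itgN f : itg mu f -> itg mu (fun x => - f x).
Proof. by move=> If; apply: (eq_integrable _ _ _ _ (integrableN If)). Qed.

Lemma itgB f g : itg mu f -> itg mu g -> itg mu (fun x => f x - g x).
Proof. by move=> ? ?; apply: itgD => //; apply: itgN. Qed.

Lemma itgZl k f : itg mu f -> itg mu (fun x => k * f x).
Proof. by move=> If; apply: (eq_integrable _ _ _ _ (integrableZl measurableT k If)). Qed.

Lemma itgZr k f : itg mu f -> itg mu (fun x => f x * k).
Proof.
move=> /(itgZl k) If; rewrite (_ : (fun _ => _) = (fun x => k * f x))//.
by apply/funext => x; rewrite mulrC.
Qed.

Lemma itg_norm f : itg mu f -> itg mu (fun x => `|f x|).
Proof. by move=> /integrable_norm. Qed.

Lemma itg0 : itg mu (fun=> 0).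
Proof. exact: integrable0. Qed.

Lemma eq_Rint f g : (forall x, f x = g x) ->
  \int[mu]_x f x = \int[mu]_x g x.
Proof. by move=> fg; congr Rintegral; apply/funext. Qed.

Lemma RintD f g : itg mu f -> itg mu g ->
  \int[mu]_x (f x + g x) = \int[mu]_x f x + \int[mu]_x g x.
Proof. by move=> ? ?; rewrite RintegralD. Qed.

Lemma RintB f g : itg mu f -> itg mu g ->
  \int[mu]_x (f x - g x) = \int[mu]_x f x - \int[mu]_x g x.
Proof. by move=> ? ?; rewrite RintegralB. Qed.

Lemma RintZl k f : itg mu f -> \int[mu]_x (k * f x) = k * \int[mu]_x f x.
Proof. by move=> ?; rewrite RintegralZl. Qed.

Lemma RintZr k f : itg mu f -> \int[mu]_x (f x * k) = (\int[mu]_x f x) * k.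
Proof. by move=> ?; rewrite RintegralZr. Qed.

Lemma RintN f : itg mu f -> \int[mu]_x (- f x) = - \int[mu]_x f x.
Proof.
move=> ?; rewrite -mulN1r -RintZl//; apply: eq_Rint => x; by rewrite mulN1r.
Qed.

Lemma Rint0 : \int[mu]_x (0 : R) = 0.
Proof.
rewrite -[RHS](mul0r (\int[mu]_x (0 : R))) -RintZl; last exact: itg0.
by apply: eq_Rint => x; rewrite mul0r.
Qed.

Lemma Rint_ge0 f : (forall x, 0 <= f x) -> 0 <= \int[mu]_x f x.
Proof. by move=> f0; apply: Rintegral_ge0. Qed.

Lemma le_Rint f g : itg mu f -> itg mu g -> (forall x, f x <= g x) ->
  \int[mu]_x f x <= \int[mu]_x g x.
Proof. by move=> ? ? fg; apply: le_Rintegral. Qed.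

Lemma le_Rint_norm f : itg mu f -> `|\int[mu]_x f x| <= \int[mu]_x `|f x|.
Proof. by move=> ?; apply: le_normr_Rintegral. Qed.

Lemma Rint_bound f g : measurable_fun setT f -> itg mu g ->
  (forall x, `|f x| <= g x) -> `|\int[mu]_x f x| <= \int[mu]_x g x.
Proof.
move=> mf ig fg; have itf := itg_le mf fg ig.
by apply: (le_trans (le_Rint_norm itf)); apply: le_Rint => //; exact: itg_norm.
Qed.
End itg_theory.

Section Rfubini.
Context d1 d2 (T1 : measurableType d1) (T2 : measurableType d2) (R : realType).
Variable m1 : {sigma_finite_measure set T1 -> \bar R}.
Variable m2 : {sigma_finite_measure set T2 -> \bar R}.
Variables (F : T1 * T2 -> R) (g : T1 -> R) (h : T2 -> R).
Hypotheses (mF : measurable_fun setT F) (ig : itg m1 g) (ih : itg m2 h).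
Hypothesis FE : forall x y, `|F (x, y)| <= g x * h y.

(** The domination holds at every point, so every section is integrable and not just almost every
    one; the iterated real integrals below carry no exceptional set. *)
Lemma sec1_itg x : itg m2 (fun y => F (x, y)).
Proof using All.
apply: (@itg_le _ _ _ _ _ (fun y => g x * h y)) => //; last exact: itgZl.
exact: measurableT_comp.
Qed.

Lemma sec2_itg y : itg m1 (fun x => F (x, y)).
Proof using All.
apply: (@itg_le _ _ _ _ _ (fun x => g x * h y)) => //; last exact: itgZr.
exact: measurableT_comp.
Qed.

Lemma prod_itg : itg (m1 \x m2)%E F.
Proof using All.
apply/integrable12ltyP; first exact/measurable_EFinP.
apply: (@le_lt_trans _ _ (\int[m1]_x (`|g x| * \int[m2]_y `|h y|)%:E)%E).
  apply: ge0_le_integral => //.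
  - by move=> x _; apply: integral_ge0.
  - apply: (@measurable_fun_fubini_tonelli_F _ _ _ _ _ m2 (fun z => `|(F z)%:E|%E)) => //.
    by apply: measurableT_comp => //; apply/measurable_EFinP.
  - apply/measurable_EFinP; apply: measurable_funM => //.
    by apply: measurableT_comp => //; exact: itg_meas ig.
  - move=> x _.
    rewrite EFinM /Rintegral fineK; last first.
      by apply: integrable_fin_num => //; exact: itg_norm.
    rewrite -integralZl//; last exact: itg_norm.
    apply: ge0_le_integral => //.
    + apply: measurableT_comp => //; apply/measurable_EFinP; exact: itg_meas (sec1_itg x).
    + apply/measurable_EFinP; apply: measurable_funM => //; apply: measurableT_comp => //; exact: itg_meas ih.
    + by move=> y _; rewrite /= -EFinM lee_fin -normrM (le_trans (FE x y))// ler_norm.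
rewrite ltey_eq; apply/orP; left.
apply: integrable_fin_num => //.
by apply: (@itgZr _ _ _ m1 _ (fun x => `|g x|)); exact: itg_norm.
Qed.

Lemma Rint12 : \int[(m1 \x m2)%E]_z F z = \int[m1]_x \int[m2]_y F (x, y).
Proof using All.
rewrite /Rintegral -(integral12_prod_meas1 prod_itg); congr fine.
apply: eq_integral => x _; rewrite /fubini_F/= fineK//.
exact: (integrable_fin_num measurableT (sec1_itg x)).
Qed.

Lemma Rint21 : \int[(m1 \x m2)%E]_z F z = \int[m2]_y \int[m1]_x F (x, y).
Proof using All.
rewrite /Rintegral -(integral21_prod_meas1 prod_itg); congr fine.
apply: eq_integral => x _; rewrite /fubini_G/= fineK//.
exact: (integrable_fin_num measurableT (sec2_itg x)).
Qed.

Lemma Rfubini : \int[m1]_x \int[m2]_y F (x, y) = \int[m2]_y \int[m1]_x F (x, y).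
Proof using All. by rewrite -Rint12 Rint21. Qed.

Lemma itg_Rint12 : itg m1 (fun x => \int[m2]_y F (x, y)).
Proof using All.
have := integrable_fubini_F prod_itg; apply: eq_integrable => // x _.
by rewrite /fubini_F/= fineK// (integrable_fin_num measurableT (sec1_itg x)).
Qed.

Lemma itg_Rint21 : itg m2 (fun y => \int[m1]_x F (x, y)).
Proof using All.
apply: (@itg_le _ _ _ _ _ (fun y => (\int[m1]_x `|g x|) * `|h y|)).
- apply: (@eq_measurable_fun _ _ _ _ _ (fine \o fubini_G m1 (EFin \o F))) => //.
  by apply: measurableT_comp => //; exact: measurable_fubini_G prod_itg.
- move=> y; rewrite -RintZr; last exact: itg_norm.
  apply: Rint_bound.
  + exact: itg_meas (sec2_itg y).
  + by apply: (@itgZr _ _ _ m1 `|h y| (fun x => `|g x|)); exact: itg_norm.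
  + by move=> x; rewrite -normrM (le_trans (FE x y))// ler_norm.
- by apply: itgZl; exact: itg_norm.
Qed.
End Rfubini.

(** * Measurability, integrable weights and substitution on the line *)

Section R2.
Variable R : realType.
Local Notation leb := (@lebesgue_measure R).

(** The sigma-algebra of the plane is the product one. An open set belongs to it as the countable
    union of the squares of rational centre and radius 1/(n+1) that it contains. *)
Lemma open2_measurable (O : set (R * R)) : open O -> measurable O.
Proof.
move=> oO.
pose rect (k : rat * rat * nat) : set (R * R) :=
  ball (ratr k.1.1 : R) (k.2.+1%:R^-1) `*` ball (ratr k.1.2 : R) (k.2.+1%:R^-1).
pose F k := if `[< rect k `<=` O >] then rect k else set0.
have -> : O = \bigcup_k F k.
  apply/seteqP; split => [x Ox|x [k _]]; last first.
    by rewrite /F; case: asboolP => // /(_ x).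
  have /nbhs_ballP[e /= e0 eO] : nbhs x O by exact: open_nbhs_nbhs.
  have [n ne] : exists n : nat, n.+1%:R^-1 < e / 2.
    have [n] := @ltr_add_invr R 0 (e / 2) ltac:(by rewrite divr_gt0).
    by rewrite add0r => ?; exists n.
  have rin (z : R) : exists q : rat, ball (ratr q : R) (n.+1%:R^-1) z.
    have : z - n.+1%:R^-1 < z + n.+1%:R^-1.
      by rewrite ltrD2l (@lt_trans _ _ 0) ?oppr_lt0 ?invr_gt0.
    move=> /rat_in_itvoo[q]; rewrite in_itv/= => /andP[q1 q2]; exists q.
    by move: q1 q2; set d := _^-1 => q1 q2; rewrite /ball/= ltr_norml; apply/andP; split; lra.
  have [q1 hq1] := rin x.1; have [q2 hq2] := rin x.2.
  exists (q1, q2, n) => //; rewrite /F; case: asboolP => [_|]; first by split.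
  case; move=> z [/= z1 z2]; apply: eO; split.
      exact: ball_split (ball_sym (le_ball (ltW ne) hq1)) (le_ball (ltW ne) z1).
  exact: ball_split (ball_sym (le_ball (ltW ne) hq2)) (le_ball (ltW ne) z2).
apply: countable_bigcupT_measurable; first exact: countableP.
move=> k; rewrite /F; case: asboolP => // _.
by apply: measurableX; apply: open_measurable; exact: ball_open.
Qed.

Lemma continuous2_measurable (f : R * R -> R) :
  continuous f -> measurable_fun setT f.
Proof.
move=> /continuousP cf; apply: (measurability _ (RGenOpens.measurableE R)).
move=> _ [_ [a [b ->] <-]]; rewrite setTI; apply: open2_measurable.
exact/cf/interval_open.
Qed.

(** By evenness the integral is twice the one over the half-line, which the antiderivative evaluates
    to [l - F 0]. *)
Lemma even_itg (f F : R -> R) (l : R) : (forall x, 0 <= f x) -> continuous f ->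
  (forall x, f (- x) = f x) -> F x @[x --> +oo] --> l ->
  (forall x : R, 0 <= x -> is_derive x 1 F (f x)) -> itg leb f.
Proof.
move=> f0 cf fN Fl dF.
apply/integrableP; split.
  by apply/measurable_EFinP; exact: continuous_measurable_fun.
under eq_integral => x _ do rewrite /= ger0_norm//.
rewrite ge0_symfun_integralT//; last by move=> x /=; rewrite fN.
rewrite [X in (_ * X)%E](_ : _ = (\int[leb]_(x in `[0%R, +oo[) (f x)%:E)%E); last first.
  by congr integral; apply/seteqP; split => x /=; rewrite in_itv/= andbT.
rewrite (@ge0_continuous_FTC2y _ f F 0 l)//.
- by rewrite -EFinD -EFinM ltry.
- by apply: continuous_subspaceT.
- by move=> x x0; case: (dF x (ltW x0)).
- have [/derivable1_diffP/differentiable_continuous+ _] := dF 0 (lexx _).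
  by apply: cvg_at_right_filter.
- by move=> x; rewrite in_itv/= andbT => x0; case: (dF x (ltW x0)) => _; rewrite derive1E.
Qed.

Lemma expR_abs_itg (a : R) : 0 < a -> itg leb (fun x => expR (- (a * `|x|))).
Proof.
move=> a0.
have cf : continuous (fun x : R => expR (- (a * `|x|))).
  move=> x; apply: continuous_comp; last exact: continuous_expR.
  apply: continuousN; apply: continuousM; first exact: cst_continuous.
  exact: norm_continuous.
pose F (x : R) := - a^-1 * expR (- (a * x)).
apply: (@even_itg _ F 0) => //.
- by move=> x; rewrite normrN.
- rewrite -[X in _ --> X](mulr0 (- a^-1)); apply: cvgMr.
  apply: (@cvg_comp _ _ _ (fun x : R => a * x) (fun z : R => expR (- z)) _ (pinfty_nbhs R)); last exact: cvgr_expR.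
  exact: gt0_cvgMry cvg_id.
- move=> x x0; rewrite ger0_norm//.
  apply: is_derive_eq.
  rewrite /GRing.scale/=; field; by rewrite gt_eqF.
Qed.

(** The exponent exceeds 1, for integrability, and the fourth power of the weight is
    [(1 + |x|) ^- 5], the power produced by the interpolation between two weighted sup norms in
    [interp]. *)
Definition wt (x : R) : R := (1 + `|x|) `^ (- (5 / 4)).

Lemma wt_ge0 x : 0 <= wt x. Proof. exact: powR_ge0. Qed.

Lemma wt_cont : continuous wt.
Proof.
move=> x.
have h : {for 1 + `|x|, continuous (fun y : R => y `^ (- (5 / 4)))}.
  apply/differentiable_continuous/derivable1_diffP.
  by apply: derivable_powR; rewrite in_itv/= andbT ltr_pwDl.
apply: (@continuous_comp _ _ _ (fun x : R => 1 + `|x|) (fun y : R => y `^ (- (5 / 4)))) => //.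
by apply: cvgD; [exact: cvg_cst|exact: norm_continuous].
Qed.

Lemma wt4 x : wt x ^+ 4 = (1 + `|x|) ^- 5.
Proof.
have x0 : 0 <= 1 + `|x| by rewrite addr_ge0.
rewrite /wt -powR_mulrn ?powR_ge0// -powRrM -powR_invn//; congr (_ `^ _).
by field.
Qed.

Lemma wt_itg : itg leb wt.
Proof.
pose F (x : R) : R := - 4 * (1 + x) `^ (- (1 / 4)).
apply: (@even_itg _ F 0).
- exact: wt_ge0.
- exact: wt_cont.
- by move=> x; rewrite /wt normrN.
- rewrite -[X in _ --> X](mulr0 (- 4)); apply: cvgMr.
  apply/cvgrPdist_le => e e0.
  near=> x.
  have x0 : 0 < x by near: x; exact: nbhs_pinfty_gt.
  have x1 : 0 < 1 + x by rewrite addr_gt0.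
  rewrite sub0r normrN ger0_norm ?powR_ge0// powRN.
  rewrite invf_ple ?posrE ?powR_gt0//.
  rewrite (_ : e^-1 = ((e^-1) ^+ 4) `^ (1/4)); last first.
    rewrite -powR_mulrn ?invr_ge0 ?ltW// -powRrM.
    rewrite (_ : _ * _ = 1) ?powRr1 ?invr_ge0 ?ltW//; by field.
  apply: ge0_ler_powR; rewrite ?nnegrE ?exprn_ge0 ?invr_ge0 ?ltW//.
  apply: (@lt_trans _ _ x); last by rewrite ltrDr.
  near: x; apply: nbhs_pinfty_gt; exact: num_real.
- move=> x x0; have x1 : 0 < 1 + x by rewrite (lt_le_trans _ (_ : 1 <= _)) ?lerDl.
  rewrite /wt (ger0_norm x0).
  have h := is_derive1_powR (- (1/4)) x1.
  have h2 : is_derive x 1 (fun x : R => (1 + x) `^ (- (1 / 4))) ((- (1 / 4) * (1 + x) `^ (- (1 / 4) - 1)) * (0 + 1)).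
    apply: (@is_derive1_comp _ (fun y => y `^ (- (1/4))) (fun x => 1 + x)).
  apply: is_derive_eq.
  rewrite (_ : - (1 / 4) - 1 = - (5 / 4)) /GRing.scale/=.
    by move: (_ `^ _) => q; field.
  by field.
Unshelve. all: end_near. Qed.

Lemma itv_cvg (g : R -> R) : itg leb g ->
  \int[leb]_(x in `[- n%:R, n%:R]) g x @[n --> \oo] --> \int[leb]_x g x.
Proof.
move=> ig.
pose D n := `[- n%:R, n%:R]%classic : set R.
have mg := itg_meas ig.
have mD n : measurable (D n) by exact: measurable_itv.
have mf n : measurable_fun setT (EFin \o (g \_ (D n))).
  apply/measurable_EFinP; apply/(measurable_restrictT _ (mD n)).
  exact: measurable_funTS.
have cf : {ae leb, forall x, setT x -> (EFin \o (g \_ (D n))) x @[n --> \oo] --> (EFin \o g) x}.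
  apply: aeW => x _; apply: cvg_near_cst; near=> n.
  rewrite /= patchE ifT// inE /D/= in_itv/= -ler_norml.
  near: n; exact: nbhs_infty_ger.
have df : {ae leb, forall x n, setT x -> (`|(EFin \o (g \_ (D n))) x| <= `|g x|%:E)%E}.
  apply: aeW => x n _; rewrite /= lee_fin patchE; case: ifP => // _.
  by rewrite normr0.
have [_ _ h] := @dominated_convergence _ _ _ leb setT measurableT (fun n => EFin \o (g \_ (D n))) (EFin \o g) (fun x => `|g x|%:E) mf ((measurable_EFinP _ _).2 mg) cf (itg_norm ig) df.
have /fine_cvg : (\int[leb]_x (EFin \o (g \_ (D n))) x)%E @[n --> \oo] --> (\int[leb]_x g x)%:E.
  by rewrite /Rintegral fineK ?(integrable_fin_num measurableT ig).
apply: cvg_trans; apply: near_eq_cvg; near=> n.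
by rewrite /= /Rintegral [in RHS]integral_mkcond restrict_EFin.
Unshelve. all: end_near. Qed.

Lemma subst_ge0 (a b : R) (G : R -> R) : 0 < a -> continuous G -> (forall x, 0 <= G x) ->
  itg leb G ->
  itg leb (fun x => G (a * x + b)) /\ \int[leb]_x G (a * x + b) = a^-1 * \int[leb]_x G x.
Proof.
move=> a0 cG G0 iG.
have dF (x : R) : is_derive x 1 (fun x => a * x + b) a.
  by apply: is_derive_eq; rewrite /GRing.scale/=; ring.
have F'E : (fun x : R => a * x + b)^`()%classic = cst a.
  by apply/funext => x; rewrite derive1E derive_val.
have cF : continuous (fun x => G (a * x + b)).
  move=> x; apply: (@continuous_comp _ _ _ (fun x => a * x + b) G); last exact: cG.
  by apply: cvgD; [apply: cvgMr; exact: cvg_id|exact: cvg_cst].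
have h := @increasing_ge0_integration_by_substitutionT _ (fun x => a * x + b) G.
have {}h : (\int[leb]_x (G x)%:E = \int[leb]_x (G (a * x + b) * a)%:E)%E.
  rewrite h ?F'E//.
  - by move=> x y xy; rewrite ltrD2r ltr_pM2l.
  - by move=> x; exact: cvg_cst.
  - by apply/cvg_ex; exists a; exact: cvg_cst.
  - by apply/cvg_ex; exists a; exact: cvg_cst.
  - apply/cvgrNyPle => A; near=> x; rewrite -lerBrDr mulrC -(ler_pdivlMr _ _ a0).
    by near: x; apply: nbhs_ninfty_le; exact: num_real.
  - apply/cvgryPge => A; near=> x; rewrite -lerBlDr mulrC -(ler_pdivrMr _ _ a0).
    by near: x; apply: nbhs_pinfty_ge; exact: num_real.
have i1 : itg leb (fun x => G (a * x + b) * a).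
  apply/integrableP; split.
    by apply/measurable_EFinP; apply: measurable_funM => //; exact: continuous_measurable_fun.
  rewrite [X in (X < _)%E](_ : _ = (\int[leb]_x (G (a * x + b) * a)%:E)%E); last first.
    by apply: eq_integral => x _; rewrite /= ger0_norm// mulr_ge0// ltW.
  by rewrite -h ltey_eq (integrable_fin_num measurableT iG).
have i2 : itg leb (fun x => G (a * x + b)).
  have := itgZr a^-1 i1; congr itg; apply/funext => x; by rewrite mulfK ?gt_eqF.
split=> //.
have -> : \int[leb]_x G x = \int[leb]_x (G (a * x + b) * a) by rewrite /Rintegral h.
by rewrite RintZr// mulrCA mulVf ?gt_eqF// mulr1.
Unshelve. all: end_near. Qed.

(** The signed case follows from the nonnegative one, [G] being the difference of the nonnegative
    functions [|G| + G] and [|G|]. *)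
Lemma subst_line (a b : R) (G : R -> R) : 0 < a -> continuous G -> itg leb G ->
  itg leb (fun x => G (a * x + b)) /\ \int[leb]_x G (a * x + b) = a^-1 * \int[leb]_x G x.
Proof.
move=> a0 cG iG.
have cN : continuous (fun x => `|G x|).
  by move=> x; apply: (@continuous_comp _ _ _ G Num.norm); [exact: cG|exact: norm_continuous].
have [i1 e1] := @subst_ge0 a b (fun x => `|G x|) a0 cN (fun=> normr_ge0 _) (itg_norm iG).
have [i2 e2] := @subst_ge0 a b (fun x => `|G x| + G x) a0
  (fun x => cvgD (cN x) (cG x)) ltac:(by move=> x; have := ler_norm (- G x); rewrite normrN; lra) (itgD (itg_norm iG) iG).
have E : (fun x => G (a * x + b)) = (fun x => (`|G (a * x + b)| + G (a * x + b)) - `|G (a * x + b)|).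
  by apply/funext => x; rewrite addrAC subrr add0r.
rewrite E; split; first exact: itgB.
rewrite RintB// e1 e2 RintD//; last exact: itg_norm.
by rewrite mulrDr addrAC subrr add0r.
Qed.
End R2.

(** * Euclidean norm, separable weights and Fubini in the plane *)

Section R2.
Variable R : realType.
Local Notation leb := (@lebesgue_measure R).

Lemma dotpC (x y : R * R) : dotp x y = dotp y x.
Proof. by rewrite /dotp; ring. Qed.

Lemma enorm_ge0 (x : R * R) : 0 <= enorm x. Proof. exact: sqrtr_ge0. Qed.

Lemma enorm2 (x : R * R) : enorm x ^+ 2 = x.1 ^+ 2 + x.2 ^+ 2.
Proof. by rewrite /enorm /dotp -!expr2 sqr_sqrtr// addr_ge0 ?sqr_ge0. Qed.

Lemma enorm_le (x : R * R) (r : R) : 0 <= r -> (enorm x <= r) = (x.1 ^+ 2 + x.2 ^+ 2 <= r ^+ 2).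
Proof. by move=> r0; rewrite -enorm2 ler_pXn2r ?nnegrE// enorm_ge0. Qed.

Lemma enorm1_le (x : R * R) : `|x.1| <= enorm x.
Proof.
rewrite -(@ler_pXn2r _ 2)// ?nnegrE ?enorm_ge0// enorm2 real_normK ?num_real//.
by rewrite lerDl sqr_ge0.
Qed.

Lemma enorm2_le (x : R * R) : `|x.2| <= enorm x.
Proof.
rewrite -(@ler_pXn2r _ 2)// ?nnegrE ?enorm_ge0// enorm2 real_normK ?num_real//.
by rewrite lerDr sqr_ge0.
Qed.

Lemma pcoord_le j (x : R * R) : `|pcoord j x| <= enorm x.
Proof. by rewrite /pcoord; case: ifP => _; [exact: enorm1_le|exact: enorm2_le]. Qed.

Lemma enorm_le_l1 (x : R * R) : enorm x <= `|x.1| + `|x.2|.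
Proof.
rewrite enorm_le ?addr_ge0// sqrrD !real_normK ?num_real//.
by rewrite addrAC lerDl mulrn_wge0// mulr_ge0.
Qed.

Lemma l1_le_enorm (x : R * R) : `|x.1| + `|x.2| <= 2 * enorm x.
Proof. by have := enorm1_le x; have := enorm2_le x; lra. Qed.

Lemma dotp_le (x y : R * R) : `|dotp x y| <= enorm x * enorm y.
Proof.
rewrite -(@ler_pXn2r _ 2)// ?nnegrE ?mulr_ge0 ?enorm_ge0// exprMn !enorm2 real_normK ?num_real//.
rewrite -subr_ge0 /dotp.
rewrite (_ : _ - _ = (x.1 * y.2 - x.2 * y.1) ^+ 2) ?sqr_ge0//; ring.
Qed.

Lemma enormD (x y : R * R) : enorm (x + y) <= enorm x + enorm y.
Proof.
rewrite enorm_le ?addr_ge0 ?enorm_ge0//= [(enorm x + enorm y) ^+ 2]sqrrD !enorm2.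
have := dotp_le x y; move=> /ler_normlW; rewrite /dotp => h.
rewrite mulr2n; lra.
Qed.

Lemma enormN (x : R * R) : enorm (- x) = enorm x.
Proof. by rewrite /enorm /dotp/= !mulrNN. Qed.

Lemma enormB (x y : R * R) : enorm (x - y) <= enorm x + enorm y.
Proof. by rewrite -(enormN y) enormD. Qed.

Lemma enorm_lb (x y : R * R) : enorm x - enorm y <= enorm (x - y).
Proof. by rewrite lerBlDr -{1}(subrK y x) enormD. Qed.

(** A separable substitute for e^{-a|x|}, so that domination by a product applies; the two are
    comparable up to halving the rate, by [exp_enorm_le] and [expw_le]. *)
Definition expw (a : R) (x : R * R) : R := expR (- (a * `|x.1|)) * expR (- (a * `|x.2|)).

Lemma expw_ge0 a x : 0 <= expw a x. Proof. by rewrite mulr_ge0 ?expR_ge0. Qed.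

Lemma exp_enorm_le a (x : R * R) : 0 <= a -> expR (- (a * enorm x)) <= expw (a / 2) x.
Proof.
move=> a0; rewrite /expw -expRD ler_expR.
by have := l1_le_enorm x; move=> /(ler_wpM2l a0); lra.
Qed.

Lemma expw_le a (x : R * R) : 0 <= a -> expw a x <= expR (- (a * enorm x)).
Proof.
move=> a0; rewrite /expw -expRD ler_expR.
by have := enorm_le_l1 x; move=> /(ler_wpM2l a0); lra.
Qed.

Lemma expw_itg a : 0 < a -> itg (leb2 R) (expw a).
Proof.
move=> a0; have h := expR_abs_itg a0.
apply: (@prod_itg _ _ _ _ _ leb leb (expw a) _ _ _ h h).
- by apply: measurable_funM; apply: (measurableT_comp (itg_meas h)).
- by move=> x y; rewrite /expw/= ger0_norm// mulr_ge0 ?expR_ge0.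
Qed.

Definition W (x : R * R) : R := wt x.1 * wt x.2.

Lemma W_ge0 x : 0 <= W x. Proof. by rewrite mulr_ge0 ?wt_ge0. Qed.

Lemma W_itg : itg (leb2 R) W.
Proof.
have h := @wt_itg R.
apply: (@prod_itg _ _ _ _ _ leb leb W _ _ _ h h).
- by apply: measurable_funM; apply: (measurableT_comp (itg_meas h)).
- by move=> x y; rewrite /W/= ger0_norm// mulr_ge0 ?wt_ge0.
Qed.

Definition om (x : R * R) : R := 1 + x.1 ^+ 2 + x.2 ^+ 2.

Lemma om_ge1 x : 1 <= om x.
Proof. by rewrite /om -addrA lerDl addr_ge0 ?sqr_ge0. Qed.

Lemma om_gt0 x : 0 < om x. Proof. exact: lt_le_trans ltr01 (om_ge1 x). Qed.

Lemma omE x : om x = 1 + enorm x ^+ 2. Proof. by rewrite enorm2 addrA. Qed.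

(** The fourth power of [W] is the inverse fifth power of (1 + |x_1|)(1 + |x_2|), which is at most
    [2 * om x]; hence 32 = 2^5. *)
Lemma W_om x : om x ^- 5 <= 32 * W x ^+ 4.
Proof.
have a0 := normr_ge0 x.1; have b0 := normr_ge0 x.2.
have p0 : 0 < (1 + `|x.1|) * (1 + `|x.2|) by rewrite mulr_gt0 ?ltr_pwDl.
have h : (1 + `|x.1|) * (1 + `|x.2|) <= 2 * om x.
  rewrite /om -(real_normK (num_real x.1)) -(real_normK (num_real x.2)).
  by have := sqr_ge0 (`|x.1| - 1); have := sqr_ge0 (`|x.2| - 1); have := sqr_ge0 (`|x.1| - `|x.2|); nra.
have om0 := om_gt0 x.
rewrite /W exprMn !wt4 -invfM -exprMn -[X in _ <= X * _]invrK -invfM.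
rewrite lef_pV2 ?posrE ?mulr_gt0 ?invr_gt0 ?exprn_gt0//.
rewrite mulrC ler_pdivrMr// mulrC.
rewrite (_ : 32 = 2 ^+ 5); last by rewrite -natrX.
have q0 : 0 <= (1 + `|x.2|) * (1 + `|x.1|) by rewrite mulrC ltW.
have r0 : 0 <= om x * 2 by rewrite mulr_ge0// ltW.
by rewrite -exprMn ler_pXn2r ?nnegrE// mulrC [om x * _]mulrC.
Qed.

Lemma fun2_cont1 (G : R * R -> R) (y : R) : continuous G -> continuous (fun x => G (x, y)).
Proof.
move=> cG x; apply: (@continuous_comp _ _ _ (fun x => (x, y)) G); last exact: cG.
exact: (cvg_pair (@cvg_id _ (nbhs x)) (@cvg_cst _ y _ (nbhs x) _)).
Qed.

Lemma fun2_cont2 (G : R * R -> R) (x : R) : continuous G -> continuous (fun y => G (x, y)).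
Proof.
move=> cG y; apply: (@continuous_comp _ _ _ (fun y => (x, y)) G); last exact: cG.
exact: (cvg_pair (@cvg_cst _ x _ (nbhs y) _) (@cvg_id _ (nbhs y))).
Qed.

Section fubini2.
Variables (F : R * R -> R) (g h : R -> R).
Hypotheses (mF : measurable_fun setT F) (ig : itg leb g) (ih : itg leb h).
Hypothesis FE : forall x y, `|F (x, y)| <= g x * h y.

Lemma leb2_itg : itg (leb2 R) F.
Proof using All. exact: (@prod_itg _ _ _ _ _ leb leb F g h). Qed.

Lemma leb2_int12 : \int[leb2 R]_z F z = \int[leb]_x \int[leb]_y F (x, y).
Proof using All. exact: (@Rint12 _ _ _ _ _ leb leb F g h). Qed.

Lemma leb2_int21 : \int[leb2 R]_z F z = \int[leb]_y \int[leb]_x F (x, y).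
Proof using All. exact: (@Rint21 _ _ _ _ _ leb leb F g h). Qed.

Lemma leb2_sec1 x : itg leb (fun y => F (x, y)).
Proof using All. exact: (@sec1_itg _ _ _ _ _ leb leb F g h). Qed.

Lemma leb2_sec2 y : itg leb (fun x => F (x, y)).
Proof using All. exact: (@sec2_itg _ _ _ _ _ leb leb F g h). Qed.

Lemma leb2_itg12 : itg leb (fun x => \int[leb]_y F (x, y)).
Proof using All. exact: (@itg_Rint12 _ _ _ _ _ leb leb F g h). Qed.

Lemma leb2_itg21 : itg leb (fun y => \int[leb]_x F (x, y)).
Proof using All. exact: (@itg_Rint21 _ _ _ _ _ leb leb F g h). Qed.
End fubini2.

(** One variable is substituted at a time, with Fubini in one order and then in the other; [F1] is
    the intermediate function in which only the first variable has been changed. *)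
Lemma subst_plane (G : R * R -> R) (g h : R -> R) (a b : R) (v : R * R) :
  0 < a -> 0 < b -> continuous G -> continuous g -> continuous h ->
  itg leb g -> itg leb h -> (forall x, `|G x| <= g x.1 * h x.2) ->
  itg (leb2 R) (fun x => G (a * x.1 + v.1, b * x.2 + v.2)) /\
  \int[leb2 R]_x G (a * x.1 + v.1, b * x.2 + v.2) = (a * b)^-1 * \int[leb2 R]_x G x.
Proof.
move=> a0 b0 cG cg ch ig ih GE.
have mG := continuous2_measurable cG.
pose F x := G (a * x.1 + v.1, b * x.2 + v.2).
have [ig' _] := subst_line v.1 a0 cg ig.
have [ih' _] := subst_line v.2 b0 ch ih.
have mF : measurable_fun setT F.
  apply: measurableT_comp => //; apply/measurable_fun_pairP; split => /=.
    by apply: measurable_funD => //; apply: measurable_funM.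
  by apply: measurable_funD => //; apply: measurable_funM.
have FE x y : `|F (x, y)| <= g (a * x + v.1) * h (b * y + v.2) by exact: GE.
have GE' x y : `|G (x, y)| <= g x * h y by exact: GE.
pose F1 x := G (a * x.1 + v.1, x.2).
have mF1 : measurable_fun setT F1.
  apply: measurableT_comp => //; apply/measurable_fun_pairP; split => //=.
    by apply: measurable_funD => //; apply: measurable_funM.
  exact: measurable_snd.
have F1E x y : `|F1 (x, y)| <= g (a * x + v.1) * h y by exact: GE.
split; first exact: leb2_itg mF ig' ih' FE.
rewrite (leb2_int12 mF ig' ih' FE) /F/=.
have -> : \int[leb]_x \int[leb]_y G (a * x + v.1, b * y + v.2) =
    \int[leb]_x (b^-1 * \int[leb]_y F1 (x, y)).
  apply: eq_Rint => x.
  by have [_ <-] := subst_line v.2 b0 (@fun2_cont2 G (a * x + v.1) cG) (leb2_sec1 mG ig ih GE' _).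
rewrite RintZl; last exact: leb2_itg12 mF1 ig' ih F1E.
rewrite -(leb2_int12 mF1 ig' ih F1E) (leb2_int21 mF1 ig' ih F1E) (leb2_int21 mG ig ih GE').
rewrite invfM [a^-1 * _]mulrC -mulrA; congr (_ * _).
rewrite -RintZl; last exact: leb2_itg21 mG ig ih GE'.
apply: eq_Rint => y.
by have [_ <-] := subst_line v.1 a0 (@fun2_cont1 G y cG) (leb2_sec2 mG ig ih GE' _).
Qed.

Lemma itgR_le (f g : R -> R) : measurable_fun setT f -> (forall x, `|f x| <= g x) ->
  itg leb g -> itg leb f.
Proof. exact: (@itg_le _ _ _ leb f g). Qed.

Lemma itg2_le (f g : R * R -> R) : measurable_fun setT f -> (forall x, `|f x| <= g x) ->
  itg (leb2 R) g -> itg (leb2 R) f.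
Proof. exact: (@itg_le _ _ _ (leb2 R) f g). Qed.

(** The integral over [-n, n] is a difference of two boundary values, which the exponential bound on
    [g] sends to 0. *)
Lemma int_deriv0 (g : R -> R) (C a : R) : 0 < a -> (forall x : R, derivable g x 1) ->
  continuous g^`()%classic -> (forall x, `|g x| <= C * expR (- (a * `|x|))) ->
  (forall x, `|g^`()%classic x| <= C * expR (- (a * `|x|))) ->
  \int[leb]_x g^`()%classic x = 0.
Proof.
move=> a0 dg cg' gE g'E.
have ig' : itg leb g^`()%classic.
  have mg := continuous_measurable_fun cg'.
  exact: itgR_le mg g'E (itgZl C (expR_abs_itg a0)).
have cg : continuous g by move=> x; apply/differentiable_continuous/derivable1_diffP.
have h := itv_cvg ig'.
apply: (cvg_unique _ h) => //=.
have E n : \int[leb]_(x in `[- n.+1%:R, n.+1%:R]) g^`()%classic x = g n.+1%:R - g (- n.+1%:R).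
  have nn : - n.+1%:R < n.+1%:R :> R by rewrite (@lt_trans _ _ 0) ?oppr_lt0.
  rewrite /Rintegral (@continuous_FTC2 _ _ g _ _ nn); [by []|..].
  - exact: continuous_subspaceT.
  - split => //; last by apply: cvg_at_left_filter; exact: cg.
    by apply: cvg_at_right_filter; exact: cg.
  - by [].
rewrite -cvg_shiftS/=; under eq_fun do rewrite E.
apply/cvgrPdist_le => e e0; near=> n.
rewrite sub0r normrN.
have C0 : 0 <= C by have := gE 0; rewrite normr0 mulr0 oppr0 expR0 mulr1; exact: le_trans.
have e1 : C * expR (- (a * n.+1%:R)) <= e / 2.
  have en : 1 + a * n.+1%:R <= expR (a * n.+1%:R) by exact: expR_ge1Dx.
  rewrite expRN ler_pdivrMr ?expR_gt0// mulrC -ler_pdivrMr ?divr_gt0//.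
  apply: le_trans en; rewrite -lerBlDl -ler_pdivrMl//.
  apply: (@le_trans _ _ n%:R); last by rewrite ler_nat.
  by near: n; exact: nbhs_infty_ger.
apply: le_trans (ler_normB _ _) _.
have := gE n.+1%:R; have := gE (- n.+1%:R); rewrite normrN [`|n.+1%:R|]ger0_norm// => h1 h2.
lra.
Unshelve. all: end_near. Qed.

Lemma partial0E (f : R * R -> R) y : partial ord0 f y = (fun t => f (t, y.2))^`()%classic y.1.
Proof.
rewrite derive1E /partial /evec eqxx /derive.
apply: (congr1 (fun g : R -> R => lim (g h @[h --> 0^']))).
apply/funext => h /=; congr (_ *: (f _ - f _)); last by case: y.
by congr (_, _); rewrite /= /GRing.scale/= ?mulr0 ?add0r.
Qed.

Lemma partial1E (f : R * R -> R) y : partial ord_max f y = (fun t => f (y.1, t))^`()%classic y.2.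
Proof.
rewrite derive1E /partial /evec /= /derive.
apply: (congr1 (fun g : R -> R => lim (g h @[h --> 0^']))).
apply/funext => h /=; congr (_ *: (f _ - f _)); last by case: y.
by congr (_, _); rewrite /= /GRing.scale/= ?mulr0 ?add0r.
Qed.

Lemma derivable0E (f : R * R -> R) y : derivable f y (evec R ord0) = derivable (fun t => f (t, y.2)) y.1 1.
Proof.
rewrite /derivable /evec eqxx.
apply: (congr1 (fun g : R -> R => cvg (g h @[h --> 0^']))).
apply/funext => h /=; congr (_ *: (f _ - f _)); last by case: y.
by congr (_, _); rewrite /= /GRing.scale/= ?mulr0 ?add0r.
Qed.

Lemma derivable1E (f : R * R -> R) y : derivable f y (evec R ord_max) = derivable (fun t => f (y.1, t)) y.2 1.
Proof.
rewrite /derivable /evec /=.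
apply: (congr1 (fun g : R -> R => cvg (g h @[h --> 0^']))).
apply/funext => h /=; congr (_ *: (f _ - f _)); last by case: y.
by congr (_, _); rewrite /= /GRing.scale/= ?mulr0 ?add0r.
Qed.

Lemma ord2P (P : 'I_2 -> Prop) : P ord0 -> P ord_max -> forall j, P j.
Proof.
move=> P0 P1 [[|[|//]] h].
- by rewrite (_ : Ordinal h = ord0)//; exact: val_inj.
- by rewrite (_ : Ordinal h = ord_max)//; exact: val_inj.
Qed.

(** Fubini with the differentiated variable innermost reduces this to the line. All integrations by
    parts in the plane, in x as well as in xi, are this identity applied to a product. *)
Lemma int_partial0 j (w : R * R -> R) (C a : R) : 0 < a ->
  (forall y, derivable w y (evec R j)) -> continuous (partial j w) ->
  (forall x, `|w x| <= C * expw a x) -> (forall x, `|partial j w x| <= C * expw a x) ->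
  \int[leb2 R]_x partial j w x = 0.
Proof.
move=> a0 dw cw wE dwE; have mw := continuous2_measurable cw.
have ie := expR_abs_itg a0.
have ige : itg leb (fun x => C * expR (- (a * `|x|))) by exact: itgZl.
have FE x y : `|partial j w (x, y)| <= (C * expR (- (a * `|x|))) * expR (- (a * `|y|)).
  by rewrite -mulrA; exact: dwE.
move: j dw cw dwE mw FE; apply: ord2P => dw cw dwE mw FE.
- rewrite (leb2_int21 mw ige ie FE) -[RHS](Rint0 leb).
  apply: eq_Rint => y.
  rewrite (_ : (fun x => _) = (fun t => w (t, y))^`()%classic); last first.
    by apply/funext => x; rewrite partial0E.
  have dE : (fun t => w (t, y))^`()%classic = (fun x => partial ord0 w (x, y)).
    by apply/funext => x; rewrite partial0E.
  apply: (@int_deriv0 _ (C * expR (- (a * `|y|))) a) => //.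
  + by move=> x; have := dw (x, y); rewrite derivable0E.
  + by rewrite dE; exact: fun2_cont1.
  + by move=> x; apply: le_trans (wE _) _; rewrite /expw/= mulrCA mulrC.
  + by move=> x; rewrite dE; apply: le_trans (dwE _) _; rewrite /expw/= mulrCA mulrC.
- rewrite (leb2_int12 mw ige ie FE) -[RHS](Rint0 leb).
  apply: eq_Rint => y.
  have dE : (fun t => w (y, t))^`()%classic = (fun x => partial ord_max w (y, x)).
    by apply/funext => x; rewrite partial1E.
  rewrite -dE.
  apply: (@int_deriv0 _ (C * expR (- (a * `|y|))) a) => //.
  + by move=> x; have := dw (y, x); rewrite derivable1E.
  + by rewrite dE; exact: fun2_cont2.
  + by move=> x; apply: le_trans (wE _) _; rewrite /expw/= mulrA.
  + by move=> x; rewrite dE; apply: le_trans (dwE _) _; rewrite /expw/= mulrA.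
Qed.
End R2.

(** * Smooth functions of one variable and a smooth step *)

Section smooth1.
Variable R : realType.
Implicit Types f g : R -> R.
Local Notation leb := (@lebesgue_measure R).
Local Notation D1 := (@derive1 R R^o).

Lemma der_derive1 f (x d : R) : is_derive x 1 f d -> (D1 f) x = d.
Proof. by case=> _; rewrite derive1E. Qed.

Lemma der1 f (x : R) : derivable f x 1 -> is_derive x 1 f ((D1 f) x).
Proof. by move=> /derivableP; rewrite -derive1E. Qed.

Fixpoint sm1 n f : Prop :=
  if n is n'.+1 then (forall x : R, derivable f x 1) /\ sm1 n' (D1 f) else True.

Definition smooth1 f := forall n, sm1 n f.

Lemma sm1S n f : sm1 n.+1 f -> sm1 n f.
Proof. by elim: n f => //= n IH f [df] /IH. Qed.

Lemma sm1_cst n (k : R) : sm1 n (fun=> k).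
Proof.
elim: n k => //= n IH k; split; first by move=> x; exact: derivable_cst.
rewrite (_ : D1 _ = fun=> 0)//; apply/funext => x.
exact: derive1_cst.
Qed.

Lemma sm1D n f g : sm1 n f -> sm1 n g -> sm1 n (fun x => f x + g x).
Proof.
elim: n f g => //= n IH f g [df sf] [dg sg]; split; first by move=> x; exact: derivableD.
rewrite (_ : D1 (fun x => _) = fun x => (D1 f) x + (D1 g) x); first exact: IH.
by apply/funext => x; rewrite !derive1E deriveD.
Qed.

Lemma sm1M n f g : sm1 n f -> sm1 n g -> sm1 n (fun x => f x * g x).
Proof.
elim: n f g => // n IH f g sf sg.
have [df sf'] := sf; have [dg sg'] := sg.
split; first by move=> x; exact: derivableM.
rewrite (_ : D1 (fun x => _) = fun x => (D1 f) x * g x + f x * (D1 g) x).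
  by apply: sm1D; apply: IH => //; exact: sm1S.
apply/funext => x; rewrite !derive1E deriveM//.
by rewrite /GRing.scale/= addrC [g x * _]mulrC.
Qed.

Lemma sm1Z n k f : sm1 n f -> sm1 n (fun x => k * f x).
Proof. by apply: sm1M; exact: sm1_cst. Qed.

Lemma is_derive_affine f (a b x : R) : derivable f (a * x + b) 1 ->
  is_derive x 1 (fun x => f (a * x + b)) (a * (D1 f) (a * x + b)).
Proof.
move=> df.
have h1 : is_derive x 1 (fun x : R => a * x + b) a.
  by apply: is_derive_eq; rewrite /GRing.scale/=; ring.
have h2 := der1 df.
have := @is_derive1_comp R f (fun x : R => a * x + b) x _ _ h2 h1.
by rewrite mulrC.
Qed.

Lemma sm1_affine n f (a b : R) : sm1 n f -> sm1 n (fun x => f (a * x + b)).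
Proof.
elim: n f => //= n IH f [df sf].
have h x := is_derive_affine (df (a * x + b)).
split; first by move=> x; case: (h x).
rewrite (_ : D1 (fun x => _) = fun x => a * (D1 f) (a * x + b)); first by apply/sm1Z/IH.
by apply/funext => x; exact: der_derive1.
Qed.

Lemma smooth1_der f : smooth1 f -> smooth1 (D1 f).
Proof. by move=> sf n; case: (sf n.+1). Qed.

Lemma smooth1_derivable f : smooth1 f -> forall x : R, derivable f x 1.
Proof. by move=> /(_ 1%N)[]. Qed.

Lemma derivable_cont f : (forall x : R, derivable f x 1) -> continuous f.
Proof. by move=> df x; apply/differentiable_continuous/derivable1_diffP. Qed.

Lemma smooth1_cont f : smooth1 f -> continuous f.
Proof. by move/smooth1_derivable/derivable_cont. Qed.

Lemma is_derive_quad f (C : R) : 0 <= C -> (forall x, `|f x| <= C * x ^+ 2) -> is_derive (0 : R) 1 f 0.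
Proof.
move=> C0 fC.
have f0 : f 0 = 0 by apply/eqP; rewrite -normr_le0; have := fC 0; rewrite expr0n mulr0.
have h : (fun h : R => h^-1 *: (f (h *: 1 + 0) - f 0)) @ 0^' --> (0 : R).
  apply/cvgr0Pnorm_le => e e0; near=> x.
  have x0 : x != 0 by near: x; exact: nbhs_dnbhs_neq.
  rewrite f0 subr0 addr0 /GRing.scale/= mulr1 normrM normfV ler_pdivrMl ?normr_gt0//.
  apply: le_trans (fC x) _.
  rewrite -(real_normK (num_real x)) expr2 mulrCA ler_pM2l ?normr_gt0//.
  have : `|x| <= e / (C + 1).
    near: x; apply: dnbhs0_le; rewrite divr_gt0//; lra.
  rewrite ler_pdivlMr; last by lra.
  by have := normr_ge0 x; nra.
split; first by apply/cvg_ex; exists 0.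
exact: cvg_lim.
Unshelve. all: end_near. Qed.

(** The functions t^{-n} e^{-1/t} span a space stable under differentiation, see [is_derive_eb];
    smoothness of e^{-1/t} at 0 becomes an induction over the whole family. *)
Definition exp_bump (n : nat) (t : R) : R := if t <= 0 then 0 else t ^- n * expR (- t^-1).

Lemma eb_ge0 n t : 0 <= exp_bump n t.
Proof. by rewrite /exp_bump; case: ifPn => //; rewrite -ltNge => t0; rewrite mulr_ge0 ?expR_ge0 ?invr_ge0 ?exprn_ge0 ?ltW. Qed.

(** The term of order n + 2 of the exponential series at 1/t dominates t^{-n-2}. A quadratic bound
    suffices for the derivative at 0 to exist and vanish. *)
Lemma eb_quad n t : `|exp_bump n t| <= (n.+2)`!%:R * t ^+ 2.
Proof.
rewrite ger0_norm ?eb_ge0// /exp_bump; case: ifPn => [_|].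
  by rewrite mulr_ge0 ?sqr_ge0.
rewrite -ltNge => t0.
have s0 : 0 <= t^-1 by rewrite invr_ge0 ltW.
have := expR_ge1Dxn n.+1 s0 => h.
rewrite expRN ler_pdivrMr ?expR_gt0//.
have f0 : (0 : R) < (n.+2)`!%:R by rewrite ltr0n fact_gt0.
apply: (@le_trans _ _ ((n.+2)`!%:R * t ^+ 2 * (1 + t^-1 ^+ n.+2 / (n.+2)`!%:R))); last first.
  by rewrite ler_wpM2l// mulr_ge0 ?sqr_ge0// ltW.
rewrite mulrDr mulr1 [X in _ <= _ + X](_ : _ = t ^- n).
  by rewrite lerDr mulr_ge0 ?sqr_ge0 ?ltW.
rewrite -addn2 exprD -!exprVn; field; by rewrite gt_eqF//= gt_eqF.
Qed.

Lemma eb_le0 n t : t <= 0 -> exp_bump n t = 0.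
Proof. by rewrite /exp_bump => ->. Qed.

Lemma eb_gt0 n t : 0 < t -> exp_bump n t = t^-1 ^+ n * expR (- t^-1).
Proof. by move=> t0; rewrite /exp_bump leNgt t0 /= exprVn. Qed.

Lemma is_derive_eb n (t : R) : is_derive t 1 (exp_bump n) (- n%:R * exp_bump n.+1 t + exp_bump n.+2 t).
Proof.
have [t0|t0|->] := ltrgt0P t.
- have h1 : is_derive t 1 (fun s : R => s^-1) (- (t ^- 2)).
    have := @is_deriveV _ (fun s : R => s) t 1 1; rewrite gt_eqF// => /(_ erefl _).
    by move=> h; apply: (is_derive_eq h); rewrite /GRing.scale/= mulr1.
  have h2 : is_derive t 1 (fun s : R => s^-1 ^+ n) (n%:R * t^-1 ^+ n.-1 * (- (t ^- 2))).
    have h : is_derive (t^-1) 1 (fun y : R => y ^+ n) (n%:R * t^-1 ^+ n.-1).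
      have h := @is_deriveX _ _ (@id R) n (t^-1) 1 1 (is_derive_id _ _).
      rewrite (_ : (fun y : R => y ^+ n) = id ^+ n); last by apply/funext => y; rewrite exprfctE.
      by apply: (is_derive_eq h); rewrite /GRing.scale/= mulr1.
    exact: (@is_derive1_comp R (fun y : R => y ^+ n) (fun s : R => s^-1)).
  have h3 : is_derive t 1 (fun s : R => expR (- s^-1)) (expR (- t^-1) * t ^- 2).
    have h4 : is_derive t 1 (fun s : R => - s^-1) (t ^- 2).
      by apply: is_derive_eq; rewrite opprK.
    exact: (@is_derive1_comp R expR (fun s : R => - s^-1)).
  apply: (@near_eq_is_derive _ _ _ (fun s : R => s^-1 ^+ n * expR (- s^-1))).
    near=> s; rewrite eb_gt0//; near: s; exact: lt_nbhsr.
  apply: is_derive_eq; rewrite !eb_gt0// /GRing.scale/=.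
  rewrite -!exprVn; move: (t^-1) => i.
  by case: n h2 => [|n] _; rewrite /= !exprS ?expr0; ring.
- rewrite !(eb_le0 _ (ltW t0)) mulr0 addr0.
  apply: (@near_eq_is_derive _ _ _ (fun _ : R => (0 : R))).
    near=> s; rewrite eb_le0// ltW//; near: s; exact: lt_nbhsl.
- rewrite !(eb_le0 _ (lexx _)) mulr0 addr0.
  apply: is_derive_quad (eb_quad n); by rewrite ler0n.
Unshelve. all: end_near. Qed.

Lemma smooth1_eb n : smooth1 (exp_bump n).
Proof.
move=> k; elim: k n => //= k IH n; split.
  by move=> x; case: (is_derive_eb n x).
rewrite (_ : D1 _ = fun t => - n%:R * exp_bump n.+1 t + exp_bump n.+2 t).
  by apply: sm1D => //; exact: sm1Z.
by apply/funext => x; apply: der_derive1; exact: is_derive_eb.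
Qed.

(** Normalised primitive of the bump e^{-1/t} e^{-1/(1-t)}, extended by 0 outside (0, 1). *)
Lemma smooth_step : exists H : R -> R,
  [/\ smooth1 H, (forall t, t <= 0 -> H t = 0), (forall t, 1 <= t -> H t = 1),
      (forall t, 0 <= H t <= 1) & (forall t, 0 <= D1 H t)].
Proof.
pose b t := exp_bump 0 t * exp_bump 0 (1 - t).
have b_ge0 t : 0 <= b t by rewrite mulr_ge0 ?eb_ge0.
have bl t : t <= 0 -> b t = 0 by move=> t0; rewrite /b eb_le0// mul0r.
have br t : 1 <= t -> b t = 0 by move=> t1; rewrite /b [X in _ * X]eb_le0 ?mulr0// subr_le0.
have sb : smooth1 b.
  move=> n; apply: sm1M; first exact: smooth1_eb.
  rewrite (_ : (fun x => _) = (fun x => exp_bump 0 (-1 * x + 1))).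
    by apply: sm1_affine; exact: smooth1_eb.
  by apply/funext => x; rewrite mulN1r addrC.
have cb := smooth1_cont sb.
have mb := continuous_measurable_fun cb.
have ib u : leb.-integrable [set` Interval -oo%O (BRight u)] (EFin \o b).
  apply: (@integrableS _ _ _ _ setT) => //.
  have mi : measurable_fun setT (\1_`[0, 1] : R -> R) by exact: measurable_indic.
  apply: (@itgR_le _ b (fun x => (expR (- (1 * `|x|))) * expR 1)) => //; last first.
    by apply: itgZr; exact: expR_abs_itg.
  move=> x; rewrite ger0_norm// -expRD mul1r.
  have [x0|x0] := leP x 0; first by rewrite bl// expR_ge0.
  have [x1|x1] := leP 1 x; first by rewrite br// expR_ge0.
  apply: (@le_trans _ _ 1).
    rewrite /b !eb_gt0 ?subr_gt0// !expr0 !mul1r -[X in _ <= X]mulr1 ler_pM ?expR_ge0//.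
      by rewrite expR_le1 oppr_le0 invr_ge0 ltW.
    by rewrite expR_le1 oppr_le0 invr_ge0 ltW// subr_gt0.
  by rewrite -[X in X <= _]expR0 ler_expR gtr0_norm//; lra.
pose F x := \int[leb]_(t in [set` Interval -oo%O (BRight x)]) b t.
have dF (x : R) : is_derive x 1 F (b x).
  have xu : x < x + 1 by rewrite ltrDl.
  have [h1 h2] := @continuous_FTC1 R b -oo%O x (x + 1) xu (ib _) (ltNyr _) (cb x).
  by split; [exact: h1|rewrite -derive1E; exact: h2].
have D1F : D1 F = b by apply/funext => x; exact: der_derive1.
have dF' x : derivable F x 1 by case: (dF x).
have cF := derivable_cont dF'.
have mvt x y : x <= y -> exists2 c, x <= c <= y & F y - F x = b c * (y - x).
  move=> xy; have [c + ->] := @MVT_segment R F b x y xy (fun c _ => dF c) (continuous_subspaceT cF).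
  by exists c.
have Fmono x y : x <= y -> F x <= F y.
  by move=> xy; rewrite -subr_ge0; have [c _ ->] := mvt _ _ xy; rewrite mulr_ge0// subr_ge0.
have F0 x : x <= 0 -> F x = 0.
  move=> x0; rewrite /F -[RHS](Rint0 leb) Rintegral_mkcond; apply: eq_Rint => t.
  rewrite patchE; case: ifPn => //; rewrite inE/= in_itv/= => tx; apply: bl; exact: le_trans x0.
have F1 x : 1 <= x -> F x = F 1.
  move=> x1; apply/eqP; rewrite -subr_eq0; have [c /andP[c1 _] ->] := mvt _ _ x1.
  by rewrite br// mul0r.
(* The primitive already increases strictly between 1/4 and 3/4, where the bump is positive. *)
have I0 : 0 < F 1.
  apply: (@lt_le_trans _ _ (F (3/4))); last by apply: Fmono; lra.
  apply: (@le_lt_trans _ _ (F (1/4))); first by rewrite -(F0 0)//; apply: Fmono; lra.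
  rewrite -subr_gt0; have [|c /andP[c1 c2] ->] := mvt (1/4) (3/4); first by lra.
  rewrite mulr_gt0//; last by lra.
  by rewrite /b !eb_gt0 ?mulr_gt0 ?exprn_gt0 ?expR_gt0 ?invr_gt0//; lra.
exists (fun x => (F 1)^-1 * F x); split.
- move=> n; apply: sm1Z; case: n => // n; split => //.
  by rewrite D1F; exact: sb.
- by move=> t t0; rewrite (F0 t t0) mulr0.
- by move=> t t1; rewrite (F1 t t1) mulVf// gt_eqF.
- move=> t; rewrite mulr_ge0 ?invr_ge0 ?(ltW I0)//=; last first.
    have [t0|t0] := leP t 0; first by rewrite (F0 t t0).
    by rewrite -(F0 0)//; apply: Fmono; exact: ltW.
  rewrite ler_pdivrMl// mulr1; have [t1|t1] := leP t 1; first exact: Fmono.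
  by rewrite (F1 t (ltW t1)).
- move=> t; rewrite (@der_derive1 _ t ((F 1)^-1 * b t)); first by rewrite mulr_ge0 ?invr_ge0 ?(ltW I0).
Qed.
End smooth1.
Notation D1 := (@derive1 _ _^o).

(** * Tensor products as test functions *)

Section tens.
Variable R : realType.
Local Notation leb := (@lebesgue_measure R).
Local Notation D1 := (@derive1 R R^o).
Implicit Types p q : R -> R.
Implicit Types (u v w : R * R -> R) (s : seq 'I_2).

Lemma smooth_cont u s : smooth u -> continuous (partials s u).
Proof. by move=> su; have [] := su (size s) s (leqnn _). Qed.

Lemma smooth_derivable u s j y : smooth u -> derivable (partials s u) y (evec R j).
Proof. by move=> su; have [_] := su (size s).+1 s (leqnSn _); exact. Qed.

Definition tens p q (x : R * R) := p x.1 * q x.2.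

Lemma partial0_tens p q : (forall x : R, derivable p x 1) -> partial ord0 (tens p q) = tens (D1 p) q.
Proof.
move=> dp; apply/funext => y; rewrite partial0E /tens/=.
by rewrite derive1Mr.
Qed.

Lemma partial1_tens p q : (forall x : R, derivable q x 1) -> partial ord_max (tens p q) = tens p (D1 q).
Proof.
move=> dq; apply/funext => y; rewrite partial1E /tens/=.
by rewrite derive1Ml.
Qed.

Lemma derivable_tens p q j y : smooth1 p -> smooth1 q -> derivable (tens p q) y (evec R j).
Proof.
move=> /smooth1_derivable dp /smooth1_derivable dq; move: j; apply: ord2P.
  rewrite derivable0E; exact: (@derivableM _ _ p (cst (q y.2)) y.1 1 (dp _) (@derivable_cst _ _ _ _ _ _)).
rewrite derivable1E; exact: (@derivableM _ _ (cst (p y.1)) q y.2 1 (@derivable_cst _ _ _ _ _ _) (dq _)).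
Qed.

Lemma cont_fst (p : R -> R) : continuous p -> continuous (fun x : R * R => p x.1).
Proof. by move=> cp x; apply: (@continuous_comp _ _ _ fst p); [exact: cvg_fst|exact: cp]. Qed.

Lemma cont_snd (p : R -> R) : continuous p -> continuous (fun x : R * R => p x.2).
Proof. by move=> cp x; apply: (@continuous_comp _ _ _ snd p); [exact: cvg_snd|exact: cp]. Qed.

Lemma cont_tens p q : continuous p -> continuous q -> continuous (tens p q).
Proof.
move=> cp cq x; apply: (@continuousM _ _ (fun x => p x.1) (fun x => q x.2)).
  exact: cont_fst.
exact: cont_snd.
Qed.

(** On a tensor product only the number of occurrences of each index in [s] matters, so no theorem
    on the symmetry of mixed derivatives is involved. *)
Lemma partials_tens p q s : smooth1 p -> smooth1 q ->
  [/\ smooth1 (iter (count_mem ord0 s) D1 p), smooth1 (iter (count_mem ord_max s) D1 q) &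
   partials s (tens p q) = tens (iter (count_mem ord0 s) D1 p) (iter (count_mem ord_max s) D1 q)].
Proof.
move=> sp sq; elim: s => //= j s [sp' sq' ->].
move: j; apply: ord2P; rewrite /= ?add0n ?add1n /=.
  split => //; first exact: smooth1_der.
  by rewrite partial0_tens//; exact: smooth1_derivable.
split => //; first exact: smooth1_der.
by rewrite partial1_tens//; exact: smooth1_derivable.
Qed.

Definition supp1 (r : R) p := forall t, r < `|t| -> p t = 0.

Lemma supp1_der r p : supp1 r p -> supp1 r (D1 p).
Proof.
move=> sp t rt; rewrite derive1E.
rewrite (@near_eq_derive _ _ _ p (fun=> 0)) ?derive_cst//.
near=> z; apply: sp; near: z.
have := @norm_continuous _ _ t; move=> /cvgr_gt; apply; exact: rt.
Unshelve. all: end_near. Qed.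

Lemma supp1_iter r p n : supp1 r p -> supp1 r (iter n D1 p).
Proof. by move=> sp; elim: n => //= n IH; exact: supp1_der. Qed.

Lemma test_tens r p q : smooth1 p -> smooth1 q -> supp1 r p -> supp1 r q ->
  test_function (tens p q).
Proof.
move=> sp sq rp rq; split.
  move=> n s _; have [sp' sq' ->] := partials_tens s sp sq; split.
    by apply: cont_tens; exact: smooth1_cont.
  by move=> _ j y; exact: derivable_tens.
exists (r + r) => y ry; rewrite /tens.
have [h|h] := ltP r `|y.1|; first by rewrite rp// mul0r.
rewrite rq ?mulr0//; have h2 := enorm_le_l1 y; have {}ry := ry; lra.
Qed.

Lemma pderiv_tens m p q : smooth1 p -> smooth1 q ->
  pderiv m (tens p q) = tens (iter m.1 D1 p) (iter m.2 D1 q).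
Proof.
move=> sp sq; rewrite /pderiv; have [_ _ ->] := partials_tens (nseq m.1 ord0 ++ nseq m.2 ord_max) sp sq.
by rewrite !count_cat !count_nseq /= !mul1n !mul0n addn0.
Qed.

Lemma cs_bound (r : R) w : continuous w -> (forall y, r < `|y.1| -> w y = 0) ->
  (forall y, r < `|y.2| -> w y = 0) -> exists C, forall y, `|w y| <= C * expw 1 y.
Proof.
move=> cw w1 w2.
have : compact (w @` (`[- r, r] `*` `[- r, r])).
  apply: continuous_compact; first exact: continuous_subspaceT.
  by apply: compact_setX; exact: segment_compact.
move=> /compact_bounded[M [_ /(_ (M + 1))]]; rewrite ltrDl ltr01 => /(_ erefl) hM.
exists (`|M + 1| * expR r * expR r) => y.
have [h1|h1] := ltP r `|y.1|.
  by rewrite w1// normr0 !mulr_ge0 ?expR_ge0.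
have [h2|h2] := ltP r `|y.2|.
  by rewrite w2// normr0 !mulr_ge0 ?expR_ge0.
apply: (@le_trans _ _ `|M + 1|).
  apply: le_trans (ler_norm _); apply: hM; exists y => //.
  by split; rewrite /= in_itv/= -ler_norml.
rewrite -!mulrA ler_peMr// /expw mulrCA mulrA -!expRD -[X in X <= _]expR0 ler_expR; lra.
Qed.

Lemma cs_itg (r : R) w : continuous w -> (forall y, r < `|y.1| -> w y = 0) ->
  (forall y, r < `|y.2| -> w y = 0) -> itg (leb2 R) w.
Proof.
move=> cw w1 w2; have [C h] := cs_bound cw w1 w2.
exact: itg2_le (continuous2_measurable cw) h (itgZl _ (expw_itg ltr01)).
Qed.

Lemma partialM j u v y : derivable u y (evec R j) -> derivable v y (evec R j) ->
  partial j (fun x => u x * v x) y = partial j u y * v y + u y * partial j v y.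
Proof.
by move=> du dv; rewrite /partial (deriveM du dv) /GRing.scale/= addrC (mulrC (v y)).
Qed.

Lemma contM2 u v : continuous u -> continuous v -> continuous (fun x => u x * v x).
Proof. by move=> cu cv x; apply: (@continuousM _ _ u v); [exact: cu|exact: cv]. Qed.

Lemma contD2 u v : continuous u -> continuous v -> continuous (fun x => u x + v x).
Proof. by move=> cu cv x; apply: (@continuousD _ _ _ u v); [exact: cu|exact: cv]. Qed.

(** The compact support of the test function supplies the decay, so [v] itself may grow. *)
Lemma ibp_tens j v r p q : (forall y, derivable v y (evec R j)) -> continuous v ->
  continuous (partial j v) -> smooth1 p -> smooth1 q -> supp1 r p -> supp1 r q ->
  \int[leb2 R]_x (partial j v x * tens p q x) =
  - \int[leb2 R]_x (v x * partial j (tens p q) x).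
Proof.
move=> dv cv cdv sp sq rp rq.
have dt y : derivable (tens p q) y (evec R j) by exact: derivable_tens.
have [sp' sq' tE] := partials_tens [:: j] sp sq; rewrite /= in tE.
have ct : continuous (tens p q) by apply: cont_tens; exact: smooth1_cont.
have ct' : continuous (partial j (tens p q)) by rewrite tE; apply: cont_tens; exact: smooth1_cont.
have t1 y : r < `|y.1| -> tens p q y = 0 by move=> h; rewrite /tens rp// mul0r.
have t2 y : r < `|y.2| -> tens p q y = 0 by move=> h; rewrite /tens rq// mulr0.
have t1' y : r < `|y.1| -> partial j (tens p q) y = 0.
  by move=> h; rewrite tE /tens (supp1_iter _ rp)// mul0r.
have t2' y : r < `|y.2| -> partial j (tens p q) y = 0.
  by move=> h; rewrite tE /tens (supp1_iter _ rq)// mulr0.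
have i1 : itg (leb2 R) (fun x => partial j v x * tens p q x).
  by apply: (@cs_itg r); [exact: contM2|move=> y /t1 ->; rewrite mulr0|move=> y /t2 ->; rewrite mulr0].
have i2 : itg (leb2 R) (fun x => v x * partial j (tens p q) x).
  by apply: (@cs_itg r); [exact: contM2|move=> y /t1' ->; rewrite mulr0|move=> y /t2' ->; rewrite mulr0].
apply/eqP; rewrite -addr_eq0 -RintD//; apply/eqP.
pose w x := v x * tens p q x.
have wE : partial j w = fun x => partial j v x * tens p q x + v x * partial j (tens p q) x.
  by apply/funext => x; exact: partialM.
rewrite -wE.
have cw : continuous w by exact: contM2.
have cw' : continuous (partial j w) by rewrite wE; apply: contD2; exact: contM2.
have [C1 h1] : exists C, forall y, `|w y| <= C * expw 1 y.
  by apply: (@cs_bound r) => // y h; rewrite /w; [rewrite t1|rewrite t2]; rewrite ?mulr0.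
have [C2 h2] : exists C, forall y, `|partial j w y| <= C * expw 1 y.
  by apply: (@cs_bound r) => // y h; rewrite wE; [rewrite t1 ?t1'|rewrite t2 ?t2']; rewrite ?mulr0 ?addr0.
apply: (@int_partial0 _ j w (Num.max C1 C2) 1 ltr01 _ cw').
- by move=> y; exact: derivableM.
- by move=> x; apply: le_trans (h1 x) _; rewrite ler_wpM2r ?expw_ge0// le_max lexx.
- by move=> x; apply: le_trans (h2 x) _; rewrite ler_wpM2r ?expw_ge0// le_max lexx orbT.
Qed.

Lemma ibps_tens s u r p q : smooth u -> smooth1 p -> smooth1 q -> supp1 r p -> supp1 r q ->
  \int[leb2 R]_x (partials s u x * tens p q x) =
  (-1) ^+ size s * \int[leb2 R]_x (u x * tens (iter (count_mem ord0 s) D1 p) (iter (count_mem ord_max s) D1 q) x).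
Proof.
move=> su; elim: s p q => [|j s IH] p q sp sq rp rq /=; first by rewrite expr0 mul1r.
rewrite (@ibp_tens _ _ r)//.
- have [sp' sq' tE] := partials_tens [:: j] sp sq; rewrite /= in tE.
  rewrite tE IH//; [|exact: supp1_iter..].
  rewrite exprS mulN1r mulNr -!iterD !addn0.
  by rewrite [X in iter X D1 p]addnC [X in iter X D1 q]addnC.
- by move=> y; exact: smooth_derivable.
- exact: smooth_cont.
- exact: (@smooth_cont _ (j :: s)).
Qed.
End tens.

(** * Sobolev and exponential bounds *)

Section sob.
Variable R : realType.
Local Notation leb := (@lebesgue_measure R).
Local Notation D1 := (@derive1 R R^o).
Implicit Types p q : R -> R.

Lemma D1_near0 p (k t : R) : (\near t, p t = k) -> D1 p t = 0.
Proof.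
move=> h; rewrite derive1E (@near_eq_derive _ _ _ p (fun=> k)) ?derive_cst//.
Qed.

Lemma D1_affine p (a b x : R) : derivable p (a * x + b) 1 ->
  D1 (fun x => p (a * x + b)) x = a * D1 p (a * x + b).
Proof. by move=> dp; apply: der_derive1; exact: is_derive_affine. Qed.

Lemma step_int (H : R -> R) : smooth1 H -> (forall t, t <= 0 -> H t = 0) ->
  (forall t, 1 <= t -> H t = 1) -> itg leb (D1 H) /\ \int[leb]_t D1 H t = 1.
Proof.
move=> sH H0 H1.
have dH := smooth1_derivable sH; have cH := smooth1_cont sH.
have cH' := smooth1_cont (smooth1_der sH).
have z0 t : t < 0 -> D1 H t = 0.
  move=> t0; apply: (@D1_near0 _ 0); near=> s; apply: H0; apply: ltW; near: s; exact: lt_nbhsl.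
have z1 t : 1 < t -> D1 H t = 0.
  move=> t0; apply: (@D1_near0 _ 1); near=> s; apply: H1; apply: ltW; near: s; exact: lt_nbhsr.
have ib : itg leb (D1 H).
  have [c c01 cM] := @EVT_max R (fun t => `|D1 H t|) 0 1 ler01 (continuous_subspaceT (fun x => continuous_comp (cH' x) (@norm_continuous _ _ _))).
  apply: (@itgR_le _ _ (fun x => (`|D1 H c| * expR 1) * (expR (- (1 * `|x|))))) => //; last first.
  - by apply: itgZl; exact: expR_abs_itg.
  - move=> x; rewrite -mulrA -expRD.
    have [x0|x0] := ltP x 0; first by rewrite z0// normr0 mulr_ge0 ?expR_ge0.
    have [x1|x1] := ltP 1 x; first by rewrite z1// normr0 mulr_ge0 ?expR_ge0.
    apply: (@le_trans _ _ `|D1 H c|); first by apply: cM; rewrite in_itv/= x0.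
    rewrite ler_peMr// -[X in X <= _]expR0 ler_expR mul1r ger0_norm//; lra.
  - exact: continuous_measurable_fun.
split => //; apply: (cvg_unique _ (itv_cvg ib)) => //=.
rewrite -cvg_shiftS/=; apply: cvg_near_cst; near=> n.
have nn : - n.+1%:R < n.+1%:R :> R by rewrite (@lt_trans _ _ 0) ?oppr_lt0.
rewrite /Rintegral (@continuous_FTC2 _ _ H _ _ nn).
- rewrite /= H1 ?ler1n// H0 ?subr0//.
- exact: continuous_subspaceT.
- split; first by move=> x _; exact: dH.
    by apply: cvg_at_right_filter; exact: cH.
  by apply: cvg_at_left_filter; exact: cH.
- by [].
Unshelve. all: end_near. Qed.

Definition ind (a t : R) : R := if a <= t <= a + 2 then 1 else 0.

Lemma indE a : ind a = \1_`[a, a + 2].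
Proof.
by apply/funext => t; rewrite /ind indicE mem_setE /= in_itv/=; case: ifP.
Qed.

Lemma ind_ge0 a t : 0 <= ind a t. Proof. by rewrite /ind; case: ifP. Qed.

Lemma ind_itg a : itg leb (ind a).
Proof.
rewrite indE; apply: integrable_indic_itv.
Qed.

Lemma ind_int a : \int[leb]_t ind a t = 2.
Proof.
have h : leb `[a, a + 2]%classic = 2%:E.
  rewrite lebesgue_measure_itv/= lte_fin ltrDl ltr0n/= -EFinB.
  by rewrite addrAC subrr add0r.
by rewrite indE /Rintegral integral_indic// setIT; exact: (congr1 fine h).
Qed.

Lemma tens_int p q : itg leb p -> itg leb q ->
  itg (leb2 R) (tens p q) /\ \int[leb2 R]_x tens p q x = (\int[leb]_t p t) * (\int[leb]_t q t).
Proof.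
move=> ip iq.
have mt : measurable_fun setT (tens p q).
  by apply: measurable_funM; [apply: (measurableT_comp (itg_meas ip))|apply: (measurableT_comp (itg_meas iq))].
have FE a b : `|tens p q (a, b)| <= `|p a| * `|q b| by rewrite /tens/= normrM.
split; first exact: leb2_itg mt (itg_norm ip) (itg_norm iq) FE.
rewrite (leb2_int12 mt (itg_norm ip) (itg_norm iq) FE)/= -RintZr//.
by apply: eq_Rint => a; rewrite -RintZl.
Qed.

(** The square has [y] as its lower left corner, side 2 and area 4. Keeping it in the Sobolev
    inequality makes that inequality local, which gives decay at infinity and not only
    boundedness. *)
Definition ind2 (y x : R * R) : R := ind y.1 x.1 * ind y.2 x.2.

Lemma ind2_ge0 y x : 0 <= ind2 y x. Proof. by rewrite mulr_ge0 ?ind_ge0. Qed.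

Lemma ind2_le1 y x : ind2 y x <= 1.
Proof. by rewrite /ind2 /ind; case: ifP; case: ifP; rewrite ?mulr1 ?mulr0 ?mul0r. Qed.

Lemma ind2_meas y : measurable_fun setT (ind2 y).
Proof. by apply: measurable_funM; apply: (measurableT_comp (itg_meas (ind_itg _))). Qed.

Lemma ind2_itg y : itg (leb2 R) (ind2 y) /\ \int[leb2 R]_x ind2 y x = 4.
Proof.
have [h1 h2] := tens_int (ind_itg y.1) (ind_itg y.2).
by split; [exact: h1|rewrite [LHS]h2 !ind_int -natrM].
Qed.

(** An approximate identity [b] on [0, e] is written as A' - B, with [A] and [B] bounded and
    supported in [0, 2] uniformly in [e]. Testing against [b] recovers point values as [e] tends to
    0, while the derivative in A' is moved onto the tested function; this is the one-dimensional
    mechanism of the Sobolev inequality below. *)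
Lemma mollifier (H : R -> R) : smooth1 H -> (forall t, t <= 0 -> H t = 0) ->
  (forall t, 1 <= t -> H t = 1) -> (forall t, 0 <= H t <= 1) ->
  (forall t, 0 <= D1 H t) ->
  exists2 K : R, 1 <= K & forall e : R, 0 < e <= 1 -> exists A B b : R -> R,
   [/\ smooth1 A /\ smooth1 B, (forall t, D1 A t = b t + B t),
      (forall t, `|A t| <= K * ind 0 t) /\ (forall t, `|B t| <= K * ind 0 t),
      (forall t, 0 <= b t) /\ (forall t, ~~ (0 <= t <= e) -> b t = 0) &
      itg leb b /\ \int[leb]_t b t = 1].
Proof.
move=> sH H0 H1 H01 dH0.
have dH := smooth1_derivable sH; have cH := smooth1_cont sH.
have cH' := smooth1_cont (smooth1_der sH).
have z0 t : t < 0 -> D1 H t = 0.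
  move=> t0; apply: (@D1_near0 _ 0); near=> s; apply: H0; apply: ltW; near: s; exact: lt_nbhsl.
have z1 t : 1 < t -> D1 H t = 0.
  move=> t0; apply: (@D1_near0 _ 1); near=> s; apply: H1; apply: ltW; near: s; exact: lt_nbhsr.
have [c c01 cM] := @EVT_max R (D1 H) 0 1 ler01 (continuous_subspaceT cH').
have Hc t : D1 H t <= D1 H c.
  have [t0|t0] := ltP t 0; first by rewrite z0.
  have [t1|t1] := ltP 1 t; first by rewrite z1.
  by apply: cM; rewrite in_itv/= t0.
have [iH iH1] := step_int sH H0 H1.
exists (1 + D1 H c) => [|e /andP[e0 e1]]; first by rewrite lerDl.
have K0 : 0 <= 1 + D1 H c by rewrite addr_ge0.
(* [chi] is 1 up to t = 1 and 0 from t = 2; [He] climbs from 0 to 1 on [0, e]. As e <= 1, the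
   derivative of [He] lives where [chi] is 1, so that (He chi)' = He' + He chi'. *)
pose chi t := 1 + -1 * H (1 * t + -1).
pose He t := H (e^-1 * t + 0).
have schi : smooth1 chi by move=> n; apply: sm1D; [exact: sm1_cst|apply: sm1Z; exact: sm1_affine].
have sHe : smooth1 He by move=> n; exact: sm1_affine.
have Dchi t : D1 chi t = - D1 H (t - 1).
  apply: der_derive1.
  have h := is_derive_affine (dH (1 * t + -1)).
  rewrite /chi; apply: is_derive_eq; rewrite /GRing.scale/= !mul1r; ring.
have DHe t : D1 He t = e^-1 * D1 H (e^-1 * t).
  by rewrite (D1_affine (dH _)) addr0.
exists (fun t => He t * chi t), (fun t => He t * D1 chi t), (fun t => D1 He t).
have e10 : 0 < e^-1 by rewrite invr_gt0.
have He0 t : t <= 0 -> He t = 0 by move=> t0; rewrite /He addr0 H0// pmulr_rle0.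
have He1 t : 0 <= He t <= 1 by exact: H01.
split.
- split => n; apply: sm1M => //.
  exact: smooth1_der.
- move=> t; rewrite derive1E deriveM/=; [|exact: smooth1_derivable..].
  rewrite -!derive1E /GRing.scale/= addrC; congr (_ + _); rewrite mulrC.
  have [t1|t1] := leP t 1.
    by rewrite /chi H0 ?mulr0 ?addr0 ?mulr1// mul1r subr_le0.
  by rewrite DHe z1 ?mulr0 ?mul0r// mulrC ltr_pdivlMr// mul1r (le_lt_trans e1).
- have indt t : 0 <= (1 + D1 H c) * ind 0 t by rewrite mulr_ge0 ?ind_ge0.
  split => t.
  + have [t0|t0] := leP t 0; first by rewrite He0// mul0r normr0.
    have [t2|t2] := leP 2 t.
      by rewrite /chi mul1r H1 ?mulr1 ?subrr ?mulr0 ?normr0//; lra.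
    rewrite /ind add0r (ltW t0) (ltW t2)/= mulr1 normrM.
    have -> : `|He t| = He t by rewrite ger0_norm//; case/andP: (He1 t).
    have /andP[a1 a2] := He1 t; have /andP[b1 b2] := H01 (1 * t + -1).
    rewrite /chi ger0_norm; last by rewrite mulN1r subr_ge0.
    have := dH0 c; move: (H _) a1 a2 b1 b2 => h; nra.
  + have [t0|t0] := leP t 0; first by rewrite He0// mul0r normr0.
    have [t2|t2] := ltP 2 t.
      by rewrite Dchi z1 ?oppr0 ?mulr0 ?normr0//; lra.
    rewrite /ind add0r (ltW t0) t2/= mulr1 normrM Dchi normrN.
    rewrite [`|D1 _ _|]ger0_norm//.
    have -> : `|He t| = He t by rewrite ger0_norm//; case/andP: (He1 t).
    have /andP[a1 a2] := He1 t; have := Hc (t - 1); have := dH0 (t - 1).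
    by have := dH0 c; nra.
- split => t; first by rewrite DHe mulr_ge0// ltW.
  rewrite negb_and -!ltNge => /orP[t0|t1]; rewrite DHe; first by rewrite z0 ?mulr0// pmulr_rlt0.
  by rewrite z1 ?mulr0// mulrC ltr_pdivlMr// mul1r.
- have [i1 i2] := @subst_line R e^-1 0 (D1 H) e10 cH' iH.
  have E : D1 He = (fun t => e^-1 * D1 H (e^-1 * t + 0)).
    by apply/funext => t; rewrite DHe addr0.
  rewrite E; split; first exact: itgZl.
  by rewrite (RintZl _ i1) i2 iH1 mulr1 invrK mulVf ?(gt_eqF e0).
Unshelve. all: end_near. Qed.

(** The inequality |g| <= l + g^2 / l with a free parameter [l] plays the part of Cauchy-Schwarz;
    the factor 4 is the area of the square. *)
Lemma sob_int (g : R * R -> R) p q (K l : R) y : L2 g -> 0 < l -> 0 <= K ->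
  measurable_fun setT (tens p q) ->
  (forall x, `|tens p q x| <= K * ind2 y x) ->
  `|\int[leb2 R]_x (g x * tens p q x)| <=
    K * (4 * l + l^-1 * \int[leb2 R]_x (ind2 y x * g x ^+ 2)).
Proof.
move=> L2g l0 K0 mt pq.
have ig2 : itg (leb2 R) (fun x => g x ^+ 2) by exact: Lfun2_integrable_sqr.
have mg : measurable_fun setT g.
  by move: L2g; rewrite /L2 => /sub_Lfun_mfun; rewrite inE.
have iig : itg (leb2 R) (fun x => ind2 y x * g x ^+ 2).
  apply: (@itg2_le _ _ (fun x => g x ^+ 2)) => //.
    by apply: measurable_funM; [exact: ind2_meas|exact: itg_meas ig2].
  move=> x; rewrite ger0_norm; last by apply: mulr_ge0; [exact: ind2_ge0|exact: sqr_ge0].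
  by rewrite ler_piMl ?sqr_ge0 ?ind2_le1.
have [ii i4] := ind2_itg y.
have iR : itg (leb2 R) (fun x => K * (l * ind2 y x + l^-1 * (ind2 y x * g x ^+ 2))).
  by apply: itgZl; apply: itgD; exact: itgZl.
apply: (@le_trans _ _ (\int[leb2 R]_x (K * (l * ind2 y x + l^-1 * (ind2 y x * g x ^+ 2))))).
  apply: (@Rint_bound _ _ _ (leb2 R)) => //; first exact: measurable_funM.
  move=> x; rewrite normrM; apply: (@le_trans _ _ (`|g x| * (K * ind2 y x))).
    by rewrite ler_wpM2l.
  rewrite mulrCA ler_wpM2l// [l^-1 * _]mulrCA [l * _]mulrC -mulrDr mulrC ler_wpM2l ?ind2_ge0//.
  have h : 0 <= (`|g x| - l) ^+ 2 by exact: sqr_ge0.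
  have g2 : `|g x| ^+ 2 = g x ^+ 2 by rewrite real_normK// num_real.
  rewrite -(ler_pM2l l0) mulrDr mulrA mulfV ?gt_eqF// mul1r -expr2.
  have := normr_ge0 (g x); nra.
rewrite RintZl; last by apply: itgD; exact: itgZl.
by rewrite (RintD (itgZl _ ii) (itgZl _ iig)) (RintZl _ ii) (RintZl _ iig) i4 [l * 4]mulrC.
Qed.

Lemma cont_lb (v : R * R -> R) (y : R * R) (k : R) : continuous v -> k < v y ->
  exists2 e : R, 0 < e <= 1 & forall x, 0 <= x.1 - y.1 <= e -> 0 <= x.2 - y.2 <= e -> k <= v x.
Proof.
move=> cv kv.
have /nbhs_ballP[d /= d0 dE] : \forall x \near y, k < v x.
  by have /cvgr_gt := cv y; apply.
exists (Num.min 1 (d / 2)); first by rewrite lt_min ltr01 divr_gt0//= ge_min lexx.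
move=> x /andP[a1 a2] /andP[b1 b2].
have hd : Num.min 1 (d / 2) < d by rewrite gt_min; apply/orP; right; lra.
apply: ltW; apply: dE; split; rewrite /ball/= distrC ger0_norm//.
  exact: le_lt_trans hd.
exact: le_lt_trans hd.
Qed.

(** Local Sobolev inequality in the plane, with the derivatives of orders (0,0), (0,1), (1,0) and
    (1,1) only: [mollifier] is used in each variable, and the four products of [A] and [B] receive
    one derivative each. Only [v y] is bounded above; the absolute value comes from applying this to
    [-v]. *)
Lemma sob_core : exists2 K : R, 0 < K & forall (v : R * R -> R) (g : nat -> nat -> R * R -> R),
  continuous v ->
  (forall p q r i j, (i <= 1)%N -> (j <= 1)%N -> smooth1 p -> smooth1 q -> supp1 r p -> supp1 r q ->
    \int[leb2 R]_x (v x * tens (iter i D1 p) (iter j D1 q) x) =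
    (-1) ^+ (i + j) * \int[leb2 R]_x (g i j x * tens p q x)) ->
  (forall i j, (i <= 1)%N -> (j <= 1)%N -> L2 (g i j)) ->
  forall y l, 0 < l -> v y <= K * (l + l^-1 *
    (\int[leb2 R]_x (ind2 y x * g 0%N 0%N x ^+ 2) + \int[leb2 R]_x (ind2 y x * g 0%N 1%N x ^+ 2)
    + \int[leb2 R]_x (ind2 y x * g 1%N 0%N x ^+ 2) + \int[leb2 R]_x (ind2 y x * g 1%N 1%N x ^+ 2))).
Proof.
have [H [sH H0 H1 H01 dH0]] := smooth_step R.
have [K K1 hK] := mollifier sH H0 H1 H01 dH0.
have K0 : 0 <= K by lra.
exists (16 * K ^+ 2); first by rewrite mulr_gt0// exprn_gt0//; lra.
move=> v g cv hv hg y l l0.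
set G00 := \int[leb2 R]_x _; set G01 := \int[leb2 R]_x _.
set G10 := \int[leb2 R]_x _; set G11 := \int[leb2 R]_x _.
set RHS := (X in _ <= X).
rewrite leNgt; apply/negP => RHSv.
(* If the bound failed, [v] would exceed a value [k] above the right side on a small square at [y];
   the mollified value would then be at least [k], although it obeys the bound. *)
pose k := (RHS + v y) / 2.
have kv : k < v y by rewrite /k; lra.
have Rk : RHS < k by rewrite /k; lra.
have [e e01 eP] := cont_lb cv kv.
have [A [B [b [[sA sB] DA [AK BK] [b0 bs] [ib ib1]]]]] := hK e e01.
pose T (f : R -> R) (a t : R) := f (1 * t + - a).
have sT f a : smooth1 f -> smooth1 (T f a) by move=> sf n; exact: sm1_affine.
have DT f a : smooth1 f -> D1 (T f a) = T (D1 f) a.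
  move=> sf; apply/funext => t; rewrite /T D1_affine ?mul1r//; exact: smooth1_derivable.
pose r : R := `|y.1| + `|y.2| + 2.
have rT f a : (forall t, `|f t| <= K * ind 0 t) -> `|a| <= `|y.1| + `|y.2| -> supp1 r (T f a).
  move=> fK ay t rt; apply/eqP; rewrite -normr_le0; apply: le_trans (fK _) _.
  rewrite /ind mul1r add0r; case: ifP; rewrite ?mulr0// => /andP[h1 h2].
  have : `|t| <= `|a| + 2.
    rewrite -[t](subrK a) addrC; apply: le_trans (ler_normD _ _) _.
    by rewrite lerD2l ger0_norm.
  by move=> ht; exfalso; move: rt; rewrite ltNge (le_trans ht)// /r lerD2r.
have y1 : `|y.1| <= `|y.1| + `|y.2| by rewrite lerDl.
have y2 : `|y.2| <= `|y.1| + `|y.2| by rewrite lerDr.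
have indT a t : ind 0 (1 * t + - a) = ind a t.
  by rewrite /ind mul1r add0r subr_ge0 lerBlDr addrC.
have tK P Q : (forall t, `|P t| <= K * ind 0 t) -> (forall t, `|Q t| <= K * ind 0 t) ->
    forall x, `|tens (T P y.1) (T Q y.2) x| <= K ^+ 2 * ind2 y x.
  move=> PK QK x; rewrite /tens normrM /ind2 expr2 mulrACA.
  by apply: ler_pM => //; rewrite -indT; [exact: PK|exact: QK].
have mT P Q : smooth1 P -> smooth1 Q -> measurable_fun setT (tens (T P y.1) (T Q y.2)).
  by move=> sP sQ; apply: continuous2_measurable; apply: cont_tens; apply: smooth1_cont; exact: sT.
have cT P Q : smooth1 P -> smooth1 Q -> continuous (tens (T P y.1) (T Q y.2)).
  by move=> sP sQ; apply: cont_tens; apply: smooth1_cont; exact: sT.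
have iT P Q : smooth1 P -> smooth1 Q -> supp1 r (T P y.1) -> supp1 r (T Q y.2) ->
    itg (leb2 R) (fun x => v x * tens (T P y.1) (T Q y.2) x).
  move=> sP sQ rP rQ; apply: (@cs_itg _ r); first exact: contM2 cv (cT _ _ sP sQ).
    by move=> x h; rewrite /tens rP// mul0r mulr0.
  by move=> x h; rewrite /tens rQ// !mulr0.
have sA' := smooth1_der sA.
have rA1 := rT A y.1 AK y1; have rA2 := rT A y.2 AK y2.
have rB1 := rT B y.1 BK y1; have rB2 := rT B y.2 BK y2.
have rA1' : supp1 r (T (D1 A) y.1) by rewrite -DT//; exact: supp1_der.
have rA2' : supp1 r (T (D1 A) y.2) by rewrite -DT//; exact: supp1_der.
(* Substituting b = A' - B in both variables leaves derivatives on factors [A] only. *)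
have bE x : v x * tens (T b y.1) (T b y.2) x =
    (v x * tens (T (D1 A) y.1) (T (D1 A) y.2) x - v x * tens (T (D1 A) y.1) (T B y.2) x)
    - (v x * tens (T B y.1) (T (D1 A) y.2) x - v x * tens (T B y.1) (T B y.2) x).
  by rewrite /tens /T !DA; ring.
have i1 := iT _ _ sA' sA' rA1' rA2'; have i2 := iT _ _ sA' sB rA1' rB2.
have i3 := iT _ _ sB sA' rB1 rA2'; have i4 := iT _ _ sB sB rB1 rB2.
have L : \int[leb2 R]_x (v x * tens (T b y.1) (T b y.2) x) <= RHS.
  rewrite (eq_Rint (leb2 R) bE) (RintB (itgB i1 i2) (itgB i3 i4)) (RintB i1 i2) (RintB i3 i4).
  have := hv (T A y.1) (T A y.2) r 1%N 1%N isT isT (sT _ _ sA) (sT _ _ sA) rA1 rA2.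
  have := hv (T A y.1) (T B y.2) r 1%N 0%N isT isT (sT _ _ sA) (sT _ _ sB) rA1 rB2.
  have := hv (T B y.1) (T A y.2) r 0%N 1%N isT isT (sT _ _ sB) (sT _ _ sA) rB1 rA2.
  have := hv (T B y.1) (T B y.2) r 0%N 0%N isT isT (sT _ _ sB) (sT _ _ sB) rB1 rB2.
  rewrite !addn0 !addn1 /= !DT// expr0 expr1 sqrrN expr1n !mul1r !mulN1r.
  move=> -> -> -> ->.
  have K20 : 0 <= K ^+ 2 by exact: sqr_ge0.
  have := sob_int (hg 1%N 1%N isT isT) l0 K20 (mT _ _ sA sA) (tK _ _ AK AK).
  have := sob_int (hg 1%N 0%N isT isT) l0 K20 (mT _ _ sA sB) (tK _ _ AK BK).
  have := sob_int (hg 0%N 1%N isT isT) l0 K20 (mT _ _ sB sA) (tK _ _ BK AK).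
  have := sob_int (hg 0%N 0%N isT isT) l0 K20 (mT _ _ sB sB) (tK _ _ BK BK).
  rewrite -/G00 -/G01 -/G10 -/G11.
  move=> /ler_normlW a1 /ler_normlW a2 /ler_normlW a3 /ler_normlW a4.
  have G0 i j : 0 <= \int[leb2 R]_x (ind2 y x * g i j x ^+ 2).
    by apply: Rint_ge0 => x; rewrite mulr_ge0 ?ind2_ge0 ?sqr_ge0.
  have h0 : 0 <= K ^+ 2 * (l^-1 * (G00 + G01 + G10 + G11)).
    rewrite mulr_ge0// mulr_ge0 ?invr_ge0 ?(ltW l0)//.
    by rewrite !addr_ge0//; exact: G0.
  rewrite /RHS; move: a1 a2 a3 a4 h0; rewrite !mulrDr.
  by move: (K ^+ 2 * l) {RHSv kv Rk K1 K0 e01} => kl; lra.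
have [jb jb1] : itg (leb2 R) (tens (T b y.1) (T b y.2)) /\ \int[leb2 R]_x tens (T b y.1) (T b y.2) x = 1.
  have cb : continuous b.
    have -> : b = (fun t => D1 A t + -1 * B t).
      by apply/funext => t; rewrite DA mulN1r addrK.
    apply: (@smooth1_cont R) => n; apply: sm1D; first exact: sA'.
    by apply: sm1Z; exact: sB.
  have [k1 k2] := subst_line (- y.1) ltr01 cb ib; have [k3 k4] := subst_line (- y.2) ltr01 cb ib.
  have [k5 k6] := tens_int k1 k3.
  split; first exact: k5.
  by rewrite [LHS]k6 k2 k4 ib1 invr1 !mulr1.
have : k <= \int[leb2 R]_x (v x * tens (T b y.1) (T b y.2) x).
  rewrite -[leLHS]mulr1 -jb1 -(RintZl _ jb); apply: le_Rint.
  - exact: itgZl.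
  - have := itgB (itgB i1 i2) (itgB i3 i4); rewrite (_ : (fun x => _) = (fun x => v x * tens (T b y.1) (T b y.2) x))//.
    by apply/funext => x; rewrite bE.
  - move=> x; rewrite /tens /T.
    have [h1|h1] := boolP (0 <= 1 * x.1 - y.1 <= e); last by rewrite (bs _ h1) mul0r !mulr0.
    have [h2|h2] := boolP (0 <= 1 * x.2 - y.2 <= e); last by rewrite (bs _ h2) !mulr0.
    rewrite ler_wpM2r ?mulr_ge0//; apply: eP; [move: h1|move: h2]; by rewrite mul1r.
by move=> /le_trans /(_ L); rewrite leNgt Rk.
Qed.
End sob.

Section dct.
Context d (T : measurableType d) (R : realType).
Variable mu : {measure set T -> \bar R}.

Lemma Rdct (f_ : nat -> T -> R) (f g : T -> R) :
  (forall n, measurable_fun setT (f_ n)) -> measurable_fun setT f -> itg mu g ->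
  (forall n x, `|f_ n x| <= g x) -> (forall x, f_ n x @[n --> \oo] --> f x) ->
  \int[mu]_x f_ n x @[n --> \oo] --> \int[mu]_x f x.
Proof.
move=> mf_ mf ig fg ff.
have cf : {ae mu, forall x, setT x -> (EFin \o f_ n) x @[n --> \oo] --> (EFin \o f) x}.
  by apply: aeW => x _; apply: cvg_EFin; [exact: nearW|exact: ff].
have df : {ae mu, forall x n, setT x -> (`|(EFin \o f_ n) x| <= (g x)%:E)%E}.
  by apply: aeW => x n _; rewrite /= lee_fin.
have [h0 _ h] := @dominated_convergence _ _ _ mu setT measurableT (fun n => EFin \o f_ n) (EFin \o f) (fun x => (g x)%:E) (fun n => (measurable_EFinP _ _).2 (mf_ n)) ((measurable_EFinP _ _).2 mf) cf ig df.
apply/fine_cvg; rewrite /Rintegral fineK//.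
exact: (integrable_fin_num measurableT h0).
Qed.
End dct.

Section sobcor.
Variable R : realType.
Local Notation D1 := (@derive1 R R^o).

Lemma L2_itg (g : R * R -> R) : L2 g -> itg (leb2 R) (fun x => g x ^+ 2).
Proof. by move=> h; exact: Lfun2_integrable_sqr. Qed.

Lemma ind2_itg_mul (h : R * R -> R) y : (forall x, 0 <= h x) -> itg (leb2 R) h ->
  itg (leb2 R) (fun x => ind2 y x * h x) /\
  \int[leb2 R]_x (ind2 y x * h x) <= \int[leb2 R]_x h x.
Proof.
move=> h0 ih.
have i1 : itg (leb2 R) (fun x => ind2 y x * h x).
  apply: (itg2_le _ _ ih); first by apply: measurable_funM; [exact: ind2_meas|exact: itg_meas ih].
  move=> x; rewrite ger0_norm; last by apply: mulr_ge0; [exact: ind2_ge0|].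
  by rewrite ler_piMl ?ind2_le1.
split=> //; apply: le_Rint => // x; by rewrite ler_piMl ?ind2_le1.
Qed.

Definition ind2sum (y : R * R) (g : nat -> nat -> R * R -> R) :=
  \int[leb2 R]_x (ind2 y x * g 0%N 0%N x ^+ 2) + \int[leb2 R]_x (ind2 y x * g 0%N 1%N x ^+ 2)
  + \int[leb2 R]_x (ind2 y x * g 1%N 0%N x ^+ 2) + \int[leb2 R]_x (ind2 y x * g 1%N 1%N x ^+ 2).

(* Only tensor products are used as test functions, which spares the a.e.
   identification of weak and classical derivatives. *)
Definition tested_derivatives (v : R * R -> R) (g : nat -> nat -> R * R -> R) :=
  forall p q (r : R) i j, (i <= 1)%N -> (j <= 1)%N -> smooth1 p -> smooth1 q -> supp1 r p -> supp1 r q ->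
    \int[leb2 R]_x (v x * tens (iter i D1 p) (iter j D1 q) x) =
    (-1) ^+ (i + j) * \int[leb2 R]_x (g i j x * tens p q x).

Lemma sob_abs : exists2 K : R, 0 < K & forall (v : R * R -> R) (g : nat -> nat -> R * R -> R),
  continuous v -> tested_derivatives v g -> (forall i j, (i <= 1)%N -> (j <= 1)%N -> L2 (g i j)) ->
  forall y l, 0 < l -> `|v y| <= K * (l + l^-1 * ind2sum y g).
Proof.
have [K K0 hK] := sob_core R.
exists K => // v g cv hv hg y l l0.
rewrite ler_norml; apply/andP; split; last exact: hK.
have E : ind2sum y g = ind2sum y (fun i j x => - g i j x).
  rewrite /ind2sum; congr (_ + _ + _ + _); apply: eq_Rint => x; by rewrite sqrrN.
rewrite lerNl E; apply: (hK (fun x => - v x) (fun i j x => - g i j x)) => //.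
- by move=> x; apply: (@continuousN _ _ _ v); exact: cv.
- move=> p q r i j i1 j1 sp sq rp rq.
  have sp' : smooth1 (fun t => -1 * p t) by move=> n; apply: sm1Z; exact: sp.
  have rp' : supp1 r (fun t => -1 * p t) by move=> t /rp ->; rewrite mulr0.
  have := hv _ q r i j i1 j1 sp' sq rp' rq.
  have iE : iter i D1 (fun t => -1 * p t) = fun t => -1 * iter i D1 p t.
    case: i i1 => [|[|//]] _ //=; apply/funext => t.
    by rewrite [LHS]derive1Ml ?[in RHS]/derive1//; exact: smooth1_derivable.
  rewrite iE => h.
  transitivity (\int[leb2 R]_x (v x * tens (fun t => -1 * iter i D1 p t) (iter j D1 q) x)).
    by apply: eq_Rint => x; rewrite /tens; ring.
  rewrite h; congr (_ * _); apply: eq_Rint => x; rewrite /tens; ring.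
- move=> i j i1 j1; have := hg i j i1 j1; rewrite /L2 => h.
  exact: (Lfun_oppr_closed h).
Qed.

Lemma sob_sup : exists2 K : R, 0 < K & forall (u : R * R -> R) a, 0 <= a -> continuous u ->
  (sobolev_sq 2 u <= (a ^+ 2)%:E)%E -> forall y, `|u y| <= K * a.
Proof.
have [K K0 hK] := sob_abs.
exists (5 * K); first by rewrite mulr_gt0.
move=> u a a0 cu hu y.
apply/ler_addgt0Pr => e e0.
(* The Sobolev norm is an infimum, possibly not attained, and [a] may be 0, so [l] is taken slightly
   larger. Each of the four local masses is at most l^2, and l + 4 l^2 / l = 5 l. *)
pose l := a + e / (5 * K).
have e'0 : 0 < e / (5 * K) by rewrite divr_gt0// mulr_gt0.
have l0 : 0 < l by rewrite /l ltr_wpDl.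
have al : a < l by rewrite /l ltrDl.
rewrite (_ : 5 * K * a + e = 5 * K * l); last first.
  by rewrite /l; field; rewrite gt_eqF.
have /ereal_inf_lt[s [g [Lu hg] ->] hs] : (sobolev_sq 2 u < (l ^+ 2)%:E)%E.
  by apply: (le_lt_trans hu); rewrite lte_fin ltr_pXn2r// nnegrE ltW.
have L2g i j : (i <= 1)%N -> (j <= 1)%N -> L2 (g (i, j)).
  by move=> i1 j1; have [] := hg (i, j) (leq_add i1 j1).
have E0 i j : (0 <= \int[leb2 R]_x (g (i, j) x ^+ 2)%:E)%E.
  by apply: integral_ge0 => x _; rewrite lee_fin sqr_ge0.
have gl i j : (i <= 1)%N -> (j <= 1)%N -> \int[leb2 R]_x (ind2 y x * g (i, j) x ^+ 2) <= l ^+ 2.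
  move=> i1 j1.
  have ig := L2_itg (L2g _ _ i1 j1).
  have [_ le1] := ind2_itg_mul y (fun x => sqr_ge0 (g (i,j) x)) ig.
  apply: (le_trans le1).
  rewrite -lee_fin /Rintegral fineK; last exact: (integrable_fin_num measurableT ig).
  apply: ltW; apply: le_lt_trans hs.
  have i3 : (i < 3)%N by rewrite (leq_ltn_trans i1).
  have j3 : (j < 3)%N by rewrite (leq_ltn_trans j1).
  rewrite (bigD1 (Ordinal i3))//= (bigD1 (Ordinal j3))/=; last exact: leq_add i1 j1.
  rewrite -addeA leeDl// adde_ge0//; first by apply: sume_ge0 => k _; exact: E0.
  by apply: sume_ge0 => k _; apply: sume_ge0 => k' _; exact: E0.
have wp : tested_derivatives u (fun i j => g (i, j)).
  move=> p q r i j i1 j1 sp sq rp rq.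
  have [_ /(_ _ (test_tens sp sq rp rq))] := hg (i, j) (leq_add i1 j1).
  by rewrite pderiv_tens.
apply: (le_trans (hK u (fun i j => g (i, j)) cu wp L2g y l l0)).
rewrite -[leRHS]mulrA mulrCA ler_wpM2l ?(ltW K0)//.
rewrite /ind2sum.
have := gl 0%N 0%N isT isT; have := gl 0%N 1%N isT isT.
have := gl 1%N 0%N isT isT; have := gl 1%N 1%N isT isT.
set x1 := Rintegral _ _ _; set x2 := Rintegral _ _ _; set x3 := Rintegral _ _ _; set x4 := Rintegral _ _ _.
move=> a1 a2 a3 a4.
have : l^-1 * (x4 + x3 + x2 + x1) <= 4 * l.
  rewrite ler_pdivrMl// mulrCA -expr2; lra.
move=> h; rewrite (_ : 5 * l = l + 4 * l) ?lerD2l//; ring.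
Qed.

Lemma iterD1 (p : R -> R) m i : iter m D1 (iter i D1 p) = iter (m + i) D1 p.
Proof. by rewrite iterD. Qed.

Lemma smooth1_iter (p : R -> R) m : smooth1 p -> smooth1 (iter m D1 p).
Proof. by move=> sp; elim: m => //= m; exact: smooth1_der. Qed.

Lemma count2 (s : seq 'I_2) : (count_mem ord0 s + count_mem ord_max s)%N = size s.
Proof.
elim: s => //= j s <-; move: j; apply: ord2P => /=; first by rewrite add1n add0n addSn.
by rewrite add1n add0n addnS.
Qed.

(** The derivatives in [s] are moved to the test function classically, those of order (i, j) are
    added on top, and the weak derivatives of [u] itself absorb them all; hence the use of H^k with
    k = |s| + 2. *)
Lemma hinf_wder (u : R * R -> R) (s : seq 'I_2) : in_Hinfty u ->
  exists g : nat -> nat -> R * R -> R,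
   [/\ continuous (partials s u), tested_derivatives (partials s u) g & (forall i j, (i <= 1)%N -> (j <= 1)%N -> L2 (g i j))].
Proof.
move=> [su hu]; have [g [Lu hg]] := hu (size s + 2)%N.
pose m0 := count_mem ord0 s; pose m1 := count_mem ord_max s.
have md i j : (i <= 1)%N -> (j <= 1)%N -> (mdeg (m0 + i, m1 + j) <= size s + 2)%N.
  by move=> i1 j1; rewrite /mdeg/= addnACA count2 leq_add2l (leq_add i1 j1).
exists (fun i j => g (m0 + i, m1 + j)%N); split.
- exact: smooth_cont.
- move=> p q r i j i1 j1 sp sq rp rq.
  rewrite (ibps_tens s su (smooth1_iter i sp) (smooth1_iter j sq) (supp1_iter i rp) (supp1_iter j rq)).
  rewrite !iterD1.
  have [_ /(_ _ (test_tens sp sq rp rq))] := hg _ (md _ _ i1 j1).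
  rewrite pderiv_tens//= => ->.
  rewrite mulrA -exprD; congr (_ * _).
  rewrite -signr_odd -[RHS]signr_odd; congr (_ ^+ (nat_of_bool _)).
  by rewrite /mdeg/= addnACA count2 addnA oddD addnn odd_double.
- by move=> i j i1 j1; have [] := hg _ (md _ _ i1 j1).
Qed.

Lemma hinf_bounded (u : R * R -> R) (s : seq 'I_2) : in_Hinfty u ->
  exists B, forall y, `|partials s u y| <= B.
Proof.
move=> hu; have [g [cv hv hg]] := hinf_wder s hu.
have [K K0 hK] := sob_abs.
exists (K * (1 + 1^-1 * (\int[leb2 R]_x (g 0%N 0%N x ^+ 2) + \int[leb2 R]_x (g 0%N 1%N x ^+ 2) +
  \int[leb2 R]_x (g 1%N 0%N x ^+ 2) + \int[leb2 R]_x (g 1%N 1%N x ^+ 2)))) => y.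
apply: (le_trans (hK _ _ cv hv hg y 1 ltr01)).
rewrite ler_wpM2l ?(ltW K0)// lerD2l ler_wpM2l ?invr_ge0// /ind2sum.
by rewrite !lerD//; apply: (ind2_itg_mul y (fun x => sqr_ge0 _) (L2_itg (hg _ _ _ _))).2.
Qed.

(** Dominated convergence for the restrictions of [h] to the complements of growing l^1 balls. *)
Lemma tail_small (h : R * R -> R) (e : R) : 0 < e -> (forall x, 0 <= h x) -> itg (leb2 R) h ->
  exists r : R, forall y, r <= enorm y -> \int[leb2 R]_x (ind2 y x * h x) <= e.
Proof.
move=> e0 h0 ih; have mh := itg_meas ih.
pose t (n : nat) (x : R * R) : R := if n%:R < `|x.1| + `|x.2| then h x else 0.
have mt n : measurable_fun setT (t n).
  apply: measurable_fun_if => //.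
    apply: (measurable_fun_ltr (measurable_cst _)).
    by apply: measurable_funD; apply: measurableT_comp.
  by apply: measurable_funTS.
have tE n x : `|t n x| <= h x.
  by rewrite /t; case: ifP => _; rewrite ?normr0// ger0_norm.
have t0 n x : 0 <= t n x by rewrite /t; case: ifP.
have := @Rdct _ _ _ (leb2 R) t (fun=> 0) h mt (measurable_cst _) ih tE.
rewrite Rint0 => /(_ _)/cvgr0Pnorm_le.
have tc x : t n x @[n --> \oo] --> (0 : R).
  apply: cvg_near_cst; near=> n.
  rewrite /t ifF//; apply/negbTE; rewrite -leNgt; near: n; exact: nbhs_infty_ger.
move=> /(_ tc e e0)[N _ /(_ N (leqnn N))/= hN].
(* Points of the square at [y] differ from [y] by at most 2 in each coordinate, hence by 4 in the
   l^1 norm. *)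
exists (N%:R + 4 + 1) => y yr.
have iN : itg (leb2 R) (t N) by exact: itg2_le (mt N) (tE N) ih.
apply: (@le_trans _ _ (\int[leb2 R]_x t N x)); last by apply: le_trans (ler_norm _) hN.
apply: le_Rint => //; first exact: (ind2_itg_mul y h0 ih).1.
move=> x; rewrite /t; case: ifPn => [_|]; first by rewrite ler_piMl ?ind2_le1.
rewrite -leNgt => xN; rewrite /ind2 /ind.
case: ifPn => [/andP[a1 a2]|_]; last by rewrite !mul0r.
case: ifPn => [/andP[b1 b2]|_]; last by rewrite mulr0 mul0r.
exfalso.
have h1 : `|y.1| <= `|x.1| + 2.
  rewrite -[y.1](subrK x.1) addrC; apply: le_trans (ler_normD _ _) _.
  by rewrite lerD2l ler_norml; apply/andP; split; lra.
have h2 : `|y.2| <= `|x.2| + 2.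
  rewrite -[y.2](subrK x.2) addrC; apply: le_trans (ler_normD _ _) _.
  by rewrite lerD2l ler_norml; apply/andP; split; lra.
have := enorm_le_l1 y; move: yr xN; move: (N%:R) => n; lra.
Unshelve. all: end_near. Qed.

(** In the local Sobolev inequality the four masses on the square at [y] fall below l^2 far away,
    and [l] is at our disposal; again l + 4 l = 5 l. *)
Lemma hinf_vanish (u : R * R -> R) (e : R) : in_Hinfty u -> 0 < e ->
  exists r : R, forall y, r <= enorm y -> `|u y| <= e.
Proof.
move=> hu e0; have [g [cv hv hg]] := hinf_wder [::] hu.
have [K K0 hK] := sob_abs.
pose l := e / (5 * K).
have l0 : 0 < l by rewrite divr_gt0// mulr_gt0.
have l20 : 0 < l ^+ 2 by rewrite exprn_gt0.
have T i j (i1 : (i <= 1)%N) (j1 : (j <= 1)%N) :=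
  tail_small l20 (fun x => sqr_ge0 (g i j x)) (L2_itg (hg i j i1 j1)).
have [r0 h0] := T 0%N 0%N isT isT; have [r1 h1] := T 0%N 1%N isT isT.
have [r2 h2] := T 1%N 0%N isT isT; have [r3 h3] := T 1%N 1%N isT isT.
exists (Num.max (Num.max r0 r1) (Num.max r2 r3)) => y.
rewrite !ge_max => /andP[/andP[/h0 a0 /h1 a1] /andP[/h2 a2 /h3 a3]].
apply: (le_trans (hK _ _ cv hv hg y l l0)).
rewrite (_ : e = K * (l + 4 * l)); last by rewrite /l; field; rewrite gt_eqF.
rewrite ler_wpM2l ?(ltW K0)// lerD2l /ind2sum ler_pdivrMl// mulrCA -expr2.
lra.
Qed.
End sobcor.

(** * The maximum principle on half planes *)

Section barrier.
Variable R : realType.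
Local Notation D1 := (@derive1 R R^o).

(** If f'' were positive at the maximum, f' would be positive just to its right and the mean value
    theorem would make f increase there. *)
Lemma second_test (f : R -> R) (t0 e : R) : 0 < e -> (forall t : R, derivable f t 1) ->
  derivable (D1 f) t0 1 -> (forall t, `|t - t0| < e -> f t <= f t0) -> D1 (D1 f) t0 <= 0.
Proof.
move=> e0 df ddf fmax.
have h0 : is_derive t0 1 f 0.
  apply: (@derive1_at_max R f (t0 - e) (t0 + e)).
  - by lra.
  - by move=> t _; exact: df.
  - by rewrite in_itv/=; apply/andP; split; lra.
  - by move=> t; rewrite in_itv/= => /andP[t1 t2]; apply: fmax; rewrite ltr_norml; apply/andP; split; lra.
have f'0 : D1 f t0 = 0 by exact: der_derive1.
rewrite leNgt; apply/negP => k0.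
have : (fun h : R => h^-1 *: (D1 f (h *: 1 + t0) - D1 f t0)) @ 0^' --> D1 (D1 f) t0.
  by rewrite [X in _ --> X]derive1E; exact: ddf.
move=> /cvgr_gt/(_ 0 k0) H.
have /nbhs_ballP[d /= d0 dP] : \forall h \near (0 : R), h != 0 -> 0 < h^-1 *: (D1 f (h *: 1 + t0) - D1 f t0).
  by move: H; rewrite /dnbhs /within/=.
pose m := Num.min (d / 2) (e / 2).
have m0 : 0 < m by rewrite lt_min !divr_gt0.
have md : m < d by rewrite gt_min; apply/orP; left; lra.
have me : m < e by rewrite gt_min; apply/orP; right; lra.
have [c + cE] := @MVT R f (D1 f) t0 (t0 + m) (ltac:(by rewrite ltrDl)) (fun x _ => der1 (df x)) (continuous_subspaceT (derivable_cont df)).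
rewrite in_itv/= => /andP[c1 c2].
have ct : 0 < c - t0 by rewrite subr_gt0.
have := dP (c - t0); rewrite /ball/= sub0r normrN gtr0_norm// gt_eqF// => /(_ _ isT).
rewrite /GRing.scale/= mulr1 subrK f'0 subr0 pmulr_rgt0 ?invr_gt0//.
have -> : c - t0 < d by lra.
move=> /(_ isT) fc.
have mE : t0 + m - t0 = m by ring.
have := fmax (t0 + m); rewrite mE gtr0_norm// => /(_ me).
by rewrite -subr_le0 cE mE leNgt mulr_gt0.
Qed.

Lemma max_exp (f : R -> R) (c k t0 e : R) : 0 < e -> (forall t : R, derivable f t 1) ->
  derivable (D1 f) t0 1 ->
  (forall t, `|t - t0| < e -> f t - c * expR (k * t) <= f t0 - c * expR (k * t0)) ->
  D1 (D1 f) t0 <= c * (k ^+ 2 * expR (k * t0)).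
Proof.
move=> e0 df ddf fmax.
have dE (a t : R) : is_derive t 1 (fun t => a * expR (k * t)) (a * (k * expR (k * t))).
  have h1 : is_derive t 1 (fun x : R => k * x) k.
    by apply: is_derive_eq; rewrite /GRing.scale/=; ring.
  have h2 := @is_derive1_comp R expR (fun x : R => k * x) t _ _ (is_derive_expR _) h1.
  by apply: is_derive_eq; rewrite /GRing.scale/=; ring.
pose g t := f t - c * expR (k * t).
have dg (t : R) : is_derive t 1 g (D1 f t - c * (k * expR (k * t))).
  have h1 := der1 (df t); have h2 := dE c t.
  by apply: is_derive_eq.
have g'E : D1 g = fun t => D1 f t - (c * k) * expR (k * t).
  by apply/funext => t; rewrite (der_derive1 (dg t)) mulrA.
have dg' : is_derive t0 1 (D1 g) (D1 (D1 f) t0 - c * k * (k * expR (k * t0))).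
  rewrite g'E; have h1 := der1 ddf; have h2 := dE (c * k) t0.
  by apply: is_derive_eq.
have := @second_test g t0 e e0 _ _ fmax.
rewrite (der_derive1 dg') subr_le0 => h.
rewrite (_ : c * _ = c * k * (k * expR (k * t0))); last by ring.
by apply: h; [move=> t; case: (dg t)|case: dg'].
Qed.

(** For a point y0 of direction [th], the comparison function [b] is the exponential B e^{-a (th.x -
    R0)}, which equals the claimed bound at y0, satisfies Delta b = a^2 b exactly because [th] is a
    unit vector, and is a tensor product, so that one-variable second derivative tests suffice. A
    positive maximum of f - b over the half plane th.x >= R0 would give a^2 f <= Delta f <= Delta b
    = a^2 b at that point. *)
Lemma barrier (f : R * R -> R) (a R0 B : R) :
  Cn 2 f -> 0 < a -> 0 <= R0 -> 0 <= B -> (forall y, f y <= B) ->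
  (forall e, 0 < e -> exists r : R, forall y, r <= enorm y -> f y <= e) ->
  (forall y, R0 <= enorm y -> a ^+ 2 * f y <= laplacian f y) ->
  forall y, f y <= B * expR (- (a * (enorm y - R0))).
Proof.
move=> Cf a0 R00 B0 fB fdec flap y0.
have [y0R|y0R] := ltP (enorm y0) R0.
  apply: le_trans (fB y0) _; rewrite ler_peMr// -[X in X <= _]expR0 ler_expR.
  by rewrite oppr_ge0 mulr_ge0_le0 ?(ltW a0)//; lra.
have [yz|y0nz] := eqVneq (enorm y0) 0.
  apply: le_trans (fB y0) _; rewrite ler_peMr// -[X in X <= _]expR0 ler_expR.
  by rewrite (_ : enorm y0 - R0 = 0) ?mulr0 ?oppr0//; lra.
have y0p : 0 < enorm y0 by rewrite lt_neqAle eq_sym y0nz enorm_ge0.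
pose th : R * R := (y0.1 / enorm y0, y0.2 / enorm y0).
have th1 : th.1 ^+ 2 + th.2 ^+ 2 = 1.
  rewrite /th/= !expr_div_n -mulrDl -enorm2 mulfV// sqrf_eq0 gt_eqF//.
have eth : enorm th = 1 by rewrite /enorm /dotp -!expr2 th1 sqrtr1.
have thy : dotp th y0 = enorm y0.
  rewrite /dotp/= mulrAC [X in _ + X]mulrAC -mulrDl -!expr2 -enorm2 expr2 mulfK//.
clearbody th.
pose b (x : R * R) : R := B * expR (a * R0) * expR (- a * th.1 * x.1) * expR (- a * th.2 * x.2).
have bE x : b x = B * expR (- (a * (dotp th x - R0))).
  rewrite /b /dotp (_ : - (a * _) = a * R0 + (- a * th.1 * x.1 + - a * th.2 * x.2)); last by ring.
  by rewrite !expRD !mulrA.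
rewrite -thy -bE leNgt; apply/negP => fb.
have b0 x : 0 <= b x by rewrite bE mulr_ge0 ?expR_ge0.
pose eta := f y0 - b y0.
have eta0 : 0 < eta by rewrite subr_gt0.
have [r rP] := fdec (eta / 2) (ltac:(by rewrite divr_gt0)).
pose w x := f x - b x.
have cf : continuous f by have [] := Cf [::] isT.
have cb : continuous b.
  rewrite (_ : b = tens (fun t => B * expR (a * R0) * expR (- a * th.1 * t)) (fun t => expR (- a * th.2 * t)))//.
  have ce (k c : R) : continuous (fun t => c * expR (k * t)).
    move=> t; apply: cvgMr; apply: (@continuous_comp _ _ _ (fun t : R => k * t) expR).
      by apply: cvgMr; exact: cvg_id.
    exact: continuous_expR.
  apply: cont_tens; first exact: ce.
  by have := ce (- a * th.2) 1; rewrite (_ : (fun t => 1 * _) = (fun t => expR (- a * th.2 * t)))//; apply/funext => t; rewrite mul1r.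
have cw : continuous w by move=> x; apply: (@continuousB _ _ _ f b); [exact: cf|exact: cb].
pose r' := `|r| + 1.
have rr' : r < r' by rewrite /r' ltr_pwDr// ler_norm.
clearbody r'.
pose S : set (R * R) := (`[- r', r'] `*` `[- r', r']) `&` [set x | R0 <= dotp th x].
have cS : compact S.
  apply: compact_closedI; first by apply: compact_setX; exact: segment_compact.
  have := @preimage_closed _ _ (fun x : R * R => dotp th x) [set t | R0 <= t].
  apply; last exact: closed_ge.
  move=> x _; rewrite /dotp; apply: cvgD; apply: cvgMr; [exact: cvg_fst|exact: cvg_snd].
have wr x : r <= enorm x -> w x <= eta / 2.
  by move=> /rP fx; rewrite /w; have := b0 x; lra.
have inS x : eta <= w x -> enorm x < r.
  by move=> wx; rewrite ltNge; apply/negP => /wr; lra.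
have box x : enorm x < r -> (- r' < x.1 < r') /\ (- r' < x.2 < r').
  by move=> xr; rewrite -!ltr_norml; split; apply: (@lt_trans _ _ r) => //; apply: le_lt_trans xr; [exact: enorm1_le|exact: enorm2_le].
have Sy0 : S y0.
  have [h1 h2] := box y0 (inS y0 (lexx _)).
  have [/andP[a1 a2] /andP[a3 a4]] := (h1, h2).
  by split; [split; rewrite /= in_itv/= !ltW|rewrite /= thy].
have [y1 + ymax] := compact_EVT_max (ex_intro _ y0 Sy0) cS (continuous_subspaceT cw).
rewrite inE => -[_ /= y1R].
have wy1 : eta <= w y1 by apply: ymax; rewrite inE.
have y1le x : dotp th x <= enorm x.
  by apply: (le_trans (ler_norm _)); apply: (le_trans (dotp_le _ _)); rewrite eth mul1r.
(* On the edge of the half plane b equals [B], which bounds [f]; the maximum cannot be there. *)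
have y1R' : R0 < dotp th y1.
  rewrite lt_neqAle y1R andbT; apply/eqP => RE.
  have := wy1; rewrite /w bE -RE subrr mulr0 oppr0 expR0 mulr1; have := fB y1; lra.
have [/andP[b1 b2] /andP[b3 b4]] := box y1 (inS y1 wy1).
(* Radius within which both coordinate segments through the maximum stay in [S]; moving by less than
   [e] along an axis changes th.x by less than [e] since the coordinates of [th] are at most 1. *)
pose e := Num.min (Num.min (Num.min (r' - y1.1) (y1.1 + r')) (Num.min (r' - y1.2) (y1.2 + r'))) (dotp th y1 - R0).
have e0 : 0 < e.
  rewrite /e !lt_min; apply/andP; split; last by rewrite subr_gt0.
  by move: b1 b2 b3 b4; clear; move=> *; apply/andP; split; apply/andP; split; lra.
have [e1 e2 e3 e4 e5] : [/\ e <= r' - y1.1, e <= y1.1 + r', e <= r' - y1.2, e <= y1.2 + r' & e <= dotp th y1 - R0].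
  by rewrite /e !ge_min !lexx !orbT.
clearbody e.
have th1' : `|th.1| <= 1 by rewrite -eth; exact: enorm1_le.
have th2' : `|th.2| <= 1 by rewrite -eth; exact: enorm2_le.
have abs_lem (h k : R) : `|h| <= 1 -> `|k| < e -> - e < h * k.
  move=> h1 ke; suff : `|h * k| < e by rewrite ltr_norml => /andP[].
  by apply: le_lt_trans ke; rewrite normrM ler_piMl.
have max0 (t : R) : `|t - y1.1| < e -> w (t, y1.2) <= w y1.
  move=> te; apply: ymax; rewrite inE; split.
    by move: te e1 e2 e3 e4 b1 b2 b3 b4; clear; move=> te e1 e2 e3 e4 b1 b2 b3 b4; move: te; rewrite ltr_norml => /andP[? ?]; split; rewrite /= in_itv/=; apply/andP; split; lra.
  change (R0 <= dotp th (t, y1.2)); have := abs_lem _ _ th1' te; move: e5; rewrite /dotp; clear; case: th y1 => [p q] [y1 y2] /=; move=> *; lra.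
have max1 (t : R) : `|t - y1.2| < e -> w (y1.1, t) <= w y1.
  move=> te; apply: ymax; rewrite inE; split.
    by move: te e1 e2 e3 e4 b1 b2 b3 b4; clear; move=> te e1 e2 e3 e4 b1 b2 b3 b4; move: te; rewrite ltr_norml => /andP[? ?]; split; rewrite /= in_itv/=; apply/andP; split; lra.
  change (R0 <= dotp th (y1.1, t)); have := abs_lem _ _ th2' te; move: e5; rewrite /dotp; clear; case: th y1 => [p q] [y1 y2] /=; move=> *; lra.
have df j x : derivable f x (evec R j) by have [_] := Cf [::] isT; exact.
have ddf i j x : derivable (partial i f) x (evec R j) by have [_] := Cf [:: i] isT; exact.
have L0 : partial ord0 (partial ord0 f) y1 <= (a * th.1) ^+ 2 * b y1.
  have E1 : D1 (fun t => f (t, y1.2)) = fun t => partial ord0 f (t, y1.2).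
    by apply/funext => t; rewrite partial0E.
  have := @max_exp (fun t => f (t, y1.2)) (B * expR (a * R0) * expR (- a * th.2 * y1.2)) (- a * th.1) y1.1 e e0.
  rewrite E1 [partial ord0 (partial ord0 f) y1]partial0E => h.
  apply: (le_trans (h _ _ _)).
  - by move=> t; have := df ord0 (t, y1.2); rewrite derivable0E.
  - by have := ddf ord0 ord0 y1; rewrite derivable0E.
  - move=> t /max0; rewrite /w /b /=.
    by case: (y1) => /= z1 z2; rewrite mulrAC [X in _ <= _ - X]mulrAC.
  - by rewrite /b le_eqVlt; apply/orP; left; apply/eqP; ring.
have L1 : partial ord_max (partial ord_max f) y1 <= (a * th.2) ^+ 2 * b y1.
  have E1 : D1 (fun t => f (y1.1, t)) = fun t => partial ord_max f (y1.1, t).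
    by apply/funext => t; rewrite partial1E.
  have := @max_exp (fun t => f (y1.1, t)) (B * expR (a * R0) * expR (- a * th.1 * y1.1)) (- a * th.2) y1.2 e e0.
  rewrite E1 [partial ord_max (partial ord_max f) y1]partial1E => h.
  apply: (le_trans (h _ _ _)).
  - by move=> t; have := df ord_max (y1.1, t); rewrite derivable1E.
  - by have := ddf ord_max ord_max y1; rewrite derivable1E.
  - move=> t /max1; rewrite /w /b /=.
    by case: (y1) => /= z1 z2.
  - by rewrite /b le_eqVlt; apply/orP; left; apply/eqP; ring.
have := flap y1 (le_trans y1R (y1le _)).
rewrite /laplacian /pderiv/= => h.
have : a ^+ 2 * f y1 <= a ^+ 2 * b y1.
  apply: (le_trans h); apply: (le_trans (lerD L0 L1)).
  rewrite (_ : _ + _ = a ^+ 2 * (th.1 ^+ 2 + th.2 ^+ 2) * b y1); last by ring.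
  by rewrite th1 mulr1.
rewrite ler_pM2l ?exprn_gt0// => fb1.
by move: (lt_le_trans eta0 wy1); rewrite /w subr_gt0 ltNge fb1.
Qed.
End barrier.

(** * Decay rates of derivatives by Landau's inequality *)

Section landau.
Variable R : realType.
Local Notation D1 := (@derive1 R R^o).
Implicit Types (f g : R * R -> R) (F : (R * R -> R) -> Prop).

Definition bdd2 f := exists B : R, forall y, `|f y| <= B.

(** Peeling off the innermost derivative makes the product rule an immediate induction; [smbP]
    translates to sequences of derivatives. *)
Fixpoint smooth_bounded_upto n f : Prop := [/\ continuous f, bdd2 f &
  if n is n'.+1 then (forall j y, derivable f y (evec R j)) /\ (forall j, smooth_bounded_upto n' (partial j f)) else True].

Lemma smbE n f : smooth_bounded_upto n.+1 f <-> [/\ continuous f, bdd2 f,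
  (forall j y, derivable f y (evec R j)) & (forall j, smooth_bounded_upto n (partial j f))].
Proof. by split => [[? ? []]|[]]. Qed.

Lemma smbS n f : smooth_bounded_upto n.+1 f -> smooth_bounded_upto n f.
Proof.
elim: n f => [|n IH] f; first by case=> ? ? _; split.
by move/smbE => [cf bf df h]; apply/smbE; split => // j; apply: IH; exact: h.
Qed.

Lemma bdd2D f g : bdd2 f -> bdd2 g -> bdd2 (fun x => f x + g x).
Proof. by move=> [B hB] [B' hB']; exists (B + B') => y; apply: le_trans (ler_normD _ _) _; rewrite lerD. Qed.

Lemma bdd2M f g : bdd2 f -> bdd2 g -> bdd2 (fun x => f x * g x).
Proof. by move=> [B hB] [B' hB']; exists (B * B') => y; rewrite normrM; apply: ler_pM. Qed.

Lemma partialD j f g : (forall y, derivable f y (evec R j)) -> (forall y, derivable g y (evec R j)) ->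
  partial j (fun x => f x + g x) = fun x => partial j f x + partial j g x.
Proof. by move=> df dg; apply/funext => x; rewrite /partial (deriveD (df x) (dg x)). Qed.

Lemma smbD n f g : smooth_bounded_upto n f -> smooth_bounded_upto n g -> smooth_bounded_upto n (fun x => f x + g x).
Proof.
elim: n f g => [|n IH] f g.
  by move=> [cf bf _] [cg bg _]; split => //; [exact: contD2|exact: bdd2D].
move=> /smbE[cf bf df sf] /smbE[cg bg dg sg]; apply/smbE; split.
- exact: contD2.
- exact: bdd2D.
- by move=> j y; exact: (derivableD (df j y) (dg j y)).
- by move=> j; rewrite (partialD (df j) (dg j)); apply: IH; [exact: sf|exact: sg].
Qed.

Lemma smbM n f g : smooth_bounded_upto n f -> smooth_bounded_upto n g -> smooth_bounded_upto n (fun x => f x * g x).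
Proof.
elim: n f g => [|n IH] f g.
  by move=> [cf bf _] [cg bg _]; split => //; [exact: contM2|exact: bdd2M].
move=> sf sg; have /smbE[cf bf df sf'] := sf; have /smbE[cg bg dg sg'] := sg; apply/smbE; split.
- exact: contM2.
- exact: bdd2M.
- by move=> j y; exact: (derivableM (df j y) (dg j y)).
- move=> j; rewrite (_ : partial j _ = fun y => partial j f y * g y + f y * partial j g y).
    apply: smbD; apply: IH; [exact: sf'|exact: smbS|exact: smbS|exact: sg'].
  by apply/funext => y; exact: partialM (df j y) (dg j y).
Qed.

Lemma partials_rcons s j f : partials (rcons s j) f = partials s (partial j f).
Proof. by rewrite /partials foldr_rcons. Qed.

Lemma smbP f : (forall n, smooth_bounded_upto n f) <-> smooth f /\ forall s, bdd2 (partials s f).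
Proof.
split=> [h|[sf bf] n]; last first.
  suff H s : smooth_bounded_upto n (partials s f) by exact: (H [::]).
  elim: n s => [|n IH] s; first by split=> //; exact: smooth_cont.
  apply/smbE; split; [exact: smooth_cont|exact: bf| |].
    by move=> j y; exact: smooth_derivable.
  by move=> j; exact: (IH (j :: s)).
have H s : forall n, smooth_bounded_upto n (partials s f).
  elim/last_ind: s f h => [|s j IH] f h; first exact: h.
  by rewrite partials_rcons; apply: IH => n; have /smbE[_ _ _] := h n.+1; apply.
split=> [n s _|s]; last by have [] := H s 0%N.
have /smbE[c1 _ d1 _] := H s 1%N; split; first exact: c1.
by move=> _ j y; exact: d1.
Qed.

Lemma smooth_partial j f : smooth f -> smooth (partial j f).
Proof.
move=> sf n s hs; rewrite -partials_rcons; split; first exact: smooth_cont.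
by move=> _ i y; exact: smooth_derivable.
Qed.

(* Decay rates are quantified over families of functions, so that the constants
   do not depend on the velocity. *)
Definition smooth_family F := (forall f, F f -> smooth f) /\
  forall s, exists B : R, forall f, F f -> forall y, `|partials s f y| <= B.

Definition derived_family s F g := exists2 f, F f & g = partials s f.

Definition decay_rate r F := exists2 C : R, 0 <= C & forall f, F f -> forall y, `|f y| <= C * expR (- (r * enorm y)).

Lemma goodfam_d j F : smooth_family F -> smooth_family (derived_family [:: j] F).
Proof.
move=> [sF bF]; split=> [g [f Ff ->]|s]; first exact/smooth_partial/sF.
have [B hB] := bF (rcons s j); exists B => g [f Ff ->] y.
by rewrite /= -partials_rcons; exact: hB.
Qed.

Lemma line_mvt j f (y : R * R) (h : R) : 0 < h -> (forall y, derivable f y (evec R j)) ->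
  exists2 z, (exists2 t, 0 <= t <= h & z = y + t *: evec R j) &
    f (y + h *: evec R j) - f y = h * partial j f z.
Proof.
move=> h0; move: j; apply: ord2P => df.
- have d1 (t : R) : is_derive t 1 (fun t => f (t, y.2)) (partial ord0 f (t, y.2)).
    by rewrite partial0E; apply: der1; have := df (t, y.2); rewrite derivable0E.
  have dd (x : R) : derivable (fun t => f (t, y.2)) x 1 by case: (d1 x).
  have yh : y.1 < y.1 + h by rewrite ltrDl.
  have [c + cE] := @MVT R _ _ _ _ yh (fun x _ => d1 x) (continuous_subspaceT (derivable_cont dd)).
  rewrite in_itv/= => /andP[c1 c2]; exists (c, y.2).
    exists (c - y.1); first by apply/andP; split; lra.
    by rewrite /evec eqxx; case: (y) => /= a b; congr (_, _); rewrite /= /GRing.scale/= ?mulr1 ?mulr0 ?addr0// addrC subrK.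
  move: cE; rewrite [y.1 + h]addrC addrK [_ * h]mulrC => <-; congr (f _ - f _); last by case: (y).
  by rewrite /evec eqxx; case: (y) => /= a b; congr (_, _); rewrite /= /GRing.scale/= ?mulr1 ?mulr0 ?addr0// addrC.
- have d1 (t : R) : is_derive t 1 (fun t => f (y.1, t)) (partial ord_max f (y.1, t)).
    by rewrite partial1E; apply: der1; have := df (y.1, t); rewrite derivable1E.
  have dd (x : R) : derivable (fun t => f (y.1, t)) x 1 by case: (d1 x).
  have yh : y.2 < y.2 + h by rewrite ltrDl.
  have [c + cE] := @MVT R _ _ _ _ yh (fun x _ => d1 x) (continuous_subspaceT (derivable_cont dd)).
  rewrite in_itv/= => /andP[c1 c2]; exists (y.1, c).
    exists (c - y.2); first by apply/andP; split; lra.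
    by rewrite /evec /=; case: (y) => /= a b; congr (_, _); rewrite /= /GRing.scale/= ?mulr1 ?mulr0 ?addr0// addrC subrK.
  move: cE; rewrite [y.2 + h]addrC addrK [_ * h]mulrC => <-; congr (f _ - f _); last by case: (y).
  by rewrite /evec /=; case: (y) => /= a b; congr (_, _); rewrite /= /GRing.scale/= ?mulr1 ?mulr0 ?addr0// addrC.
Qed.

Lemma enorm_evec j : enorm (evec R j) = 1.
Proof. by rewrite /enorm /dotp /evec; case: ifP => _ /=; rewrite !mulr0 mulr1 ?addr0 ?add0r sqrtr1. Qed.

Lemma enormZ (t : R) (x : R * R) : enorm (t *: x) = `|t| * enorm x.
Proof.
rewrite /enorm /dotp/= /GRing.scale/= -sqrtr_sqr -sqrtrM ?sqr_ge0//; congr (Num.sqrt _); ring.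
Qed.

Lemma rate_shift r C (f : R * R -> R) (y v : R * R) : 0 <= r -> 0 <= C -> enorm v <= 1 ->
  (forall y, `|f y| <= C * expR (- (r * enorm y))) ->
  `|f (y + v)| <= C * expR r * expR (- (r * enorm y)).
Proof.
move=> r0 C0 v1 fE; apply: (le_trans (fE _)); rewrite -mulrA -expRD ler_wpM2l// ler_expR.
have : enorm y <= enorm (y + v) + enorm v by rewrite -{1}(addrK v y) enormB.
by move=> /(ler_wpM2l r0); move: (ler_wpM2l r0 v1); rewrite !mulrDr; lra.
Qed.

Lemma rate_le r r' F : r' <= r -> decay_rate r F -> decay_rate r' F.
Proof.
move=> rr [C C0 hC]; exists C => // f Ff y; apply: (le_trans (hC f Ff y)).
by rewrite ler_wpM2l// ler_expR lerN2 ler_wpM2r// enorm_ge0.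
Qed.

(** If f decays at rate r and f'' at rate s^2 r, Landau's inequality gives f' the mean rate (1 +
    s^2) r / 2. Started at 0, where f' is merely bounded, the iteration increases to its fixed point
    1. *)
Fixpoint sq (n : nat) : R := if n is n'.+1 then (1 + sq n' ^+ 2) / 2 else 0.

Lemma sq_bd n : 0 <= sq n <= 1.
Proof. by elim: n => [|n /andP[a b]] /=; [rewrite lexx ler01|apply/andP; split; nra]. Qed.

(** The defect d = 1 - s follows d -> d - d^2 / 2 and hence decays like 2 / n. *)
Lemma sq_cvg n : 1 - sq n <= 2 / n.+2%:R.
Proof.
elim: n => [|n IH] /=; first by rewrite subr0 divff.
have /andP[a b] := sq_bd n.
have n0 : (0 : R) < n.+2%:R by [].
have n1 : (0 : R) < n.+3%:R by [].
rewrite ler_pdivlMr//; move: IH; rewrite ler_pdivlMr// => IH.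
have -> : (n.+3%:R : R) = n.+2%:R + 1 by rewrite -natr1.
move: (sq n) (n.+2%:R : R) a b n0 IH => s N a b n0 IH.
have [d dE] : exists d, d = 1 - s by exists (1 - s).
have -> : s = 1 - d by rewrite dE; ring.
rewrite -dE in IH; have d0 : 0 <= d by lra.
have d1 : d <= 1 by lra.
nra.
Qed.

(** The induction hypothesis is used twice, on [F] for the first derivative and then on the derived
    family for the second, which gives f'' the rate s^2 r. Then f'(y) is compared with a difference
    quotient of step h: |f'| is at most a multiple of sup|f| / h + h sup|f''| near y, with h
    exponentially small in |y|. *)
Lemma landau_step n F r j : 0 <= r -> smooth_family F -> decay_rate r F -> decay_rate (sq n * r) (derived_family [:: j] F).
Proof.
elim: n F r => [|n IH] F r r0 gF rF.
  have [sF bF] := gF; have [B hB] := bF [:: j]; exists `|B| => // g [f Ff ->] y.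
  by rewrite /= !mul0r oppr0 expR0 mulr1; apply: le_trans (ler_norm _); exact: hB.
have /andP[s0 s1] := sq_bd n.
have r1F := IH F r r0 gF rF.
have r2F := IH _ (sq n * r) (mulr_ge0 s0 r0) (goodfam_d j gF) r1F.
have [C C0 hC] := rF; have [C2 C20 hC2] := r2F.
have [sF bF] := gF.
set s := sq n in s0 s1 r1F r2F hC2.
(* With h = e^{-k|y|} this [k] balances the two errors: r - k = s^2 r + k = (1 + s^2) r / 2. *)
pose k := (1 - s ^+ 2) * r / 2.
have k0 : 0 <= k by rewrite /k; apply: mulr_ge0; [apply: mulr_ge0; [nra|]|rewrite invr_ge0].
have s2r0 : 0 <= s * (s * r) by rewrite !mulr_ge0.
exists (2 * C * expR r + C2 * expR (s * (s * r))).
  by rewrite addr_ge0// !mulr_ge0// expR_ge0.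
move=> g [f Ff ->] y /=.
have sf := sF f Ff.
have df x : derivable f x (evec R j) by exact: (@smooth_derivable _ f [::]).
have ddf x : derivable (partial j f) x (evec R j) by exact: (@smooth_derivable _ f [:: j]).
pose h := expR (- (k * enorm y)).
have h0 : 0 < h by exact: expR_gt0.
have h1 : h <= 1 by rewrite /h expR_le1 oppr_le0 mulr_ge0// enorm_ge0.
have [z [t /andP[t0 th] zE] fz] := line_mvt y h0 df.
have sh (v : R) : 0 <= v <= h -> enorm (v *: evec R j) <= 1.
  by move=> /andP[v0 vh]; rewrite enormZ enorm_evec mulr1 ger0_norm//; lra.
have b1 : `|f (y + h *: evec R j)| <= C * expR r * expR (- (r * enorm y)).
  by apply: rate_shift => //; [apply: sh; rewrite (ltW h0) lexx|exact: hC].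
have b2 : `|f y| <= C * expR r * expR (- (r * enorm y)).
  apply: (le_trans (hC f Ff y)); rewrite ler_wpM2r ?expR_ge0// ler_peMr//.
  by rewrite -[X in X <= _]expR0 ler_expR.
have pE : partial j f z = h^-1 * (f (y + h *: evec R j) - f y).
  by rewrite fz mulrA mulVf ?mul1r// gt_eqF.
have b3 : `|partial j f z| <= h^-1 * (2 * C * expR r * expR (- (r * enorm y))).
  rewrite pE normrM ger0_norm ?invr_ge0 ?(ltW h0)// ler_wpM2l ?invr_ge0 ?(ltW h0)//.
  apply: (le_trans (ler_normB _ _)); move: b1 b2; lra.
have b4 : `|partial j f z - partial j f y| <= h * (C2 * expR (s * (s * r)) * expR (- (s * (s * r) * enorm y))).
  have [tz|tp] := eqVneq t 0.
    rewrite zE tz scale0r addr0 subrr normr0 mulr_ge0 ?(ltW h0)//.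
    by rewrite !mulr_ge0 ?expR_ge0.
  have tp' : 0 < t by rewrite lt_neqAle eq_sym tp.
  have [z' [t' /andP[t'0 t't] z'E] fz'] := line_mvt y tp' ddf.
  rewrite zE fz' normrM ger0_norm//; apply: ler_pM => //.
  rewrite z'E; apply: (@rate_shift _ _ (partial j (partial j f))) => //.
    by apply: sh; rewrite t'0/= (le_trans t't).
  by move=> x; apply: hC2; exists (partial j f) => //; exists f.
apply: (@le_trans _ _ (`|partial j f z| + `|partial j f z - partial j f y|)).
  by rewrite -{1}(subrK (partial j f z) (partial j f y)) addrC distrC; exact: ler_normD.
rewrite mulrDl; apply: lerD.
  apply: (le_trans b3); rewrite mulrCA -[h^-1]expRN opprK -expRD ler_wpM2l ?mulr_ge0 ?expR_ge0//.
  rewrite ler_expR -/s /k (_ : _ - _ = - ((1 + s ^+ 2) / 2 * r * enorm y)) //; by field.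
apply: (le_trans b4); rewrite mulrCA -expRD ler_wpM2l ?mulr_ge0 ?expR_ge0//.
rewrite ler_expR -/s /k (_ : _ - _ = - ((1 + s ^+ 2) / 2 * r * enorm y)) //; by field.
Qed.

Lemma goodfam_ds s F : smooth_family F -> smooth_family (derived_family s F).
Proof.
move=> gF; have [sF bF] := gF; split.
  move=> g [f Ff ->]; move: (sF f Ff) => sf; elim: s => [|j s IH]; [exact: sf|exact/smooth_partial/IH].
move=> s'; have [B hB] := bF (s' ++ s); exists B => g [f Ff ->] y.
by have := hB f Ff y; rewrite /partials foldr_cat.
Qed.

(** Each derivative costs an arbitrarily small part of the rate, so any r' < r is reached by
    interposing a rate [q] at every step. For r' <= 0 boundedness is enough. *)
Lemma landau_rate F r r' s : 0 <= r -> smooth_family F -> decay_rate r F -> r' < r -> decay_rate r' (derived_family s F).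
Proof.
move=> r0 gF rF; elim: s r' => [|j s IH] r' rr.
  by have [C C0 hC] := rate_le (ltW rr) rF; exists C => // g [f Ff ->]; exact: hC.
have [rneg|rpos] := leP r' 0.
  have [B hB] := gF.2 (j :: s); exists `|B| => // g [f Ff ->] y.
  apply: (le_trans (hB f Ff y)); apply: (le_trans (ler_norm _)); rewrite ler_peMr//.
  by rewrite -[X in X <= _]expR0 ler_expR oppr_ge0 mulr_le0_ge0// enorm_ge0.
have [q q1 q2] : exists2 q, r' < q & q < r by exists ((r' + r) / 2); lra.
have q0 : 0 < q by lra.
have [n hn] : exists n : nat, 2 / n.+2%:R < 1 - r' / q.
  have d0 : 0 < 1 - r' / q by rewrite subr_gt0 ltr_pdivrMr// mul1r.
  have [n] := @ltr_add_invr R 0 ((1 - r' / q) / 2) (ltac:(by rewrite divr_gt0)).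
  rewrite add0r => hn; exists n.
  apply: (@le_lt_trans _ _ (2 * n.+1%:R^-1)); last first.
    by move: hn; move: (_^-1) (_ / q) => A1 A2; lra.
  by rewrite ler_wpM2l// lef_pV2 ?posrE// ler_nat.
have [C C0 hC] := @landau_step n _ q j (ltW q0) (goodfam_ds s gF) (IH q q2).
have le : r' <= sq n * q.
  rewrite -ler_pdivrMr//; move: (sq_cvg n) hn; move: (2 / _) (sq n) (r' / q); clear; move=> *; lra.
have [C' C'0 hC'] := rate_le le (ex_intro2 _ _ C C0 hC).
exists C' => // g [f Ff ->] y; apply: hC'; exists (partials s f) => //; by exists f.
Qed.
End landau.

(** * Uniform bounds and decay of the profiles *)

Section profiles.
Variable R : realType.
Implicit Types (u v : R * R -> R).

Lemma sqmodE (f : R * R -> R[i]) y : sqmod f y = reF f y * reF f y + imF f y * imF f y.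
Proof.
rewrite /sqmod /reF /imF; case: (f y) => a b /=.
by rewrite sqr_sqrtr ?addr_ge0 ?sqr_ge0// !expr2.
Qed.

Lemma sobolev_sq_ge0 k u : (0 <= sobolev_sq k u)%E.
Proof.
apply: le_ereal_inf_tmp => _ [g _ ->].
apply: sume_ge0 => i _; apply: sume_ge0 => j _.
by apply: integral_ge0 => x _; rewrite lee_fin sqr_ge0.
Qed.

Lemma sqrte_le (x : \bar R) (r : R) : (0 <= x)%E -> 0 <= r -> (x `^ 2^-1 <= r%:E)%E -> (x <= (r ^+ 2)%:E)%E.
Proof.
case: x => [x| |] //=.
  rewrite !lee_fin => x0 r0; rewrite powR12_sqrt// => h.
  by rewrite -[x]sqr_sqrtr// ler_pXn2r// ?nnegrE ?sqrtr_ge0.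
by move=> _ _; rewrite invr_eq0 pnatr_eq0/= leNgt ltry.
Qed.

Lemma sobolevC_le k (f : R * R -> R[i]) (r : R) : 0 <= r -> (sobolevC k f <= r%:E)%E ->
  (sobolev_sq k (reF f) <= (r ^+ 2)%:E)%E /\ (sobolev_sq k (imF f) <= (r ^+ 2)%:E)%E.
Proof.
move=> r0 h.
have h1 := sobolev_sq_ge0 k (reF f); have h2 := sobolev_sq_ge0 k (imF f).
have := sqrte_le (adde_ge0 h1 h2) r0 h => h3.
by split; apply: le_trans h3; [exact: leeDl|exact: leeDr].
Qed.

Lemma hinf_smb u n : in_Hinfty u -> smooth_bounded_upto n u.
Proof. by move=> hu; apply/smbP: n; split; [exact: hu.1|move=> s; exact: hinf_bounded]. Qed.

(** The Sobolev inequality turns the H^2 closeness into closeness in the sup norm, which carries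
    bounds on [Q] over to all small [c]. *)
Lemma profiles_unif (cs : R) (Q : R * R -> R) U N V : 0 < cs < 1 -> nls_soliton Q ->
  solitary_profiles cs Q U N V ->
  exists ct R0 M : R, [/\ 0 < ct < cs, ct <= 1 / 10, 0 <= R0, 0 <= M &
   forall c, enorm c < ct -> forall y, [/\ `|reF (U c) y| <= M, `|imF (U c) y| <= M, `|N c y| <= M &
    (R0 <= enorm y -> `|N c y| <= 1 / 4)]].
Proof.
move=> /andP[cs0 cs1] [_ CQ _ _ _] [hreg hU hN hV [C C0 hC]].
have cQ : continuous Q by have [] := CQ [::] isT.
have [K K0 hK] := sob_sup R.
have KC0 : 0 < K * C by exact: mulr_gt0.
have close c : enorm c < cs -> forall y, [/\ `|reF (U c) y - Q y| <= K * C * enorm c ^+ 2,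
    `|imF (U c) y| <= K * C * enorm c ^+ 2 & `|N c y + Q y ^+ 2| <= K * C * enorm c ^+ 2].
  move=> hc y; have [h1 h2 _] := hC c hc.
  have [r1 r2 r3 _ _] := hreg c hc.
  have r0 : 0 <= C * enorm c ^+ 2 by rewrite mulr_ge0 ?sqr_ge0// ltW.
  have [h3 h4] := sobolevC_le r0 h1.
  have h5 := sqrte_le (sobolev_sq_ge0 _ _) r0 h2.
  have E1 : reF (fun y => U c y - (Q y)%:C) = fun y => reF (U c) y - Q y.
    by apply/funext => x; rewrite /reF; case: (U c x).
  have E2 : imF (fun y => U c y - (Q y)%:C) = imF (U c).
    by apply/funext => x; rewrite /imF; case: (U c x) => a b /=; rewrite oppr0 addr0.
  rewrite E1 in h3; rewrite E2 in h4; rewrite -!mulrA; split.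
  - apply: (hK _ _ r0 _ h3 y) => x.
    apply: (@continuousB _ _ _ (reF (U c)) Q); last exact: cQ.
    exact: (@smooth_cont _ _ [::] r1.1).
  - exact: (hK _ _ r0 (@smooth_cont _ _ [::] r2.1) h4 y).
  - apply: (hK _ _ r0 _ h5 y); apply: contD2; first exact: (@smooth_cont _ _ [::] r3.1).
    by rewrite (_ : (fun x => _) = fun x => Q x * Q x)//; exact: contM2.
have e0 : enorm ((0, 0) : R * R) = 0 by rewrite /enorm /dotp/= !mulr0 addr0 sqrtr0.
have h0 : enorm ((0, 0) : R * R) < cs by rewrite e0.
(* At c = 0 the closeness estimate has right side 0, so [Q] is the real part of a profile, hence in
   every H^k: bounded and vanishing at infinity. *)
have QE : Q = reF (U (0, 0)).
  apply/funext => y; have [h _ _] := close _ h0 y.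
  by move: h; rewrite e0 expr0n/= mulr0 normr_le0 subr_eq0 => /eqP.
have [rU _ _ _ _] := hreg _ h0; rewrite -QE in rU.
have [B hB] := hinf_bounded [::] rU; rewrite /= in hB.
have q0 : (0 : R) < 1 / 4 by lra.
have [R0 hR0] := hinf_vanish rU q0.
(* The first entry keeps [ct] below [cs], the second makes A(xi) comparable to |xi|^2, and the third
   bounds the sup distance to the soliton by 1/8. Where Q <= 1/4 this gives |N| <= 1/8 + 1/16 <=
   1/4. *)
pose ct := Num.min (Num.min (cs / 2) (1 / 10)) (1 / (8 * (K * C + 1))).
have KC1 : 0 < 8 * (K * C + 1) by rewrite mulr_gt0// addr_gt0.
have ct0 : 0 < ct by rewrite !lt_min !divr_gt0.
have [t1 t2 t3] : [/\ ct <= cs / 2, ct <= 1 / 10 & ct <= 1 / (8 * (K * C + 1))].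
  by rewrite /ct !ge_min !lexx !orbT.
clearbody ct.
have ctcs : ct < cs by move: t1 cs0; clear; lra.
have small c : enorm c < ct -> K * C * enorm c ^+ 2 <= 1 / 8.
  move=> hc; have c0 := enorm_ge0 c.
  have cc : enorm c ^+ 2 <= ct.
    by rewrite expr2; apply: (@le_trans _ _ (enorm c * 1)); [rewrite ler_wpM2l//; move: hc t2; lra|rewrite mulr1 ltW].
  apply: (@le_trans _ _ (K * C * (1 / (8 * (K * C + 1))))).
    by rewrite ler_wpM2l ?(ltW KC0)// (le_trans cc).
  rewrite mul1r ler_pdivrMr//; move: KC0; move: (K * C) => k; lra.
exists ct, (Num.max R0 0), (`|B| + 1 + B ^+ 2); split => //.
- by rewrite ct0 ctcs.
- by rewrite le_max lexx orbT.
- by rewrite !addr_ge0// sqr_ge0.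
move=> c hc y; have [a1 a2 a3] := close c (lt_trans hc ctcs) y.
have s8 := small c hc.
have QB : `|Q y| <= `|B| by apply: le_trans (hB y) (ler_norm _).
have Q2B : Q y ^+ 2 <= B ^+ 2.
  by rewrite -(real_normK (num_real (Q y))) -(real_normK (num_real B)) ler_pXn2r ?nnegrE.
have Q20 := sqr_ge0 (Q y); have B20 := sqr_ge0 B; have B0 := normr_ge0 B.
split.
- apply: (@le_trans _ _ (`|reF (U c) y - Q y| + `|Q y|)).
    by rewrite -{1}(subrK (Q y) (reF (U c) y)) ler_normD.
  move: a1 s8 QB B20; clear; lra.
- move: a2 s8 B0 B20; clear; lra.
- apply: (@le_trans _ _ (`|N c y + Q y ^+ 2| + Q y ^+ 2)).
    rewrite -{1}(addrK (Q y ^+ 2) (N c y)); apply: (le_trans (ler_normB _ _)).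
    by rewrite [`|Q y ^+ 2|]ger0_norm.
  move: a3 s8 Q2B B0; clear; lra.
- rewrite ge_max => /andP[/hR0 Q4 _].
  have Q16 : Q y ^+ 2 <= 1 / 16.
    rewrite -(real_normK (num_real (Q y))) expr2; have := normr_ge0 (Q y); nra.
  apply: (@le_trans _ _ (`|N c y + Q y ^+ 2| + Q y ^+ 2)).
    rewrite -{1}(addrK (Q y ^+ 2) (N c y)); apply: (le_trans (ler_normB _ _)).
    by rewrite [`|Q y ^+ 2|]ger0_norm.
  move: a3 s8 Q16; clear; lra.
Qed.

Lemma lap_sq u y : smooth u -> laplacian (fun x => u x * u x) y =
  2 * (partial ord0 u y ^+ 2 + partial ord_max u y ^+ 2) + 2 * (u y * laplacian u y).
Proof.
move=> su.
have du j x : derivable u x (evec R j) by exact: (@smooth_derivable _ u [::]).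
have ddu i j x : derivable (partial i u) x (evec R j) by exact: (@smooth_derivable _ u [:: i]).
have E j : partial j (fun x => u x * u x) = fun x => partial j u x * u x + u x * partial j u x.
  by apply/funext => x; exact: partialM (du j x) (du j x).
have E2 j : partial j (partial j (fun x => u x * u x)) y = 2 * partial j u y ^+ 2 + 2 * (u y * partial j (partial j u) y).
  rewrite E partialD; last 2 first.
  - by move=> x; exact: (derivableM (ddu j j x) (du j x)).
  - by move=> x; exact: (derivableM (du j x) (ddu j j x)).
  rewrite (partialM (ddu j j y) (du j y)) (partialM (du j y) (ddu j j y)).
  move: (partial j u y) (partial j (partial j u) y) (u y); clear => *; ring.
rewrite /laplacian /pderiv/= !E2.
move: (partial ord0 u y) (partial ord_max u y) (partial ord0 (partial ord0 u) y) (partial ord_max (partial ord_max u) y) (u y).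
by clear => *; ring.
Qed.

Lemma lap_D u v y : smooth u -> smooth v -> laplacian (fun x => u x + v x) y = laplacian u y + laplacian v y.
Proof.
move=> su sv.
have E j : partial j (partial j (fun x => u x + v x)) y = partial j (partial j u) y + partial j (partial j v) y.
  rewrite partialD; [|by move=> x; exact: (@smooth_derivable _ _ [::])..].
  by rewrite partialD//; move=> x; exact: (@smooth_derivable _ _ [:: j]).
rewrite /laplacian /pderiv/= !E; exact: addrACA.
Qed.

Lemma complex_eqs (a b x y n : R) : a +i* b = (x +i* y) + n%:C * (x +i* y) ->
  a = (1 + n) * x /\ b = (1 + n) * y.
Proof. by case=> -> ->; split; ring. Qed.

Lemma profile_lap (cs : R) (Q : R * R -> R) U N V c y : solitary_profiles cs Q U N V -> enorm c < cs ->
  laplacian (reF (U c)) y = (1 + N c y) * reF (U c) y /\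
  laplacian (imF (U c)) y = (1 + N c y) * imF (U c) y.
Proof.
move=> [_ hU _ _ _] hc; have := hU c hc y; rewrite /laplacianC => h.
apply: complex_eqs; rewrite h /reF /imF; by case: (U c y).
Qed.

(** Outside the ball N >= -1/4, so Delta f >= (3/2) f once the squared gradients are dropped, and
    (6/5)^2 = 36/25 < 3/2. A rate above 1 leaves room for the loss in [landau_rate], so that all
    derivatives end up with rate 1. *)
Lemma profiles_decay (cs : R) (Q : R * R -> R) U N V ct R0 M :
  solitary_profiles cs Q U N V -> ct < cs -> 0 <= R0 -> 0 <= M ->
  (forall c, enorm c < ct -> forall y, [/\ `|reF (U c) y| <= M, `|imF (U c) y| <= M, `|N c y| <= M &
    (R0 <= enorm y -> `|N c y| <= 1 / 4)]) ->
  exists2 C : R, 0 <= C & forall c, enorm c < ct -> forall y,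
    sqmod (U c) y <= C * expR (- (6 / 5 * enorm y)).
Proof.
move=> hP ctcs R00 M0 hM.
have [hreg _ _ _ _] := hP.
exists (2 * M ^+ 2 * expR (6 / 5 * R0)); first by rewrite !mulr_ge0 ?expR_ge0.
move=> c hc y; have hc' := lt_trans hc ctcs.
have [hu hv _ _ _] := hreg c hc'.
set u := reF (U c) in hu; set v := imF (U c) in hv.
pose f x := u x * u x + v x * v x.
have sf n : smooth_bounded_upto n f by apply: smbD; apply: smbM; exact: hinf_smb.
have /smbP[smf _] := sf.
have fE x : sqmod (U c) x = f x by rewrite sqmodE.
have fM x : f x <= 2 * M ^+ 2.
  have [a1 a2 _ _] := hM c hc x.
  have : `|u x| ^+ 2 <= M ^+ 2 by rewrite ler_pXn2r// nnegrE.
  have : `|v x| ^+ 2 <= M ^+ 2 by rewrite ler_pXn2r// nnegrE.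
  by rewrite !real_normK ?num_real// /f -!expr2; lra.
rewrite fE.
have -> : 2 * M ^+ 2 * expR (6 / 5 * R0) * expR (- (6 / 5 * enorm y)) =
   2 * M ^+ 2 * expR (- (6 / 5 * (enorm y - R0))).
  by rewrite -mulrA -expRD; congr (_ * expR _); ring.
apply: (@barrier _ f).
- exact: smf.
- by [].
- by [].
- by rewrite mulr_ge0 ?sqr_ge0.
- exact: fM.
- move=> e e0.
  have m0 : 0 < Num.min 1 (e / 2) by rewrite lt_min ltr01 divr_gt0.
  have [r1 h1] := hinf_vanish hu m0; have [r2 h2] := hinf_vanish hv m0.
  exists (Num.max r1 r2) => x; rewrite ge_max => /andP[/h1 + /h2].
  rewrite !le_min /f -!expr2 -(real_normK (num_real (u x))) -(real_normK (num_real (v x))).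
  move=> /andP[a1 a2] /andP[b1 b2]; have := normr_ge0 (u x); have := normr_ge0 (v x); nra.
- move=> x xR; have [_ _ _ /(_ xR) N4] := hM c hc x.
  have [l1 l2] := profile_lap x hP hc'.
  have su2 n : smooth_bounded_upto n (fun x => u x * u x) by apply: smbM; exact: hinf_smb.
  have sv2 n : smooth_bounded_upto n (fun x => v x * v x) by apply: smbM; exact: hinf_smb.
  have /smbP[su2' _] := su2; have /smbP[sv2' _] := sv2.
  rewrite /f lap_D// !lap_sq; [|exact: hv.1|exact: hu.1].
  rewrite l1 l2 -/u -/v.
  have := sqr_ge0 (partial ord0 u x); have := sqr_ge0 (partial ord_max u x).
  have := sqr_ge0 (partial ord0 v x); have := sqr_ge0 (partial ord_max v x).
  have := sqr_ge0 (u x); have := sqr_ge0 (v x).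
  move: N4; rewrite ler_norml => /andP[n1 _]; move: n1.
  move: (partial _ _ _) (partial _ _ _) (partial _ _ _) (partial _ _ _) (u x) (v x) (N c x).
  clear => p1 p2 p3 p4 a b n n1 b2 a2 *.
  (* What remains is linear: (6/5)^2 <= 2 (1 - 1/4). *)
  have : 0 <= (n + 1 / 4) * b ^+ 2 by rewrite mulr_ge0//; lra.
  have : 0 <= (n + 1 / 4) * a ^+ 2 by rewrite mulr_ge0//; lra.
  lra.
Qed.
End profiles.

(** * The Fourier transform *)

Section leb2sf.
Variable R : realType.
Local Notation leb := (@lebesgue_measure R).

Lemma leb2_sigma_finite : sigma_finite setT (leb2 R).
Proof.
have /sigma_finiteP[F [TF ndF Foo]] := sigma_finiteT leb.
exists (fun n => F n `*` F n).
  rewrite -setXTT TF predeqE => -[x y]; split.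
    move=> [/= [n _ Fnx] [k _ Gky]]; exists (maxn n k) => //; split.
    - by move: x Fnx; exact/subsetPset/ndF/leq_maxl.
    - by move: y Gky; exact/subsetPset/ndF/leq_maxr.
  by move=> [n _ []/= ? ?]; split; exists n.
move=> k; have [? ?] := Foo k.
split; first exact: measurableX.
by rewrite product_measure1E// lte_mul_pinfty// ge0_fin_numE.
Qed.

(* A copy of the plane measure carrying the sigma-finite structure that the
   library requires for Fubini over pairs of plane points. *)
Definition leb2f : set (measurableTypeR R * measurableTypeR R)%type -> \bar R := leb2 R.
Let leb2m : {measure set (measurableTypeR R * measurableTypeR R)%type -> \bar R} := leb2 R.
HB.instance Definition _ := isMeasure.Build _ _ _ leb2f (@measure0 _ _ _ leb2m) (@measure_ge0 _ _ _ leb2m) (@measure_semi_sigma_additive _ _ _ leb2m).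
HB.instance Definition _ := Measure_isSigmaFinite.Build _ _ _ leb2f leb2_sigma_finite.

Definition leb2sf : {sigma_finite_measure set (measurableTypeR R * measurableTypeR R)%type -> \bar R} := leb2f.

Section fubini4.
Variables (F : (R * R) * (R * R) -> R) (g h : R * R -> R).
Hypotheses (mF : measurable_fun setT F) (ig : itg (leb2 R) g) (ih : itg (leb2 R) h).
Hypothesis FE : forall x y, `|F (x, y)| <= g x * h y.

Lemma fubini4 : \int[leb2 R]_x \int[leb2 R]_y F (x, y) = \int[leb2 R]_y \int[leb2 R]_x F (x, y).
Proof using All. exact: (@Rfubini _ _ _ _ _ leb2sf leb2sf F g h mF ig ih FE). Qed.

Lemma fubini4_itg12 : itg (leb2 R) (fun x => \int[leb2 R]_y F (x, y)).
Proof using All. exact: (@itg_Rint12 _ _ _ _ _ leb2sf leb2sf F g h mF ig ih FE). Qed.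
End fubini4.
End leb2sf.

(** * Real Fourier transforms and weighted bounds for products *)

Section fourier.
Variable R : realType.
Local Notation leb := (@lebesgue_measure R).
Implicit Types (u v w p q : R * R -> R).

Lemma cos_lip (a b : R) : `|cos a - cos b| <= `|a - b|.
Proof.
wlog ab : a b / a <= b.
  by move=> h; have [/h//|/ltW/h] := leP a b; rewrite distrC [X in _ <= X]distrC.
have [c _ E] := @MVT_segment R cos (fun x => - sin x) a b ab (fun x _ => is_derive_cos x) (continuous_subspaceT (@continuous_cos R)).
rewrite distrC E normrM normrN [`|a - b|]distrC ler_piMl//; exact: sin_max.
Qed.

Lemma sin_lip (a b : R) : `|sin a - sin b| <= `|a - b|.
Proof.
wlog ab : a b / a <= b.
  by move=> h; have [/h//|/ltW/h] := leP a b; rewrite distrC [X in _ <= X]distrC.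
have [c _ E] := @MVT_segment R sin (fun x => cos x) a b ab (fun x _ => is_derive_sin x) (continuous_subspaceT (@continuous_sin R)).
rewrite distrC E normrM [`|a - b|]distrC ler_piMl//; exact: cos_max.
Qed.

Lemma dotpDl (x y z : R * R) : dotp (x + y) z = dotp x z + dotp y z.
Proof. by rewrite /dotp /=; ring. Qed.

Lemma dotpDr (x y z : R * R) : dotp z (x + y) = dotp z x + dotp z y.
Proof. by rewrite /dotp /=; ring. Qed.

Lemma dotpNr (x z : R * R) : dotp z (- x) = - dotp z x.
Proof. by rewrite /dotp /=; ring. Qed.

Lemma dotpBr (x y z : R * R) : dotp z (x - y) = dotp z x - dotp z y.
Proof. by rewrite dotpDr dotpNr. Qed.

Lemma dotpBl (x y z : R * R) : dotp (x - y) z = dotp x z - dotp y z.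
Proof. by rewrite /dotp /=; ring. Qed.

Lemma dotp_meas2 : measurable_fun setT (fun z : (R * R) * (R * R) => dotp z.1 z.2).
Proof.
rewrite /dotp; apply: measurable_funD; apply: measurable_funM.
- by apply: (@measurableT_comp _ _ _ _ _ _ fst) => //; exact: measurable_fst.
- by apply: (@measurableT_comp _ _ _ _ _ _ fst) => //; exact: measurable_snd.
- by apply: (@measurableT_comp _ _ _ _ _ _ snd) => //; exact: measurable_fst.
- by apply: (@measurableT_comp _ _ _ _ _ _ snd) => //; exact: measurable_snd.
Qed.

Lemma dotp_meas (y : R * R) : measurable_fun setT (fun x : R * R => dotp x y).
Proof.
by rewrite /dotp; apply: measurable_funD; apply: measurable_funM.
Qed.

Lemma cos_meas : measurable_fun setT (@cos R).
Proof. by apply: continuous_measurable_fun; exact: continuous_cos. Qed.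

Lemma sin_meas : measurable_fun setT (@sin R).
Proof. by apply: continuous_measurable_fun; exact: continuous_sin. Qed.

Lemma itg_mul_bdd u v (B : R) : itg (leb2 R) u -> measurable_fun setT v -> (forall x, `|v x| <= B) ->
  itg (leb2 R) (fun x => u x * v x).
Proof.
move=> iu mv vB.
have h : itg (leb2 R) (fun x => `|u x| * B) by apply: itgZr; exact: itg_norm.
apply: itg2_le h => [|x]; first by apply: measurable_funM => //; exact: itg_meas iu.
by rewrite normrM ler_wpM2l.
Qed.

Lemma cosd_itg u (xi : R * R) : itg (leb2 R) u -> itg (leb2 R) (fun x => u x * cos (dotp x xi)).
Proof.
move=> iu; apply: (itg_mul_bdd iu (B := 1)) => [|x]; last exact: cos_max.
by apply: (measurableT_comp cos_meas); exact: dotp_meas.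
Qed.

Lemma sind_itg u (xi : R * R) : itg (leb2 R) u -> itg (leb2 R) (fun x => u x * sin (dotp x xi)).
Proof.
move=> iu; apply: (itg_mul_bdd iu (B := 1)) => [|x]; last exact: sin_max.
by apply: (measurableT_comp sin_meas); exact: dotp_meas.
Qed.

(* Fourier transforms are kept real: FC u - i FS u is the transform of u, and fa u
   is comparable to its modulus. *)
Definition FC u (xi : R * R) : R := \int[leb2 R]_x (u x * cos (dotp x xi)).

Definition FS u (xi : R * R) : R := \int[leb2 R]_x (u x * sin (dotp x xi)).

Definition fa u (xi : R * R) : R := `|FC u xi| + `|FS u xi|.

Lemma fa_ge0 u xi : 0 <= fa u xi. Proof. by rewrite addr_ge0. Qed.

Lemma FC_bound u xi : itg (leb2 R) u -> `|FC u xi| <= \int[leb2 R]_x `|u x|.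
Proof.
move=> iu; apply: (@Rint_bound _ _ _ (leb2 R)).
- exact: itg_meas (cosd_itg xi iu).
- exact: itg_norm.
- by move=> x; rewrite normrM ler_piMr// cos_max.
Qed.

Lemma FS_bound u xi : itg (leb2 R) u -> `|FS u xi| <= \int[leb2 R]_x `|u x|.
Proof.
move=> iu; apply: (@Rint_bound _ _ _ (leb2 R)).
- exact: itg_meas (sind_itg xi iu).
- exact: itg_norm.
- by move=> x; rewrite normrM ler_piMr// sin_max.
Qed.

Lemma lip_cont (f : R * R -> R) (L : R) : (forall x y, `|f x - f y| <= L * enorm (x - y)) -> continuous f.
Proof.
move=> fL x; apply/cvgrPdist_le => e e0.
have L1 : 0 < `|L| + 1 by rewrite ltr_pwDr.
have d0 : 0 < (`|L| + 1)^-1 * e / 2 by rewrite divr_gt0// mulr_gt0// invr_gt0.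
have hb := nbhsx_ballx x _ d0; near=> y.
apply: (le_trans (fL _ _)).
apply: (@le_trans _ _ ((`|L| + 1) * enorm (x - y))).
  rewrite ler_wpM2r ?enorm_ge0//; have := ler_norm L; lra.
rewrite -ler_pdivlMl//; apply: (le_trans (enorm_le_l1 _)).
have [h1 h2] : ball x ((`|L| + 1)^-1 * e / 2) y by near: y.
move: h1 h2; rewrite /ball/=; move: (`|x.1 - y.1|) (`|x.2 - y.2|) ((`|L| + 1)^-1 * e) => a b c.
clear => *; lra.
Unshelve. all: end_near. Qed.

Lemma FC_lip u : itg (leb2 R) u -> itg (leb2 R) (fun x => u x * enorm x) ->
  continuous (FC u) /\ continuous (FS u).
Proof.
move=> iu iux.
have in1 := itg_norm iux.
split; apply: (@lip_cont _ (\int[leb2 R]_x `|u x * enorm x|)) => xi eta.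
  rewrite /FC -(RintB (cosd_itg _ iu) (cosd_itg _ iu)) -(RintZr _ in1).
  apply: (@Rint_bound _ _ _ (leb2 R)).
  - exact: itg_meas (itgB (cosd_itg _ iu) (cosd_itg _ iu)).
  - exact: itgZr.
  - move=> x; rewrite -mulrBr !normrM -mulrA ler_wpM2l// (le_trans (cos_lip _ _))//.
    by rewrite -dotpBr (le_trans (dotp_le _ _))// ger0_norm// enorm_ge0.
rewrite /FS -(RintB (sind_itg _ iu) (sind_itg _ iu)) -(RintZr _ in1).
apply: (@Rint_bound _ _ _ (leb2 R)).
- exact: itg_meas (itgB (sind_itg _ iu) (sind_itg _ iu)).
- exact: itgZr.
- move=> x; rewrite -mulrBr !normrM -mulrA ler_wpM2l// (le_trans (sin_lip _ _))//.
  by rewrite -dotpBr (le_trans (dotp_le _ _))// ger0_norm// enorm_ge0.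
Qed.

Lemma fa_cont u : continuous (FC u) -> continuous (FS u) -> continuous (fa u).
Proof.
move=> cC cS; apply: contD2 => x.
  by apply: (@continuous_comp _ _ _ (FC u) Num.norm); [exact: cC|exact: norm_continuous].
by apply: (@continuous_comp _ _ _ (FS u) Num.norm); [exact: cS|exact: norm_continuous].
Qed.

(** Compared through fourth powers: om^{-8} <= om^{-5} <= 32 W^4 and 32 <= 3^4. Two spare powers of
    [om] thus always pay for integrability over the plane. *)
Lemma om2_W (x : R * R) : om x ^- 2 <= 3 * W x.
Proof.
have o1 := om_ge1 x; have o0 := om_gt0 x.
rewrite -(@ler_pXn2r _ 4)// ?nnegrE ?invr_ge0 ?exprn_ge0 ?(ltW o0)//; last by rewrite mulr_ge0// W_ge0.
rewrite exprVn -exprM exprMn; apply: (@le_trans _ _ (om x ^- 5)).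
  rewrite lef_pV2 ?posrE ?exprn_gt0//; exact: ler_weXn2l.
apply: (le_trans (W_om x)); rewrite ler_wpM2r ?exprn_ge0 ?W_ge0//.
by rewrite -natrX ler_nat.
Qed.

Section product.
Variables (u p q : R * R -> R) (B : R).
Hypotheses (iu : itg (leb2 R) u) (mp : measurable_fun setT p) (mq : measurable_fun setT q).
Hypothesis pqB : forall x, `|p x| + `|q x| <= B * W x.
Let g (z : (R * R) * (R * R)) := p z.2 * cos (dotp z.1 z.2) + q z.2 * sin (dotp z.1 z.2).

Lemma prod_g_meas : measurable_fun setT g.
Proof using mp mq.
rewrite /g; apply: measurable_funD; apply: measurable_funM.
- by apply: (measurableT_comp mp).
- by apply: (measurableT_comp cos_meas); exact: dotp_meas2.
- by apply: (measurableT_comp mq).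
- by apply: (measurableT_comp sin_meas); exact: dotp_meas2.
Qed.

Lemma prod_g_le x y : `|g (x, y)| <= `|p y| + `|q y|.
Proof using All.
rewrite /g/=; apply: (le_trans (ler_normD _ _)); rewrite !normrM lerD//.
  by rewrite ler_piMr// cos_max.
by rewrite ler_piMr// sin_max.
Qed.

Lemma prod_pq_itg : itg (leb2 R) (fun x => `|p x| + `|q x|).
Proof using All.
apply: itg2_le (itgZl B (@W_itg R)).
  by apply: measurable_funD; exact: measurableT_comp.
by move=> x; rewrite ger0_norm ?addr_ge0.
Qed.

Lemma prod_swap (k : R -> R) xi : measurable_fun setT k -> (forall t, `|k t| <= 1) ->
  \int[leb2 R]_x (((\int[leb2 R]_y g (x, y)) * u x) * k (dotp x xi)) =
  \int[leb2 R]_y (p y * (\int[leb2 R]_x (u x * (cos (dotp x y) * k (dotp x xi)))) +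
     q y * (\int[leb2 R]_x (u x * (sin (dotp x y) * k (dotp x xi))))).
Proof using All.
move=> mk k1.
pose F (z : (R * R) * (R * R)) := g z * (u z.1 * k (dotp z.1 xi)).
have mF : measurable_fun setT F.
  apply: measurable_funM; first exact: prod_g_meas.
  apply: measurable_funM; first by apply: (measurableT_comp (itg_meas iu)).
  apply: (measurableT_comp mk).
  by apply: (@measurableT_comp _ _ _ _ _ _ (fun x : R * R => dotp x xi)) => //; exact: dotp_meas.
have FE x y : `|F (x, y)| <= `|u x| * (`|p y| + `|q y|).
  rewrite /F/= normrM mulrC; apply: ler_pM => //; last exact: prod_g_le.
  by rewrite normrM ler_piMr.
have ig x : itg (leb2 R) (fun y => g (x, y)).
  apply: itg2_le (prod_g_le x) prod_pq_itg.
  by apply: (measurableT_comp prod_g_meas); exact: measurable_pair1.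
transitivity (\int[leb2 R]_x \int[leb2 R]_y F (x, y)).
  by apply: eq_Rint => x; rewrite -mulrA -RintZr.
rewrite (fubini4 mF (itg_norm iu) prod_pq_itg FE).
apply: eq_Rint => y; rewrite /F /g/=.
have b1 : itg (leb2 R) (fun x => u x * (cos (dotp x y) * k (dotp x xi))).
  apply: (itg_mul_bdd iu (B := 1)) => [|x].
    apply: measurable_funM; first by apply: (measurableT_comp cos_meas); exact: dotp_meas.
    by apply: (measurableT_comp mk); exact: dotp_meas.
  by rewrite normrM mulr_ile1// cos_max.
have b2 : itg (leb2 R) (fun x => u x * (sin (dotp x y) * k (dotp x xi))).
  apply: (itg_mul_bdd iu (B := 1)) => [|x].
    apply: measurable_funM; first by apply: (measurableT_comp sin_meas); exact: dotp_meas.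
    by apply: (measurableT_comp mk); exact: dotp_meas.
  by rewrite normrM mulr_ile1// sin_max.
rewrite -(RintZl _ b1) -(RintZl _ b2) -(RintD (itgZl _ b1) (itgZl _ b2)).
by apply: eq_Rint => x; ring.
Qed.

Hypotheses (cC : continuous (FC u)) (cS : continuous (FS u)).

(** The real part of the inverse transform of p - i q, without its normalising factor. *)
Definition synth (p q : R * R -> R) (x : R * R) : R :=
  \int[leb2 R]_y (p y * cos (dotp x y) + q y * sin (dotp x y)).

Lemma fa_shift_meas (v : R * R) : measurable_fun setT (fun y : R * R => fa u (y + v)).
Proof using All.
apply: continuous2_measurable => y; apply: (@continuous_comp _ _ _ (fun y : R * R => y + v) (fa u)); last exact: fa_cont.
by apply: cvgD; [exact: cvg_id|exact: cvg_cst].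
Qed.

Lemma fa_bound xi : fa u xi <= 2 * \int[leb2 R]_x `|u x|.
Proof using All. by rewrite mulr_natl mulr2n lerD ?FC_bound ?FS_bound. Qed.

Lemma fa_shift_itg (v : R * R) : itg (leb2 R) (fun y => (`|p y| + `|q y|) * fa u (y + v)).
Proof using All.
apply: (itg_mul_bdd prod_pq_itg (fa_shift_meas v) (B := 2 * \int[leb2 R]_x `|u x|)) => x.
by rewrite ger0_norm ?fa_ge0 ?fa_bound.
Qed.

Lemma FCD_shift (y xi : R * R) : \int[leb2 R]_x (u x * (cos (dotp x y) * cos (dotp x xi))) = (FC u (y + xi) + FC u (y - xi)) / 2.
Proof using All.
rewrite /FC -(RintD (cosd_itg _ iu) (cosd_itg _ iu)) -(RintZr _ (itgD (cosd_itg _ iu) (cosd_itg _ iu))).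
apply: eq_Rint => x; rewrite dotpBr dotpDr cosB cosD.
by move: (cos _) (sin _) (cos _) (sin _) => a b c d; field.
Qed.

Lemma FSD_shift (y xi : R * R) : \int[leb2 R]_x (u x * (sin (dotp x y) * cos (dotp x xi))) = (FS u (y + xi) + FS u (y - xi)) / 2.
Proof using All.
rewrite /FS -(RintD (sind_itg _ iu) (sind_itg _ iu)) -(RintZr _ (itgD (sind_itg _ iu) (sind_itg _ iu))).
apply: eq_Rint => x; rewrite dotpBr dotpDr sinD sinB.
by move: (cos _) (sin _) (cos _) (sin _) => a b c d; field.
Qed.

Lemma FSB_shift (y xi : R * R) : \int[leb2 R]_x (u x * (cos (dotp x y) * sin (dotp x xi))) = (FS u (y + xi) - FS u (y - xi)) / 2.
Proof using All.
rewrite /FS -(RintB (sind_itg _ iu) (sind_itg _ iu)) -(RintZr _ (itgB (sind_itg _ iu) (sind_itg _ iu))).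
apply: eq_Rint => x; rewrite dotpBr dotpDr sinD sinB.
by move: (cos _) (sin _) (cos _) (sin _) => a b c d; field.
Qed.

Lemma FCB_shift (y xi : R * R) : \int[leb2 R]_x (u x * (sin (dotp x y) * sin (dotp x xi))) = (FC u (y - xi) - FC u (y + xi)) / 2.
Proof using All.
rewrite /FC -(RintB (cosd_itg _ iu) (cosd_itg _ iu)) -(RintZr _ (itgB (cosd_itg _ iu) (cosd_itg _ iu))).
apply: eq_Rint => x; rewrite dotpBr dotpDr cosB cosD.
by move: (cos _) (sin _) (cos _) (sin _) => a b c d; field.
Qed.

(** The transform of a product is a convolution. In real form the product formulas for cos and sin
    produce the two translates of [fa u] by xi and by -xi, each with a factor 1/2 that the sum of
    the bounds for [FC] and [FS] cancels. *)
Lemma fa_synth_le (xi : R * R) : fa (fun x => synth p q x * u x) xi <=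
  \int[leb2 R]_y ((`|p y| + `|q y|) * fa u (y + xi)) + \int[leb2 R]_y ((`|p y| + `|q y|) * fa u (y - xi)).
Proof using All.
have i1 := fa_shift_itg xi; have i2 := fa_shift_itg (- xi).
have cm (v : R * R) : measurable_fun setT (fun y : R * R => FC u (y + v)).
  apply: continuous2_measurable => y; apply: (@continuous_comp _ _ _ (fun y : R * R => y + v) (FC u)); last exact: cC.
  by apply: cvgD; [exact: cvg_id|exact: cvg_cst].
have sm (v : R * R) : measurable_fun setT (fun y : R * R => FS u (y + v)).
  apply: continuous2_measurable => y; apply: (@continuous_comp _ _ _ (fun y : R * R => y + v) (FS u)); last exact: cS.
  by apply: cvgD; [exact: cvg_id|exact: cvg_cst].
have key (a b c d P Q A B' : R) : `|a| <= A -> `|b| <= B' -> `|c| <= A -> `|d| <= B' ->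
    `|P * ((a + b) / 2) + Q * ((c + d) / 2)| <= 2^-1 * ((`|P| + `|Q|) * A + (`|P| + `|Q|) * B').
  move=> ha hb hc hd; apply: (le_trans (ler_normD _ _)); rewrite !normrM [`|2^-1|]ger0_norm//.
  have h1 : `|P| * `|a + b| <= `|P| * (A + B') by rewrite ler_wpM2l// (le_trans (ler_normD _ _))// lerD.
  have h2 : `|Q| * `|c + d| <= `|Q| * (A + B') by rewrite ler_wpM2l// (le_trans (ler_normD _ _))// lerD.
  by move: (`|P|) (`|Q|) (`|a + b|) (`|c + d|) h1 h2 => *; lra.
have faC z : `|FC u z| <= fa u z by rewrite /fa lerDl.
have faS z : `|FS u z| <= fa u z by rewrite /fa lerDr.
have S0 : 2^-1 * \int[leb2 R]_y ((`|p y| + `|q y|) * fa u (y + xi) + (`|p y| + `|q y|) * fa u (y - xi)) =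
  2^-1 * (\int[leb2 R]_y ((`|p y| + `|q y|) * fa u (y + xi)) + \int[leb2 R]_y ((`|p y| + `|q y|) * fa u (y - xi))) by rewrite RintD.
have mk (e1 e2 e3 e4 : R * R -> R) : measurable_fun setT e1 -> measurable_fun setT e2 -> measurable_fun setT e3 -> measurable_fun setT e4 ->
    measurable_fun setT (fun y => p y * ((e1 y + e2 y) / 2) + q y * ((e3 y + e4 y) / 2)).
  move=> m1 m2 m3 m4; apply: measurable_funD; apply: measurable_funM => //.
    by apply: measurable_funM; [exact: measurable_funD|exact: measurable_cst].
  by apply: measurable_funM; [exact: measurable_funD|exact: measurable_cst].
have mN (e1 : R * R -> R) : measurable_fun setT e1 -> measurable_fun setT (fun y => - e1 y).
  by move=> m1; exact: measurableT_comp.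
have E1 : `|FC (fun x => synth p q x * u x) xi| <= 2^-1 * (\int[leb2 R]_y ((`|p y| + `|q y|) * fa u (y + xi)) + \int[leb2 R]_y ((`|p y| + `|q y|) * fa u (y - xi))).
  rewrite /FC (prod_swap xi cos_meas (@cos_max R)) -S0 -(RintZl _ (itgD i1 i2)).
  apply: (@Rint_bound _ _ _ (leb2 R)); last 1 first.
  - by move=> y; rewrite FCD_shift FSD_shift; exact: key.
  - under eq_fun do rewrite FCD_shift FSD_shift.
    exact: mk (cm _) (cm _) (sm _) (sm _).
  - exact: (itgZl _ (itgD i1 i2)).
have E2 : `|FS (fun x => synth p q x * u x) xi| <= 2^-1 * (\int[leb2 R]_y ((`|p y| + `|q y|) * fa u (y + xi)) + \int[leb2 R]_y ((`|p y| + `|q y|) * fa u (y - xi))).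
  rewrite /FS (prod_swap xi sin_meas (@sin_max R)) -S0 -(RintZl _ (itgD i1 i2)).
  apply: (@Rint_bound _ _ _ (leb2 R)); last 1 first.
  - move=> y; rewrite FSB_shift FCB_shift [FC u _ - _]addrC; apply: key => //; rewrite ?normrN //.
  - under eq_fun do rewrite FSB_shift FCB_shift.
    under eq_fun do rewrite [FC u _ - _]addrC.
    exact: mk (sm _) (mN _ (sm _)) (mN _ (cm _)) (cm _).
  - exact: (itgZl _ (itgD i1 i2)).
have half (Z : R) : 2^-1 * Z + 2^-1 * Z = Z by field.
by rewrite /fa -[leRHS]half; exact: lerD E1 E2.
Qed.
End product.

(** A frequency is the difference of two others, so its weight is at most 4 times the larger of
    their weights. *)
Lemma om_shift (k : nat) (x y : R * R) : om x ^+ k <= 4 ^+ k * (om y ^+ k + om (y + x) ^+ k).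
Proof.
have h : om x <= 2 * (om y + om (y + x)).
  rewrite /om /=; have := sqr_ge0 (y.1 + (y.1 + x.1)); have := sqr_ge0 (y.2 + (y.2 + x.2)).
  by move: x.1 x.2 y.1 y.2 ; clear; move=> *; nra.
have o0 z : 0 <= om z := ltW (@om_gt0 R z).
have h2 : om x <= 4 * Num.max (om y) (om (y + x)).
  apply: (le_trans h); have : om y <= Num.max (om y) (om (y + x)) by rewrite le_max lexx.
  have : om (y + x) <= Num.max (om y) (om (y + x)) by rewrite le_max lexx orbT.
  by lra.
apply: (@le_trans _ _ ((4 * Num.max (om y) (om (y + x))) ^+ k)); first by rewrite lerXn2r ?nnegrE ?mulr_ge0 ?le_max ?o0.
rewrite exprMn ler_wpM2l ?exprn_ge0// /Num.max; case: ifP => _.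
  by rewrite lerDr exprn_ge0.
by rewrite lerDl exprn_ge0.
Qed.

(** In the convolution the weight falls on one factor or the other: the factor that receives it is
    taken in weighted sup norm and the other one in L^1. Translation invariance of the integral
    removes the shift. *)
Lemma prod_om k u p q (B B' MP Ma : R) xi : itg (leb2 R) u -> measurable_fun setT p -> measurable_fun setT q ->
  (forall x, `|p x| + `|q x| <= B * W x) -> continuous (FC u) -> continuous (FS u) ->
  (forall x, fa u x <= B' * W x) ->
  (forall x, om x ^+ k * (`|p x| + `|q x|) <= MP) -> (forall x, om x ^+ k * fa u x <= Ma) ->
  om xi ^+ k * fa (fun x => synth p q x * u x) xi <=
    2 * 4 ^+ k * (MP * \int[leb2 R]_x fa u x + Ma * \int[leb2 R]_x (`|p x| + `|q x|)).
Proof.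
move=> iu mp mq pqB cC cS faB hP ha.
have ipq := prod_pq_itg iu mp mq pqB.
have c4 : 0 <= 4 ^+ k :> R by rewrite exprn_ge0.
have tr (v : R * R) : itg (leb2 R) (fun y => fa u (y + v)) /\ \int[leb2 R]_y fa u (y + v) = \int[leb2 R]_y fa u y.
  have iw := @wt_itg R.
  have [|||h1 h2] := @subst_plane R (fa u) (fun x => B' * wt x) (@wt R) 1 1 v ltr01 ltr01 (fa_cont cC cS) _ (@wt_cont R) _ iw.
  - by move=> x; apply: cvgM; [exact: cvg_cst|exact: wt_cont].
  - exact: itgZl.
  - by move=> x; rewrite ger0_norm ?fa_ge0// -mulrA; exact: faB.
  have E (y : R * R) : (1 * y.1 + v.1, 1 * y.2 + v.2) = y + v by rewrite !mul1r.
  move: h1 h2; rewrite mul1r invr1 mul1r.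
  under eq_fun do rewrite E.
  move=> h1 h2; split=> //; rewrite -h2; apply: eq_Rint => y; by rewrite E.
have step (v : R * R) : (forall y, om xi ^+ k <= 4 ^+ k * (om y ^+ k + om (y + v) ^+ k)) ->
   om xi ^+ k * \int[leb2 R]_y ((`|p y| + `|q y|) * fa u (y + v)) <= 4 ^+ k * (MP * \int[leb2 R]_x fa u x + Ma * \int[leb2 R]_x (`|p x| + `|q x|)).
  move=> hv; have [t1 t2] := tr v.
  have is' := fa_shift_itg iu mp mq pqB cC cS v.
  rewrite -(RintZl _ is') -t2 -(RintZl _ t1) -(RintZl _ ipq) -(RintD (itgZl _ t1) (itgZl _ ipq)) -(RintZl _ (itgD (itgZl _ t1) (itgZl _ ipq))).
  apply: (@le_Rint _ _ _ (leb2 R)); [exact: itgZl|exact: itgZl (itgD (itgZl _ t1) (itgZl _ ipq))|].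
  move=> y; have P0 : 0 <= `|p y| + `|q y| by rewrite addr_ge0.
  have A0 := fa_ge0 u (y + v).
  apply: (@le_trans _ _ (4 ^+ k * (om y ^+ k + om (y + v) ^+ k) * ((`|p y| + `|q y|) * fa u (y + v)))).
    by apply: ler_wpM2r; [exact: mulr_ge0|exact: hv].
  rewrite -mulrA; apply: ler_wpM2l; first by rewrite exprn_ge0.
  have := ler_wpM2r A0 (hP y); have := ler_wpM2r P0 (ha (y + v)).
  by move: (om y ^+ k) (om (y + v) ^+ k) (`|p y| + `|q y|) (fa u (y + v)) ; clear; move=> *; nra.
apply: (le_trans (ler_wpM2l _ (fa_synth_le iu mp mq pqB cC cS xi))); first by rewrite exprn_ge0// ltW// om_gt0.
have s1 := step xi (fun y => om_shift k xi y).
have s2 : om xi ^+ k * \int[leb2 R]_y ((`|p y| + `|q y|) * fa u (y - xi)) <= 4 ^+ k * (MP * \int[leb2 R]_x fa u x + Ma * \int[leb2 R]_x (`|p x| + `|q x|)).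
  apply: (step (- xi)) => y; have := om_shift k (- xi) y.
  by rewrite {1}/om /= !sqrrN -/(om xi).
rewrite mulrDr; move: s1 s2; rewrite -!mulrA [2 * _]mulr_natl mulr2n; exact: lerD.
Qed.
End fourier.

(** * Transforms of exponentially decaying functions *)

Section exp_decaying.
Variable R : realType.
Local Notation leb := (@lebesgue_measure R).
Implicit Types (u v f : R * R -> R) (s : seq 'I_2).

Lemma exp_pow (k : nat) (t : R) : 0 <= t -> t ^+ k <= k`!%:R * expR t.
Proof.
case: k => [|k] t0; first by rewrite expr0 fact0 mul1r -expR0 ler_expR.
have k0 : 0 < (k.+1)`!%:R :> R by rewrite ltr0n fact_gt0.
have := expR_ge1Dxn k t0 => /(le_trans _) h; rewrite -ler_pdivrMl// mulrC.
by apply: (h) => //; rewrite lerDr.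
Qed.

Lemma expw_half a (x : R * R) : expw a x = expw (a / 2) x * expw (a / 2) x.
Proof.
rewrite /expw (_ : a * `|x.1| = a / 2 * `|x.1| + a / 2 * `|x.1|); last by field.
rewrite (_ : a * `|x.2| = a / 2 * `|x.2| + a / 2 * `|x.2|); last by field.
by rewrite !opprD !expRD; ring.
Qed.

Lemma expw_pol k a (x : R * R) : 0 < a -> enorm x ^+ k * expw a x <= k`!%:R * (2 / a) ^+ k * expw (a / 2) x.
Proof.
move=> a0; have a2 : 0 < a / 2 by rewrite divr_gt0.
have h := @exp_pow k (a / 2 * enorm x) (mulr_ge0 (ltW a2) (enorm_ge0 x)).
have e := expw_le x (ltW a2); have w0 := expw_ge0 (a / 2) x.
rewrite expw_half mulrA; apply: ler_wpM2r => //.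
have E : enorm x ^+ k = (2 / a) ^+ k * (a / 2 * enorm x) ^+ k.
  by rewrite -exprMn mulrA; congr (_ ^+ _); field; rewrite gt_eqF.
rewrite E mulrAC -mulrA [X in _ <= X]mulrC; apply: ler_wpM2l; first by rewrite exprn_ge0// divr_ge0// ltW.
rewrite mulrC; apply: (le_trans (ler_pM _ w0 h e)); first by rewrite exprn_ge0// mulr_ge0 ?enorm_ge0// ltW.
by rewrite expRN mulfK// gt_eqF// expR_gt0.
Qed.

Definition exp_decaying u := smooth u /\ exists2 a : R, 0 < a &
  forall s, exists2 C : R, 0 <= C & forall y, `|partials s u y| <= C * expw a y.

Lemma edec_partial j u : exp_decaying u -> exp_decaying (partial j u).
Proof.
move=> [su [a a0 h]]; split; first exact: smooth_partial.
by exists a => // s; rewrite -partials_rcons.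
Qed.

Lemma edec_partials s u : exp_decaying u -> exp_decaying (partials s u).
Proof. by elim: s => //= j s IH /IH; exact: edec_partial. Qed.

Lemma edec_itg u : exp_decaying u -> itg (leb2 R) u.
Proof.
move=> [su [a a0 /(_ [::]) [C C0 h]]].
apply: itg2_le (h) (itgZl _ (expw_itg a0)).
apply: continuous2_measurable; exact: (@smooth_cont _ _ [::] su).
Qed.

Lemma enorm_cont : continuous (@enorm R).
Proof.
apply: (@lip_cont _ _ 1) => x y; rewrite mul1r ler_norml enorm_lb andbT lerNl opprB.
by rewrite -[enorm (x - y)]enormN opprB enorm_lb.
Qed.

Lemma edec_itg1 u k : exp_decaying u -> itg (leb2 R) (fun x => u x * enorm x ^+ k).
Proof.
move=> [su [a a0 /(_ [::]) [C C0 h]]].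
apply: (@itg2_le _ _ (fun x => C * (k`!%:R * (2 / a) ^+ k * expw (a / 2) x))).
- apply: measurable_funM; first by apply: continuous2_measurable; exact: (@smooth_cont _ _ [::] su).
  apply: measurable_funX; apply: continuous2_measurable; exact: enorm_cont.
- move=> x; rewrite normrM [`|enorm x ^+ k|]ger0_norm; last by rewrite exprn_ge0 ?enorm_ge0.
  apply: (@le_trans _ _ (C * expw a x * enorm x ^+ k)).
    by apply: ler_wpM2r; [rewrite exprn_ge0// enorm_ge0|exact: h].
  by rewrite -mulrA [expw a x * _]mulrC; apply: ler_wpM2l => //; exact: expw_pol.
- apply: itgZl; apply: itgZl; apply: expw_itg; by rewrite divr_gt0.
Qed.

Lemma edec_fcont u : exp_decaying u -> continuous (FC u) /\ continuous (FS u).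
Proof. move=> eu; apply: FC_lip; [exact: edec_itg|exact: (edec_itg1 1 eu)]. Qed.

Lemma phase_deriv (c : R -> R) (c' : R -> R) j (xi y : R * R) : (forall t : R, is_derive t 1 c (c' t)) ->
  derivable (fun x : R * R => c (dotp x xi)) y (evec R j) /\
  partial j (fun x : R * R => c (dotp x xi)) y = pcoord j xi * c' (dotp y xi).
Proof.
move=> hc; elim/ord2P: j.
  have H : is_derive y.1 1 (fun t : R => c (dotp (t, y.2) xi)) (xi.1 * c' (dotp y xi)).
    rewrite /dotp/=.
    have -> : (fun t : R => c (t * xi.1 + y.2 * xi.2)) = (fun t => c (xi.1 * t + y.2 * xi.2)) by apply/funext => t; rewrite mulrC.
    have := @is_derive_affine R c xi.1 (y.2 * xi.2) y.1 (@ex_derive _ _ _ _ _ _ _ (hc _)).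
    by rewrite (der_derive1 (hc _)) [xi.1 * y.1]mulrC.
  split; first by rewrite derivable0E; exact: (@ex_derive _ _ _ _ _ _ _ H).
  by rewrite partial0E (der_derive1 H).
have H : is_derive y.2 1 (fun t : R => c (dotp (y.1, t) xi)) (xi.2 * c' (dotp y xi)).
  rewrite /dotp/=.
  have -> : (fun t : R => c (y.1 * xi.1 + t * xi.2)) = (fun t => c (xi.2 * t + y.1 * xi.1)) by apply/funext => t; congr c; ring.
  have := @is_derive_affine R c xi.2 (y.1 * xi.1) y.2 (@ex_derive _ _ _ _ _ _ _ (hc _)).
  by rewrite (der_derive1 (hc _)) [xi.2 * y.2]mulrC [y.2 * _ + _]addrC.
split; first by rewrite derivable1E; exact: (@ex_derive _ _ _ _ _ _ _ H).
by rewrite partial1E (der_derive1 H).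
Qed.

Lemma dotp_cont (xi : R * R) : continuous (fun x : R * R => dotp x xi).
Proof. by apply: (@lip_cont _ _ (enorm xi)) => x y; rewrite -dotpBl mulrC dotp_le. Qed.

Lemma pcoord_cont j : continuous (@pcoord R j).
Proof.
apply: (@lip_cont _ _ 1) => x y; rewrite mul1r; apply: le_trans (pcoord_le j (x - y)).
by rewrite /pcoord; case: ifP.
Qed.

(** Stated for any bounded function of the phase with bounded derivative, so that cos and sin are
    treated at once. *)
Lemma int_phase (c c' : R -> R) j u (xi : R * R) : exp_decaying u -> (forall t : R, is_derive t 1 c (c' t)) ->
  (forall t, `|c t| <= 1) -> (forall t, `|c' t| <= 1) -> continuous c' ->
  \int[leb2 R]_x (partial j u x * c (dotp x xi)) = - (pcoord j xi * \int[leb2 R]_x (u x * c' (dotp x xi))).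
Proof.
move=> eu hc c1 c'1 cc'.
have cc : continuous c by apply: derivable_cont => t; exact: (@ex_derive _ _ _ _ _ _ _ (hc t)).
have [su [a a0 hd]] := eu; have [C0 C00 h0] := hd [::]; have [C1 C10 h1] := hd [:: j].
have ccd : continuous (fun x : R * R => c (dotp x xi)).
  by move=> x; apply: (@continuous_comp _ _ _ (fun x : R * R => dotp x xi) c); [exact: dotp_cont|exact: cc].
have ccd' : continuous (fun x : R * R => c' (dotp x xi)).
  by move=> x; apply: (@continuous_comp _ _ _ (fun x : R * R => dotp x xi) c'); [exact: dotp_cont|exact: cc'].
have du y : derivable u y (evec R j) by exact: (@smooth_derivable _ u [::]).
have E y : partial j (fun x => u x * c (dotp x xi)) y = partial j u y * c (dotp y xi) + pcoord j xi * (u y * c' (dotp y xi)).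
  have [d1 d2] := phase_deriv j xi y hc.
  by rewrite (partialM (du y) d1) d2; move: (partial _ _ _) (u y) (c _) (c' _) (pcoord _ _) => a1 a2 a3 a4 a5; ring.
have i1 : itg (leb2 R) (fun x => partial j u x * c (dotp x xi)).
  by apply: (itg_mul_bdd (edec_itg (edec_partial j eu)) (B := 1)) => //; exact: continuous2_measurable.
have i2 : itg (leb2 R) (fun x => u x * c' (dotp x xi)).
  by apply: (itg_mul_bdd (edec_itg eu) (B := 1)) => //; exact: continuous2_measurable.
have := @int_partial0 R j (fun x => u x * c (dotp x xi)) (C0 + (C1 + `|pcoord j xi| * C0)) a a0.
have K y : `|u y * c' (dotp y xi)| <= C0 * expw a y.
  by rewrite normrM; apply: le_trans (h0 y); rewrite ler_piMr.
have w0 y := expw_ge0 a y.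
have -> : \int[leb2 R]_x partial j (fun x => u x * c (dotp x xi)) x =
  \int[leb2 R]_x (partial j u x * c (dotp x xi)) + pcoord j xi * \int[leb2 R]_x (u x * c' (dotp x xi)).
  by rewrite -(RintZl _ i2) -(RintD i1 (itgZl _ i2)); apply: eq_Rint => x; rewrite E.
move=> h; apply/eqP; rewrite -addr_eq0; apply/eqP; apply: h.
- by move=> y; apply: derivableM; [exact: du|exact: (phase_deriv j xi y hc).1].
- rewrite (_ : partial _ _ = fun y => partial j u y * c (dotp y xi) + pcoord j xi * (u y * c' (dotp y xi))); last by apply/funext => y; rewrite E.
  apply: contD2; apply: contM2 => //; first exact: (@smooth_cont _ _ [:: j] su).
    by move=> x; exact: cvg_cst.
  by apply: contM2 => //; exact: (@smooth_cont _ _ [::] su).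
- move=> y; rewrite normrM; apply: (@le_trans _ _ (C0 * expw a y)).
    by apply: le_trans (h0 y); rewrite ler_piMr.
  by apply: ler_wpM2r => //; rewrite lerDl addr_ge0// mulr_ge0.
- move=> y; rewrite E; apply: (le_trans (ler_normD _ _)); rewrite !mulrDl addrA.
  have hh : `|partial j u y * c (dotp y xi)| <= C1 * expw a y.
    by rewrite normrM; apply: le_trans (h1 y); rewrite ler_piMr.
  have h2 : `|pcoord j xi * (u y * c' (dotp y xi))| <= `|pcoord j xi| * C0 * expw a y.
    by rewrite normrM -mulrA ler_wpM2l.
  have h3 : 0 <= C0 * expw a y by rewrite mulr_ge0.
  by rewrite -addrA; apply: ler_wpDl => //; rewrite lerD.
Qed.

Lemma FC_partial j u xi : exp_decaying u -> FC (partial j u) xi = pcoord j xi * FS u xi.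
Proof.
move=> eu; rewrite /FC (int_phase j xi eu (@is_derive_cos R) (@cos_max R)).
- rewrite /FS -mulrN -RintN; last by under eq_fun do rewrite mulrN; exact: itgN (sind_itg _ (edec_itg eu)).
  by congr (_ * _); apply: eq_Rint => x; rewrite mulrN opprK.
- by move=> t; rewrite normrN sin_max.
- by move=> t; apply: cvgN; exact: continuous_sin.
Qed.

Lemma FS_partial j u xi : exp_decaying u -> FS (partial j u) xi = - (pcoord j xi * FC u xi).
Proof.
by move=> eu; rewrite /FS (int_phase j xi eu (@is_derive_sin R) (@sin_max R) (@cos_max R) (@continuous_cos R)).
Qed.

Lemma fa_partial j u xi : exp_decaying u -> fa (partial j u) xi = `|pcoord j xi| * fa u xi.
Proof.
by move=> eu; rewrite /fa FC_partial// FS_partial// normrN !normrM -mulrDr addrC.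
Qed.

Lemma FC_partial2 j u xi : exp_decaying u -> FC (partial j (partial j u)) xi = - (pcoord j xi ^+ 2 * FC u xi) /\
  FS (partial j (partial j u)) xi = - (pcoord j xi ^+ 2 * FS u xi).
Proof.
move=> eu; have ej := edec_partial j eu; split.
  by rewrite (FC_partial j xi ej) (FS_partial j xi eu) mulrN mulrA -expr2.
by rewrite (FS_partial j xi ej) (FC_partial j xi eu) mulrA -expr2.
Qed.

(** [om] is the symbol of 1 - Delta. *)
Lemma FC_lap u xi : exp_decaying u -> om xi * FC u xi = FC (fun y => u y - laplacian u y) xi /\
  om xi * FS u xi = FS (fun y => u y - laplacian u y) xi.
Proof.
move=> eu; have iu := edec_itg eu.
have i0 := edec_itg (edec_partial ord0 (edec_partial ord0 eu)).
have i1 := edec_itg (edec_partial ord_max (edec_partial ord_max eu)).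
have [a0 b0] := FC_partial2 ord0 xi eu; have [a1 b1] := FC_partial2 ord_max xi eu.
have key (a y z : R) : y = - (xi.1 ^+ 2 * a) -> z = - (xi.2 ^+ 2 * a) -> om xi * a = a - (y + z).
  by move=> -> ->; rewrite /om; ring.
split.
  rewrite (key _ _ _ a0 a1) -(RintD (cosd_itg xi i0) (cosd_itg xi i1)) -(RintB (cosd_itg xi iu) (itgD (cosd_itg xi i0) (cosd_itg xi i1))).
  by apply: eq_Rint => x; rewrite mulrBl /laplacian /pderiv/= mulrDl.
rewrite (key _ _ _ b0 b1) -(RintD (sind_itg xi i0) (sind_itg xi i1)) -(RintB (sind_itg xi iu) (itgD (sind_itg xi i0) (sind_itg xi i1))).
by apply: eq_Rint => x; rewrite mulrBl /laplacian /pderiv/= mulrDl.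
Qed.

Lemma fa_partial2 j u xi : exp_decaying u -> fa (partial j (partial j u)) xi = pcoord j xi ^+ 2 * fa u xi.
Proof.
move=> eu; have [a b] := FC_partial2 j xi eu.
have P0 := sqr_ge0 (pcoord j xi); rewrite /fa a b; move: (pcoord j xi ^+ 2) P0 (FC u xi) (FS u xi) => p p0 c d.
by rewrite !normrN !normrM (ger0_norm p0) mulrDr.
Qed.

(** This is qualitative, the constant depending on [u]: it makes the suprema in the absorption
    argument finite. Bounds independent of the velocity come from [wiener]. *)
Lemma om_fa k u : exp_decaying u -> exists2 B : R, 0 <= B & forall xi, om xi ^+ k * fa u xi <= B.
Proof.
elim: k u => [|k IH] u eu.
  exists (2 * \int[leb2 R]_x `|u x|); first by rewrite mulr_ge0// Rint_ge0.
  by move=> xi; rewrite expr0 mul1r mulr_natl mulr2n lerD ?FC_bound ?FS_bound//; exact: edec_itg.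
have [B0 B00 h0] := IH _ eu.
have [B1 B10 h1] := IH _ (edec_partial ord0 (edec_partial ord0 eu)).
have [B2 B20 h2] := IH _ (edec_partial ord_max (edec_partial ord_max eu)).
exists (B0 + B1 + B2) => [|xi]; first by rewrite !addr_ge0.
have key (p q q1 q2 : R) : p * q <= B0 -> q1 = xi.1 ^+ 2 * q -> p * q1 <= B1 -> q2 = xi.2 ^+ 2 * q -> p * q2 <= B2 ->
    p * om xi * q <= B0 + B1 + B2.
  move=> a -> b -> c; rewrite /om.
  rewrite (_ : _ * q = p * q + p * (xi.1 ^+ 2 * q) + p * (xi.2 ^+ 2 * q)); last by ring.
  by rewrite !lerD.
rewrite exprSr; exact: (key _ _ _ _ (h0 xi) (fa_partial2 ord0 xi eu) (h1 xi) (fa_partial2 ord_max xi eu) (h2 xi)).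
Qed.

Lemma fa_W u : exp_decaying u -> exists2 B : R, 0 <= B & forall xi, fa u xi <= B * W xi.
Proof.
move=> /(om_fa 2) [B B0 h]; exists (B * 3) => [|xi]; first by rewrite mulr_ge0.
have o0 : 0 < om xi ^+ 2 by rewrite exprn_gt0 ?om_gt0.
have := h xi; rewrite -ler_pdivlMl// => /le_trans; apply.
by rewrite mulrC -mulrA ler_wpM2l ?om2_W.
Qed.

(** The rate is halved once by [landau_rate] and once in passing from the Euclidean exponential to
    the separable one. *)
Lemma edec_of_smb u (C a : R) : 0 < a -> (forall n, smooth_bounded_upto n u) -> (forall y, `|u y| <= C * expR (- (a * enorm y))) -> exp_decaying u.
Proof.
move=> a0 /smbP [su bu] h; split=> //; exists (a / 4); first by rewrite divr_gt0.
have C0 : 0 <= C.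
  have := le_trans (normr_ge0 _) (h 0); rewrite pmulr_lge0//; exact: expR_gt0.
have gF : smooth_family (eq u).
  by split=> [_ <-|s]//; have [B hB] := bu s; exists B => _ <-.
have rF : decay_rate a (eq u) by exists C => // _ <-.
move=> s; have [|D D0 hD] := @landau_rate R (eq u) a (a / 2) s (ltW a0) gF rF; first by rewrite ltr_pdivrMr// ltr_pMr// ltr1n.
exists D => // y; apply: (le_trans (hD _ _ y)); first by exists u.
rewrite ler_wpM2l//; have := exp_enorm_le y (ltW (divr_gt0 a0 (ltr0Sn R 1))).
by rewrite (_ : a / 2 / 2 = a / 4)//; field.
Qed.
End exp_decaying.

(** * Trigonometric moments of Gaussians *)

Section gauss.
Variable R : realType.
Local Notation leb := (@lebesgue_measure R).
Local Notation D1 := (@derive1 R R^o).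

Lemma der_mul (f g : R -> R) (x df dg : R) : is_derive x 1 f df -> is_derive x 1 g dg ->
  is_derive x 1 (fun t => f t * g t) (df * g x + f x * dg).
Proof.
move=> hf hg; have := is_deriveM hf hg; rewrite /GRing.scale/= addrC [g x * df]mulrC; exact.
Qed.

Lemma der_comp (f g : R -> R) (x df dg : R) : is_derive (g x) 1 f df -> is_derive x 1 g dg ->
  is_derive x 1 (fun t => f (g t)) (dg * df).
Proof. by move=> hf hg; rewrite mulrC; exact: (@is_derive1_comp R f g x _ _ hf hg). Qed.

Lemma der_eq (f : R -> R) (x d d' : R) : is_derive x 1 f d -> d = d' -> is_derive x 1 f d'.
Proof. by move=> h <-. Qed.

Lemma der_pow (k : nat) (x : R) : is_derive x 1 (fun t : R => t ^+ k) (k%:R * x ^+ k.-1).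
Proof.
have h := @is_deriveX _ _ (@id R) k x 1 1 (is_derive_id _ _).
rewrite (_ : (fun y : R => y ^+ k) = id ^+ k); last by apply/funext => y; rewrite exprfctE.
by apply: (is_derive_eq h); rewrite /GRing.scale/= mulr1.
Qed.

Lemma quad_der (F : R -> R) (x d C : R) : (forall h, `|F (x + h) - F x - h * d| <= C * h ^+ 2) -> is_derive x 1 F d.
Proof.
move=> h.
have h' t : `|F (x + t) - F x - t * d| <= `|C| * t ^+ 2.
  by apply: (le_trans (h t)); rewrite ler_wpM2r ?sqr_ge0// ler_norm.
have d0 := @is_derive_quad R (fun t => F (x + t) - F x - t * d) `|C| (normr_ge0 C) h'.
have dx : is_derive x 1 (fun y => F (x + (1 * y + - x)) - F x - (1 * y + - x) * d) (1 * 0).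
  have E0 : 1 * x + - x = 0 by ring.
  have dd : derivable (fun t : R => F (x + t) - F x - t * d) (1 * x + - x) 1.
    by rewrite E0; exact: (@ex_derive _ _ _ _ _ _ _ d0).
  have := is_derive_affine dd; rewrite E0 (der_derive1 d0); exact.
have E : F = (fun y => F (x + (1 * y + - x)) - F x - (1 * y + - x) * d) + (fun y => y * d + (F x - x * d)).
  apply/funext => y; have E1 : x + (1 * y + - x) = y by ring.
  have key (A B C0 : R) : A = B -> A = B - C0 - (1 * y - x) * d + (y * d + (C0 - x * d)) by move=> ->; ring.
  by apply: (key (F y) _ (F x)); rewrite E1.
have da : is_derive x 1 (fun y : R => y * d + (F x - x * d)) d.
  have -> : (fun y : R => y * d + (F x - x * d)) = (fun y => d *: y + (F x - x * d)) by apply/funext => y; rewrite mulrC.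
  by apply: is_derive_eq; rewrite addr0 /GRing.scale/= mulr1.
by rewrite E; apply: (is_derive_eq (is_deriveD dx da)); rewrite mulr0 add0r.
Qed.

Lemma taylor1 (c c' : R -> R) (t d : R) : (forall x : R, is_derive x 1 c (c' x)) -> (forall a b, `|c' a - c' b| <= `|a - b|) ->
  `|c (t + d) - c t - d * c' t| <= d ^+ 2.
Proof.
move=> hc hl; have cc : continuous c by apply: derivable_cont => x; exact: (@ex_derive _ _ _ _ _ _ _ (hc x)).
have key (z : R) : `|z - t| <= `|d| -> `|d * c' z - d * c' t| <= d ^+ 2.
  move=> hz; rewrite -mulrBr normrM -(real_normK (num_real d)) expr2 ler_wpM2l//.
  exact: le_trans (hl _ _) hz.
have [d0|d0] := leP 0 d.
  have [|z zi ->] := @MVT_segment R c c' t (t + d) _ (fun x _ => hc x) (continuous_subspaceT cc); first by rewrite lerDl.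
  rewrite (_ : t + d - t = d) 1?[c' z * d]mulrC; last by ring.
  by apply: key; move: zi; rewrite in_itv/= => /andP[z1 z2]; rewrite !ger0_norm ?subr_ge0//; lra.
have [|z zi E] := @MVT_segment R c c' (t + d) t _ (fun x _ => hc x) (continuous_subspaceT cc); first by rewrite gerDl ltW.
rewrite -(opprB (c t)) E (_ : - (c' z * _) = d * c' z); last by ring.
apply: key; move: zi; rewrite in_itv/= => /andP[z1 z2]; rewrite ler0_norm ?subr_le0// ltr0_norm//; lra.
Qed.

Definition ga (a x : R) : R := expR (- (a * x ^+ 2)).

Lemma ga_ge0 a x : 0 <= ga a x. Proof. exact: expR_ge0. Qed.

Lemma ga_der (a x : R) : is_derive x 1 (ga a) (- (2 * a * x) * ga a x).
Proof.
rewrite /ga; have d : is_derive x 1 (fun x : R => - (a * x ^+ 2)) (- (2 * a * x)).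
  have -> : (fun x : R => - (a * x ^+ 2)) = (fun x => (- a) *: x ^+ 2) by apply/funext => y; rewrite /GRing.scale/=; ring.
  by apply: is_derive_eq; rewrite /GRing.scale/=; ring.
exact: der_comp (is_derive_expR _) d.
Qed.

Lemma ga_cont a : continuous (ga a).
Proof. by apply: derivable_cont => x; exact: (@ex_derive _ _ _ _ _ _ _ (ga_der a x)). Qed.

Lemma ga_le a b x : 0 < a -> ga a x <= expR (b ^+ 2 / (4 * a)) * expR (- (b * `|x|)).
Proof.
move=> a0; rewrite /ga -expRD ler_expR -(real_normK (num_real x)).
have h : 0 <= a * (`|x| - b / (2 * a)) ^+ 2 by rewrite mulr_ge0 ?sqr_ge0// ltW.
have E : a * (`|x| - b / (2 * a)) ^+ 2 = a * `|x| ^+ 2 - b * `|x| + b ^+ 2 / (4 * a) by field; rewrite gt_eqF.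
by rewrite E in h; lra.
Qed.

Lemma pow_ga_le k a x : 0 < a -> `|x| ^+ k * ga a x <= k`!%:R * expR (a^-1) * expR (- (1 * `|x|)).
Proof.
move=> a0; have := ga_le 2 x a0; rewrite (_ : 2 ^+ 2 / (4 * a) = a^-1); last by field; rewrite gt_eqF.
move=> h; have h2 := exp_pow k (normr_ge0 x).
apply: (le_trans (ler_pM _ (ga_ge0 _ _) h2 h)); first exact: exprn_ge0.
by rewrite mulrACA -expRD (_ : `|x| + _ = - (1 * `|x|))//; ring.
Qed.

Lemma pow_ga_itg k a (c : R -> R) : 0 < a -> continuous c -> (forall x, `|c x| <= 1) ->
  itg leb (fun x => x ^+ k * ga a x * c x).
Proof.
move=> a0 cc c1; apply: itgR_le (itgZl (k`!%:R * expR (a^-1)) (expR_abs_itg ltr01)).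
  apply: continuous_measurable_fun => x; apply: cvgM; last exact: cc.
  by apply: cvgM; [exact: exprn_continuous|exact: ga_cont].
move=> x; apply: le_trans (pow_ga_le k x a0); rewrite normrM normrM normrX (ger0_norm (ga_ge0 _ _)).
by rewrite ler_piMr// mulr_ge0 ?exprn_ge0 ?ga_ge0.
Qed.

Lemma phase_cont (c : R -> R) (w p : R) : continuous c -> continuous (fun x => c (w * x + p)).
Proof.
move=> cc x; apply: (@continuous_comp _ _ _ (fun x => w * x + p) c); last exact: cc.
by apply: cvgD; [apply: cvgM; [exact: cvg_cst|exact: cvg_id]|exact: cvg_cst].
Qed.

Lemma gc_itg k a w p : 0 < a -> itg leb (fun x => x ^+ k * ga a x * cos (w * x + p)).
Proof. by move=> a0; apply: pow_ga_itg => // [|x]; [apply: phase_cont; exact: continuous_cos|exact: cos_max]. Qed.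

Lemma gs_itg k a w p : 0 < a -> itg leb (fun x => x ^+ k * ga a x * sin (w * x + p)).
Proof. by move=> a0; apply: pow_ga_itg => // [|x]; [apply: phase_cont; exact: continuous_sin|exact: sin_max]. Qed.

Definition mc k a w p := \int[leb]_x (x ^+ k * ga a x * cos (w * x + p)).

Definition ms k a w p := \int[leb]_x (x ^+ k * ga a x * sin (w * x + p)).

Lemma phase_der (c c' : R -> R) (w p x : R) : (forall x : R, is_derive x 1 c (c' x)) ->
  is_derive x 1 (fun x => c (w * x + p)) (w * c' (w * x + p)).
Proof.
move=> hc; have := @is_derive_affine R c w p x (@ex_derive _ _ _ _ _ _ _ (hc _)).
by rewrite (der_derive1 (hc _)).
Qed.

(** The derivative of x^k e^{-a x^2} c(w x + p) integrates to 0. The resulting recurrence gives the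
    moments of orders 1 and 2 from that of order 0. *)
Lemma mc_ibp k a (w p : R) (c c' : R -> R) : 0 < a -> (forall x : R, is_derive x 1 c (c' x)) -> continuous c' ->
  (forall x, `|c x| <= 1) -> (forall x, `|c' x| <= 1) ->
  k%:R * \int[leb]_x (x ^+ k.-1 * ga a x * c (w * x + p)) - 2 * a * \int[leb]_x (x ^+ k.+1 * ga a x * c (w * x + p))
  + w * \int[leb]_x (x ^+ k * ga a x * c' (w * x + p)) = 0.
Proof.
move=> a0 hc cc' c1 c'1.
have cc : continuous c by apply: derivable_cont => x; exact: (@ex_derive _ _ _ _ _ _ _ (hc x)).
have ic l : itg leb (fun x => x ^+ l * ga a x * c (w * x + p)) by apply: pow_ga_itg => //; exact: phase_cont.
have ic' l : itg leb (fun x => x ^+ l * ga a x * c' (w * x + p)) by apply: pow_ga_itg => //; exact: phase_cont.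
have Hd (x : R) : is_derive x 1 (fun x => x ^+ k * ga a x * c (w * x + p))
   (k%:R * (x ^+ k.-1 * ga a x * c (w * x + p)) - 2 * a * (x ^+ k.+1 * ga a x * c (w * x + p)) + w * (x ^+ k * ga a x * c' (w * x + p))).
  have d1 := ga_der a x; have d2 := phase_der w p x hc.
  have d3 := der_mul (der_mul (der_pow k x) d1) d2.
  apply: (der_eq d3).
  by rewrite exprS; move: (x ^+ k) (x ^+ k.-1) (ga a x) (c _) (c' _) => A B D E F; ring.
have bd l (h : R -> R) x : (forall x, `|h x| <= 1) -> `|x ^+ l * ga a x * h (w * x + p)| <= l`!%:R * expR (a^-1) * expR (- (1 * `|x|)).
  move=> h1; apply: le_trans (pow_ga_le l x a0); rewrite normrM normrM normrX (ger0_norm (ga_ge0 _ _)).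
  by rewrite ler_piMr// mulr_ge0 ?exprn_ge0 ?ga_ge0.
rewrite -(RintZl _ (ic k.-1)) -(RintZl _ (ic k.+1)) -(RintZl _ (ic' k)).
rewrite -(RintB (itgZl _ (ic _)) (itgZl _ (ic _))) -(RintD (itgB (itgZl _ (ic _)) (itgZl _ (ic _))) (itgZl _ (ic' _))).
have E x : D1 (fun x => x ^+ k * ga a x * c (w * x + p)) x = (k%:R * (x ^+ k.-1 * ga a x * c (w * x + p)) - 2 * a * (x ^+ k.+1 * ga a x * c (w * x + p)) + w * (x ^+ k * ga a x * c' (w * x + p))).
  exact: der_derive1 (Hd x).
under eq_Rint do rewrite -E.
have a00 := ltW a0.
apply: (@int_deriv0 R _ ((k`!%:R + k%:R * k.-1`!%:R + 2 * a * k.+1`!%:R + `|w| * k`!%:R) * expR a^-1) 1 ltr01).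
- by move=> x; exact: (@ex_derive _ _ _ _ _ _ _ (Hd x)).
- rewrite (_ : D1 _ = fun x => (k%:R * (x ^+ k.-1 * ga a x * c (w * x + p)) - 2 * a * (x ^+ k.+1 * ga a x * c (w * x + p)) + w * (x ^+ k * ga a x * c' (w * x + p)))); last by apply/funext.
  have cl (l : nat) (h : R -> R) (b : R) : continuous h -> continuous (fun x : R => b * (x ^+ l * ga a x * h (w * x + p))).
    move=> ch x; apply: cvgM; first exact: cvg_cst.
    apply: cvgM; last exact: phase_cont.
    by apply: cvgM; [exact: exprn_continuous|exact: ga_cont].
  by move=> x; apply: cvgD; [apply: cvgB|]; exact: cl.
- move=> x; apply: (le_trans (bd k c x c1)); apply: ler_wpM2r; first exact: expR_ge0.
  by apply: ler_wpM2r; [exact: expR_ge0|rewrite -!addrA lerDl !addr_ge0// ?mulr_ge0].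
- move=> x; rewrite E; have B1 := bd k.-1 c x c1; have B2 := bd k.+1 c x c1; have B3 := bd k c' x c'1.
  move: (x ^+ k.-1 * _ * _) (x ^+ k.+1 * _ * _) (x ^+ k * _ * _) (expR a^-1) (expR (- _)) (expR_ge0 (a^-1)) (expR_ge0 (- (1 * `|x|))) B1 B2 B3 => X Y Z e1 e2 e10 e20 B1 B2 B3.
  apply: (le_trans (ler_normD _ _)); apply: (le_trans (lerD (ler_normB _ _) (lexx _))).
  rewrite (normrM k%:R) (normrM (2 * a)) (normrM w) [`|k%:R|]ger0_norm// [`|2 * a|]ger0_norm ?mulr_ge0//.
  have h1 : k%:R * `|X| <= k%:R * (k.-1`!%:R * e1 * e2) by rewrite ler_wpM2l.
  have h2 : 2 * a * `|Y| <= 2 * a * (k.+1`!%:R * e1 * e2) by rewrite ler_wpM2l// mulr_ge0.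
  have h3 : `|w| * `|Z| <= `|w| * (k`!%:R * e1 * e2) by rewrite ler_wpM2l.
  apply: (le_trans (lerD (lerD h1 h2) h3)).
  have h4 : 0 <= k`!%:R * e1 * e2 by rewrite !mulr_ge0.
  move: (k`!%:R) (k.-1`!%:R) (k.+1`!%:R) h4 {h1 h2 h3 B1 B2 B3} => f1 f2 f3 h4.
  rewrite [X in _ <= X](_ : _ = f1 * e1 * e2 + (k%:R * (f2 * e1 * e2) + 2 * a * (f3 * e1 * e2) + `|w| * (f1 * e1 * e2))); last by ring.
  by rewrite lerDr.
Qed.

Lemma mc_der a (w p : R) : 0 < a -> is_derive w 1 (fun w => mc 0 a w p) (- ms 1 a w p).
Proof.
move=> a0; apply: (@quad_der _ _ _ (\int[leb]_x (x ^+ 2 * ga a x * 1))) => h.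
have i1 := gc_itg 0 (w + h) p a0; have i2 := gc_itg 0 w p a0; have i3 := gs_itg 1 w p a0.
have i4 : itg leb (fun x => x ^+ 2 * ga a x * 1) by apply: pow_ga_itg => // [x|x]; [exact: cvg_cst|rewrite normr1].
have -> : mc 0 a (w + h) p - mc 0 a w p - h * - ms 1 a w p =
   \int[leb]_x (x ^+ 0 * ga a x * cos ((w + h) * x + p) - x ^+ 0 * ga a x * cos (w * x + p) + h * (x ^+ 1 * ga a x * sin (w * x + p))).
  by rewrite (RintD (itgB i1 i2) (itgZl _ i3)) (RintB i1 i2) (RintZl _ i3) /mc /ms mulrN opprK.
rewrite mulrC -(RintZl _ i4).
apply: (@Rint_bound _ _ _ leb); [exact: itg_meas (itgD (itgB i1 i2) (itgZl _ i3))|exact: itgZl|].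
move=> x; have := @taylor1 cos (fun x => - sin x) (w * x + p) (h * x) (@is_derive_cos R).
have -> : (w + h) * x + p = w * x + p + h * x by ring.
move=> /(_ _) T; have {T} T := T (fun a b => _).
rewrite expr0 expr1 mul1r mulr1.
have -> : ga a x * cos (w * x + p + h * x) - ga a x * cos (w * x + p) + h * (x * ga a x * sin (w * x + p)) =
  ga a x * (cos (w * x + p + h * x) - cos (w * x + p) - (h * x) * - sin (w * x + p)) by ring.
rewrite normrM (ger0_norm (ga_ge0 _ _)) mulrA -exprMn mulrC; apply: ler_wpM2r; first exact: ga_ge0.
by apply: T => u v; rewrite opprK addrC distrC [X in _ <= X]distrC -[X in X <= _]normrN opprB sin_lip.
Qed.

Definition J0 (a w : R) := Num.sqrt pi / Num.sqrt a * expR (- (w ^+ 2 / (4 * a))).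

Lemma mc00 a p : 0 < a -> mc 0 a 0 p = cos p * J0 a 0.
Proof.
move=> a0; have sa : 0 < Num.sqrt a by rewrite sqrtr_gt0.
have ig : itg leb (@gauss_fun R) := integrableT_gauss.
have [_ E] := subst_line 0 sa (@continuous_gauss_fun R) ig.
rewrite /J0 expr0n/= mul0r oppr0 expR0 mulr1.
have E2 : \int[leb]_x @gauss_fun R x = Num.sqrt pi by rewrite /Rintegral integralT_gauss.
rewrite [_ / _]mulrC -E2 -E -RintZl; last first.
  by have [] := subst_line 0 sa (@continuous_gauss_fun R) ig.
apply: eq_Rint => x; rewrite mul0r add0r expr0 mul1r mulrC /ga /gauss_fun addr0 exprMn sqr_sqrtr//; exact: ltW.
Qed.

(** Multiplied by e^{w^2/(4a)}, the integral has zero derivative in w, because its derivative is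
    minus the first sine moment, which the recurrence expresses by the integral itself. The value at
    w = 0 is the Gauss integral. *)
Lemma mc0E a w p : 0 < a -> mc 0 a w p = cos p * J0 a w.
Proof.
move=> a0; have an0 : a != 0 by rewrite gt_eqF.
pose E w := mc 0 a w p * expR (w ^+ 2 / (4 * a)).
have dE (x : R) : is_derive x 1 E 0.
  have d1 : is_derive x 1 (fun w : R => w ^+ 2 / (4 * a)) (x / (2 * a)).
    apply: (der_eq (der_mul (der_pow 2 x) (is_derive_cst ((4 * a)^-1) x 1))).
    by rewrite mulr0 addr0 /cst/= expr1; field.
  have d2 := der_mul (mc_der x p a0) (der_comp (is_derive_expR _) d1).
  apply: (der_eq d2).
  have := mc_ibp 0 x p a0 (@is_derive_sin R) (@continuous_cos R) (@sin_max R) (@cos_max R).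
  rewrite -/(ms 1 a x p) -/(mc 0 a x p) mul0r sub0r => h.
  have -> : ms 1 a x p = x * mc 0 a x p / (2 * a).
    by apply/eqP; rewrite eq_sym -subr_eq0 -(mulIr_eq0 _ (mulIf (_ : 2 * a != 0))) ?mulf_neq0//; apply/eqP; rewrite -[RHS]h; field.
  by field.
have := is_derive_0_is_cst w 0 dE; rewrite /E expr0n/= mul0r expR0 mulr1 mc00// => h.
have e0 : expR (w ^+ 2 / (4 * a)) != 0 by rewrite gt_eqF ?expR_gt0.
apply: (mulIf e0); rewrite h /J0 expr0n/= mul0r oppr0 expR0.
move: (w ^+ 2 / (4 * a)) (Num.sqrt pi / Num.sqrt a) => X Y.
by rewrite -[RHS]mulrA -[Y * _ * _]mulrA -expRD addNr expR0.
Qed.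

Lemma ms1E a w p : 0 < a -> ms 1 a w p = w / (2 * a) * (cos p * J0 a w).
Proof.
move=> a0; have an0 : a != 0 by rewrite gt_eqF.
have := mc_ibp 0 w p a0 (@is_derive_sin R) (@continuous_cos R) (@sin_max R) (@cos_max R).
rewrite -/(ms 1 a w p) -/(mc 0 a w p) mc0E// mul0r sub0r.
move: (cos p * _) (ms _ _ _ _) => X Y /eqP; rewrite addrC subr_eq0 => /eqP h.
by rewrite mulrAC h; field.
Qed.

Lemma mc2E a w p : 0 < a -> mc 2 a w p = (2 * a)^-1 * (1 - w ^+ 2 / (2 * a)) * (cos p * J0 a w).
Proof.
move=> a0; have an0 : a != 0 by rewrite gt_eqF.
have := mc_ibp 1 w p a0 (@is_derive_cos R) _ (@cos_max R).
move=> /(_ _ _) T; have {T} : 1%:R * mc 0 a w p - 2 * a * mc 2 a w p + w * \int[leb]_x (x ^+ 1 * ga a x * - sin (w * x + p)) = 0.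
  by apply: T => x; [apply: cvgN; exact: continuous_sin|rewrite normrN sin_max].
have -> : \int[leb]_x (x ^+ 1 * ga a x * - sin (w * x + p)) = - ms 1 a w p.
  by rewrite /ms -RintN; [apply: eq_Rint => x; rewrite mulrN|exact: gs_itg].
rewrite mc0E// ms1E//; move: (cos p * _) (mc _ _ _ _) => X Y h.
have {}h : 2 * a * Y = X - w * (w / (2 * a) * X) by apply/eqP; rewrite -subr_eq0; apply/eqP; rewrite -[RHS]oppr0 -h; ring.
have -> : Y = (2 * a * Y) / (2 * a) by field.
by rewrite h; field.
Qed.
End gauss.

(** * Multipliers in real form and Fourier inversion *)

Section inversion.
Variable R : realType.
Local Notation leb := (@lebesgue_measure R).
Implicit Types (u : R * R -> R).

Definition gg (a b : R) (x : R * R) := ga a x.1 * ga b x.2.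

Lemma gg_ge0 a b x : 0 <= gg a b x. Proof. by rewrite mulr_ge0 ?ga_ge0. Qed.

Lemma gg_le1 a b x : 0 <= a -> 0 <= b -> gg a b x <= 1.
Proof.
move=> a0 b0; rewrite /gg /ga -expRD -[X in _ <= X]expR0 ler_expR.
by rewrite -opprD oppr_le0 addr_ge0// mulr_ge0 ?sqr_ge0.
Qed.

Lemma gg_cont a b : continuous (gg a b).
Proof. by apply: (@cont_tens _ (ga a) (ga b)); exact: ga_cont. Qed.

Lemma pow_gg_le k l a b (x : R * R) : 0 < a -> 0 < b ->
  `|x.1 ^+ k * x.2 ^+ l * gg a b x| <= (k`!%:R * expR (a^-1) * expR (- (1 * `|x.1|))) * (l`!%:R * expR (b^-1) * expR (- (1 * `|x.2|))).
Proof.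
move=> a0 b0; have h1 := pow_ga_le k x.1 a0; have h2 := pow_ga_le l x.2 b0.
rewrite /gg mulrACA !normrM !normrX (ger0_norm (ga_ge0 _ _)) (ger0_norm (ga_ge0 _ _)).
by apply: ler_pM => //; rewrite mulr_ge0 ?exprn_ge0 ?ga_ge0.
Qed.

Lemma pow_gg_cont k l a b : continuous (fun x : R * R => x.1 ^+ k * x.2 ^+ l * gg a b x).
Proof.
apply: contM2; last exact: gg_cont.
by apply: contM2; [apply: (@cont_fst _ (fun x : R => x ^+ k))|apply: (@cont_snd _ (fun x : R => x ^+ l))]; exact: exprn_continuous.
Qed.

Lemma pow_gg_itg k l a b : 0 < a -> 0 < b -> itg (leb2 R) (fun x => x.1 ^+ k * x.2 ^+ l * gg a b x).
Proof.
move=> a0 b0.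
apply: itg2_le (fun x => pow_gg_le k l x a0 b0) _.
  exact: continuous2_measurable (@pow_gg_cont k l a b).
have := itgZl (k`!%:R * expR (a^-1) * (l`!%:R * expR (b^-1))) (@expw_itg R 1 ltr01).
by under eq_fun do rewrite /expw mulrACA.
Qed.

Lemma gg_itg a b : 0 < a -> 0 < b -> itg (leb2 R) (gg a b).
Proof. by move=> a0 b0; have := pow_gg_itg 0 0 a0 b0; under eq_fun do rewrite !expr0 !mul1r. Qed.

Lemma gg_cos_fub k l a b (w : R * R) p : 0 < a -> 0 < b ->
  \int[leb2 R]_x (x.1 ^+ k * x.2 ^+ l * gg a b x * cos (dotp x w + p)) =
  \int[leb]_x \int[leb]_y ((x ^+ k * y ^+ l * gg a b (x, y)) * cos (dotp (x, y) w + p)) /\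
  \int[leb2 R]_x (x.1 ^+ k * x.2 ^+ l * gg a b x * cos (dotp x w + p)) =
  \int[leb]_y \int[leb]_x ((x ^+ k * y ^+ l * gg a b (x, y)) * cos (dotp (x, y) w + p)).
Proof.
move=> a0 b0.
have mF : measurable_fun setT (fun x : R * R => x.1 ^+ k * x.2 ^+ l * gg a b x * cos (dotp x w + p)).
  apply: measurable_funM; first exact: continuous2_measurable (@pow_gg_cont k l a b).
  apply: (measurableT_comp (@cos_meas R)); apply: measurable_funD; [exact: dotp_meas|exact: measurable_cst].
have FE (x y : R) : `|(x ^+ k * y ^+ l * gg a b (x, y)) * cos (dotp (x, y) w + p)| <= (k`!%:R * expR (a^-1) * expR (- (1 * `|x|))) * (l`!%:R * expR (b^-1) * expR (- (1 * `|y|))).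
  by rewrite normrM; apply: le_trans (pow_gg_le k l (x, y) a0 b0); rewrite ler_piMr// cos_max.
have ie c : itg leb (fun x => c * expR (- (1 * `|x|))) by apply: itgZl; exact: expR_abs_itg.
by split; [exact: (leb2_int12 mF (ie _) (ie _) FE)|exact: (leb2_int21 mF (ie _) (ie _) FE)].
Qed.

Lemma gg_cos1 k a b (w : R * R) p : 0 < a -> 0 < b ->
  \int[leb2 R]_x (x.1 ^+ k * gg a b x * cos (dotp x w + p)) = mc k a w.1 p * J0 b w.2.
Proof.
move=> a0 b0; have [E _] := gg_cos_fub k 0 w p a0 b0.
transitivity (\int[leb2 R]_x (x.1 ^+ k * x.2 ^+ 0 * gg a b x * cos (dotp x w + p))).
  by apply: eq_Rint => x; rewrite expr0 mulr1.
rewrite E /mc -(RintZr _ (gc_itg k _ _ a0)); apply: eq_Rint => x.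
rewrite -mulrA -(mc0E _ _ b0) /mc -(RintZl _ (gc_itg 0 _ _ b0)).
apply: eq_Rint => y; rewrite /gg /dotp/= expr0 mulr1 mul1r !mulrA; congr (_ * cos _).
by rewrite [w.1 * x]mulrC [w.2 * y]mulrC addrA [y * _ + _]addrC.
Qed.

Lemma gg_cos2 k a b (w : R * R) p : 0 < a -> 0 < b ->
  \int[leb2 R]_x (x.2 ^+ k * gg a b x * cos (dotp x w + p)) = mc k b w.2 p * J0 a w.1.
Proof.
move=> a0 b0; have [_ E] := gg_cos_fub 0 k w p a0 b0.
transitivity (\int[leb2 R]_x (x.1 ^+ 0 * x.2 ^+ k * gg a b x * cos (dotp x w + p))).
  by apply: eq_Rint => x; rewrite expr0 mul1r.
rewrite E /mc -(RintZr _ (gc_itg k _ _ b0)); apply: eq_Rint => x.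
rewrite -mulrA -(mc0E _ _ a0) /mc -(RintZl _ (gc_itg 0 _ _ a0)).
apply: eq_Rint => y; rewrite (_ : dotp (y, x) w + p = w.1 * y + (w.2 * x + p)); last by rewrite /dotp/=; ring.
by rewrite /gg/= expr0 !mul1r; move: (cos _) (ga a y) (ga b x) (x ^+ k) => A B C D; ring.
Qed.

Lemma gg_int k a : 0 < a ->
  [/\ \int[leb2 R]_x gg a a x = J0 a 0 ^+ 2,
      \int[leb2 R]_x (x.1 ^+ k * gg a a x) = mc k a 0 0 * J0 a 0 &
      \int[leb2 R]_x (x.2 ^+ k * gg a a x) = mc k a 0 0 * J0 a 0].
Proof.
move=> a0; have c1 (x : R * R) : cos (dotp x (0, 0) + 0) = 1 by rewrite /dotp/= !mulr0 !addr0 cos0.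
have h1 k' : \int[leb2 R]_x (x.1 ^+ k' * gg a a x) = mc k' a 0 0 * J0 a 0.
  by rewrite -(gg_cos1 k' (0, 0) 0 a0 a0); apply: eq_Rint => x; rewrite c1 mulr1.
split=> //.
  have := h1 0%N; rewrite mc0E// cos0 mul1r -expr2 => <-.
  by apply: eq_Rint => x; rewrite expr0 mul1r.
by rewrite -(gg_cos2 k (0, 0) 0 a0 a0); apply: eq_Rint => x; rewrite c1 mulr1.
Qed.

(* c4 * MI m u 0 is the Fourier multiplier of symbol m applied to u.  Shifting the
   phase p by pi / 2 accounts for the factor i of a derivative. *)
Definition MI (m u : R * R -> R) (p : R) (y : R * R) : R :=
  \int[leb2 R]_xi (m xi * (FC u xi * cos (dotp y xi + p) + FS u xi * sin (dotp y xi + p))).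

Lemma phase_fa u p (y xi : R * R) : `|FC u xi * cos (dotp y xi + p) + FS u xi * sin (dotp y xi + p)| <= fa u xi.
Proof.
apply: (le_trans (ler_normD _ _)); rewrite !normrM /fa lerD// ler_piMr// ?cos_max ?sin_max//.
Qed.

(** Fubini: a multiplier with integrable symbol is the convolution with the transform of its symbol.
    The symbols of the statement become integrable only after damping. *)
Lemma MI_swap_itg (m u : R * R -> R) p (y : R * R) : itg (leb2 R) u -> itg (leb2 R) m ->
  itg (leb2 R) (fun x => u x * \int[leb2 R]_xi (m xi * cos (dotp xi (y - x) + p))) /\
  MI m u p y = \int[leb2 R]_x (u x * \int[leb2 R]_xi (m xi * cos (dotp xi (y - x) + p))).
Proof.
move=> iu im.
pose F (z : (R * R) * (R * R)) := u z.1 * (m z.2 * cos (dotp y z.2 - dotp z.1 z.2 + p)).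
have md (z : R * R) : measurable_fun setT (fun xi : R * R => cos (dotp xi z + p)).
  by apply: (measurableT_comp (@cos_meas R)); apply: measurable_funD; [exact: dotp_meas|exact: measurable_cst].
have mF : measurable_fun setT F.
  apply: measurable_funM; first by apply: (measurableT_comp (itg_meas iu)).
  apply: measurable_funM; first by apply: (measurableT_comp (itg_meas im)).
  apply: (measurableT_comp (@cos_meas R)); apply: measurable_funD; last exact: measurable_cst.
  apply: measurable_funB; last exact: dotp_meas2.
  by under eq_fun do rewrite dotpC; apply: (@measurableT_comp _ _ _ _ _ _ (fun x : R * R => dotp x y)) => //; exact: dotp_meas.
have FE x xi : `|F (x, xi)| <= `|u x| * `|m xi|.
  by rewrite /F/= !normrM ler_wpM2l// ler_piMr// cos_max.
have E := fubini4 mF (itg_norm iu) (itg_norm im) FE.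
have E2 x : \int[leb2 R]_xi F (x, xi) = u x * \int[leb2 R]_xi (m xi * cos (dotp xi (y - x) + p)).
  rewrite /F/= -RintZl; last first.
    by apply: (itg_mul_bdd im (B := 1)); [|move=> xi; exact: cos_max].
  by apply: eq_Rint => xi; rewrite dotpBr ![dotp xi _]dotpC.
split.
  by have := fubini4_itg12 mF (itg_norm iu) (itg_norm im) FE; under eq_fun do rewrite E2.
transitivity (\int[leb2 R]_xi \int[leb2 R]_x F (x, xi)); last first.
  by rewrite -E; apply: eq_Rint => x; exact: E2.
rewrite /MI; apply: eq_Rint => xi; rewrite /FC /FS.
rewrite -(RintZr _ (cosd_itg xi iu)) -(RintZr _ (sind_itg xi iu)) -(RintD (itgZr _ (cosd_itg xi iu)) (itgZr _ (sind_itg xi iu))).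
rewrite -(RintZl _ (itgD (itgZr _ (cosd_itg xi iu)) (itgZr _ (sind_itg xi iu)))).
apply: eq_Rint => x; rewrite /F/= (_ : dotp y xi - dotp x xi + p = (dotp y xi + p) - dotp x xi) ?cosB; last by ring.
by move: (cos _) (sin _) (cos _) (sin _) => a b c d; ring.
Qed.

Lemma MI_swap (m u : R * R -> R) p (y : R * R) : itg (leb2 R) u -> itg (leb2 R) m ->
  MI m u p y = \int[leb2 R]_x (u x * \int[leb2 R]_xi (m xi * cos (dotp xi (y - x) + p))).
Proof. by move=> iu im; have [] := MI_swap_itg p y iu im. Qed.

Lemma coord_lip (f : R -> R) (B a b : R) : (forall x : R, derivable f x 1) -> (forall x, `|f^`()%classic x| <= B) ->
  `|f a - f b| <= B * `|a - b|.
Proof.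
move=> df fB; wlog ab : a b / a <= b.
  by move=> h; have [/h//|/ltW/h] := leP a b; rewrite distrC [`|b - a|]distrC.
have [c _ E] := @MVT_segment R f f^`()%classic a b ab (fun x _ => der1 (df x)) (continuous_subspaceT (derivable_cont df)).
by rewrite distrC E normrM [`|a - b|]distrC ler_wpM2r.
Qed.

Lemma edec_lip u : exp_decaying u -> exists2 L : R, 0 <= L & forall x y, `|u x - u y| <= L * enorm (x - y).
Proof.
move=> [su [a a0 h]]; have [C0 C00 h0] := h [:: ord0]; have [C1 C10 h1] := h [:: ord_max].
have w1 (z : R * R) : expw a z <= 1.
  have a1 := ltW a0; apply: (le_trans (expw_le _ a1)); by rewrite -[X in _ <= X]expR0 ler_expR oppr_le0 mulr_ge0 ?enorm_ge0.
have b0 z : `|partial ord0 u z| <= C0 by apply: (le_trans (h0 z)); rewrite ler_piMr.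
have b1 z : `|partial ord_max u z| <= C1 by apply: (le_trans (h1 z)); rewrite ler_piMr.
have d j y : derivable u y (evec R j) by exact: (@smooth_derivable _ u [::]).
exists (C0 + C1) => [|[x1 x2] [y1 y2]]; first exact: addr_ge0.
have l1 : `|u (x1, x2) - u (y1, x2)| <= C0 * `|x1 - y1|.
  apply: (@coord_lip (fun t => u (t, x2))) => t.
    by have := d ord0 (t, x2); rewrite derivable0E.
  by have := b0 (t, x2); rewrite partial0E.
have l2 : `|u (y1, x2) - u (y1, y2)| <= C1 * `|x2 - y2|.
  apply: (@coord_lip (fun t => u (y1, t))) => t.
    by have := d ord_max (y1, t); rewrite derivable1E.
  by have := b1 (y1, t); rewrite partial1E.
have n1 := enorm1_le ((x1, x2) - (y1, y2)); have n2 := enorm2_le ((x1, x2) - (y1, y2)).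
rewrite (_ : u _ - _ = (u (x1, x2) - u (y1, x2)) + (u (y1, x2) - u (y1, y2))); last by ring.
apply: (le_trans (ler_normD _ _)); rewrite mulrDl lerD//.
  by apply: (le_trans l1); rewrite ler_wpM2l.
by apply: (le_trans l2); rewrite ler_wpM2l.
Qed.

Lemma small_eq0 (x K : R) : (forall r, 0 < r -> r <= 1 -> `|x| <= K * r) -> x = 0.
Proof.
move=> h; apply/eqP; rewrite -normr_le0; apply/ler_addgt0Pr => e e0; rewrite add0r.
have K1 : 0 < `|K| + 1 by rewrite ltr_wpDl.
have := h (Num.min 1 (e / (`|K| + 1))); rewrite lt_min ltr01 divr_gt0// ge_min lexx => /(_ isT isT)/le_trans; apply.
apply: (@le_trans _ _ (`|K| * (e / (`|K| + 1)))).
  apply: (@le_trans _ _ (`|K| * Num.min 1 (e / (`|K| + 1)))).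
    by rewrite ler_wpM2r ?ler_norm// le_min ler01 ltW// divr_gt0.
  by rewrite ler_wpM2l// ge_min lexx orbT.
by rewrite mulrCA -[X in _ <= X]mulr1 ler_wpM2l ?(ltW e0)// ler_pdivrMr// mul1r lerDl.
Qed.

Lemma shift_int (G : R * R -> R) (g h : R -> R) (v : R * R) : continuous G -> continuous g -> continuous h ->
  itg leb g -> itg leb h -> (forall x, `|G x| <= g x.1 * h x.2) ->
  itg (leb2 R) (fun x => G (x - v)) /\ \int[leb2 R]_x G (x - v) = \int[leb2 R]_x G x.
Proof.
move=> cG cg ch ig ih GE.
have [h1 h2] := @subst_plane R G g h 1 1 (- v) ltr01 ltr01 cG cg ch ig ih GE.
have E (y : R * R) : (1 * y.1 + (- v).1, 1 * y.2 + (- v).2) = y - v by rewrite !mul1r.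
move: h1 h2; rewrite mul1r invr1 mul1r.
under eq_fun do rewrite E.
by move=> h1 h2; split=> //; rewrite -h2; apply: eq_Rint => y; rewrite E.
Qed.

Lemma gg_shift k l a b v : 0 < a -> 0 < b ->
  itg (leb2 R) (fun x => (x - v).1 ^+ k * (x - v).2 ^+ l * gg a b (x - v)) /\
  \int[leb2 R]_x ((x - v).1 ^+ k * (x - v).2 ^+ l * gg a b (x - v)) = \int[leb2 R]_x (x.1 ^+ k * x.2 ^+ l * gg a b x).
Proof.
move=> a0 b0.
have ie c : itg leb (fun x => c * expR (- (1 * `|x|))) by apply: itgZl; exact: expR_abs_itg.
have ce c : continuous (fun x : R => c * expR (- (1 * `|x|))).
  move=> x; apply: cvgM; first exact: cvg_cst.
  apply: (@continuous_comp _ _ _ (fun x : R => - (1 * `|x|)) expR); last exact: continuous_expR.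
  by apply: cvgN; apply: cvgM; [exact: cvg_cst|exact: norm_continuous].
exact: (@shift_int (fun x => x.1 ^+ k * x.2 ^+ l * gg a b x) _ _ v (@pow_gg_cont k l a b) (ce _) (ce _) (ie _) (ie _) (fun x => pow_gg_le k l x a0 b0)).
Qed.

Lemma amgm_bd (r e : R) : 0 < r -> e <= r + r^-1 * e ^+ 2.
Proof.
move=> r0; rewrite -(ler_pM2l r0) mulrDr mulrA divff ?gt_eqF// mul1r.
by have := sqr_ge0 (r - e); have := sqr_ge0 e; have := sqr_ge0 r; nra.
Qed.

(** The Gaussian-damped inversion integral is a convolution with a heat kernel of width about r, and
    [u] is Lipschitz. The first moment |x - y| is replaced by r + |x - y|^2 / r, whose Gaussian
    integral is explicit: the two terms contribute 4 and 16 to the constant 20. *)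
Lemma heat_approx u (y : R * R) (r L : R) : 0 < r -> 0 <= L -> itg (leb2 R) u ->
  (forall x y, `|u x - u y| <= L * enorm (x - y)) ->
  `|MI (gg (r ^+ 2) (r ^+ 2)) u 0 y - 4 * pi ^+ 2 * u y| <= 20 * pi ^+ 2 * L * r.
Proof.
move=> r0 L0 iu uL; have r20 : 0 < r ^+ 2 by rewrite exprn_gt0.
have rn0 : r != 0 by rewrite gt_eqF.
pose s := (4 * r ^+ 2)^-1; have s0 : 0 < s by rewrite invr_gt0 mulr_gt0.
rewrite (MI_swap _ _ iu (gg_itg r20 r20)).
have K x : \int[leb2 R]_xi (gg (r ^+ 2) (r ^+ 2) xi * cos (dotp xi (y - x) + 0)) = pi / r ^+ 2 * gg s s (x - y).
  transitivity (\int[leb2 R]_xi (xi.1 ^+ 0 * gg (r ^+ 2) (r ^+ 2) xi * cos (dotp xi (y - x) + 0))).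
    by apply: eq_Rint => xi; rewrite expr0 mul1r.
  rewrite (gg_cos1 0 _ _ r20 r20) mc0E// cos0 mul1r /J0 sqrtr_sqr gtr0_norm// /gg /ga.
  have E (t t' : R) : - ((t - t') ^+ 2 / (4 * r ^+ 2)) = - (s * (t' - t) ^+ 2) by rewrite /s; field.
  rewrite /= !E mulrACA -(mulrACA (Num.sqrt pi)) -expr2 sqr_sqrtr ?pi_ge0//.
  by congr (_ * _); congr (_ * _); field.
under eq_Rint do rewrite K.
have [g1 g2] := gg_shift 0 0 y s0 s0.
have {g1 g2} [ig0 Eg0] : itg (leb2 R) (fun x => gg s s (x - y)) /\ \int[leb2 R]_x gg s s (x - y) = \int[leb2 R]_x gg s s x.
  split; first by move: g1; under eq_fun do rewrite !expr0 !mul1r.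
  by move: g2; under eq_Rint do rewrite !expr0 !mul1r; under [X in _ = X -> _]eq_Rint do rewrite !expr0 !mul1r.
have [h1 h2] := gg_shift 2 0 y s0 s0.
have {h1 h2} [ig1 Eg1] : itg (leb2 R) (fun x => (x - y).1 ^+ 2 * gg s s (x - y)) /\ \int[leb2 R]_x ((x - y).1 ^+ 2 * gg s s (x - y)) = \int[leb2 R]_x (x.1 ^+ 2 * gg s s x).
  split; first by move: h1; under eq_fun do rewrite !expr0 !mulr1.
  by move: h2; under eq_Rint do rewrite !expr0 !mulr1; under [X in _ = X -> _]eq_Rint do rewrite !expr0 !mulr1.
have [h1 h2] := gg_shift 0 2 y s0 s0.
have {h1 h2} [ig2 Eg2] : itg (leb2 R) (fun x => (x - y).2 ^+ 2 * gg s s (x - y)) /\ \int[leb2 R]_x ((x - y).2 ^+ 2 * gg s s (x - y)) = \int[leb2 R]_x (x.2 ^+ 2 * gg s s x).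
  split; first by move: h1; under eq_fun do rewrite !expr0 !mul1r.
  by move: h2; under eq_Rint do rewrite !expr0 !mul1r; under [X in _ = X -> _]eq_Rint do rewrite !expr0 !mul1r.
have [I0 I1 I2] := gg_int 2 s0.
have Js : J0 s 0 ^+ 2 = pi / s.
  by rewrite /J0 expr0n/= mul0r oppr0 expR0 mulr1 exprMn exprVn !sqr_sqrtr ?pi_ge0// ltW.
have M2 : mc 2 s 0 0 * J0 s 0 = (2 * s)^-1 * (pi / s).
  by rewrite mc2E// cos0 mul1r expr0n/= mul0r subr0 mulr1 -mulrA -expr2 Js.
move: I0 I1 I2; rewrite M2 Js => I0 I1 I2.
have mu := itg_meas iu.
have p0 : 0 <= pi / r ^+ 2 by rewrite divr_ge0 ?pi_ge0 ?sqr_ge0.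
have iug : itg (leb2 R) (fun x => u x * (pi / r ^+ 2 * gg s s (x - y))).
  apply: (itg_mul_bdd iu (B := pi / r ^+ 2)); first exact: itg_meas (itgZl _ ig0).
  move=> x; rewrite (normrM (pi / _)) (ger0_norm p0) (ger0_norm (gg_ge0 _ _ _)).
  by apply: ler_piMr p0 _; apply: gg_le1; exact: ltW.
have -> : 4 * pi ^+ 2 * u y = \int[leb2 R]_x (u y * (pi / r ^+ 2) * gg s s (x - y)).
  by rewrite (RintZl _ ig0) Eg0 I0 /s; field.
rewrite -(RintB iug (itgZl _ ig0)).
have -> : 20 * pi ^+ 2 * L * r = \int[leb2 R]_x (pi / r ^+ 2 * L * (r * gg s s (x - y) + r^-1 * ((x - y).1 ^+ 2 * gg s s (x - y) + (x - y).2 ^+ 2 * gg s s (x - y)))).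
  rewrite (RintZl _ (itgD (itgZl _ ig0) (itgZl _ (itgD ig1 ig2)))) (RintD (itgZl _ ig0) (itgZl _ (itgD ig1 ig2))) (RintZl _ ig0) (RintZl _ (itgD ig1 ig2)) (RintD ig1 ig2).
  by rewrite Eg0 Eg1 Eg2 I0 I1 I2 /s; field.
apply: (@Rint_bound _ _ _ (leb2 R)).
- exact: itg_meas (itgB iug (itgZl _ ig0)).
- exact: itgZl _ (itgD (itgZl _ ig0) (itgZl _ (itgD ig1 ig2))).
move=> x; have g0 := gg_ge0 s s (x - y).
have -> : u x * (pi / r ^+ 2 * gg s s (x - y)) - u y * (pi / r ^+ 2) * gg s s (x - y) = (pi / r ^+ 2) * ((u x - u y) * gg s s (x - y)) by ring.
rewrite (normrM (pi / _)) (ger0_norm p0) -mulrA; apply: (ler_wpM2l p0); rewrite (normrM (_ - _)) (ger0_norm g0).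
have -> : L * (r * gg s s (x - y) + r^-1 * ((x - y).1 ^+ 2 * gg s s (x - y) + (x - y).2 ^+ 2 * gg s s (x - y))) = L * (r + r^-1 * enorm (x - y) ^+ 2) * gg s s (x - y).
  by rewrite enorm2; ring.
exact: ler_wpM2r g0 _ _ (le_trans (uL _ _) (ler_wpM2l L0 (amgm_bd _ r0))).
Qed.

(** Removing the damping costs at most r^2 times the integral of [om * fa u], and [heat_approx]
    costs a multiple of r; the difference is therefore smaller than any such multiple. *)
Lemma inversion u y : exp_decaying u -> MI (fun=> 1) u 0 y = 4 * pi ^+ 2 * u y.
Proof.
move=> eu; have [L L0 uL] := edec_lip eu; have iu := edec_itg eu.
have [B B0 hB] := om_fa 3 eu.
have [cC cS] := edec_fcont eu.
have [Bw Bw0 hBw] := fa_W eu.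
have cfa := fa_cont cC cS.
have ifa : itg (leb2 R) (fa u).
  apply: itg2_le (itgZl Bw (@W_itg R)); first exact: continuous2_measurable.
  by move=> x; rewrite ger0_norm ?fa_ge0.
have mm p : measurable_fun setT (fun xi => FC u xi * cos (dotp y xi + p) + FS u xi * sin (dotp y xi + p)).
  have md : measurable_fun setT (fun xi : R * R => dotp y xi + p).
    by under eq_fun do rewrite dotpC; apply: measurable_funD; [exact: dotp_meas|exact: measurable_cst].
  apply: measurable_funD; apply: measurable_funM; try exact: continuous2_measurable.
    exact: (measurableT_comp (@cos_meas R)).
  exact: (measurableT_comp (@sin_meas R)).
have ifW : itg (leb2 R) (fun xi => B * (3 * W xi)) by apply: itgZl; apply: itgZl; exact: W_itg.
have iM (m : R * R -> R) (b : R) : measurable_fun setT m -> (forall x, `|m x| <= b) ->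
    itg (leb2 R) (fun xi => m xi * (FC u xi * cos (dotp y xi + 0) + FS u xi * sin (dotp y xi + 0))).
  move=> meas_m mb; under eq_fun do rewrite mulrC; apply: itg_mul_bdd => //.
  by apply: itg2_le ifa => // xi; exact: phase_fa.
apply/eqP; rewrite -subr_eq0; apply/eqP; apply: (@small_eq0 _ (\int[leb2 R]_xi (B * (3 * W xi)) + 20 * pi ^+ 2 * L)) => r r0 r1.
rewrite (_ : MI _ _ _ _ - _ = (MI (fun=> 1) u 0 y - MI (gg (r ^+ 2) (r ^+ 2)) u 0 y) + (MI (gg (r ^+ 2) (r ^+ 2)) u 0 y - 4 * pi ^+ 2 * u y)); last by ring.
apply: (le_trans (ler_normD _ _)); rewrite [X in _ <= X]mulrDl; apply: lerD; last exact: heat_approx.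
have i1 : itg (leb2 R) (fun xi => 1 * (FC u xi * cos (dotp y xi + 0) + FS u xi * sin (dotp y xi + 0))).
  by apply: (iM (fun=> 1) 1) => // x; rewrite normr1.
have g1 x : gg (r ^+ 2) (r ^+ 2) x <= 1 by rewrite gg_le1// sqr_ge0.
have i2 : itg (leb2 R) (fun xi => gg (r ^+ 2) (r ^+ 2) xi * (FC u xi * cos (dotp y xi + 0) + FS u xi * sin (dotp y xi + 0))).
  apply: (iM _ 1) => [|x]; first exact: continuous2_measurable (@gg_cont _ _).
  by rewrite ger0_norm ?gg_ge0.
rewrite /MI -(RintB i1 i2).
have ub : \int[leb2 R]_xi (r ^+ 2 * (B * (3 * W xi))) <= (\int[leb2 R]_xi (B * (3 * W xi))) * r.
  rewrite (RintZl _ ifW) mulrC ler_wpM2l//.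
    by apply: Rint_ge0 => x; apply: mulr_ge0 => //; apply: mulr_ge0 => //; exact: W_ge0.
  by rewrite expr2 ler_piMr// ltW.
apply: le_trans ub; apply: (@Rint_bound _ _ _ (leb2 R)).
- exact: itg_meas (itgB i1 i2).
- exact: itgZl.
move=> xi; rewrite -mulrBl normrM ger0_norm ?subr_ge0//.
(* Plain convexity, 1 - e^{-s} <= s. *)
have h1 : 1 - gg (r ^+ 2) (r ^+ 2) xi <= r ^+ 2 * om xi.
  rewrite /gg /ga -expRD; have := expR_ge1Dx (- (r ^+ 2 * xi.1 ^+ 2) + - (r ^+ 2 * xi.2 ^+ 2)).
  rewrite /om; have : 0 <= r ^+ 2 by rewrite sqr_ge0.
  by move: (expR _) => e; nra.
apply: (@le_trans _ _ (r ^+ 2 * om xi * fa u xi)).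
  by apply: ler_pM => //; [rewrite subr_ge0|exact: phase_fa].
rewrite -mulrA ler_wpM2l ?sqr_ge0//.
have o0 : 0 < om xi ^+ 2 by rewrite exprn_gt0 ?om_gt0.
apply: (@le_trans _ _ (B * om xi ^- 2)); last by rewrite ler_wpM2l ?om2_W.
by rewrite ler_pdivlMr// mulrC mulrA -exprSr.
Qed.
End inversion.

(** * Weighted sup norms of the transforms, uniformly in the velocity *)

Section wiener.
Variable R : realType.
Local Notation leb := (@lebesgue_measure R).
Implicit Types (w : R * R -> R).

(** Three copies of the weight [om] and one of its square give om^5 g^4 <= s^4, and [W_om] turns
    om^{-5} into W^4. The result is an integrable majorant of [g] whose size is (m1^3 m2)^{1/4}. *)
Lemma interp (g : R * R -> R) (m1 m2 s : R) : (forall x, 0 <= g x) -> 0 <= s ->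
  (forall x, om x ^+ 1 * g x <= m1) -> (forall x, om x ^+ 2 * g x <= m2) -> m1 ^+ 3 * m2 <= s ^+ 4 ->
  forall x, g x <= 3 * s * W x.
Proof.
move=> g0 s0 h1 h2 hs x; have o0 := om_gt0 x; have w0 := W_ge0 x.
rewrite -(@ler_pXn2r _ 4)//; [|by rewrite nnegrE|by rewrite nnegrE; apply: mulr_ge0 => //; apply: mulr_ge0].
have o1 : 0 <= om x ^+ 1 * g x by rewrite mulr_ge0 ?exprn_ge0// ltW.
have o2 : 0 <= om x ^+ 2 * g x by rewrite mulr_ge0 ?exprn_ge0// ltW.
have E : om x ^+ 5 * g x ^+ 4 = (om x ^+ 1 * g x) ^+ 3 * (om x ^+ 2 * g x) by ring.
have h : om x ^+ 5 * g x ^+ 4 <= s ^+ 4.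
  rewrite E; apply: le_trans hs; apply: ler_pM => //; first exact: exprn_ge0.
  by rewrite lerXn2r// nnegrE// (le_trans o1).
have o5 : 0 < om x ^+ 5 by rewrite exprn_gt0.
move: h; rewrite -ler_pdivlMl// => /le_trans; apply.
have hW := W_om x; have s4 : 0 <= s ^+ 4 by rewrite exprn_ge0.
apply: (le_trans (ler_wpM2r s4 hW)); move: (W x) w0 => w w0.
rewrite [X in _ <= X](_ : _ = 81 * (w ^+ 4 * s ^+ 4)); last by ring.
by rewrite -mulrA ler_wpM2r ?mulr_ge0 ?exprn_ge0// ler_nat.
Qed.

Lemma h_om_arith (A M a b F X : R) : 0 <= A -> 0 <= M -> X = a + b ->
  2 * A * (8 * A * M * X * a + M * F) + 2 * A * (8 * A * M * X * b + M * F) <= 4 * A * M * (8 * A * X ^+ 2 + F).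
Proof.
move=> A0 M0 ->; rewrite -subr_ge0 (_ : _ - _ = 16 * (A * A * M * (a + b) ^+ 2)); last by ring.
have AM := mulr_ge0 (mulr_ge0 A0 A0) M0; have ab := sqr_ge0 (a + b).
by apply: mulr_ge0 => //; exact: mulr_ge0.
Qed.

Lemma f_arith (m X s4 : R) : 0 <= s4 -> (8 * 4 ^+ 1 * m * X) ^+ 3 = (8 * 4) ^+ 3 * (m ^+ 3 * X ^+ 3) /\
  (8 * 4 : R) ^+ 3 * (8 * 4 ^+ 2) * (X ^+ 4 * s4) <= (64 * X) ^+ 4 * s4.
Proof.
move=> h; split; first by rewrite expr1 !exprMn -!mulrA.
have -> : (64 : R) = 2 * (8 * 4) by rewrite -!natrM.
have -> : (8 * 4 ^+ 2 : R) = 8 * 4 * 4 by rewrite expr2 mulrA.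
have : 0 <= (8 * 4 : R) by rewrite -natrM.
move: (8 * 4 : R) => a a0; rewrite -subr_ge0 (_ : _ - _ = 12 * (a ^+ 4 * X ^+ 4 * s4)); last by ring.
have A4 : 0 <= a ^+ 4 by rewrite exprn_ge0.
have X4 : 0 <= X ^+ 4 by rewrite exprn_even_ge0.
by apply: mulr_ge0 => //; apply: mulr_ge0 => //; exact: mulr_ge0.
Qed.

Lemma le_1Dsqr (Y : R) : Y <= 1 + Y ^+ 2.
Proof. by have := sqr_ge0 (Y - 1); have := sqr_ge0 Y; rewrite sqrrB; nra. Qed.

Lemma XF_arith (F X s w : R) : 0 <= s -> 0 <= w -> X <= 3 * s * w -> F <= 3 * (64 * X * s) * w -> F <= 24 ^+ 2 * w ^+ 2 * s ^+ 2.
Proof.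
by move=> s0 w0 hX hF; have := ler_wpM2l (mulr_ge0 s0 w0) hX; lra.
Qed.

Lemma pi2_ge : 16 <= (2 * pi) ^+ 2 :> R.
Proof.
have := @pi_ge2 R; move: (pi : R) => p h; have -> : (16 : R) = (2 * 2) ^+ 2 by rewrite -natrM -natrX.
by rewrite lerXn2r// ?nnegrE ?mulr_ge0 ?(le_trans _ h)// ler_wpM2l.
Qed.

Definition c4 : R := ((2 * pi) ^+ 2)^-1.

Lemma c4_ge0 : 0 <= c4. Proof. by rewrite invr_ge0 sqr_ge0. Qed.

Lemma c4_le : c4 <= 1 / 16.
Proof. by rewrite /c4 div1r lef_pV2 ?posrE ?pi2_ge//; exact: lt_le_trans pi2_ge. Qed.

Lemma c4pi : c4 * (4 * pi ^+ 2) = 1.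
Proof. rewrite /c4; have := @pi_gt0 R; move: (pi : R) => p p0; field; by rewrite gt_eqF. Qed.

Lemma fa_itg w : exp_decaying w -> itg (leb2 R) (fa w).
Proof.
move=> ew; have [B B0 h] := fa_W ew; have [cC cS] := edec_fcont ew.
apply: itg2_le (itgZl B (@W_itg R)); first by apply: continuous2_measurable; exact: fa_cont.
by move=> x; rewrite ger0_norm ?fa_ge0.
Qed.

Lemma mult_itg (m w : R * R -> R) (B p : R) y : exp_decaying w -> measurable_fun setT m -> (forall x, `|m x| <= B) ->
  itg (leb2 R) (fun xi => m xi * (FC w xi * cos (dotp y xi + p) + FS w xi * sin (dotp y xi + p))).
Proof.
move=> ew mm mB; have [cC cS] := edec_fcont ew.
under eq_fun do rewrite mulrC; apply: itg_mul_bdd mB => //.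
apply: itg2_le (fa_itg ew) => [|xi]; last exact: phase_fa.
have md : measurable_fun setT (fun xi : R * R => dotp y xi + p).
  by under eq_fun do rewrite dotpC; apply: measurable_funD; [exact: dotp_meas|exact: measurable_cst].
apply: measurable_funD; apply: measurable_funM; try exact: continuous2_measurable.
  exact: (measurableT_comp (@cos_meas R)).
exact: (measurableT_comp (@sin_meas R)).
Qed.

(** Inversion writes [w] as the multiplier of symbol 1, so [w] plus a multiplier is a single
    synthesis; [N] enters the product estimate in this form. *)
Lemma MI_synth (sg w : R * R -> R) y : exp_decaying w -> measurable_fun setT sg -> (forall x, `|sg x| <= 1) ->
  w y + c4 * MI sg w 0 y = synth (fun xi => c4 * (1 + sg xi) * FC w xi) (fun xi => c4 * (1 + sg xi) * FS w xi) y.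
Proof.
move=> ew ms s1; have I1 := inversion y ew.
have i1 : itg (leb2 R) (fun xi => 1 * (FC w xi * cos (dotp y xi + 0) + FS w xi * sin (dotp y xi + 0))).
  by apply: (@mult_itg (fun=> 1) w 1) => // x; rewrite normr1.
have i2 := mult_itg 0 y ew ms s1.
have -> : w y = c4 * MI (fun=> 1) w 0 y by rewrite I1 mulrA c4pi mul1r.
rewrite -mulrDr /MI -(RintD i1 i2) -(RintZl _ (itgD i1 i2)) /synth.
by apply: eq_Rint => xi; rewrite addr0; ring.
Qed.

Lemma edec_synth w y : exp_decaying w -> w y = synth (fun xi => c4 * FC w xi) (fun xi => c4 * FS w xi) y.
Proof.
move=> ew; have z1 (x : R * R) : `|(0 : R)| <= 1 by rewrite normr0.
have := @MI_synth (fun=> 0) w y ew (measurable_cst _) z1.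
rewrite (_ : MI (fun=> 0) w 0 y = 0) ?mulr0 ?addr0.
  by move=> ->; rewrite /synth; apply: eq_Rint => xi; rewrite mulr1.
by rewrite /MI -[RHS](@Rint0 _ _ _ (leb2 R)); apply: eq_Rint => x; rewrite mul0r.
Qed.

(** One of the two factors is written as a synthesis by inversion, so that [prod_om] applies to the
    square. *)
Lemma sq_om k w (Mk : R) : exp_decaying w -> (forall x, om x ^+ k * fa w x <= Mk) -> forall xi,
  om xi ^+ k * fa (fun x => w x * w x) xi <= 4 * 4 ^+ k * Mk * \int[leb2 R]_x fa w x.
Proof.
move=> ew hM xi; have [cC cS] := edec_fcont ew; have [B B0 hB] := fa_W ew.
have Pf x : `|c4 * FC w x| + `|c4 * FS w x| <= fa w x.
  rewrite !normrM -mulrDr -/(fa w x) ler_piMl ?fa_ge0// ger0_norm ?c4_ge0//.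
  by apply: (le_trans c4_le); rewrite ler_pdivrMr// mul1r ler1n.
have oo (x : R * R) : 0 <= om x ^+ k by rewrite exprn_ge0// ltW// om_gt0.
have m1 : measurable_fun setT (fun x => c4 * FC w x).
  by apply: measurable_funM => //; exact: continuous2_measurable.
have m2 : measurable_fun setT (fun x => c4 * FS w x).
  by apply: measurable_funM => //; exact: continuous2_measurable.
have hW x : `|c4 * FC w x| + `|c4 * FS w x| <= B * W x := le_trans (Pf x) (hB x).
have hP x : om x ^+ k * (`|c4 * FC w x| + `|c4 * FS w x|) <= Mk.
  by apply: le_trans (hM x); apply: ler_wpM2l.
have M0 : 0 <= Mk by apply: le_trans (hM 0); rewrite mulr_ge0 ?fa_ge0.
have := prod_om xi (edec_itg ew) m1 m2 hW cC cS hB hP hM.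
rewrite (_ : (fun x => synth _ _ x * w x) = (fun x => w x * w x)); last first.
  by apply/funext => x; rewrite -edec_synth.
move=> /le_trans; apply.
have iP := prod_pq_itg (edec_itg ew) m1 m2 hW.
have X2 : \int[leb2 R]_x (`|c4 * FC w x| + `|c4 * FS w x|) <= \int[leb2 R]_x fa w x.
  exact: (@le_Rint _ _ _ (leb2 R)) iP (fa_itg ew) Pf.
have p4 : 0 <= 4 ^+ k :> R by rewrite exprn_ge0.
rewrite -mulrDr mulrA; have c0 : 0 <= 2 * 4 ^+ k * Mk by rewrite !mulr_ge0.
apply: (le_trans (ler_wpM2l c0 (lerD (lexx _) X2))).
by rewrite le_eqVlt; apply/orP; left; apply/eqP; ring.
Qed.

Section system.
Variables (u v f N sg : R * R -> R).
Hypotheses (eu : exp_decaying u) (ev : exp_decaying v) (ef : exp_decaying f).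
Hypothesis fE : forall x, f x = u x * u x + v x * v x.
Hypotheses (ms : measurable_fun setT sg) (s1 : forall x, `|sg x| <= 1).
Hypothesis NE : forall y, N y = - f y - c4 * MI sg f 0 y.
Let X := \int[leb2 R]_x fa u x + \int[leb2 R]_x fa v x.
Let XF := \int[leb2 R]_x fa f x.
Let h x := fa u x + fa v x.

Lemma fa_f_le xi : fa f xi <= fa (fun x => u x * u x) xi + fa (fun x => v x * v x) xi.
Proof using All.
have iu : itg (leb2 R) (fun x => u x * u x).
  apply: itg2_le (edec_itg ef).
    by apply: measurable_funM; exact: itg_meas (edec_itg eu).
  by move=> x; rewrite fE ger0_norm -?expr2 ?sqr_ge0// lerDl sqr_ge0.
have iv : itg (leb2 R) (fun x => v x * v x).
  apply: itg2_le (edec_itg ef).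
    by apply: measurable_funM; exact: itg_meas (edec_itg ev).
  by move=> x; rewrite fE ger0_norm -?expr2 ?sqr_ge0// lerDr sqr_ge0.
have E1 : FC f xi = FC (fun x => u x * u x) xi + FC (fun x => v x * v x) xi.
  by rewrite /FC -(RintD (cosd_itg _ iu) (cosd_itg _ iv)); apply: eq_Rint => x; rewrite fE mulrDl.
have E2 : FS f xi = FS (fun x => u x * u x) xi + FS (fun x => v x * v x) xi.
  by rewrite /FS -(RintD (sind_itg _ iu) (sind_itg _ iv)); apply: eq_Rint => x; rewrite fE mulrDl.
rewrite /fa E1 E2 addrACA; apply: lerD; exact: ler_normD.
Qed.

Lemma X_ge w : exp_decaying w -> 0 <= \int[leb2 R]_x fa w x.
Proof. by move=> ew; apply: Rint_ge0 => x; exact: fa_ge0. Qed.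

Lemma f_om k (Mk : R) : (forall x, om x ^+ k * h x <= Mk) -> forall xi, om xi ^+ k * fa f xi <= 8 * 4 ^+ k * Mk * X.
Proof using All.
move=> hM xi; have oo (x : R * R) : 0 <= om x ^+ k by rewrite exprn_ge0// ltW// om_gt0.
have hu x : om x ^+ k * fa u x <= Mk by apply: le_trans (hM x); apply: ler_wpM2l => //; rewrite lerDl fa_ge0.
have hv x : om x ^+ k * fa v x <= Mk by apply: le_trans (hM x); apply: ler_wpM2l => //; rewrite lerDr fa_ge0.
apply: (le_trans (ler_wpM2l (oo xi) (fa_f_le xi))); rewrite mulrDr.
apply: (le_trans (lerD (sq_om eu hu xi) (sq_om ev hv xi))); rewrite -mulrDr -/X.
have M0 : 0 <= Mk by apply: le_trans (hu 0); rewrite mulr_ge0 ?fa_ge0.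
have X0 : 0 <= X by rewrite addr_ge0 ?X_ge.
by rewrite -!mulrA ler_wpM2r ?mulr_ge0 ?exprn_ge0// ler_nat.
Qed.

(** The equation reads (1 - Delta) w = - N w, so one power of [om] is gained from a bound on the
    product. The coefficients of N are dominated by [fa f] because [c4 <= 1 / 16] and |1 + sg| <=
    2. *)
Lemma N_om k w (Mk Fk : R) : exp_decaying w -> (forall y, laplacian w y = (1 + N y) * w y) ->
  (forall x, om x ^+ k * fa w x <= Mk) -> (forall x, om x ^+ k * fa f x <= Fk) ->
  forall xi, om xi ^+ k.+1 * fa w xi <= 2 * 4 ^+ k * (Fk * \int[leb2 R]_x fa w x + Mk * XF).
Proof using All.
move=> ew lw hM hF xi; have [cC cS] := edec_fcont ew; have [B B0 hB] := fa_W ew.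
have [cCf cSf] := edec_fcont ef; have [Bf Bf0 hBf] := fa_W ef.
pose p xi := c4 * (1 + sg xi) * FC f xi; pose q xi := c4 * (1 + sg xi) * FS f xi.
have Pf x : `|p x| + `|q x| <= fa f x.
  rewrite /p /q !(normrM (c4 * _)) -mulrDr -/(fa f x) ler_piMl ?fa_ge0// normrM (ger0_norm c4_ge0).
  apply: (@le_trans _ _ (1 / 16 * 2)); last by lra.
  apply: ler_pM => //; [exact: c4_ge0|exact: c4_le|].
  by apply: (le_trans (ler_normD _ _)); rewrite normr1; have := s1 x; lra.
have oo (x : R * R) : 0 <= om x ^+ k by rewrite exprn_ge0// ltW// om_gt0.
have mc : measurable_fun setT (fun x => c4 * (1 + sg x)).
  by apply: measurable_funM => //; apply: measurable_funD.
have mp : measurable_fun setT p by apply: measurable_funM => //; exact: continuous2_measurable.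
have mq : measurable_fun setT q by apply: measurable_funM => //; exact: continuous2_measurable.
have hW x : `|p x| + `|q x| <= Bf * W x := le_trans (Pf x) (hBf x).
have hP x : om x ^+ k * (`|p x| + `|q x|) <= Fk.
  by apply: le_trans (hF x); apply: ler_wpM2l.
have M0 : 0 <= Mk by apply: le_trans (hM 0); rewrite mulr_ge0 ?fa_ge0.
have := prod_om xi (edec_itg ew) mp mq hW cC cS hB hP hM.
have -> : (fun x => synth p q x * w x) = (fun y => w y - laplacian w y).
  by apply/funext => x; rewrite lw NE /p /q -MI_synth//; ring.
have [E1 E2] := FC_lap xi ew.
have -> : fa (fun y => w y - laplacian w y) xi = om xi * fa w xi.
  by rewrite /fa -E1 -E2 !normrM -mulrDr ger0_norm// ltW// om_gt0.
rewrite mulrA -exprSr => /le_trans; apply.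
apply: ler_wpM2l; first by rewrite mulr_ge0 ?exprn_ge0.
rewrite lerD2l; apply: ler_wpM2l => //.
exact: (@le_Rint _ _ _ (leb2 R)) (prod_pq_itg (edec_itg ew) mp mq hW) (fa_itg ef) Pf.
Qed.

Hypotheses (lu : forall y, laplacian u y = (1 + N y) * u y) (lv : forall y, laplacian v y = (1 + N y) * v y).

Lemma h_om k (Mk : R) : (forall x, om x ^+ k * h x <= Mk) ->
  forall xi, om xi ^+ k.+1 * h xi <= 4 * 4 ^+ k * Mk * (8 * 4 ^+ k * X ^+ 2 + XF).
Proof using All.
move=> hM xi; have oo (x : R * R) : 0 <= om x ^+ k by rewrite exprn_ge0// ltW// om_gt0.
have hu x : om x ^+ k * fa u x <= Mk by apply: le_trans (hM x); apply: ler_wpM2l => //; rewrite lerDl fa_ge0.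
have hv x : om x ^+ k * fa v x <= Mk by apply: le_trans (hM x); apply: ler_wpM2l => //; rewrite lerDr fa_ge0.
have hF := f_om hM.
have := lerD (N_om eu lu hu hF xi) (N_om ev lv hv hF xi); move=> h2; rewrite mulrDr; apply: (le_trans h2).
have p4 : 0 <= 4 ^+ k :> R by rewrite exprn_ge0.
have M0 : 0 <= Mk by apply: le_trans (hu 0); rewrite mulr_ge0 ?fa_ge0.
exact: h_om_arith.
Qed.

(** This is the absorption step. With [m2] the supremum of om^2 h and s^4 = m1^3 m2, interpolation
    bounds [X] by s and [XF] by X s, hence both X^2 and XF by multiples of s^2; [h_om] at k = 1
    bounds m2 by a multiple of m1 (X^2 + XF). So s^4 <= D s^2, where D depends on [m1] only. *)
Lemma XXF_bound (m1 : R) : (forall x, om x ^+ 1 * h x <= m1) ->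
  let D := 24 ^+ 3 * m1 ^+ 4 * (\int[leb2 R]_x W x) ^+ 2 in
  X ^+ 2 <= 9 * (\int[leb2 R]_x W x) ^+ 2 * D /\ XF <= 24 ^+ 2 * (\int[leb2 R]_x W x) ^+ 2 * D.
Proof using All.
move=> hm1; set Wi := \int[leb2 R]_x W x; move=> D.
have h0 x : 0 <= h x by rewrite addr_ge0 ?fa_ge0.
have o0 k (x : R * R) : 0 <= om x ^+ k by rewrite exprn_ge0// ltW// om_gt0.
have [Bu Bu0 hBu] := om_fa 2 eu; have [Bv Bv0 hBv] := om_fa 2 ev.
pose S := [set om x ^+ 2 * h x | x in [set: R * R]].
have S0 : S !=set0 by exists (om 0 ^+ 2 * h 0); exists 0.
have Sub : has_ubound S by exists (Bu + Bv) => _ [x _ <-]; rewrite mulrDr lerD.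
pose m2 := sup S.
have hm2 x : om x ^+ 2 * h x <= m2 by apply: ub_le_sup => //; exists x.
have m20 : 0 <= m2 by apply: le_trans (hm2 0); rewrite mulr_ge0.
have m10 : 0 <= m1 by apply: le_trans (hm1 0); rewrite mulr_ge0.
pose s := Num.sqrt (Num.sqrt (m1 ^+ 3 * m2)).
have s0 : 0 <= s := sqrtr_ge0 _.
have s4 : s ^+ 4 = m1 ^+ 3 * m2.
  by rewrite (exprM _ 2 2) /s !sqr_sqrtr ?sqrtr_ge0// mulr_ge0// exprn_ge0.
have hW := interp h0 s0 hm1 hm2 (eq_ind_r (fun z => z <= _) (lexx _) (esym s4)).
have Wi0 : 0 <= Wi by apply: Rint_ge0 => x; exact: W_ge0.
have XE : X = \int[leb2 R]_x h x by rewrite /X -(RintD (fa_itg eu) (fa_itg ev)).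
have X0 : 0 <= X by rewrite addr_ge0 ?X_ge.
have hX : X <= 3 * s * Wi.
  rewrite XE -(RintZl _ (@W_itg R)); apply: (@le_Rint _ _ _ (leb2 R)) => //.
    exact: itgD (fa_itg eu) (fa_itg ev).
  by apply: itgZl; exact: W_itg.
have F1 := f_om hm1; have F2 := f_om hm2.
have sX : 0 <= 64 * X * s by rewrite !mulr_ge0.
have hF : XF <= 3 * (64 * X * s) * Wi.
  rewrite /XF -(RintZl _ (@W_itg R)); apply: (@le_Rint _ _ _ (leb2 R)).
  - exact: fa_itg.
  - by apply: itgZl; exact: W_itg.
  (* The bounds for [f] carry an extra factor X in each weight: (32 m1 X)^3 (128 m2 X) <= (64 X
     s)^4. *)
  apply: (interp (fun x => fa_ge0 f x) sX F1 F2).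
  have s40 : 0 <= s ^+ 4 by rewrite exprn_ge0.
  have [E1 E2] := @f_arith m1 X _ s40; rewrite E1 [X in _ <= X]exprMn; apply: le_trans E2.
  rewrite s4 le_eqVlt; apply/orP; left; apply/eqP.
  by move: ((8 * 4) ^+ 3) (8 * 4 ^+ 2) => A B; ring.
have XX : X ^+ 2 <= 9 * Wi ^+ 2 * s ^+ 2.
  have : X ^+ 2 <= (3 * s * Wi) ^+ 2 by rewrite lerXn2r// nnegrE// !mulr_ge0.
  by move=> /le_trans; apply; rewrite le_eqVlt; apply/orP; left; apply/eqP; ring.
have XFX : XF <= 24 ^+ 2 * Wi ^+ 2 * s ^+ 2.
  exact: XF_arith hX hF.
have hm2' : m2 <= 4 * 4 ^+ 1 * m1 * (8 * 4 ^+ 1 * X ^+ 2 + XF).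
  by apply: ge_sup => // _ [x _ <-]; exact: h_om hm1 x.
have sD : s ^+ 2 <= D.
  (* Dividing by s^2 requires it to be nonzero; the constant 24^3 is 16 (32 * 9 + 24^2). *)
  have [->|sn0] := eqVneq (s ^+ 2) 0; first by rewrite /D !mulr_ge0 ?sqr_ge0 ?exprn_ge0.
  have sp : 0 < s ^+ 2 by rewrite lt_neqAle eq_sym sn0 sqr_ge0.
  rewrite -(ler_pM2r sp) -exprD s4 /D.
  have : m1 ^+ 3 * m2 <= m1 ^+ 3 * (16 * m1 * (32 * (9 * Wi ^+ 2 * s ^+ 2) + 24 ^+ 2 * Wi ^+ 2 * s ^+ 2)).
    apply: ler_wpM2l; first exact: exprn_ge0.
    apply: (le_trans hm2'); rewrite expr1 -!natrM; apply: ler_wpM2l; first by rewrite mulr_ge0.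
    by apply: lerD => //; apply: ler_wpM2l.
  by move=> /le_trans; apply; rewrite le_eqVlt; apply/orP; left; apply/eqP; ring.
split.
  by apply: (le_trans XX); apply: ler_wpM2l => //; rewrite mulr_ge0 ?sqr_ge0.
by apply: (le_trans XFX); apply: ler_wpM2l => //; rewrite mulr_ge0 ?sqr_ge0.
Qed.
End system.

Lemma wpos (k : nat) (B X F : R) : 0 <= B -> 0 <= X -> 0 <= F -> 0 <= 4 * 4 ^+ k * B * (8 * 4 ^+ k * X + F).
Proof.
move=> B0 X0 F0; have k0 : 0 <= 4 ^+ k :> R by rewrite exprn_ge0.
apply: mulr_ge0; first by apply: mulr_ge0 => //; exact: mulr_ge0.
by apply: addr_ge0 => //; apply: mulr_ge0 => //; exact: mulr_ge0.
Qed.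

(** Once the L^1 norms are controlled by [m1] alone, [h_om] raises the weight one power at a
    time. *)
Lemma wiener (m1 : R) : forall k, exists2 B : R, 0 <= B & forall u v f N sg : R * R -> R,
  exp_decaying u -> exp_decaying v -> exp_decaying f -> (forall x, f x = u x * u x + v x * v x) ->
  measurable_fun setT sg -> (forall x, `|sg x| <= 1) -> (forall y, N y = - f y - c4 * MI sg f 0 y) ->
  (forall y, laplacian u y = (1 + N y) * u y) -> (forall y, laplacian v y = (1 + N y) * v y) ->
  (forall x, om x ^+ 1 * (fa u x + fa v x) <= m1) ->
  forall x, om x ^+ k * (fa u x + fa v x) <= B /\ om x ^+ k * fa f x <= B.
Proof.
pose Wi := \int[leb2 R]_x W x; pose D := 24 ^+ 3 * m1 ^+ 4 * Wi ^+ 2.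
pose X2 := 9 * Wi ^+ 2 * D; pose F2 := 24 ^+ 2 * Wi ^+ 2 * D.
have W20 : 0 <= Wi ^+ 2 by rewrite sqr_ge0.
have D0 : 0 <= D.
  by apply: mulr_ge0 => //; apply: mulr_ge0; [rewrite exprn_ge0|rewrite exprn_even_ge0].
have X20 : 0 <= X2 by apply: mulr_ge0 => //; apply: mulr_ge0.
have F20 : 0 <= F2 by apply: mulr_ge0 => //; apply: mulr_ge0 => //; rewrite exprn_ge0.
have H k : exists2 B : R, 0 <= B & forall u v f N sg : R * R -> R,
  exp_decaying u -> exp_decaying v -> exp_decaying f -> (forall x, f x = u x * u x + v x * v x) ->
  measurable_fun setT sg -> (forall x, `|sg x| <= 1) -> (forall y, N y = - f y - c4 * MI sg f 0 y) ->
  (forall y, laplacian u y = (1 + N y) * u y) -> (forall y, laplacian v y = (1 + N y) * v y) ->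
  (forall x, om x ^+ 1 * (fa u x + fa v x) <= m1) ->
  forall x, om x ^+ k * (fa u x + fa v x) <= B.
  elim: k => [|k [B B0 IH]].
    exists `|m1| => // u v f N sg eu ev ef fE ms s1 NE lu lv hm x.
    apply: le_trans (ler_norm _); apply: le_trans (hm x); rewrite expr0 expr1.
    by apply: ler_wpM2r; [rewrite addr_ge0 ?fa_ge0|exact: om_ge1].
  exists (4 * 4 ^+ k * B * (8 * 4 ^+ k * X2 + F2)).
    by apply: wpos.
  move=> u v f N sg eu ev ef fE ms s1 NE lu lv hm x.
  have hk := IH u v f N sg eu ev ef fE ms s1 NE lu lv hm.
  have [b1 b2] := XXF_bound eu ev ef fE ms s1 NE lu lv hm.
  apply: (le_trans (h_om eu ev ef fE ms s1 NE lu lv hk x)).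
  have k0 : 0 <= 4 ^+ k :> R by rewrite exprn_ge0.
  apply: ler_wpM2l; first by apply: mulr_ge0 => //; exact: mulr_ge0.
  by apply: lerD => //; apply: ler_wpM2l => //; exact: mulr_ge0.
move=> k; have [B B0 hB] := H k.
have k0 : 0 <= 4 ^+ k :> R by rewrite exprn_ge0.
have c0 : 0 <= 8 * 4 ^+ k * B by apply: mulr_ge0 => //; exact: mulr_ge0.
have c1 : 0 <= 8 * 4 ^+ k * B * (1 + X2) by apply: mulr_ge0 => //; exact: addr_ge0.
exists (B + 8 * 4 ^+ k * B * (1 + X2)); first exact: addr_ge0.
move=> u v f N sg eu ev ef fE ms s1 NE lu lv hm x.
have hk := hB u v f N sg eu ev ef fE ms s1 NE lu lv hm.
have [b1 _] := XXF_bound eu ev ef fE ms s1 NE lu lv hm.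
split; first by apply: (le_trans (hk x)); rewrite lerDl.
apply: (le_trans (f_om eu ev ef fE ms s1 NE hk x)); apply: ler_wpDl => //.
apply: ler_wpM2l => //; apply: (@le_trans _ _ (1 + (\int[leb2 R]_x fa u x + \int[leb2 R]_x fa v x) ^+ 2)).
  exact: le_1Dsqr.
by rewrite lerD2l.
Qed.
End wiener.

(** * The profile equations in Fourier form and their uniform bounds *)

Section apply.
Variable R : realType.
Local Notation leb := (@lebesgue_measure R).

Definition Aq (c xi : R * R) : R := enorm xi ^+ 2 - dotp c xi ^+ 2.

Lemma dotp2_le (c xi : R * R) : enorm c <= 1 / 10 -> dotp c xi ^+ 2 <= enorm c ^+ 2 * enorm xi ^+ 2 /\
  dotp c xi ^+ 2 <= enorm xi ^+ 2 / 100.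
Proof.
move=> hc; have h : dotp c xi ^+ 2 <= enorm c ^+ 2 * enorm xi ^+ 2.
  rewrite -exprMn -[dotp c xi ^+ 2]real_normK ?num_real// lerXn2r ?nnegrE ?mulr_ge0 ?enorm_ge0//.
  exact: dotp_le.
split=> //; apply: (le_trans h); rewrite mulrC ler_wpM2l ?sqr_ge0//.
have c0 := enorm_ge0 c; by nra.
Qed.

Lemma Aq_lb (c xi : R * R) : enorm c <= 1 / 10 -> 99 / 100 * enorm xi ^+ 2 <= Aq c xi.
Proof. by move=> /(dotp2_le xi)[_ h]; rewrite /Aq; lra. Qed.

Lemma Aq_ge0 (c xi : R * R) : enorm c <= 1 / 10 -> 0 <= Aq c xi.
Proof. by move=> /(Aq_lb xi); apply: le_trans; rewrite mulr_ge0 ?sqr_ge0// divr_ge0. Qed.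

Lemma Aq_cont (c : R * R) : continuous (Aq c).
Proof.
rewrite /Aq => x; apply: cvgB.
  by apply: (@continuous_comp _ _ _ (@enorm R) (fun t : R => t ^+ 2)); [exact: enorm_cont|exact: exprn_continuous].
apply: (@continuous_comp _ _ _ (fun xi : R * R => dotp c xi) (fun t : R => t ^+ 2)); last exact: exprn_continuous.
by rewrite (_ : (fun xi => dotp c xi) = (fun xi : R * R => dotp xi c)); [exact: dotp_cont|apply/funext => z; rewrite dotpC].
Qed.

Lemma Aqinv_meas (c : R * R) : enorm c <= 1 / 10 -> measurable_fun setT (fun xi => (Aq c xi)^-1).
Proof.
move=> hc; have -> : (fun xi => (Aq c xi)^-1) = (fun xi => Aq c xi `^ (-1)).
  by apply/funext => xi; rewrite powR_inv1// Aq_ge0.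
apply: (measurableT_comp (measurable_powR _)); apply: continuous2_measurable; exact: Aq_cont.
Qed.

Lemma sym_meas (c : R * R) (m : R * R -> R) : enorm c <= 1 / 10 -> continuous m ->
  measurable_fun setT (fun xi => m xi / Aq c xi).
Proof.
by move=> hc cm; apply: measurable_funM; [exact: continuous2_measurable|exact: Aqinv_meas].
Qed.

Lemma sym_le (c : R * R) (m : R * R -> R) (k : R) xi : enorm c <= 1 / 10 -> 0 <= k ->
  `|m xi| <= k * enorm xi ^+ 2 -> `|m xi / Aq c xi| <= 2 * k.
Proof.
move=> hc k0 hm; have := Aq_lb xi hc; have := Aq_ge0 xi hc.
(* Where the denominator vanishes, which happens at the origin only, the symbol takes the value 0
   because the inverse of 0 is 0. *)
rewrite le_eqVlt => /predU1P[<-|a0]; first by rewrite invr0 mulr0 normr0 mulr_ge0.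
move=> hA; rewrite normrM normfV (gtr0_norm a0) ler_pdivrMr//; apply: (le_trans hm).
rewrite [2 * k]mulrC -mulrA; apply: ler_wpM2l => //.
have := sqr_ge0 (enorm xi); move: hA; move: (enorm xi ^+ 2) (Aq c xi) => a b; lra.
Qed.

Lemma fourier_real (f : R * R -> R) (xi : R * R) : itg (leb2 R) f ->
  fourier (fun x => (f x)%:C) xi = FC f xi +i* (- FS f xi).
Proof.
move=> itf; rewrite /fourier /cintegral; congr (_ +i* _).
  by apply: eq_Rint => x; rewrite /reF /expi/= mul0r subr0 cosN.
rewrite /FS -(RintN (sind_itg xi itf)).
by apply: eq_Rint => x; rewrite /imF /expi/= mul0r addr0 sinN mulrN.
Qed.

(** [N] and [V] are real valued, so taking real parts of their equations loses nothing and lands in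
    the real multipliers [MI]. *)
Lemma Re_mult (sg f : R * R -> R) (y : R * R) : itg (leb2 R) f ->
  complex.Re (inv_fourier (fun xi => (sg xi)%:C * fourier (fun x => (f x)%:C) xi) y) = c4 R * MI sg f 0 y.
Proof.
move=> itf; rewrite /inv_fourier /cintegral /= mul0r subr0 /c4; congr (_ * _).
apply: eq_Rint => xi; rewrite /reF (fourier_real xi itf) /expi/= !mul0r subr0 !addr0.
by move: (cos _) (sin _) (FC f xi) (FS f xi) => a b A B; ring.
Qed.

Definition symN (c xi : R * R) := dotp c xi ^+ 2 / Aq c xi.

Section prof.
Variables (cs : R) (Q : R * R -> R) (U : R * R -> R * R -> R[i]) (N : R * R -> R * R -> R) (V : R * R -> R * R -> R * R).
Hypotheses (hUNV : solitary_profiles cs Q U N V).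

Lemma N_MI c y : enorm c < cs -> itg (leb2 R) (sqmod (U c)) ->
  N c y = - sqmod (U c) y - c4 R * MI (symN c) (sqmod (U c)) 0 y.
Proof using hUNV.
move=> hc itf; have := congr1 (fun w : R[i] => complex.Re w) (profile_N_eq hUNV hc y).
rewrite /S_op -(Re_mult (symN c) y itf) /symN /Aq => /= ->.
by case: (inv_fourier _ y).
Qed.

Lemma V_MI c j y : enorm c < cs -> itg (leb2 R) (sqmod (U c)) ->
  pcoord j (V c y) = - (c4 R * MI (fun xi => dotp c xi * pcoord j xi / Aq c xi) (sqmod (U c)) 0 y).
Proof using hUNV.
move=> hc itf; have := congr1 (fun w : R[i] => complex.Re w) (profile_V_eq hUNV hc j y).
by rewrite /T_op -(Re_mult _ y itf) /Aq => /= ->; case: (inv_fourier _ y).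
Qed.
End prof.

Lemma om_partials s (f : R * R -> R) xi : exp_decaying f -> fa (partials s f) xi <= om xi ^+ size s * fa f xi.
Proof.
move=> ef; elim: s => [|j s IH] /=; first by rewrite expr0 mul1r.
rewrite (fa_partial _ _ (edec_partials s ef)) exprS -mulrA; apply: ler_pM => //; first exact: fa_ge0.
apply: (le_trans (pcoord_le j xi)); rewrite omE.
have := enorm_ge0 xi; have := sqr_ge0 (enorm xi - 1); move: (enorm xi) => e; nra.
Qed.

(** By inversion: each derivative costs at most one power of [om], and the two extra powers make the
    integral converge. *)
Lemma sup_partials s (f : R * R -> R) (B : R) y : exp_decaying f -> (forall xi, om xi ^+ (size s + 2) * fa f xi <= B) ->
  `|partials s f y| <= 3 * B * \int[leb2 R]_x W x.
Proof.
move=> ef hB; have es := edec_partials s ef.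
have -> : partials s f y = c4 R * MI (fun=> 1) (partials s f) 0 y by rewrite inversion// mulrA c4pi mul1r.
rewrite normrM (ger0_norm (c4_ge0 R)) -(RintZl _ (@W_itg R)).
have i1 : itg (leb2 R) (fun xi => 1 * (FC (partials s f) xi * cos (dotp y xi + 0) + FS (partials s f) xi * sin (dotp y xi + 0))).
  by apply: (@mult_itg R (fun=> 1) (partials s f) 1) => // x; rewrite normr1.
have h : `|MI (fun=> 1) (partials s f) 0 y| <= \int[leb2 R]_x (3 * B * W x).
  apply: (@Rint_bound _ _ _ (leb2 R)); [exact: itg_meas i1|by apply: itgZl; exact: W_itg|].
  move=> xi; rewrite mul1r; apply: (le_trans (phase_fa _ _ _ _)); apply: (le_trans (om_partials s xi ef)).
  have o2 : 0 < om xi ^+ 2 by rewrite exprn_gt0 ?om_gt0.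
  have := hB xi; rewrite exprD mulrAC -ler_pdivlMr// => /le_trans; apply.
  rewrite [3 * B]mulrC -mulrA; apply: ler_wpM2l; last exact: om2_W.
  by apply: le_trans (hB 0); rewrite mulr_ge0 ?fa_ge0// exprn_ge0// ltW// om_gt0.
apply: (le_trans (ler_wpM2l (c4_ge0 R) h)); rewrite ler_piMl//; first by apply: le_trans h.
by apply: (le_trans (c4_le R)); lra.
Qed.

(** The transform of (1 - Delta) u = - N u is bounded by the L^1 norm of N u, for which sup bounds
    on N and decay of u suffice. This is the first weighted bound, the one that starts [wiener]. *)
Lemma om_lap_bound (u N : R * R -> R) (M C a : R) : 0 <= M -> 0 < a -> 0 <= C -> exp_decaying u ->
  (forall y, laplacian u y = (1 + N y) * u y) -> (forall y, `|N y| <= M) -> (forall y, `|u y| <= C * expw a y) ->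
  forall xi, om xi ^+ 1 * fa u xi <= 2 * (M * (C * \int[leb2 R]_x expw a x)).
Proof.
move=> M0 a0 C0 eu lu NM uC xi; have [E1 E2] := FC_lap xi eu.
have il : itg (leb2 R) (fun y => u y - laplacian u y).
  apply: itgB; first exact: edec_itg.
  rewrite /laplacian /pderiv/=; apply: itgD; apply: edec_itg; do 2! apply: edec_partial; exact: eu.
have -> : om xi ^+ 1 * fa u xi = fa (fun y => u y - laplacian u y) xi.
  by rewrite expr1 /fa -E1 -E2 !normrM -mulrDr ger0_norm// ltW// om_gt0.
have h : \int[leb2 R]_x `|u x - laplacian u x| <= M * (C * \int[leb2 R]_x expw a x).
  have ie := expw_itg a0; rewrite -(RintZl _ ie) -(RintZl _ (itgZl _ ie)).
  apply: (@le_Rint _ _ _ (leb2 R)); [exact: itg_norm|exact: itgZl (itgZl _ ie)|move=> x].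
  rewrite lu (_ : _ - _ = - (N x * u x)); last by ring.
  by rewrite normrN normrM; apply: ler_pM.
have h1 := FC_bound xi il; have h2 := FS_bound xi il.
by rewrite /fa; lra.
Qed.

Lemma profiles_uniform_bounds (cs : R) (Q : R * R -> R) U N V : 0 < cs < 1 -> nls_soliton Q ->
  solitary_profiles cs Q U N V ->
  exists ct : R, [/\ 0 < ct < cs, ct <= 1 / 10,
   (forall c, enorm c < ct -> exp_decaying (sqmod (U c))),
   (forall k, exists2 B : R, 0 <= B & forall c, enorm c < ct -> forall xi, om xi ^+ k * fa (sqmod (U c)) xi <= B) &
   (forall s, exists2 C : R, 0 <= C & forall c, enorm c < ct -> forall y, `|partials s (sqmod (U c)) y| <= C * expR (- enorm y))].
Proof.
move=> hcs hQ hP; have [ct [R0 [M [ct0 ct1 R00 M0 hM]]]] := profiles_unif hcs hQ hP.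
have [_ ctcs] := andP ct0.
have [C C0 hC] := profiles_decay hP ctcs R00 M0 hM.
have lt c : enorm c < ct -> enorm c < cs by move=> h; exact: lt_trans ctcs.
have sb c n : enorm c < ct -> smooth_bounded_upto n (reF (U c)) /\ smooth_bounded_upto n (imF (U c)).
  by move=> /lt hc; have [h1 h2 _ _ _] := profiles_regular hP hc; split; exact: hinf_smb.
(* The square root of the decay of |U|^2, whence the halved rate 3/5. *)
have dec c y : enorm c < ct -> `|reF (U c) y| <= Num.sqrt C * expR (- (3 / 5 * enorm y)) /\ `|imF (U c) y| <= Num.sqrt C * expR (- (3 / 5 * enorm y)).
  move=> hc; have := hC c hc y; rewrite sqmodE -!expr2 => h.
  have E : C * expR (- (6 / 5 * enorm y)) = (Num.sqrt C * expR (- (3 / 5 * enorm y))) ^+ 2.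
    rewrite exprMn sqr_sqrtr// expr2 -expRD; congr (_ * expR _); by field.
  have p0 : 0 <= Num.sqrt C * expR (- (3 / 5 * enorm y)) by rewrite mulr_ge0 ?sqrtr_ge0 ?expR_ge0.
  rewrite E in h.
  by split; rewrite -(@ler_pXn2r _ 2)// ?nnegrE// real_normK ?num_real//; apply: le_trans h; rewrite ?lerDl ?lerDr sqr_ge0.
have a35 : 0 < 3 / 5 :> R by lra.
have eu c : enorm c < ct -> exp_decaying (reF (U c)).
  by move=> hc; apply: (@edec_of_smb _ _ (Num.sqrt C) (3 / 5)) => // [n|y]; [exact: (sb c n hc).1|exact: (dec c y hc).1].
have ev c : enorm c < ct -> exp_decaying (imF (U c)).
  by move=> hc; apply: (@edec_of_smb _ _ (Num.sqrt C) (3 / 5)) => // [n|y]; [exact: (sb c n hc).2|exact: (dec c y hc).2].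
have sqE c : sqmod (U c) = (fun y => reF (U c) y * reF (U c) y + imF (U c) y * imF (U c) y).
  by apply/funext => y; rewrite sqmodE.
have a65 : 0 < 6 / 5 :> R by lra.
have f0 c y : 0 <= sqmod (U c) y by rewrite sqmodE -!expr2 addr_ge0 ?sqr_ge0.
have ef c : enorm c < ct -> exp_decaying (sqmod (U c)).
  move=> hc; apply: (@edec_of_smb _ _ C (6 / 5)) => // [n|y].
    by rewrite sqE; apply: smbD; apply: smbM; [exact: (sb c n hc).1|exact: (sb c n hc).1|exact: (sb c n hc).2|exact: (sb c n hc).2].
  by rewrite ger0_norm//; exact: hC.
pose IW := \int[leb2 R]_x expw (3 / 5 / 2) x.
pose m1 := 2 * (M * (Num.sqrt C * IW)) + 2 * (M * (Num.sqrt C * IW)).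
have hm c : enorm c < ct -> forall x, om x ^+ 1 * (fa (reF (U c)) x + fa (imF (U c)) x) <= m1.
  move=> hc x; rewrite mulrDr /m1.
  have a0 : 0 < 3 / 5 / 2 :> R by lra.
  have ex y := exp_enorm_le y (ltW a35).
  apply: lerD.
    apply: (om_lap_bound M0 a0 (sqrtr_ge0 C) (eu c hc) (N := N c)).
    - by move=> y; exact: (profile_lap y hP (lt c hc)).1.
    - by move=> y; have [_ _ h _] := hM c hc y.
    - by move=> y; apply: (le_trans (dec c y hc).1); rewrite ler_wpM2l ?sqrtr_ge0.
  apply: (om_lap_bound M0 a0 (sqrtr_ge0 C) (ev c hc) (N := N c)).
  - by move=> y; exact: (profile_lap y hP (lt c hc)).2.
  - by move=> y; have [_ _ h _] := hM c hc y.
  - by move=> y; apply: (le_trans (dec c y hc).2); rewrite ler_wpM2l ?sqrtr_ge0.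
have Bk k : exists2 B : R, 0 <= B & forall c, enorm c < ct -> forall xi, om xi ^+ k * fa (sqmod (U c)) xi <= B.
  have [B B0 hB] := wiener m1 k; exists B => // c hc xi.
  have c10 : enorm c <= 1 / 10 by apply: ltW; exact: lt_le_trans ct1.
  apply: (hB (reF (U c)) (imF (U c)) (sqmod (U c)) (N c) (symN c) (eu c hc) (ev c hc) (ef c hc) _ _ _ _ _ _ (hm c hc) xi).2.
  - by move=> x; rewrite sqmodE.
  - apply: (@sym_meas c (fun xi => dotp c xi ^+ 2) c10) => x.
    apply: (@continuous_comp _ _ _ (fun xi : R * R => dotp c xi) (fun t : R => t ^+ 2)); last exact: exprn_continuous.
    by rewrite (_ : (fun xi => dotp c xi) = (fun xi : R * R => dotp xi c)); [exact: dotp_cont|apply/funext => z; rewrite dotpC].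
  - move=> x; apply: (@le_trans _ _ (2 * (1 / 100))); last by lra.
    have k0 : 0 <= 1 / 100 :> R by lra.
    apply: (@sym_le c (fun xi => dotp c xi ^+ 2) _ x c10 k0).
    by rewrite ger0_norm ?sqr_ge0// mulrC mulrA mulr1; exact: (dotp2_le x c10).2.
  - by move=> y; apply: (N_MI hP _ (lt c hc)); exact: edec_itg (ef c hc).
  - by move=> y; exact: (profile_lap y hP (lt c hc)).1.
  - by move=> y; exact: (profile_lap y hP (lt c hc)).2.
exists ct; split=> // s.
(* All velocities at once: the Landau argument is applied to the whole family, so its constants do
   not depend on c. *)
pose F g := exists2 c, enorm c < ct & g = sqmod (U c).
have gF : smooth_family F.
  split=> [_ [c hc ->]|s']; first by have [] := ef c hc.
  have [B B0 hB] := Bk (size s' + 2)%N.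
  exists (3 * B * \int[leb2 R]_x W x) => _ [c hc ->] y; apply: sup_partials; [exact: ef|exact: hB].
have rF : decay_rate (6 / 5) F.
  by exists C => // _ [c hc ->] y; rewrite ger0_norm//; exact: hC.
have [|D D0 hD] := @landau_rate R F (6 / 5) 1 s (ltW a65) gF rF; first by lra.
exists D => // c hc y; have := hD (partials s (sqmod (U c))) _ y; rewrite mul1r; apply.
by exists (sqmod (U c)) => //; exists c.
Qed.
End apply.

(** * Differentiation of multipliers *)

Section mider.
Variable R : realType.
Local Notation leb := (@lebesgue_measure R).
Implicit Types (m f : R * R -> R).

Lemma om_itg k f : exp_decaying f -> itg (leb2 R) (fun xi => om xi ^+ k * fa f xi).
Proof.
move=> ef; have [B B0 hB] := om_fa (k + 2) ef; have [cC cS] := edec_fcont ef.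
apply: itg2_le (itgZl (B * 3) (@W_itg R)).
  apply: measurable_funM; last by apply: continuous2_measurable; exact: fa_cont.
  apply: measurable_funX; rewrite /om; apply: measurable_funD; last by apply: measurable_funX.
  by apply: measurable_funD => //; apply: measurable_funX.
move=> xi; have o2 : 0 < om xi ^+ 2 by rewrite exprn_gt0 ?om_gt0.
have ok : 0 <= om xi ^+ k by rewrite exprn_ge0 ?ltW ?om_gt0.
rewrite ger0_norm; last by apply: mulr_ge0 => //; exact: fa_ge0.
have := hB xi; rewrite exprD mulrAC -ler_pdivlMr// => /le_trans; apply.
by rewrite -mulrA; apply: ler_wpM2l => //; exact: om2_W.
Qed.

Lemma mi_itg k m f (K p : R) y : exp_decaying f -> measurable_fun setT m -> (forall xi, `|m xi| <= K * om xi ^+ k) ->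
  itg (leb2 R) (fun xi => m xi * (FC f xi * cos (dotp y xi + p) + FS f xi * sin (dotp y xi + p))).
Proof.
move=> ef mm mK; have [cC cS] := edec_fcont ef.
apply: itg2_le (itgZl K (om_itg k ef)).
  apply: measurable_funM => //.
  have md : measurable_fun setT (fun xi : R * R => dotp y xi + p).
    by under eq_fun do rewrite dotpC; apply: measurable_funD; [exact: dotp_meas|exact: measurable_cst].
  apply: measurable_funD; apply: measurable_funM; try exact: continuous2_measurable.
    exact: (measurableT_comp (@cos_meas R)).
  exact: (measurableT_comp (@sin_meas R)).
by move=> xi; rewrite normrM mulrA; apply: ler_pM => //; exact: phase_fa.
Qed.

Lemma taylor_phase (a b t d : R) :
  `|(a * cos (t + d) + b * sin (t + d)) - (a * cos t + b * sin t) - d * (a * cos (t + pi / 2) + b * sin (t + pi / 2))|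
   <= d ^+ 2 * (`|a| + `|b|).
Proof.
have h1 : `|cos (t + d) - cos t - d * - sin t| <= d ^+ 2.
  apply: (taylor1 t d (@is_derive_cos R)) => u v; rewrite opprK addrC -normrN opprB.
  exact: sin_lip.
have h2 := taylor1 t d (@is_derive_sin R) (@cos_lip R).
rewrite cosDpihalf sinDpihalf.
rewrite (_ : _ - _ = a * (cos (t + d) - cos t - d * - sin t) + b * (sin (t + d) - sin t - d * cos t)); last by ring.
apply: (le_trans (ler_normD _ _)); rewrite !normrM mulrDr ![d ^+ 2 * _]mulrC.
by apply: lerD; apply: ler_wpM2l.
Qed.

Lemma pc_om j (xi : R * R) : `|pcoord j xi| <= om xi.
Proof.
apply: (le_trans (pcoord_le j xi)); rewrite omE.
have := enorm_ge0 xi; have := sqr_ge0 (enorm xi - 1); move: (enorm xi) => e; nra.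
Qed.

Lemma pcm_le j k m (K : R) : (forall xi, `|m xi| <= K * om xi ^+ k) ->
  forall xi, `|pcoord j xi * m xi| <= K * om xi ^+ k.+1.
Proof.
move=> mK xi; rewrite normrM exprSr mulrA mulrC; apply: ler_pM => //; exact: pc_om.
Qed.

Lemma pcm_meas j m : measurable_fun setT m -> measurable_fun setT (fun xi => pcoord j xi * m xi).
Proof.
by move=> mm; apply: measurable_funM => //; apply: continuous2_measurable; exact: pcoord_cont.
Qed.

(** Differentiation under the integral with a quadratic remainder: the second order Taylor bound of
    the phase costs two more powers of [om], which the decay of the transform affords. *)
Lemma MI_quad j k m f (K p : R) y : exp_decaying f -> measurable_fun setT m -> (forall xi, `|m xi| <= K * om xi ^+ k) ->
  exists C : R, forall h : R, `|MI m f p (y + h *: evec R j) - MI m f p y - h * MI (fun xi => pcoord j xi * m xi) f (p + pi / 2) y| <= C * h ^+ 2.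
Proof.
move=> ef mm mK; have ef0 := om_itg k.+2 ef.
have mK' := pcm_le j mK; have mm' := pcm_meas j mm.
exists (\int[leb2 R]_xi (K * (om xi ^+ k.+2 * fa f xi))) => h.
have i1 := mi_itg p (y + h *: evec R j) ef mm mK; have i2 := mi_itg p y ef mm mK.
have i3 := mi_itg (p + pi / 2) y ef mm' mK'.
rewrite /MI -(RintB i1 i2) -(RintZl _ i3) -(RintB (itgB i1 i2) (itgZl _ i3)) -(RintZr _ (itgZl _ ef0)).
apply: (@Rint_bound _ _ _ (leb2 R)).
- exact: itg_meas (itgB (itgB i1 i2) (itgZl _ i3)).
- by apply: itgZr; exact: itgZl.
move=> xi; have E : dotp (y + h *: evec R j) xi + p = (dotp y xi + p) + h * pcoord j xi.
  rewrite dotpDl (_ : dotp (h *: evec R j) xi = h * pcoord j xi) 1?addrAC//.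
  rewrite /dotp /evec /pcoord; case: ifP => _ /=; rewrite /GRing.scale/=; ring.
rewrite E [dotp y xi + (p + _)]addrA.
have T := taylor_phase (FC f xi) (FS f xi) (dotp y xi + p) (h * pcoord j xi).
rewrite (_ : _ - _ = m xi * ((FC f xi * cos (dotp y xi + p + h * pcoord j xi) + FS f xi * sin (dotp y xi + p + h * pcoord j xi)) -
    (FC f xi * cos (dotp y xi + p) + FS f xi * sin (dotp y xi + p)) -
    h * pcoord j xi * (FC f xi * cos (dotp y xi + p + pi / 2) + FS f xi * sin (dotp y xi + p + pi / 2)))); last first.
  by move: (cos _) (sin _) (cos _) (sin _) (cos _) (sin _) => a b c d e g; ring.
rewrite normrM; apply: (le_trans (ler_pM (normr_ge0 _) (normr_ge0 _) (mK xi) T)).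
rewrite -/(fa f xi) exprMn; have f0 := fa_ge0 f xi.
have hp : pcoord j xi ^+ 2 <= om xi ^+ 2.
  have o0 := ltW (om_gt0 xi).
  by rewrite -[pcoord j xi ^+ 2]real_normK ?num_real// lerXn2r ?nnegrE//; exact: pc_om.
have K0 : 0 <= K * om xi ^+ k := le_trans (normr_ge0 _) (mK xi).
rewrite (_ : K * (om xi ^+ k.+2 * fa f xi) * h ^+ 2 = K * om xi ^+ k * (h ^+ 2 * om xi ^+ 2 * fa f xi)).
  by apply: ler_wpM2l => //; apply: ler_wpM2r => //; apply: ler_wpM2l => //; exact: sqr_ge0.
by rewrite !exprS; move: (om xi ^+ k) => a; ring.
Qed.

Lemma quad_partial j (F : R * R -> R) y (d C : R) :
  (forall h : R, `|F (y + h *: evec R j) - F y - h * d| <= C * h ^+ 2) ->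
  derivable F y (evec R j) /\ partial j F y = d.
Proof.
elim/ord2P: j => H.
  have D : is_derive y.1 1 (fun t : R => F (t, y.2)) d.
    apply: (@quad_der _ _ _ _ C) => h; have := H h; rewrite -surjective_pairing.
    by rewrite (_ : y + _ = (y.1 + h, y.2))//; case: y {H} => a b; congr (_, _); rewrite /= /GRing.scale/= ?mulr1 ?mulr0 ?addr0.
  by split; [rewrite derivable0E; exact: (@ex_derive _ _ _ _ _ _ _ D)|rewrite partial0E (der_derive1 D)].
have D : is_derive y.2 1 (fun t : R => F (y.1, t)) d.
  apply: (@quad_der _ _ _ _ C) => h; have := H h; rewrite -surjective_pairing.
  by rewrite (_ : y + _ = (y.1, y.2 + h))//; case: y {H} => a b; congr (_, _); rewrite /= /GRing.scale/= ?mulr1 ?mulr0 ?addr0.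
by split; [rewrite derivable1E; exact: (@ex_derive _ _ _ _ _ _ _ D)|rewrite partial1E (der_derive1 D)].
Qed.

Fixpoint mono (s : seq 'I_2) (xi : R * R) : R := if s is j :: s' then pcoord j xi * mono s' xi else 1.

Lemma MI_partials s k m f (K p : R) : exp_decaying f -> measurable_fun setT m -> (forall xi, `|m xi| <= K * om xi ^+ k) ->
  (forall y j, derivable (partials s (MI m f p)) y (evec R j)) /\
  partials s (MI m f p) = MI (fun xi => mono s xi * m xi) f (p + (pi / 2) *+ size s).
Proof.
move=> ef mm mK.
have H : [/\ measurable_fun setT (fun xi => mono s xi * m xi), (forall xi, `|mono s xi * m xi| <= K * om xi ^+ (size s + k)) &
  partials s (MI m f p) = MI (fun xi => mono s xi * m xi) f (p + (pi / 2) *+ size s)].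
  elim: s => [|j s [IH1 IH2 IH3]] /=.
    split; first by under eq_fun do rewrite mul1r.
      by move=> xi; rewrite mul1r.
    by apply/funext => y; rewrite addr0; apply: eq_Rint => xi; rewrite mul1r.
  split.
  - by under eq_fun do rewrite -mulrA; exact: (@pcm_meas j (fun xi => mono s xi * m xi)).
  - by move=> xi; rewrite -mulrA; exact: (@pcm_le j _ (fun xi => mono s xi * m xi) K IH2).
  rewrite IH3; apply/funext => y; have [C hC] := MI_quad j (p + (pi / 2) *+ size s) y ef IH1 IH2.
  rewrite (quad_partial hC).2 [_ *+ (size s).+1]mulrSr addrA; apply: eq_Rint => xi; by rewrite mulrA.
have [h1 h2 h3] := H; split=> // y j; rewrite h3.
have [C hC] := MI_quad j (p + (pi / 2) *+ size s) y ef h1 h2; exact: (quad_partial hC).1.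
Qed.
End mider.

(** * Far field of the truncated kernels *)

Section gauss_ibp.
Variable R : realType.
Local Notation leb := (@lebesgue_measure R).

Definition GA (c : R * R) (t : R) (x : R * R) : R := expR (- (t * Aq c x)).

(** A damped monomial against an oscillation. Allowing every phase [p] keeps the family stable under
    integration by parts, which turns cos into sin. *)
Definition J (c : R * R) (t : R) (k l : nat) (w : R * R) (p : R) (x : R * R) : R :=
  x.1 ^+ k * x.2 ^+ l * GA c t x * cos (dotp x w + p).

Lemma GA_ge0 c t x : 0 <= GA c t x. Proof. exact: expR_ge0. Qed.

Lemma GA_le c t x : enorm c <= 1 / 10 -> 0 < t -> GA c t x <= gg (t / 2) (t / 2) x.
Proof.
move=> hc t0; rewrite /GA /gg /ga -expRD ler_expR -opprD lerN2 -mulrDr -enorm2.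
have h := Aq_lb x hc; have e0 := sqr_ge0 (enorm x); have t1 := ltW t0.
rewrite -mulrA; apply: ler_wpM2l => //; lra.
Qed.

Lemma GA_le1 c t x : enorm c <= 1 / 10 -> 0 <= t -> GA c t x <= 1.
Proof.
by move=> hc t0; rewrite /GA -[X in _ <= X]expR0 ler_expR oppr_le0 mulr_ge0 ?Aq_ge0.
Qed.

Lemma GA_cont c t : continuous (GA c t).
Proof.
move=> x; apply: (@continuous_comp _ _ _ (fun x => - (t * Aq c x)) expR); last exact: continuous_expR.
by apply: cvgN; apply: cvgM; [exact: cvg_cst|exact: Aq_cont].
Qed.

Lemma J_cont c t k l w p : continuous (J c t k l w p).
Proof.
apply: contM2.
  apply: contM2; last exact: GA_cont.
  by apply: contM2; [apply: (@cont_fst _ (fun x : R => x ^+ k))|apply: (@cont_snd _ (fun x : R => x ^+ l))]; exact: exprn_continuous.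
move=> x; apply: (@continuous_comp _ _ _ (fun x : R * R => dotp x w + p) cos); last exact: continuous_cos.
by apply: cvgD; [exact: dotp_cont|exact: cvg_cst].
Qed.

Lemma J_le c t k l w p x : enorm c <= 1 / 10 -> 0 < t -> `|J c t k l w p x| <= `|x.1 ^+ k * x.2 ^+ l * gg (t / 2) (t / 2) x|.
Proof.
move=> hc t0; rewrite /J normrM; apply: (@le_trans _ _ `|x.1 ^+ k * x.2 ^+ l * GA c t x|).
  by rewrite ler_piMr// cos_max.
rewrite (normrM _ (GA c t x)) (normrM _ (gg _ _ x)) (ger0_norm (GA_ge0 c t x)) (ger0_norm (gg_ge0 _ _ x)).
by apply: ler_wpM2l => //; exact: GA_le.
Qed.

Lemma J_expw c t k l w p : enorm c <= 1 / 10 -> 0 < t -> exists2 C : R, 0 <= C & forall x, `|J c t k l w p x| <= C * expw 1 x.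
Proof.
move=> hc t0; have t2 : 0 < t / 2 by rewrite divr_gt0.
exists (k`!%:R * expR (t / 2)^-1 * (l`!%:R * expR (t / 2)^-1)).
  by rewrite !mulr_ge0 ?expR_ge0.
move=> x; apply: (le_trans (J_le _ _ _ _ _ hc t0)); apply: (le_trans (pow_gg_le k l x t2 t2)).
by rewrite /expw mulrACA.
Qed.

Lemma J_itg c t k l w p : enorm c <= 1 / 10 -> 0 < t -> itg (leb2 R) (J c t k l w p).
Proof.
move=> hc t0; have [C C0 h] := J_expw k l w p hc t0.
apply: itg2_le h (itgZl _ (expw_itg ltr01)); apply: continuous2_measurable; exact: J_cont.
Qed.

Lemma J_partial c t k l w p y :
  derivable (J c t k l w p) y (evec R ord0) /\
  partial ord0 (J c t k l w p) y = k%:R * J c t k.-1 l w p y - 2 * t * (1 - c.1 ^+ 2) * J c t k.+1 l w p y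
    + 2 * t * c.1 * c.2 * J c t k l.+1 w p y - w.1 * J c t k l w (p - pi / 2) y.
Proof.
have dA : is_derive y.1 1 (fun x : R => - (t * Aq c (x, y.2))) (- (t * (2 * (1 - c.1 ^+ 2) * y.1 - 2 * c.1 * c.2 * y.2))).
  have -> : (fun x : R => - (t * Aq c (x, y.2))) =
     (fun x => (- t * (1 - c.1 ^+ 2)) * x ^+ 2 + ((2 * t * c.1 * c.2 * y.2) * x ^+ 1 + (- t * (1 - c.2 ^+ 2) * y.2 ^+ 2) * x ^+ 0)).
    by apply/funext => x; rewrite /Aq enorm2 /dotp/=; ring.
  have d k' (a : R) : is_derive y.1 1 (fun x : R => a * x ^+ k') (a * (k'%:R * y.1 ^+ k'.-1)).
    by apply: (der_eq (der_mul (is_derive_cst a y.1 1) (der_pow k' y.1))); rewrite mul0r add0r.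
  apply: (der_eq (is_deriveD (d 2%N _) (is_deriveD (d 1%N _) (d 0%N _)))).
  by rewrite /= mul0r mulr0 addr0 expr1 expr0; ring.
have dC : is_derive y.1 1 (fun x : R => cos (dotp (x, y.2) w + p)) (w.1 * - sin (dotp y w + p)).
  have -> : (fun x : R => cos (dotp (x, y.2) w + p)) = (fun x => cos (w.1 * x + (y.2 * w.2 + p))).
    by apply/funext => x; rewrite /dotp/=; congr cos; ring.
  apply: (der_eq (phase_der w.1 (y.2 * w.2 + p) y.1 (@is_derive_cos R))).
  by rewrite /dotp; congr (_ * - sin _); ring.
have D : is_derive y.1 1 (fun x : R => J c t k l w p (x, y.2)) (k%:R * J c t k.-1 l w p y - 2 * t * (1 - c.1 ^+ 2) * J c t k.+1 l w p y
    + 2 * t * c.1 * c.2 * J c t k l.+1 w p y - w.1 * J c t k l w (p - pi / 2) y).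
  have d1 := der_mul (der_pow k y.1) (is_derive_cst (y.2 ^+ l) y.1 1).
  have d2 := der_mul (der_mul d1 (der_comp (is_derive_expR _) dA)) dC.
  apply: (der_eq d2); rewrite /J /GA /cst/= -!surjective_pairing addrA cosBpihalf !exprS mulr0 addr0.
  move: (cos _) (sin _) (expR _) (y.1 ^+ k.-1) (y.1 ^+ k) (y.2 ^+ l) => a b e f g h; ring.
split; first by rewrite derivable0E; exact: (@ex_derive _ _ _ _ _ _ _ D).
by rewrite partial0E (der_derive1 D).
Qed.

(** The xi_1-derivative of the integrand with phase p + pi/2 integrates to 0. A factor w_1 is traded
    either for a monomial of lower degree or for t times a monomial of higher degree. *)
Lemma J_ibp c t k l w p : enorm c <= 1 / 10 -> 0 < t ->
  w.1 * \int[leb2 R]_x J c t k l w p x = k%:R * \int[leb2 R]_x J c t k.-1 l w (p + pi / 2) x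
    - 2 * t * (1 - c.1 ^+ 2) * \int[leb2 R]_x J c t k.+1 l w (p + pi / 2) x
    + 2 * t * c.1 * c.2 * \int[leb2 R]_x J c t k l.+1 w (p + pi / 2) x.
Proof.
move=> hc t0; set q := p + pi / 2.
have Ep : p = q - pi / 2 by rewrite /q addrK.
have i k' l' p' := J_itg k' l' w p' hc t0.
have E x := (J_partial c t k l w q x).2.
have [C0 C00 h0] := J_expw k l w q hc t0.
have [C1 C10 h1] := J_expw k.-1 l w q hc t0.
have [C2 C20 h2] := J_expw k.+1 l w q hc t0.
have [C3 C30 h3] := J_expw k l.+1 w q hc t0.
have [C4 C40 h4] := J_expw k l w p hc t0.
pose a1 : R := k%:R; pose a2 := - (2 * t * (1 - c.1 ^+ 2)); pose a3 := 2 * t * c.1 * c.2.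
have E' x : partial ord0 (J c t k l w q) x = a1 * J c t k.-1 l w q x + a2 * J c t k.+1 l w q x + a3 * J c t k l.+1 w q x + (- w.1) * J c t k l w p x.
  by rewrite E /a1 /a2 /a3 -Ep; ring.
have H : \int[leb2 R]_x partial ord0 (J c t k l w q) x = 0.
  have c0 : 0 <= `|a1| * C1 + `|a2| * C2 + `|a3| * C3 + `|w.1| * C4 by rewrite !addr_ge0 ?mulr_ge0.
  apply: (@int_partial0 R ord0 (J c t k l w q) (C0 + (`|a1| * C1 + `|a2| * C2 + `|a3| * C3 + `|w.1| * C4)) 1 ltr01).
  - by move=> y; exact: (J_partial c t k l w q y).1.
  - rewrite (_ : partial ord0 _ = fun x => a1 * J c t k.-1 l w q x + a2 * J c t k.+1 l w q x + a3 * J c t k l.+1 w q x + (- w.1) * J c t k l w p x); last by apply/funext.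
    have cc a k' l' p' : continuous (fun x => a * J c t k' l' w p' x).
      by apply: contM2; [move=> x; exact: cvg_cst|exact: J_cont].
    by apply: contD2 => //; apply: contD2 => //; exact: contD2.
  - by move=> x; apply: (le_trans (h0 x)); apply: ler_wpM2r; [exact: expw_ge0|rewrite lerDl].
  - move=> x; rewrite E'; have w0 := expw_ge0 1 x.
    have b (a g C : R) : `|g| <= C * expw 1 x -> `|a * g| <= `|a| * C * expw 1 x.
      by move=> h; rewrite normrM -mulrA ler_wpM2l.
    apply: (@le_trans _ _ ((`|a1| * C1 + `|a2| * C2 + `|a3| * C3 + `|w.1| * C4) * expw 1 x)).
      rewrite !mulrDl; apply: (le_trans (ler_normD _ _)); apply: lerD; last by rewrite -(normrN w.1); exact: b.
      apply: (le_trans (ler_normD _ _)); apply: lerD; last exact: b.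
      by apply: (le_trans (ler_normD _ _)); apply: lerD; exact: b.
    by apply: ler_wpM2r => //; rewrite lerDr.
move: H; under eq_Rint do rewrite E'.
have j a k' l' p' : itg (leb2 R) (fun x => a * J c t k' l' w p' x) by apply: itgZl; exact: i.
rewrite (RintD (itgD (itgD (j _ _ _ _) (j _ _ _ _)) (j _ _ _ _)) (j _ _ _ _)) (RintD (itgD (j _ _ _ _) (j _ _ _ _)) (j _ _ _ _)) (RintD (j _ _ _ _) (j _ _ _ _)).
rewrite !(RintZl _ (i _ _ _)) /a1 /a2 /a3.
move: (\int[leb2 R]_x _) (\int[leb2 R]_x _) (\int[leb2 R]_x _) (\int[leb2 R]_x _) => A B D F H.
by apply/eqP; rewrite -subr_eq0; apply/eqP; rewrite -[RHS]oppr0 -H; ring.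
Qed.

(** Exchanging the coordinates spares a second integration by parts for w_2. *)
Lemma J_swap c t k l w p : enorm c <= 1 / 10 -> 0 < t ->
  \int[leb2 R]_x J c t k l w p x = \int[leb2 R]_x J (c.2, c.1) t l k (w.2, w.1) p x.
Proof.
move=> hc t0; have t2 : 0 < t / 2 by rewrite divr_gt0.
have hc' : enorm (c.2, c.1) <= 1 / 10 by apply: le_trans hc; rewrite /enorm /dotp/= addrC.
have ie a : itg leb (fun x => a * expR (- (1 * `|x|))) by apply: itgZl; exact: expR_abs_itg.
have FE k' l' c' w' (x y : R) : enorm c' <= 1 / 10 -> `|J c' t k' l' w' p (x, y)| <= (k'`!%:R * expR ((t / 2)^-1) * expR (- (1 * `|x|))) * (l'`!%:R * expR ((t / 2)^-1) * expR (- (1 * `|y|))).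
  by move=> hc0; apply: (le_trans (J_le _ _ _ _ _ hc0 t0)); exact: (pow_gg_le k' l' (x, y) t2 t2).
rewrite (leb2_int12 (continuous2_measurable (@J_cont c t k l w p)) (ie _) (ie _) (fun x y => FE k l c w x y hc)).
rewrite (leb2_int21 (continuous2_measurable (@J_cont (c.2, c.1) t l k (w.2, w.1) p)) (ie _) (ie _) (fun x y => FE l k _ _ x y hc')).
apply: eq_Rint => x; apply: eq_Rint => y; rewrite /J /GA /Aq !enorm2 /dotp/=.
by rewrite [y ^+ l * _]mulrC [y ^+ 2 + _]addrC [y * w.2 + _]addrC [c.2 * y + _]addrC.
Qed.

Lemma gg_scale k l (t : R) : 0 < t ->
  itg (leb2 R) (fun x => `|x.1 ^+ k * x.2 ^+ l * gg (t / 2) (t / 2) x|) /\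
  Num.sqrt t ^+ (k + l + 2) * \int[leb2 R]_x `|x.1 ^+ k * x.2 ^+ l * gg (t / 2) (t / 2) x| =
  \int[leb2 R]_x `|x.1 ^+ k * x.2 ^+ l * gg (1 / 2) (1 / 2) x|.
Proof.
move=> t0; have t2 : 0 < t / 2 by rewrite divr_gt0.
have h0 : 0 < 1 / 2 :> R by rewrite divr_gt0.
have i1 := itg_norm (pow_gg_itg k l t2 t2); split => //.
have st : 0 < Num.sqrt t by rewrite sqrtr_gt0.
have ie a : itg leb (fun x => a * expR (- (1 * `|x|))) by apply: itgZl; exact: expR_abs_itg.
have ce a : continuous (fun x : R => a * expR (- (1 * `|x|))).
  move=> x; apply: cvgM; first exact: cvg_cst.
  apply: (@continuous_comp _ _ _ (fun x : R => - (1 * `|x|)) expR); last exact: continuous_expR.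
  by apply: cvgN; apply: cvgM; [exact: cvg_cst|exact: norm_continuous].
have cG : continuous (fun x : R * R => `|x.1 ^+ k * x.2 ^+ l * gg (1 / 2) (1 / 2) x|).
  move=> x; apply: (@continuous_comp _ _ _ (fun x : R * R => x.1 ^+ k * x.2 ^+ l * gg (1 / 2) (1 / 2) x) Num.norm); last exact: norm_continuous.
  exact: pow_gg_cont.
have GE (x : R * R) : `| `|x.1 ^+ k * x.2 ^+ l * gg (1 / 2) (1 / 2) x| | <= _ := le_trans (eq_ind_r (fun z => z <= `|x.1 ^+ k * x.2 ^+ l * gg (1 / 2) (1 / 2) x|) (lexx _) (normr_id _)) (pow_gg_le k l x h0 h0).
have [_ E] := @subst_plane R _ _ _ _ _ 0 st st cG (ce _) (ce _) (ie _) (ie _) GE.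
have -> : \int[leb2 R]_x `|x.1 ^+ k * x.2 ^+ l * gg (1 / 2) (1 / 2) x| =
  Num.sqrt t ^+ 2 * \int[leb2 R]_x `|(Num.sqrt t * x.1 + 0, Num.sqrt t * x.2 + 0).1 ^+ k * (Num.sqrt t * x.1 + 0, Num.sqrt t * x.2 + 0).2 ^+ l * gg (1 / 2) (1 / 2) (Num.sqrt t * x.1 + 0, Num.sqrt t * x.2 + 0)|.
  by rewrite E -expr2 mulrA divff ?mul1r// gt_eqF// exprn_gt0.
rewrite [_ ^+ (k + l + 2)]exprD [Num.sqrt t ^+ (k + l) * _]mulrC -mulrA; congr (_ * _).
rewrite -(RintZl _ i1); apply: eq_Rint => x /=; rewrite !addr0 /gg /ga/= !exprMn sqr_sqrtr ?ltW//.
have -> : t / 2 * x.1 ^+ 2 = 1 / 2 * (t * x.1 ^+ 2) by ring.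
have -> : t / 2 * x.2 ^+ 2 = 1 / 2 * (t * x.2 ^+ 2) by ring.
rewrite -[Num.sqrt t ^+ (k + l)]ger0_norm ?exprn_ge0 ?ltW// -normrM exprD; congr (`|_|).
by move: (expR _) (expR _) (Num.sqrt t ^+ k) (Num.sqrt t ^+ l) (x.1 ^+ k) (x.2 ^+ l) => A B D E' F G; ring.
Qed.

(** The arithmetic condition says that |w|^n t^l times the integral is invariant under scaling. For
    n = 0 the scaling of Gaussians gives the bound; each further power of w is removed by [J_ibp],
    whose three terms all preserve the condition. *)
Lemma J_bound n : forall l k1 k2, (l + l + n = k1 + k2 + 2)%N -> exists2 C : R, 0 <= C &
  forall c t w p, enorm c <= 1 / 10 -> 0 < t -> enorm w ^+ n * `|t ^+ l * \int[leb2 R]_x J c t k1 k2 w p x| <= C.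
Proof.
elim: n => [|n IH] l k1 k2 hn.
  exists (\int[leb2 R]_x `|x.1 ^+ k1 * x.2 ^+ k2 * gg (1 / 2) (1 / 2) x|); first exact: Rint_ge0.
  move=> c t w p hc t0; rewrite expr0 mul1r; have [i1 E] := gg_scale k1 k2 t0.
  have t1 := ltW t0; have tl : 0 <= t ^+ l by rewrite exprn_ge0.
  rewrite -E -hn addn0 exprD -exprMn -expr2 sqr_sqrtr// normrM (ger0_norm tl).
  apply: ler_wpM2l => //; apply: (@Rint_bound _ _ _ (leb2 R)) => //.
    exact: itg_meas (J_itg _ _ _ _ hc t0).
  by move=> x; exact: J_le.
have H1 l' k1' k2' : (l' + l' + n.+1 = k1' + k2' + 2)%N -> exists2 C : R, 0 <= C &
  forall c t w p, enorm c <= 1 / 10 -> 0 < t -> `|w.1| * (enorm w ^+ n * `|t ^+ l' * \int[leb2 R]_x J c t k1' k2' w p x|) <= C.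
  move=> hn'; have [|C2 C20 h2] := IH l'.+1 k1'.+1 k2'; first by move: hn'; rewrite !addSn !addnS addSn; lia.
  have [|C3 C30 h3] := IH l'.+1 k1' k2'.+1; first by move: hn'; lia.
  have [C1 C10 h1] : exists2 C : R, 0 <= C & forall c t w p, enorm c <= 1 / 10 -> 0 < t -> k1'%:R * (enorm w ^+ n * `|t ^+ l' * \int[leb2 R]_x J c t k1'.-1 k2' w p x|) <= C.
    case: k1' hn' {h2 h3} => [|k1'] hn'; first by exists 0 => // *; rewrite mul0r.
    have [|C C0 h] := IH l' k1' k2'; first by move: hn'; lia.
    by exists (k1'.+1%:R * C) => [|c t w p hc t0]; [rewrite mulr_ge0|apply: ler_wpM2l => //; exact: h].
  exists (C1 + 2 * C2 + 2 * C3); first by rewrite !addr_ge0 ?mulr_ge0.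
  move=> c t w p hc t0; have E := J_ibp k1' k2' w p hc t0.
  have := h1 c t w (p + pi / 2) hc t0; have := h2 c t w (p + pi / 2) hc t0; have := h3 c t w (p + pi / 2) hc t0.
  have c1 := enorm1_le c; have c2 := enorm2_le c; have t1 := ltW t0.
  move=> b3 b2 b1; rewrite (mulrCA `|w.1|) -normrM (mulrCA w.1) E {E}.
  move: (\int[leb2 R]_x J c t k1'.-1 k2' w (p + pi / 2) x) (\int[leb2 R]_x J c t k1'.+1 k2' w (p + pi / 2) x) (\int[leb2 R]_x J c t k1' k2'.+1 w (p + pi / 2) x) b1 b2 b3 => A B D b1 b2 b3.
  have e0 : 0 <= enorm w ^+ n by rewrite exprn_ge0 ?enorm_ge0.
  have tl : 0 <= t ^+ l' by rewrite exprn_ge0.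
  have a2 : `|2 * (1 - c.1 ^+ 2)| <= 2.
    have : 0 <= c.1 ^+ 2 <= 1 by rewrite sqr_ge0/= -(real_normK (num_real c.1)) expr_le1//; lra.
    by move=> /andP[q0 q1]; rewrite ger0_norm ?mulr_ge0 ?subr_ge0// ger_pMr// gerBl.
  have a3 : `|2 * c.1 * c.2| <= 2.
    rewrite -mulrA normrM ger0_norm// ler_piMr// normrM mulr_ile1//; lra.
  have -> : t ^+ l' * (k1'%:R * A - 2 * t * (1 - c.1 ^+ 2) * B + 2 * t * c.1 * c.2 * D) =
     k1'%:R * (t ^+ l' * A) + (- (2 * (1 - c.1 ^+ 2))) * (t ^+ l'.+1 * B) + 2 * c.1 * c.2 * (t ^+ l'.+1 * D) by rewrite (exprS t l'); ring.
  move: b1 b2 b3; move: (t ^+ l' * A) (t ^+ l'.+1 * B) (t ^+ l'.+1 * D) => A' B' D' b1 b2 b3.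
  apply: (le_trans (ler_wpM2l e0 (ler_normD _ _))); rewrite mulrDr; apply: lerD.
    apply: (le_trans (ler_wpM2l e0 (ler_normD _ _))); rewrite mulrDr; apply: lerD.
      by rewrite normrM ger0_norm// mulrCA.
    by rewrite normrM normrN mulrCA; apply: ler_pM => //; rewrite mulr_ge0.
  by rewrite normrM mulrCA; apply: ler_pM => //; rewrite mulr_ge0.
have [C1 C10 h1] := H1 l k1 k2 hn.
have [|C2 C20 h2] := H1 l k2 k1; first by rewrite hn [(k2 + k1)%N]addnC.
exists (C1 + C2) => [|c t w p hc t0]; first exact: addr_ge0.
have hc' : enorm (c.2, c.1) <= 1 / 10 by apply: le_trans hc; rewrite /enorm /dotp/= addrC.
have := h2 (c.2, c.1) t (w.2, w.1) p hc' t0; rewrite -(J_swap _ _ _ _ hc t0)/=.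
have -> : enorm (w.2, w.1) = enorm w by rewrite /enorm /dotp/= addrC.
move=> b2; have b1 := h1 c t w p hc t0.
rewrite exprS -mulrA; apply: le_trans (lerD b1 b2); rewrite -mulrDl.
by apply: ler_wpM2r; [rewrite mulr_ge0 ?exprn_ge0 ?enorm_ge0|exact: enorm_le_l1].
Qed.
End gauss_ibp.

(** * Bounds on the damped kernels and decay of the multipliers *)

Section multiplier_far_field.
Variable R : realType.
Local Notation leb := (@lebesgue_measure R).

Lemma exp_quad (x : R) : `|expR x - 1 - x| <= x ^+ 2 * expR `|x|.
Proof.
have h0 := expR_ge1Dx x; rewrite ger0_norm; last by lra.
have e0 := expR_gt0 x.
have [x0|x0] := leP 0 x.
  rewrite ger0_norm//.
  have h : expR x * (1 - x) <= 1.
    have := expR_ge1Dx (- x); rewrite expRN => h; have := ler_wpM2l (ltW e0) h.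
    by rewrite mulfV ?gt_eqF.
  have := sqr_ge0 x; move: (expR x) h h0 e0 => e h h0 e0 _.
  by rewrite expr2; nra.
have e1 : 1 <= expR `|x| by have := expR_ge1Dx `|x|; have := normr_ge0 x; lra.
have h : expR x * (1 - x) <= 1.
  have := expR_ge1Dx (- x); rewrite expRN => h; have := ler_wpM2l (ltW e0) h.
  by rewrite mulfV ?gt_eqF.
apply: (@le_trans _ _ (x ^+ 2)); last by rewrite ler_peMr ?sqr_ge0.
by move: (expR x) h h0 e0 => e h h0 e0; rewrite expr2; nra.
Qed.

Lemma quad_der_local (F : R -> R) (x d C del : R) : 0 < del -> 0 <= C ->
  (forall h, `|h| <= del -> `|F (x + h) - F x - h * d| <= C * h ^+ 2) -> is_derive x 1 F d.
Proof.
move=> d0 C0 H; pose G y := if `|y - x| <= del then F y else F x + (y - x) * d.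
have Gx : G x = F x by rewrite /G subrr normr0 ltW.
have DG : is_derive x 1 G d.
  apply: (@quad_der _ _ _ _ C) => h; rewrite Gx /G (_ : x + h - x = h); last by ring.
  case: ifP => [/H//|_]; rewrite (_ : _ - _ = 0); last by ring.
  by rewrite normr0 mulr_ge0 ?sqr_ge0.
apply: (near_eq_is_derive _ DG); apply: filterS (nbhsx_ballx x _ d0) => y /= hy.
by rewrite /G ifT// distrC; exact: ltW hy.
Qed.

Section kernel.
Variables (i j : 'I_2) (k l : nat).
Let a := (k + l + 2)%N.

(** With the factors c_i taken out, every symbol needed here is [pp / Aq] times a monomial. *)
Definition pp (xi : R * R) : R := pcoord i xi * pcoord j xi.

(* The convolution kernel of the symbol Msym below, damped by e^{-t A}. *)
Definition damped_kernel (c : R * R) (p t : R) (w : R * R) : R := \int[leb2 R]_xi (pp xi / Aq c xi * J c t k l w p xi).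

Lemma pp_le xi : `|pp xi| <= 1 * enorm xi ^+ 2.
Proof. by rewrite mul1r /pp normrM expr2; apply: ler_pM => //; exact: pcoord_le. Qed.

Lemma pp_sym c xi : enorm c <= 1 / 10 -> `|pp xi / Aq c xi| <= 2.
Proof. by move=> hc; rewrite -[X in _ <= X]mulr1; apply: sym_le => //; exact: pp_le. Qed.

Lemma pp_cont : continuous pp.
Proof. by apply: contM2; exact: pcoord_cont. Qed.

Lemma pp_J : exists k' l', (k' + l' = a)%N /\ forall c t w p xi, pp xi * J c t k l w p xi = J c t k' l' w p xi.
Proof.
have h jj k0 l0 : exists k' l', (k' + l' = (k0 + l0).+1)%N /\ forall (c : R * R) (t : R) (w : R * R) (p : R) xi, pcoord jj xi * J c t k0 l0 w p xi = J c t k' l' w p xi.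
  elim/ord2P: jj.
    by exists k0.+1, l0; split=> [|c t w p xi]; [rewrite addSn|rewrite /J /pcoord/= exprS !mulrA].
  exists k0, l0.+1; split=> [|c t w p xi]; first by rewrite addnS.
  by rewrite /J /pcoord/= exprS; move: (cos _) (GA _ _ _) (_ ^+ k0) (_ ^+ l0) => A B D E; ring.
have [k1 [l1 [e1 h1]]] := h j k l; have [k2 [l2 [e2 h2]]] := h i k1 l1.
by exists k2, l2; split=> [|c t w p xi]; [rewrite e2 e1 /a !addnS addn0|rewrite /pp -mulrA h1 h2].
Qed.

Lemma damped_kernel_itg c p t w : enorm c <= 1 / 10 -> 0 < t -> itg (leb2 R) (fun xi => pp xi / Aq c xi * J c t k l w p xi).
Proof.
move=> hc t0; under eq_fun do rewrite mulrC.
apply: (itg_mul_bdd (J_itg k l w p hc t0) (B := 2)); first by apply: sym_meas => //; exact: pp_cont.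
by move=> x; exact: pp_sym.
Qed.

Lemma damped_kernel_scale : exists2 C : R, 0 <= C & forall c p t w, enorm c <= 1 / 10 -> 0 < t -> Num.sqrt t ^+ a * `|damped_kernel c p t w| <= C.
Proof.
exists (2 * \int[leb2 R]_x `|x.1 ^+ k * x.2 ^+ l * gg (1 / 2) (1 / 2) x|); first by rewrite mulr_ge0// Rint_ge0.
move=> c p t w hc t0; have [i1 E] := gg_scale k l t0.
rewrite -E mulrCA; apply: ler_wpM2l; first by rewrite exprn_ge0// sqrtr_ge0.
rewrite -(RintZl _ i1); apply: (@Rint_bound _ _ _ (leb2 R)); [exact: itg_meas (damped_kernel_itg _ _ hc t0)|exact: itgZl|].
by move=> x; rewrite normrM; apply: ler_pM => //; [exact: pp_sym|exact: J_le].
Qed.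

(** Differentiation in t cancels the denominator A. The derivative is the integral of a damped
    polynomial, to which [J_bound] applies, whereas the symbol of the kernel itself is not smooth at
    the origin. *)
Lemma damped_kernel_der (c : R * R) (p t : R) (w : R * R) : enorm c <= 1 / 10 -> 0 < t ->
  is_derive t 1 (fun t : R => damped_kernel c p t w) (- \int[leb2 R]_xi (pp xi * J c t k l w p xi)).
Proof.
(* Of the damping rate t, one half pays for e^{|h| A} with |h| <= t/2 and one quarter for the factor
   A^2 of the remainder; the last quarter leaves a Gaussian of parameter t/8. *)
move=> hc t0; have t8 : 0 < t / 8 by rewrite divr_gt0.
have t1 : 0 < t / 2 by rewrite divr_gt0.
have ig := itg_norm (pow_gg_itg k l t8 t8).
pose Cc := 64 / t ^+ 2 * \int[leb2 R]_x `|x.1 ^+ k * x.2 ^+ l * gg (t / 8) (t / 8) x|.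
have C0 : 0 <= Cc by rewrite mulr_ge0 ?divr_ge0 ?exprn_ge0 ?(ltW t0)// Rint_ge0.
apply: (quad_der_local t1 C0) => h hh.
have th : 0 < t + h by move: hh; rewrite ler_norml => /andP[]; lra.
have i1 := damped_kernel_itg p w hc th; have i2 := damped_kernel_itg p w hc t0.
have i3 : itg (leb2 R) (fun xi => pp xi * J c t k l w p xi).
  have [k' [l' [_ E]]] := pp_J; under eq_fun do rewrite E; exact: J_itg.
rewrite /damped_kernel mulrN -(RintB i1 i2) opprK -(RintZl _ i3) -(RintD (itgB i1 i2) (itgZl _ i3)) /Cc mulrAC -(RintZl _ ig).
apply: (@Rint_bound _ _ _ (leb2 R)); [exact: itg_meas (itgD (itgB i1 i2) (itgZl _ i3))|exact: itgZl|move=> x].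
have A0 := Aq_ge0 x hc.
(* This also holds where A vanishes, since the numerator then vanishes too. *)
have Epp : pp x = pp x / Aq c x * Aq c x.
  have [A1|An0] := eqVneq (Aq c x) 0; last by rewrite divfK.
  rewrite A1 mulr0; apply/eqP; rewrite -normr_le0; apply: (le_trans (pp_le x)).
  by have := Aq_lb x hc; rewrite A1; lra.
have EJ : J c (t + h) k l w p x = J c t k l w p x * expR (- h * Aq c x).
  rewrite /J /GA (_ : - ((t + h) * Aq c x) = - (t * Aq c x) + - h * Aq c x); last by ring.
  by rewrite expRD; move: (expR _) (expR _) (cos _) => u v z; ring.
have -> : pp x / Aq c x * J c (t + h) k l w p x - pp x / Aq c x * J c t k l w p x + h * (pp x * J c t k l w p x) =
  (pp x / Aq c x) * (J c t k l w p x * (expR (- h * Aq c x) - 1 - (- h * Aq c x))).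
  by rewrite EJ {3}Epp; move: (pp x / _) (J _ _ _ _ _ _ _) (expR _) => u v z; ring.
have h1 := pp_sym x hc; have h2 := exp_quad (- h * Aq c x).
have h3 : `|J c t k l w p x| * `|expR (- h * Aq c x) - 1 - (- h * Aq c x)| <= h ^+ 2 * (32 / t ^+ 2) * `|x.1 ^+ k * x.2 ^+ l * gg (t / 8) (t / 8) x|.
  have q1 : `|- h * Aq c x| <= t / 2 * Aq c x by rewrite normrM normrN (ger0_norm A0) ler_wpM2r.
  have q2 : `|J c t k l w p x| <= `|x.1 ^+ k * x.2 ^+ l| * expR (- (t * Aq c x)).
    rewrite /J !normrM [`|GA _ _ _|]ger0_norm ?GA_ge0// -[X in _ <= X]mulr1.
    by apply: ler_pM; rewrite ?mulr_ge0 ?GA_ge0// cos_max.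
  have q3 : (- h * Aq c x) ^+ 2 * expR `|- h * Aq c x| <= h ^+ 2 * (32 / t ^+ 2) * expR (t / 4 * Aq c x) * expR (t / 2 * Aq c x).
    apply: ler_pM; rewrite ?sqr_ge0 ?expR_ge0// ?ler_expR//.
    have := exp_pow 2 (mulr_ge0 (ltW (divr_gt0 t0 (ltr0Sn R 3))) A0) => q.
    rewrite mulNr sqrrN exprMn -mulrA; apply: ler_wpM2l; first exact: sqr_ge0.
    rewrite mulrAC ler_pdivlMr ?exprn_gt0//.
    by move: q; rewrite exprMn /= (_ : 2`! = 2)%N//; move: (expR _) => e; move: (Aq c x ^+ 2) => A2; rewrite exprMn exprVn; lra.
  apply: (le_trans (ler_pM (normr_ge0 _) (normr_ge0 _) q2 (le_trans h2 q3))).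
  rewrite [X in X <= _](_ : _ = h ^+ 2 * (32 / t ^+ 2) * (`|x.1 ^+ k * x.2 ^+ l| * (expR (- (t * Aq c x)) * expR (t / 4 * Aq c x) * expR (t / 2 * Aq c x)))); last first.
    by move: (expR _) (expR _) (expR _) (`|_|) (32 / _) => e1 e2 e3 m1 m2; ring.
  apply: ler_wpM2l; first by rewrite mulr_ge0 ?sqr_ge0// divr_ge0// exprn_ge0// ltW.
  rewrite (normrM (x.1 ^+ k * x.2 ^+ l)); apply: ler_wpM2l => //; rewrite -!expRD ger0_norm ?gg_ge0//.
  have t4 : 0 < t / 4 by rewrite divr_gt0.
  have := GA_le x hc t4; rewrite (_ : t / 4 / 2 = t / 8); last by field.
  by rewrite /GA (_ : - (t * Aq c x) + t / 4 * Aq c x + t / 2 * Aq c x = - (t / 4 * Aq c x))//; field.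
rewrite (normrM (pp x / Aq c x)) (normrM (J c t k l w p x)); apply: (le_trans (ler_pM (normr_ge0 _) (mulr_ge0 (normr_ge0 _) (normr_ge0 _)) h1 h3)).
by rewrite le_eqVlt; apply/orP; left; apply/eqP; move: (`|_|) => m1; field; rewrite gt_eqF.
Qed.

(** For |w| <= sqrt t the scaling bound suffices. Otherwise the kernel at t is compared with the
    kernel at |w|^2, where scaling gives |w|^{-a}; by [J_bound] the t-derivative is of order
    |w|^{-a-2}, over an interval of length at most |w|^2. *)
Lemma damped_kernel_bound : exists2 C : R, 0 <= C & forall c p t w, enorm c <= 1 / 10 -> 0 < t ->
  Num.sqrt t ^+ a * `|damped_kernel c p t w| <= C /\ enorm w ^+ a * `|damped_kernel c p t w| <= C.
Proof.
have [C0 C00 h0] := damped_kernel_scale; have [k' [l' [ea E]]] := pp_J.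
have [|C1 C10 h1] := @J_bound R a.+2 0 k' l'; first by rewrite ea !addnS !addn0 !add0n.
exists (C0 + C1) => [|c p t w hc t0]; first exact: addr_ge0.
have s0 := h0 c p t w hc t0; split; first by apply: (le_trans s0); rewrite lerDl.
have e0 := enorm_ge0 w; have st0 := sqrtr_ge0 t.
have [h|h] := leP (enorm w) (Num.sqrt t).
  apply: (@le_trans _ _ (Num.sqrt t ^+ a * `|damped_kernel c p t w|)); last by apply: (le_trans s0); rewrite lerDl.
  by apply: ler_wpM2r => //; rewrite lerXn2r// nnegrE.
have e1 : 0 < enorm w := le_lt_trans st0 h.
have tt : t < enorm w ^+ 2.
  by rewrite -[X in X < _](sqr_sqrtr (ltW t0)) ltrXn2r// nnegrE.
have D (z : R) : 0 < z -> is_derive z 1 (fun t : R => damped_kernel c p t w) (- \int[leb2 R]_xi (pp xi * J c z k l w p xi)).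
  by move=> z0; exact: damped_kernel_der.
have [||z zi E2] := @MVT R (fun t : R => damped_kernel c p t w) (fun z => - \int[leb2 R]_xi (pp xi * J c z k l w p xi)) t (enorm w ^+ 2) tt.
- by move=> z; rewrite in_itv/= => /andP[z1 _]; apply: D; exact: lt_trans t0 z1.
- apply: continuous_in_subspaceT => z; rewrite inE/= in_itv/= => /andP[z1 _].
  apply: differentiable_continuous; apply/derivable1_diffP.
  by apply: (@ex_derive _ _ _ _ _ _ _ (D z _)); exact: lt_le_trans t0 z1.
have z0 : 0 < z by move: zi; rewrite in_itv/= => /andP[z1 _]; exact: lt_trans t0 z1.
have G : enorm w ^+ a.+2 * `|\int[leb2 R]_xi (pp xi * J c z k l w p xi)| <= C1.
  by under eq_Rint do rewrite E; have := h1 c z w p hc z0; rewrite expr0 mul1r.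
have W2 := h0 c p (enorm w ^+ 2) w hc (exprn_gt0 2 e1); rewrite sqrtr_sqr ger0_norm// in W2.
rewrite -[damped_kernel c p t w](subKr (damped_kernel c p (enorm w ^+ 2) w)).
have ea0 : 0 <= enorm w ^+ a by rewrite exprn_ge0.
apply: (le_trans (ler_wpM2l ea0 (ler_normB _ _))); rewrite mulrDr; apply: lerD => //.
have tt0 : 0 <= enorm w ^+ 2 - t by rewrite subr_ge0 ltW.
rewrite E2 normrM normrN (ger0_norm tt0).
apply: le_trans G; rewrite (_ : enorm w ^+ a.+2 = enorm w ^+ a * enorm w ^+ 2); last by rewrite -exprD addn2.
rewrite -(mulrA (enorm w ^+ a)); apply: ler_wpM2l => //.
by rewrite mulrC; apply: ler_wpM2r => //; rewrite gerBl ltW.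
Qed.

Definition Msym (c xi : R * R) : R := pp xi / Aq c xi * (xi.1 ^+ k * xi.2 ^+ l).

Lemma enorm_om (xi : R * R) : enorm xi <= om xi.
Proof. by rewrite omE; have := sqr_ge0 (enorm xi - 1); have := enorm_ge0 xi; move: (enorm xi) => e; nra. Qed.

Lemma mon_om (xi : R * R) : `|xi.1 ^+ k * xi.2 ^+ l| <= om xi ^+ (k + l).
Proof.
have o0 := ltW (om_gt0 xi); rewrite normrM !normrX exprD; apply: ler_pM; rewrite ?exprn_ge0// lerXn2r ?nnegrE//.
  exact: le_trans (enorm1_le xi) (enorm_om xi).
exact: le_trans (enorm2_le xi) (enorm_om xi).
Qed.

Lemma Msym_meas c : enorm c <= 1 / 10 -> measurable_fun setT (Msym c).
Proof.
move=> hc; apply: measurable_funM; first by apply: sym_meas => //; exact: pp_cont.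
by apply: measurable_funM; apply: measurable_funX.
Qed.

Lemma Msym_le c xi : enorm c <= 1 / 10 -> `|Msym c xi| <= 2 * om xi ^+ (k + l).
Proof. by move=> hc; rewrite normrM; apply: ler_pM => //; [exact: pp_sym|exact: mon_om]. Qed.

Lemma multiplier_trunc c (f : R * R -> R) (B p t : R) y : enorm c <= 1 / 10 -> 0 < t -> exp_decaying f ->
  (forall xi, om xi ^+ (a + 2) * fa f xi <= B) ->
  itg (leb2 R) (fun x => f x * damped_kernel c p t (y - x)) /\
  `|MI (Msym c) f p y - \int[leb2 R]_x (f x * damped_kernel c p t (y - x))| <= t * (3 * B * \int[leb2 R]_x W x).
Proof.
move=> hc t0 ef hB.
have im : itg (leb2 R) (fun xi => Msym c xi * GA c t xi).
  have := damped_kernel_itg 0 0 hc t0.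
  suff E xi : pp xi / Aq c xi * J c t k l 0 0 xi = Msym c xi * GA c t xi by under eq_fun do rewrite E.
  by rewrite /J /Msym /dotp/= !mulr0 !addr0 cos0 mulr1 !mulrA.
have [i1 E1] := MI_swap_itg p y (edec_itg ef) im.
have Ek x : \int[leb2 R]_xi (Msym c xi * GA c t xi * cos (dotp xi (y - x) + p)) = damped_kernel c p t (y - x).
  by apply: eq_Rint => xi; rewrite /J /Msym !mulrA.
have i1' : itg (leb2 R) (fun x => f x * damped_kernel c p t (y - x)) by move: i1; under eq_fun do rewrite Ek.
split=> //.
have -> : \int[leb2 R]_x (f x * damped_kernel c p t (y - x)) = MI (fun xi => Msym c xi * GA c t xi) f p y.
  by rewrite E1; apply: eq_Rint => x; rewrite Ek.
have j1 := mi_itg p y ef (Msym_meas hc) (fun xi => Msym_le xi hc).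
have j2 : itg (leb2 R) (fun xi => Msym c xi * GA c t xi * (FC f xi * cos (dotp y xi + p) + FS f xi * sin (dotp y xi + p))).
  apply: (@mi_itg _ (k + l)%N _ _ 2) => //; first exact: itg_meas im.
  move=> xi; rewrite normrM (ger0_norm (GA_ge0 _ _ _)); apply: le_trans (Msym_le xi hc).
  by rewrite ler_piMr// GA_le1// ltW.
rewrite /MI -(RintB j1 j2) -(RintZl _ (@W_itg R)) -(RintZl _ (itgZl _ (@W_itg R))).
apply: (@Rint_bound _ _ _ (leb2 R)); [exact: itg_meas (itgB j1 j2)|by apply: itgZl; apply: itgZl; exact: W_itg|move=> xi].
rewrite -mulrBl normrM; have A0 := Aq_ge0 xi hc; have o0 := ltW (om_gt0 xi).
have h1 : `|Msym c xi - Msym c xi * GA c t xi| <= t * om xi ^+ a.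
  have G1 := GA_le1 xi hc (ltW t0).
  rewrite -{1}[Msym c xi]mulr1 -mulrBr normrM [`|1 - _|]ger0_norm ?subr_ge0//.
  have h2 : 1 - GA c t xi <= t * Aq c xi by have := expR_ge1Dx (- (t * Aq c xi)); rewrite /GA; lra.
  apply: (le_trans (ler_wpM2l (normr_ge0 _) h2)).
  rewrite /Msym normrM mulrCA; apply: ler_wpM2l; first exact: ltW.
  rewrite mulrAC -[X in _ * X * _](ger0_norm A0) -normrM /a [(k + l + 2)%N]addnC exprD.
  apply: ler_pM => //; last exact: mon_om.
  apply: (@le_trans _ _ `|pp xi|).
    have [->|An0] := eqVneq (Aq c xi) 0; first by rewrite mulr0 normr0.
    by rewrite divfK.
  apply: (le_trans (pp_le xi)); rewrite mul1r lerXn2r ?nnegrE ?enorm_ge0//; exact: enorm_om.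
apply: (le_trans (ler_pM (normr_ge0 _) (normr_ge0 _) h1 (phase_fa _ _ _ _))).
rewrite -(mulrA t); apply: ler_wpM2l; first exact: ltW.
have o2 : 0 < om xi ^+ 2 by rewrite exprn_gt0 ?om_gt0.
have := hB xi; rewrite exprD mulrAC -ler_pdivlMr// => /le_trans; apply.
rewrite [3 * B]mulrC -mulrA; apply: ler_wpM2l; last exact: om2_W.
by apply: le_trans (hB 0); rewrite mulr_ge0 ?fa_ge0// exprn_ge0// ltW// om_gt0.
Qed.

(** Where |x| <= |y|/2, the kernel decays like |y - x|^{-a}, comparable to |y|^{-a}. Elsewhere only
    the scaling bound t^{-a/2} is available, a power of |y| that the exponential decay of f
    absorbs. *)
Lemma multiplier_far_field (Cf B : R) : 0 <= Cf -> exists2 C : R, 0 <= C & forall c (f : R * R -> R) p y,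
  enorm c <= 1 / 10 -> exp_decaying f -> (forall x, `|f x| <= Cf * expR (- enorm x)) ->
  (forall xi, om xi ^+ (a + 2) * fa f xi <= B) -> 1 <= enorm y -> `|MI (Msym c) f p y| <= C / enorm y ^+ a.
Proof.
move=> Cf0; have [C C0 hk] := damped_kernel_bound.
have q0 : 0 < 1 / 4 :> R by lra.
have ie := @expw_itg R (1 / 4) q0.
(* With sqrt t = |y|^{-a} the scaling bound is |y|^{a^2}; the claimed |y|^{-a} requires |y|^{a^2 +
   a} <= D e^{|y|/4}, and |y|/4 is at most |x|/2 in this zone. *)
pose D : R := 4 ^+ (a * a + a) * (a * a + a)`!%:R.
have D0 : 0 <= D by rewrite mulr_ge0 ?exprn_ge0.
pose B1 := 3 * B * \int[leb2 R]_x W x.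
pose C2 := C * (2 ^+ a + D) * Cf * \int[leb2 R]_x expw (1 / 4) x.
have C20 : 0 <= C2.
  rewrite mulr_ge0//; last by apply: Rint_ge0 => x; exact: expw_ge0.
  by rewrite mulr_ge0// mulr_ge0// addr_ge0// exprn_ge0.
exists (`|B1| + C2) => [|c f p y hc ef fC hB y1]; first exact: addr_ge0.
have y0 : 0 < enorm y := lt_le_trans ltr01 y1.
have ya0 : 0 < enorm y ^+ a by rewrite exprn_gt0.
pose r := (enorm y ^+ a)^-1; have r0 : 0 < r by rewrite invr_gt0.
have t0 : 0 < r ^+ 2 by rewrite exprn_gt0.
have sq : Num.sqrt (r ^+ 2) = r by rewrite sqrtr_sqr gtr0_norm.
have [i1 h1] := multiplier_trunc p y hc t0 ef hB.
rewrite -[MI _ _ _ _](subrK (\int[leb2 R]_x (f x * damped_kernel c p (r ^+ 2) (y - x)))).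
apply: (le_trans (ler_normD _ _)); rewrite mulrDl; apply: lerD.
  apply: (le_trans h1); apply: (@le_trans _ _ (r ^+ 2 * `|B1|)); first by rewrite ler_wpM2l ?ler_norm ?sqr_ge0.
  rewrite mulrC; apply: ler_wpM2l => //; rewrite -/r expr2 ler_piMr ?(ltW r0)// invf_le1//.
  by rewrite exprn_ege1.
have -> : C2 / enorm y ^+ a = \int[leb2 R]_x (C * (2 ^+ a + D) * Cf / enorm y ^+ a * expw (1 / 4) x).
  by rewrite (RintZl _ ie) /C2 mulrAC.
apply: (@Rint_bound _ _ _ (leb2 R)); [exact: itg_meas i1|exact: itgZl|move=> x].
have [k1 k2] := hk c p (r ^+ 2) (y - x) hc t0; rewrite sq in k1.
have kk : `|damped_kernel c p (r ^+ 2) (y - x)| <= C * (2 ^+ a + D) * expR (enorm x / 2) / enorm y ^+ a.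
  rewrite ler_pdivlMr//; have ex : 1 <= expR (enorm x / 2).
    by rewrite -[X in X <= _]expR0 ler_expR divr_ge0 ?enorm_ge0.
  have [h|h] := leP (enorm x) (enorm y / 2).
    have h3 : enorm y / 2 <= enorm (y - x) by have := enorm_lb y x; lra.
    have h4 : (enorm y / 2) ^+ a <= enorm (y - x) ^+ a by rewrite lerXn2r// nnegrE ?enorm_ge0// divr_ge0// ltW.
    have h5 := le_trans (ler_wpM2r (normr_ge0 _) h4) k2.
    have h6 : `|damped_kernel c p (r ^+ 2) (y - x)| * enorm y ^+ a <= C * 2 ^+ a.
      rewrite -ler_pdivrMr ?exprn_gt0//; apply: le_trans h5.
      by rewrite expr_div_n -mulrA mulrC.
    apply: (le_trans h6); rewrite -[X in X <= _]mulr1; apply: ler_pM => //; first by rewrite mulr_ge0// exprn_ge0.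
    by apply: ler_wpM2l => //; rewrite lerDl.
  have h3 : `|damped_kernel c p (r ^+ 2) (y - x)| <= C * enorm y ^+ (a * a).
    have ra0 : 0 < r ^+ a by rewrite exprn_gt0.
    rewrite exprM -[X in _ * X]invrK -exprVn -/r ler_pdivlMr// mulrC; exact: k1.
  have h4 : enorm y ^+ (a * a + a) <= D * expR (enorm y / 4).
    have := exp_pow (a * a + a) (divr_ge0 (ltW y0) (ler0n R 4)).
    rewrite expr_div_n ler_pdivrMr ?exprn_gt0// => /le_trans; apply.
    by rewrite mulrC mulrA.
  have h5 : expR (enorm y / 4) <= expR (enorm x / 2) by rewrite ler_expR; lra.
  apply: (le_trans (ler_wpM2r (ltW ya0) h3)); rewrite -(mulrA C (enorm y ^+ (a * a))) -exprD -(mulrA C); apply: ler_wpM2l => //.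
  apply: (le_trans h4); apply: ler_pM; rewrite ?expR_ge0//.
  by rewrite lerDr exprn_ge0.
have ew : expR (- enorm x) * expR (enorm x / 2) <= expw (1 / 4) x.
  rewrite -expRD; have := exp_enorm_le x (ltW (divr_gt0 ltr01 (ltr0Sn R 1))).
  have -> : 1 / 2 / 2 = 1 / 4 :> R by field.
  have -> // : - enorm x + enorm x / 2 = - (1 / 2 * enorm x) by field.
rewrite normrM; apply: (le_trans (ler_pM (normr_ge0 _) (normr_ge0 _) (fC x) kk)).
have P0 : 0 <= C * (2 ^+ a + D) * Cf / enorm y ^+ a.
  by rewrite divr_ge0 ?(ltW ya0)// mulr_ge0// mulr_ge0// addr_ge0// exprn_ge0.
apply: (@le_trans _ _ (C * (2 ^+ a + D) * Cf / enorm y ^+ a * (expR (- enorm x) * expR (enorm x / 2)))).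
  by rewrite le_eqVlt; apply/orP; left; apply/eqP; move: (expR _) (expR _) (2 ^+ a + D) ((enorm y ^+ a)^-1) => e1 e2 u v; ring.
exact: ler_wpM2l P0 _ _ ew.
Qed.
End kernel.
End multiplier_far_field.

(** * Far-field bounds for the derivatives of the profiles *)

Section derivs.
Variable R : realType.
Local Notation leb := (@lebesgue_measure R).

Lemma partials_lin s (a b : R) (f g : R * R -> R) :
  (forall s y j, derivable (partials s f) y (evec R j)) -> (forall s y j, derivable (partials s g) y (evec R j)) ->
  partials s (fun y => a * f y + b * g y) = (fun y => a * partials s f y + b * partials s g y).
Proof.
move=> df dg; elim: s => [//|j s IH]; rewrite /= IH.
have h (r : R) (u : R * R -> R) y : derivable u y (evec R j) ->
    derivable (fun x => r * u x) y (evec R j) /\ partial j (fun x => r * u x) y = r * partial j u y.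
  move=> du; have dc : derivable (fun _ : R * R => r) y (evec R j) by exact: derivable_cst.
  split; first exact: (derivableZ du).
  by rewrite partialM// (_ : partial j (fun=> r) y = 0) ?mul0r ?add0r//; exact: derive_cst.
rewrite partialD; [|by move=> y; exact: (h a _ _ (df s y j)).1|by move=> y; exact: (h b _ _ (dg s y j)).1].
by apply/funext => y; rewrite (h a _ _ (df s y j)).2 (h b _ _ (dg s y j)).2.
Qed.

Lemma dotpl_cont (c : R * R) : continuous (dotp c).
Proof. by rewrite (_ : dotp c = (fun xi : R * R => dotp xi c)); [exact: dotp_cont|apply/funext => z; rewrite dotpC]. Qed.

Lemma symV_le (c xi : R * R) j : enorm c <= 1 / 10 -> `|dotp c xi * pcoord j xi / Aq c xi| <= 2.
Proof.
move=> hc; rewrite -[X in _ <= X]mulr1.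
apply: (@sym_le R c (fun xi => dotp c xi * pcoord j xi)) => //.
rewrite mul1r normrM expr2; apply: ler_pM => //; last exact: pcoord_le.
apply: (le_trans (dotp_le _ _)); rewrite ler_piMl ?enorm_ge0//; lra.
Qed.

Definition pdirs (m : nat * nat) : seq 'I_2 := nseq m.1 ord0 ++ nseq m.2 ord_max.

Lemma mono_ms m (xi : R * R) : mono (pdirs m) xi = xi.1 ^+ m.1 * xi.2 ^+ m.2.
Proof.
case: m => a b; rewrite /pdirs/=; elim: a => [|a IH] /=; last by rewrite IH exprS mulrA.
by rewrite mul1r; elim: b => [//|b IH] /=; rewrite IH exprS.
Qed.

Lemma MI_lin (m1 m2 f : R * R -> R) (a b K1 K2 p : R) k y : exp_decaying f -> measurable_fun setT m1 -> measurable_fun setT m2 ->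
  (forall xi, `|m1 xi| <= K1 * om xi ^+ k) -> (forall xi, `|m2 xi| <= K2 * om xi ^+ k) ->
  MI (fun xi => a * m1 xi + b * m2 xi) f p y = a * MI m1 f p y + b * MI m2 f p y.
Proof.
move=> ef h1 h2 k1 k2; have i1 := mi_itg p y ef h1 k1; have i2 := mi_itg p y ef h2 k2.
rewrite /MI -(RintZl _ i1) -(RintZl _ i2) -(RintD (itgZl _ i1) (itgZl _ i2)).
by apply: eq_Rint => xi; move: (FC f xi * cos _ + _) => A; ring.
Qed.

(** Expanding c.xi exhibits the factor |c| in front of multipliers that are bounded uniformly in c;
    for [symN_MI] the same is done twice. *)
Lemma symV_MI c j m (f : R * R -> R) p y : enorm c <= 1 / 10 -> exp_decaying f ->
  MI (fun xi => mono (pdirs m) xi * (dotp c xi * pcoord j xi / Aq c xi)) f p y =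
  c.1 * MI (Msym ord0 j m.1 m.2 c) f p y + c.2 * MI (Msym ord_max j m.1 m.2 c) f p y.
Proof.
move=> hc ef.
rewrite -(MI_lin c.1 c.2 p y ef (Msym_meas ord0 j m.1 m.2 hc) (Msym_meas ord_max j m.1 m.2 hc) (fun xi => Msym_le ord0 j m.1 m.2 xi hc) (fun xi => Msym_le ord_max j m.1 m.2 xi hc)).
apply: eq_Rint => xi; congr (_ * _); rewrite mono_ms /Msym /pp /dotp /pcoord/=.
by move: (Aq c xi)^-1 (if _ then _ else _) (_ ^+ m.1) (_ ^+ m.2) => A B D E; ring.
Qed.

Lemma symN_MI c m (f : R * R -> R) p y : enorm c <= 1 / 10 -> exp_decaying f ->
  MI (fun xi => mono (pdirs m) xi * symN c xi) f p y =
  c.1 * (c.1 * MI (Msym ord0 ord0 m.1 m.2 c) f p y + c.2 * MI (Msym ord_max ord0 m.1 m.2 c) f p y)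
  + c.2 * (c.1 * MI (Msym ord0 ord_max m.1 m.2 c) f p y + c.2 * MI (Msym ord_max ord_max m.1 m.2 c) f p y).
Proof.
move=> hc ef; rewrite -(symV_MI ord0 m p y hc ef) -(symV_MI ord_max m p y hc ef).
have mV j : measurable_fun setT (fun xi => mono (pdirs m) xi * (dotp c xi * pcoord j xi / Aq c xi)).
  under eq_fun do rewrite mono_ms; apply: measurable_funM.
    by apply: measurable_funM; apply: measurable_funX.
  apply: sym_meas => //; apply: contM2; last exact: pcoord_cont.
  exact: dotpl_cont.
have lV j xi : `|mono (pdirs m) xi * (dotp c xi * pcoord j xi / Aq c xi)| <= 2 * om xi ^+ (m.1 + m.2).
  rewrite mono_ms normrM mulrC; apply: ler_pM => //; last exact: mon_om.
  exact: symV_le.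
rewrite -(MI_lin c.1 c.2 p y ef (mV ord0) (mV ord_max) (lV ord0) (lV ord_max)).
apply: eq_Rint => xi; congr (_ * _); rewrite /symN /pcoord/= expr2 {1}/dotp.
by move: (Aq c xi)^-1 (dotp c xi) (mono _ _) => A B D; ring.
Qed.

Lemma pderivE m (f : R * R -> R) : pderiv m f = partials (pdirs m) f. Proof. by []. Qed.

Section prof.
Variables (cs : R) (Q : R * R -> R) (U : R * R -> R * R -> R[i]) (N : R * R -> R * R -> R) (V : R * R -> R * R -> R * R).
Variable ct : R.
Hypotheses (hUNV : solitary_profiles cs Q U N V) (ct0 : 0 < ct < cs) (ct1 : ct <= 1 / 10).
Hypothesis ef : forall c, enorm c < ct -> exp_decaying (sqmod (U c)).
Hypothesis hB : forall k, exists2 B : R, 0 <= B & forall c, enorm c < ct -> forall xi, om xi ^+ k * fa (sqmod (U c)) xi <= B.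
Hypothesis hC : forall s, exists2 C : R, 0 <= C & forall c, enorm c < ct -> forall y, `|partials s (sqmod (U c)) y| <= C * expR (- enorm y).

Lemma far_uniform i j m : exists2 C : R, 0 <= C & forall c p y, enorm c < ct -> 4 <= enorm y ->
  `|MI (Msym i j m.1 m.2 c) (sqmod (U c)) p y| <= C / enorm y ^+ (mdeg m + 2).
Proof using All.
have [Cf Cf0 hf] := hC [::]; have [B B0 hb] := hB (m.1 + m.2 + 2 + 2)%N.
have [C C0 h] := multiplier_far_field i j m.1 m.2 B Cf0; exists C => // c p y hc hy.
apply: h; [by apply: ltW; exact: lt_le_trans ct1|exact: ef|exact: hf|exact: hb|by apply: le_trans hy; rewrite ler1n].
Qed.

(** The local term -f of N accounts for e^{-|y|}. [V] has no local term, hence no exponential in its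
    bound. *)
Lemma far_field_bounds (m : nat * nat) : exists2 C : R, 0 < C & forall c y : R * R, enorm c < ct -> 4 <= enorm y ->
  `|pderiv m (N c) y| <= C * (expR (- enorm y) + enorm c ^+ 2 / enorm y ^+ (mdeg m + 2)) /\
  `|pderiv m (fun x => (V c x).1) y| + `|pderiv m (fun x => (V c x).2) y| <= C * (enorm c / enorm y ^+ (mdeg m + 2)).
Proof using All.
have [C1 C10 h1] := far_uniform ord0 ord0 m; have [C2 C20 h2] := far_uniform ord_max ord0 m.
have [C3 C30 h3] := far_uniform ord0 ord_max m; have [C4 C40 h4] := far_uniform ord_max ord_max m.
have [D D0 hD] := hC (pdirs m).
pose C := 1 + D + (C1 + C2 + C3 + C4).
have S0 : 0 <= C1 + C2 + C3 + C4 by rewrite !addr_ge0.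
have CS : C1 + C2 + C3 + C4 <= C by rewrite lerDr addr_ge0.
have CD : D <= C by rewrite /C; lra.
have q1 : c4 R <= 1 by apply: (le_trans (c4_le R)); lra.
exists C => [|c y hc hy]; first by rewrite /C; lra.
have [ctp ctcs] := andP ct0; have hcs := lt_trans hc ctcs.
have c10 : enorm c <= 1 / 10 by apply: ltW; exact: lt_le_trans ct1.
have efc := ef hc; have itf := edec_itg efc; have [sf _] := efc.
have df s y' j : derivable (partials s (sqmod (U c))) y' (evec R j) by exact: (@smooth_derivable _ _ s).
have e0 := enorm_ge0 c; have e1 := enorm1_le c; have e2 := enorm2_le c.
have y0 : 0 < enorm y by apply: lt_le_trans hy.
set Y := enorm y ^+ (mdeg m + 2); have Y0 : 0 < Y by rewrite exprn_gt0.
have b1 p := h1 c p y hc hy; have b2 p := h2 c p y hc hy; have b3 p := h3 c p y hc hy; have b4 p := h4 c p y hc hy.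
have lin2 (u v A B A' B' : R) : `|u| <= enorm c -> `|v| <= enorm c -> `|A| <= A' -> `|B| <= B' -> `|u * A + v * B| <= enorm c * (A' + B').
  move=> hu hv hA hBB; apply: (le_trans (ler_normD _ _)); rewrite !normrM mulrDr.
  by apply: lerD; apply: ler_pM.
have c4b (A B : R) : `|A| <= B -> `|c4 R * A| <= B.
  move=> hA; rewrite normrM (ger0_norm (c4_ge0 R)); have B0 := le_trans (normr_ge0 _) hA.
  by apply: le_trans hA; rewrite ler_piMl.
have sN : measurable_fun setT (symN c).
  apply: (@sym_meas R c (fun xi => dotp c xi ^+ 2) c10) => x.
  apply: (@continuous_comp _ _ _ (fun xi : R * R => dotp c xi) (fun t : R => t ^+ 2)); last exact: exprn_continuous.
  exact: dotpl_cont.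
have lN xi : `|symN c xi| <= 2 * om xi ^+ 0.
  rewrite expr0; apply: (@sym_le R c (fun xi => dotp c xi ^+ 2) 1) => //.
  rewrite ger0_norm ?sqr_ge0// mul1r; apply: (le_trans (dotp2_le xi c10).2); rewrite ler_piMr ?sqr_ge0// invf_le1//; exact: ler1n.
have sV j : measurable_fun setT (fun xi => dotp c xi * pcoord j xi / Aq c xi).
  apply: sym_meas => //; apply: contM2; last exact: pcoord_cont.
  exact: dotpl_cont.
have lV j xi : `|dotp c xi * pcoord j xi / Aq c xi| <= 2 * om xi ^+ 0.
  by rewrite expr0 mulr1; exact: symV_le.
split.
  have -> : N c = (fun y => (-1) * sqmod (U c) y + (- c4 R) * MI (symN c) (sqmod (U c)) 0 y).
    by apply/funext => x; rewrite (N_MI hUNV x hcs itf); ring.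
  have dM s y' j := (MI_partials s 0 efc sN lN).1 y' j.
  rewrite pderivE (partials_lin _ _ _ df dM).
  rewrite (MI_partials (pdirs m) 0 efc sN lN).2 symN_MI// mulN1r mulNr.
  apply: (le_trans (ler_normD _ _)); rewrite !normrN [X in _ <= X]mulrDr; apply: lerD.
    apply: (le_trans (hD c hc y)); apply: ler_wpM2r; first exact: expR_ge0.
    exact: CD.
  set q := _ + _ *+ _.
  apply: (@le_trans _ _ (enorm c * (enorm c * (C1 / Y + C2 / Y) + enorm c * (C3 / Y + C4 / Y)))).
    by apply: c4b; exact: (lin2 _ _ _ _ _ _ e1 e2 (lin2 _ _ _ _ _ _ e1 e2 (b1 q) (b2 q)) (lin2 _ _ _ _ _ _ e1 e2 (b3 q) (b4 q))).
  rewrite (_ : _ * _ = (C1 + C2 + C3 + C4) * (enorm c ^+ 2 / Y)); last by ring.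
  by apply: ler_wpM2r; [rewrite divr_ge0 ?sqr_ge0// ltW|exact: CS].
have VE j : (fun x => pcoord j (V c x)) = (fun x => 0 * sqmod (U c) x + (- c4 R) * MI (fun xi => dotp c xi * pcoord j xi / Aq c xi) (sqmod (U c)) 0 x).
  by apply/funext => x; rewrite (V_MI hUNV j x hcs itf); ring.
have Vb j Ca Cb : (forall p, `|MI (Msym ord0 j m.1 m.2 c) (sqmod (U c)) p y| <= Ca / Y) ->
    (forall p, `|MI (Msym ord_max j m.1 m.2 c) (sqmod (U c)) p y| <= Cb / Y) ->
    `|pderiv m (fun x => pcoord j (V c x)) y| <= enorm c * (Ca / Y + Cb / Y).
  move=> ha hb; have dM s y' j' := (MI_partials s 0 efc (sV j) (lV j)).1 y' j'.
  rewrite VE pderivE (partials_lin _ _ _ df dM).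
  rewrite (MI_partials (pdirs m) 0 efc (sV j) (lV j)).2 symV_MI// mul0r add0r mulNr normrN.
  by apply: c4b; exact: (lin2 _ _ _ _ _ _ e1 e2 (ha _) (hb _)).
have v1 := Vb ord0 C1 C2 b1 b2; have v2 := Vb ord_max C3 C4 b3 b4.
apply: (le_trans (lerD v1 v2)).
rewrite (_ : _ + _ = (C1 + C2 + C3 + C4) * (enorm c / Y)); last by ring.
by apply: ler_wpM2r; [rewrite divr_ge0// ltW|exact: CS].
Qed.
End prof.
End derivs.

(** * The multipole expansion *)

Section explicit.
Variable R : realType.
Local Notation leb := (@lebesgue_measure R).
Variables (c nu : R).
Hypotheses (hc : enorm (c, 0) <= 1 / 10) (nu0 : 0 < nu) (nuE : nu ^+ 2 = 1 - c ^+ 2).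

Definition k0 (t : R) (w : R * R) : R := damped_kernel ord0 ord0 0 0 (c, 0) 0 t w.

Lemma GA_gg t (x : R * R) : GA (c, 0) t x = gg (t * nu ^+ 2) t x.
Proof using nuE.
rewrite /GA /gg /ga -expRD nuE /Aq enorm2 /dotp/=; congr expR; ring.
Qed.

Lemma k0_der (t : R) (w : R * R) : 0 < t -> is_derive t 1 (fun t : R => k0 t w) (- (mc 2 (t * nu ^+ 2) w.1 0 * J0 t w.2)).
Proof using hc nu0 nuE.
move=> t0; have t1 : 0 < t * nu ^+ 2 by rewrite mulr_gt0// exprn_gt0.
apply: (der_eq (@damped_kernel_der R ord0 ord0 0 0 (c, 0) 0 t w hc t0)); rewrite -(gg_cos1 2 w 0 t1 t0).
congr (- _); apply: eq_Rint => x; rewrite /pp /J /pcoord/= !expr0 !mul1r GA_gg expr2; ring.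
Qed.

Definition rho2 (w : R * R) : R := (w.1 / nu) ^+ 2 + w.2 ^+ 2.

(** The antiderivative in t of the Gaussian moment in [k0_der] that vanishes as t grows to
    infinity. *)
Definition explicit_kernel (w : R * R) (t : R) : R := pi / nu ^+ 3 *
  (2 * (1 - expR (- (rho2 w / (4 * t)))) / rho2 w
   - 4 * (w.1 / nu) ^+ 2 * (1 - expR (- (rho2 w / (4 * t))) * (1 + rho2 w / (4 * t))) / rho2 w ^+ 2).

Lemma explicit_kernel_der (t : R) (w : R * R) : 0 < t -> 0 < rho2 w -> is_derive t 1 (explicit_kernel w) (- (mc 2 (t * nu ^+ 2) w.1 0 * J0 t w.2)).
Proof using nu0.
move=> t0 r0; have t1 : 0 < t * nu ^+ 2 by rewrite mulr_gt0// exprn_gt0.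
have tn : t != 0 by rewrite gt_eqF.
have rn : rho2 w != 0 by rewrite gt_eqF.
have nn : nu != 0 by rewrite gt_eqF.
have ds : is_derive t 1 (fun t : R => rho2 w / (4 * t)) (- (rho2 w / (4 * t ^+ 2))).
  have -> : (fun t : R => rho2 w / (4 * t)) = (fun t => (rho2 w / 4) * t^-1) by apply/funext => x; rewrite invfM mulrA.
  have h1 : is_derive t 1 (fun s : R => s^-1) (- (t ^- 2)).
    have := @is_deriveV _ (fun s : R => s) t 1 1; rewrite gt_eqF// => /(_ erefl _).
    by move=> h; apply: (is_derive_eq h); rewrite /GRing.scale/= mulr1.
  by apply: (der_eq (der_mul (is_derive_cst (rho2 w / 4) t 1) h1)); rewrite /cst/=; field.
have dN (f : R -> R) (d : R) : is_derive t 1 f d -> is_derive t 1 (fun x => - f x) (- d) by move=> h; exact: is_deriveN.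
have dB (a : R) (f : R -> R) (d : R) : is_derive t 1 f d -> is_derive t 1 (fun x => a - f x) (- d).
  by move=> h; apply: (der_eq (is_deriveB (is_derive_cst a t 1) h)); rewrite sub0r.
have dZ (a : R) (f : R -> R) (d : R) : is_derive t 1 f d -> is_derive t 1 (fun x => a * f x) (a * d).
  by move=> h; apply: (der_eq (der_mul (is_derive_cst a t 1) h)); rewrite mul0r add0r.
have dE := der_comp (is_derive_expR _) (dN _ _ ds).
have dS : is_derive t 1 (fun t : R => 1 + rho2 w / (4 * t)) (- (rho2 w / (4 * t ^+ 2))).
  by apply: (der_eq (is_deriveD (is_derive_cst (1 : R) t 1) ds)); rewrite add0r.
have d1 := dZ (2 / rho2 w) _ _ (dB 1 _ _ dE).
have d2 := dZ (4 * (w.1 / nu) ^+ 2 / rho2 w ^+ 2) _ _ (dB 1 _ _ (der_mul dE dS)).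
have D := dZ (pi / nu ^+ 3) _ _ (is_deriveB d1 d2).
have -> : explicit_kernel w = (fun t => pi / nu ^+ 3 * (2 / rho2 w * (1 - expR (- (rho2 w / (4 * t)))) - 4 * (w.1 / nu) ^+ 2 / rho2 w ^+ 2 * (1 - expR (- (rho2 w / (4 * t))) * (1 + rho2 w / (4 * t))))).
  by apply/funext => x; rewrite /explicit_kernel; congr (_ * (_ - _)); rewrite mulrAC.
apply: (der_eq D).
rewrite mc2E// cos0 mul1r /J0.
have -> : Num.sqrt (t * nu ^+ 2) = Num.sqrt t * nu by rewrite sqrtrM ?ltW// sqrtr_sqr gtr0_norm.
have st : Num.sqrt t != 0 by rewrite gt_eqF// sqrtr_gt0.
have Et : t = Num.sqrt t ^+ 2 by rewrite sqr_sqrtr// ltW.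
have Ep : pi = Num.sqrt pi ^+ 2 :> R by rewrite sqr_sqrtr// pi_ge0.
have -> : expR (- (rho2 w / (4 * t))) = expR (- (w.1 ^+ 2 / (4 * (t * nu ^+ 2)))) * expR (- (w.2 ^+ 2 / (4 * t))).
  by rewrite -expRD; congr expR; rewrite /rho2; field; rewrite nn tn.
rewrite [in LHS]Ep; move: (expR _) (expR _) (Num.sqrt pi) => e1 e2 sp.
move: rn; move: (rho2 w) => r rn.
by move: (Num.sqrt t) st Et => s st ->; field; rewrite ?st ?nn ?rn.
Qed.

(** The first two bounds give the decay of the explicit kernel for large t, the third its distance
    to the limit for small t. *)
Lemma sig_bounds (s : R) : 0 <= s -> [/\ 0 <= 1 - expR (- s) <= s, 0 <= 1 - expR (- s) * (1 + s) <= s ^+ 2 &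
  s * (expR (- s) * (6 + 4 * s)) <= 14].
Proof using All.
move=> s0; have e0 := expR_gt0 (- s); have e1 := expR_ge1Dx (- s); have e2 := expR_ge1Dx s.
have E : expR (- s) * expR s = 1 by rewrite -expRD addNr expR0.
have h1 : expR (- s) <= 1 by rewrite -[X in _ <= X]expR0 ler_expR oppr_le0.
have h2 : expR (- s) * (1 + s) <= 1 by rewrite -[X in _ <= X]E ler_pM2l.
have h3 : expR (- s) * s <= 1.
  by rewrite -[X in _ <= X]E ler_pM2l//; have := exp_pow 1 s0; rewrite expr1 mul1r.
have h4 : expR (- s) * s ^+ 2 <= 2.
  have F2 : 2`!%:R = 2 :> R by [].
  have Q : expR (- s) * (2 * expR s) = 2 by rewrite mulrCA E mulr1.
  by have := ler_wpM2l (ltW e0) (exp_pow 2 s0); rewrite F2 Q.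
split.
- by apply/andP; split; lra.
- apply/andP; split; first by lra.
  have s1 : 0 <= 1 + s by lra.
  by have := ler_wpM2r s1 e1; rewrite (_ : (1 + - s) * (1 + s) = 1 - s ^+ 2); [lra|ring].
- rewrite (_ : _ * _ = 6 * (expR (- s) * s) + 4 * (expR (- s) * s ^+ 2)); last by ring.
  by lra.
Qed.

Lemma explicit_kernel_large (w : R * R) (t : R) : 1 <= t -> 0 < rho2 w -> `|explicit_kernel w t| <= pi / nu ^+ 3 * (1 + (w.1 / nu) ^+ 2) / t.
Proof using All.
move=> t1 r0; have t0 : 0 < t := lt_le_trans ltr01 t1.
have p0 : 0 <= pi / nu ^+ 3 by rewrite divr_ge0 ?pi_ge0// exprn_ge0// ltW.
have s0 : 0 <= rho2 w / (4 * t) by rewrite divr_ge0 ?(ltW r0)// mulr_ge0// ltW.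
have [/andP[a1 a2] /andP[b1 b2] _] := sig_bounds s0.
rewrite /explicit_kernel normrM (ger0_norm p0) -(mulrA (pi / _)); apply: ler_wpM2l => //.
set z := (w.1 / nu) ^+ 2; have z0 : 0 <= z by rewrite sqr_ge0.
apply: (le_trans (ler_normB _ _)).
have h1 : `|2 * (1 - expR (- (rho2 w / (4 * t)))) / rho2 w| <= 1 / t.
  rewrite ger0_norm; last by rewrite divr_ge0 ?(ltW r0)// mulr_ge0.
  rewrite ler_pdivrMr//; apply: (@le_trans _ _ (2 * (rho2 w / (4 * t)))); first by rewrite ler_wpM2l.
  by rewrite (_ : 2 * _ = 1 / t * rho2 w / 2); [rewrite ler_pdivrMr// ler_peMr ?ler1n// mulr_ge0 ?divr_ge0// ltW|field; rewrite gt_eqF].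
have h2 : `|4 * z * (1 - expR (- (rho2 w / (4 * t))) * (1 + rho2 w / (4 * t))) / rho2 w ^+ 2| <= z / t.
  rewrite ger0_norm; last by rewrite divr_ge0 ?exprn_ge0 ?(ltW r0)// mulr_ge0// mulr_ge0.
  rewrite ler_pdivrMr ?exprn_gt0//; apply: (@le_trans _ _ (4 * z * (rho2 w / (4 * t)) ^+ 2)); first by rewrite ler_wpM2l// mulr_ge0.
  rewrite (_ : 4 * z * _ = z / t * rho2 w ^+ 2 * (1 / (4 * t))); last by field; rewrite gt_eqF.
  have P0 : 0 <= z / t * rho2 w ^+ 2.
    by apply: mulr_ge0; [exact: divr_ge0 z0 (ltW t0)|rewrite exprn_ge0// ltW].
  rewrite ler_piMr//.
  by rewrite ler_pdivrMr ?mulr_gt0// mul1r; lra.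
by rewrite [X in _ <= X]mulrDl; apply: lerD.
Qed.

(** The two sides have the same t-derivative, and both are O(1/t) as t grows; the constant
    difference is therefore 0. *)
Lemma k0E (t : R) (w : R * R) : 0 < t -> 0 < rho2 w -> k0 t w = explicit_kernel w t.
Proof using All.
move=> t0 r0; have [C C0 hk] := @damped_kernel_bound R ord0 ord0 0 0.
apply/eqP; rewrite -subr_eq0; apply/eqP.
pose d (s : R) := k0 s w - explicit_kernel w s.
have dd (s : R) : 0 < s -> is_derive s 1 d 0.
  by move=> s0; apply: (der_eq (is_deriveB (k0_der w s0) (explicit_kernel_der s0 r0))); rewrite subrr.
have dc (s1 s2 : R) : 0 < s1 -> s1 < s2 -> d s1 = d s2.
  move=> s10 s12; have [||z _ E] := @MVT R d (fun=> 0) s1 s2 s12.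
  - by move=> z; rewrite in_itv/= => /andP[z1 _]; apply: dd; exact: lt_trans s10 z1.
  - apply: continuous_in_subspaceT => z; rewrite inE/= in_itv/= => /andP[z1 _].
    apply: differentiable_continuous; apply/derivable1_diffP.
    by apply: (@ex_derive _ _ _ _ _ _ _ (dd z _)); exact: lt_le_trans s10 z1.
  by apply/eqP; rewrite eq_sym -subr_eq0 E mul0r.
have p0 : 0 <= pi / nu ^+ 3 by rewrite divr_ge0 ?pi_ge0// exprn_ge0// ltW.
apply: (@small_eq0 _ _ (C + pi / nu ^+ 3 * (1 + (w.1 / nu) ^+ 2))) => r r1 r2.
have [s [s1 s2 s3]] : exists s, [/\ 1 <= s, t < s & s^-1 <= r].
  exists (t + 1 + r^-1); have ri : 0 < r^-1 by rewrite invr_gt0.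
  split; [lra|lra|]; rewrite -[X in _ <= X]invrK lef_pV2 ?posrE//; lra.
have s0 := lt_le_trans ltr01 s1.
rewrite -/(d t) (dc t s t0 s2) /d; apply: (le_trans (ler_normB _ _)).
have b1 : `|k0 s w| <= C / s.
  have [h _] := hk (c, 0) 0 s w hc s0; rewrite ler_pdivlMr// mulrC.
  by move: h; rewrite !add0n sqr_sqrtr// ltW.
apply: (le_trans (lerD b1 (explicit_kernel_large s1 r0))); rewrite -mulrDl; apply: ler_wpM2l => //.
by rewrite addr_ge0// mulr_ge0// addr_ge0// sqr_ge0.
Qed.

(** This is the second derivative of log |v|^2 in v_1. *)
Definition limit_kernel (v : R * R) : R := 2 / enorm v ^+ 2 - 4 * v.1 ^+ 2 / enorm v ^+ 4.

(** The difference is e^{-s} times a bounded multiple of (6 + 4s)/|v|^2, with s = |v|^2/(4t). As s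
    e^{-s} (6 + 4s) <= 14, it is at most 14/(s |v|^2), whence 56 = 4 * 14. *)
Lemma k0_near (t : R) (v : R * R) : 0 < t -> 0 < enorm v ->
  `|nu ^+ 3 / pi * k0 t (nu * v.1, v.2) - limit_kernel v| <= 56 * t / enorm v ^+ 4.
Proof using All.
move=> t0 v0; have nn : nu != 0 by rewrite gt_eqF.
have pn : pi != 0 :> R by rewrite gt_eqF// pi_gt0.
have Er : rho2 (nu * v.1, v.2) = enorm v ^+ 2 by rewrite /rho2 enorm2/= mulrC mulKf.
have r0 : 0 < rho2 (nu * v.1, v.2) by rewrite Er exprn_gt0.
rewrite k0E// /explicit_kernel Er /= [nu * v.1 / nu]mulrC mulKf//.
have v20 : 0 < enorm v ^+ 2 by rewrite exprn_gt0.
have v1 : v.1 ^+ 2 <= enorm v ^+ 2 by rewrite enorm2 lerDl sqr_ge0.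
rewrite /limit_kernel (_ : enorm v ^+ 4 = enorm v ^+ 2 ^+ 2); last by rewrite -exprM.
move: (enorm v ^+ 2) v20 v1 => r r0' v1; have r1 : r != 0 by rewrite gt_eqF.
pose s := r / (4 * t); have s0 : 0 < s by rewrite divr_gt0// mulr_gt0.
rewrite -/s; have [_ _ h] := sig_bounds (ltW s0).
rewrite (_ : _ - _ = expR (- s) * (4 * v.1 ^+ 2 * (1 + s) / r - 2) / r); last first.
  by move: (expR _) (pi : R) pn => e p pn; field; rewrite ?nn ?pn ?r1.
rewrite normrM normfV (gtr0_norm r0') ler_pdivrMr// normrM ger0_norm ?expR_ge0//.
have q0 : 0 <= v.1 ^+ 2 / r <= 1 by rewrite divr_ge0 ?sqr_ge0 ?(ltW r0')//= ler_pdivrMr// mul1r.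
have h1 : `|4 * v.1 ^+ 2 * (1 + s) / r - 2| <= 6 + 4 * s.
  rewrite (_ : 4 * v.1 ^+ 2 * (1 + s) / r = 4 * (v.1 ^+ 2 / r) * (1 + s)); last by ring.
  by move: (v.1 ^+ 2 / r) q0 => q /andP[q0 q1]; rewrite ler_norml; apply/andP; split; nra.
apply: (le_trans (ler_wpM2l (expR_ge0 _) h1)).
rewrite -(ler_pM2l s0); apply: (le_trans h).
by rewrite /s (_ : r / (4 * t) * _ = 14)//; field; rewrite r1 gt_eqF.
Qed.
End explicit.

(** * The geometric expansion of the limit kernel *)

Section series.
Variable R : realType.
Implicit Types (z v : R * R).

Lemma geo1 (q : R) K : (1 - q) * \sum_(0 <= n < K.+1) q ^+ n = 1 - q ^+ K.+1.
Proof.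
elim: K => [|K IH]; first by rewrite big_nat1 expr0 mulr1 expr1.
by rewrite big_nat_recr//= mulrDr IH !exprS; ring.
Qed.

Lemma geo2 (q : R) K : (1 - q) ^+ 2 * \sum_(0 <= n < K.+1) (n.+1%:R * q ^+ n) =
  1 - q ^+ K.+1 * (K%:R + 2 - (K%:R + 1) * q).
Proof.
elim: K => [|K IH]; first by rewrite big_nat1 expr0 expr1; ring.
rewrite big_nat_recr//= mulrDr IH !exprS -[K.+2%:R]natr1 -[K.+1%:R]natr1.
by move: (K%:R : R) (q ^+ K) => k x; ring.
Qed.

(** With q = (2 z.v - |v|^2)/|z|^2 one has |z - v|^2 = |z|^2 (1 - q). The terms in 2 come from
    expanding 1/(1 - q), those in 4(n+1) from 1/(1 - q)^2; integration against the dilated |U|^2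
    gives [expansion_sum]. *)
Definition multipole_sum (z : R * R) (K : nat) (v : R * R) : R :=
  \sum_(0 <= n < K.+1) ((enorm z ^+ (2 * n + 2)%N)^-1 *
     ((2 - 4 * n.+1%:R * (z.1 - v.1) ^+ 2 / enorm z ^+ 2) * (2 * dotp z v - enorm v ^+ 2) ^+ n)).

Lemma multipole_sumE z K v : 0 < enorm z ->
  multipole_sum z K v = (enorm z ^+ 2)^-1 *
   (2 * (\sum_(0 <= n < K.+1) ((2 * dotp z v - enorm v ^+ 2) / enorm z ^+ 2) ^+ n)
    - 4 * ((z.1 - v.1) ^+ 2 / enorm z ^+ 2) * \sum_(0 <= n < K.+1) (n.+1%:R * ((2 * dotp z v - enorm v ^+ 2) / enorm z ^+ 2) ^+ n)).
Proof.
move=> z0; rewrite /multipole_sum !mulr_sumr -sumrB mulr_sumr; apply: eq_bigr => n _.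
rewrite addnC exprD exprM invfM expr_div_n.
by move: (n.+1%:R : R) (enorm z ^+ 2)^-1 ((enorm z ^+ 2) ^+ n)^-1 (_ ^+ n) => a b c d; ring.
Qed.

Lemma enorm_sub z v : 0 < enorm z ->
  enorm (z - v) ^+ 2 = enorm z ^+ 2 * (1 - (2 * dotp z v - enorm v ^+ 2) / enorm z ^+ 2).
Proof.
move=> z0; rewrite mulrBr mulr1 mulrCA divff ?mulr1; last by rewrite gt_eqF// exprn_gt0.
by rewrite !enorm2 /dotp/=; ring.
Qed.

(** The finite geometric sums are used in closed form, so the remainder is exact and no infinite
    series occurs. *)
Lemma series_remainder (Z2 D b q : R) K : 0 < Z2 -> 0 < D -> q = 1 - D ->
  (Z2^-1 * (2 / D - 4 * b / D ^+ 2)) -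
   Z2^-1 * (2 * ((1 - q ^+ K.+1) / D) - 4 * b * ((1 - q ^+ K.+1 * (K%:R + 2 - (K%:R + 1) * q)) / D ^+ 2)) =
  Z2^-1 * q ^+ K.+1 * (2 - 4 * (b / D) * (K%:R + 2 - (K%:R + 1) * q)) / D.
Proof.
move=> z0 d0 _; move: (q ^+ K.+1) (K%:R : R) => x k.
by field; rewrite !gt_eqF.
Qed.

(** On |v| <= g the ratio q is at most (12/5) |v|/|z| <= 24/25 in absolute value, so the exact
    remainder applies; bounding 12/5 by 3 produces the powers of 3. *)
Lemma limit_kernel_series z v K (g : R) : (3 <= K)%N -> 4 <= enorm z -> 1 <= g -> g ^+ K <= enorm z -> enorm v <= g ->
  9 / 25 * enorm z ^+ 2 <= enorm (z - v) ^+ 2 /\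
  `|limit_kernel (z - v) - multipole_sum z K v| <= 110 * (K%:R * 3 ^+ K / enorm z ^+ K.+1).
Proof.
move=> K3 z4 g1 gK vg; have z0 : 0 < enorm z by apply: lt_le_trans z4.
have v0 := enorm_ge0 v; have g0 : 0 <= g by lra.
have g3 : g ^+ 3 <= enorm z by apply: le_trans gK; exact: ler_weXn2l.
have v3 : enorm v ^+ 3 <= enorm z by apply: le_trans g3; rewrite lerXn2r// nnegrE.
(* Otherwise |v|^3 >= (8/125) |z|^2 |z| >= (128/125) |z| > |z|, using |z| >= 4, whereas K >= 3 gives
   |v|^3 <= g^K <= |z|. *)
have vz : enorm v <= 2 / 5 * enorm z.
  rewrite leNgt; apply/negP => h.
  have h3 : (2 / 5 * enorm z) ^+ 3 <= enorm v ^+ 3.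
    by rewrite lerXn2r ?nnegrE ?(ltW h)// mulr_ge0 ?ltW.
  have := le_trans h3 v3; move: (enorm z) z4 z0 => Z z4 z0.
  have ZZ : 16 <= Z ^+ 2 by have : 4 * 4 <= Z * Z by [apply: ler_pM]; rewrite -natrM -expr2.
  rewrite (_ : (2 / 5 * Z) ^+ 3 = 8 / 125 * Z ^+ 2 * Z); last by field.
  have := ler_wpM2r (ltW z0) ZZ; move: (Z ^+ 2) => w; lra.
have low : 3 / 5 * enorm z <= enorm (z - v) by have := enorm_lb z v; lra.
have lo2 : 9 / 25 * enorm z ^+ 2 <= enorm (z - v) ^+ 2.
  rewrite (_ : 9 / 25 * _ = (3 / 5 * enorm z) ^+ 2); last by field.
  by rewrite lerXn2r ?nnegrE ?enorm_ge0// mulr_ge0 ?ltW.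
split=> //.
have Z20 : 0 < enorm z ^+ 2 by rewrite exprn_gt0.
have q_def := enorm_sub v z0.
have X1 : `|2 * dotp z v - enorm v ^+ 2| <= 12 / 5 * (enorm z * enorm v).
  apply: (le_trans (ler_normB _ _)); rewrite normrM ger0_norm// [`|enorm v ^+ 2|]ger0_norm ?sqr_ge0//.
  have := dotp_le z v; have := ler_wpM2r v0 vz; rewrite expr2; move: (`|dotp z v|) => w; lra.
rewrite multipole_sumE//; set q := (2 * dotp z v - enorm v ^+ 2) / enorm z ^+ 2.
have q1 : `|q| <= 12 / 5 * (enorm v / enorm z).
  rewrite normrM normfV (gtr0_norm Z20) ler_pdivrMr//; apply: (le_trans X1).
  by rewrite le_eqVlt; apply/orP; left; apply/eqP; field; rewrite gt_eqF.
have vz' : enorm v / enorm z <= 2 / 5 by rewrite ler_pdivrMr.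
have q2 : `|q| <= 1 by lra.
pose D := 1 - q; have D0 : 9 / 25 <= D.
  by move: lo2; rewrite q_def -/q -/D mulrC ler_pM2l.
have D00 : 0 < D by apply: lt_le_trans D0; lra.
have Dn : D != 0 by rewrite gt_eqF.
pose b := (z.1 - v.1) ^+ 2 / enorm z ^+ 2.
have b0 : 0 <= b / D <= 1.
  have bb : 0 <= b by apply: divr_ge0; exact: sqr_ge0.
  by rewrite (divr_ge0 bb (ltW D00))/= ler_pdivrMr// mul1r /b ler_pdivrMr// mulrC -q_def enorm2 /= lerDl sqr_ge0.
have S1 : \sum_(0 <= n < K.+1) q ^+ n = (1 - q ^+ K.+1) / D by rewrite -geo1 mulrC mulKf.
have S2 : \sum_(0 <= n < K.+1) (n.+1%:R * q ^+ n) = (1 - q ^+ K.+1 * (K%:R + 2 - (K%:R + 1) * q)) / D ^+ 2.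
  by rewrite -geo2 mulrC mulKf// expf_neq0.
have -> : limit_kernel (z - v) = (enorm z ^+ 2)^-1 * (2 / D - 4 * b / D ^+ 2).
  rewrite /limit_kernel (_ : enorm (z - v) ^+ 4 = enorm (z - v) ^+ 2 ^+ 2); last by rewrite -exprM.
  rewrite q_def -/q -/D /b /=; move: (enorm z ^+ 2) Z20 => Z2 z20.
  by field; rewrite Dn gt_eqF.
rewrite S1 S2 -/b (series_remainder b K Z20 D00); last by rewrite /D; ring.
have K0 : 3 <= K%:R :> R by rewrite ler_nat.
rewrite normrM normfV (gtr0_norm D00) ler_pdivrMr// normrM.
have M1 : `|2 - 4 * (b / D) * (K%:R + 2 - (K%:R + 1) * q)| <= 13 * K%:R.
  move: (b / D) b0 => w /andP[w0 w1]; move: (K%:R : R) K0 q q2 {q_def X1 q1 D D0 D00 Dn S1 S2} => k k3 q q2.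
  have /andP[q3 q4] : -1 <= q <= 1 by rewrite -ler_norml.
  have m0 : 0 <= k + 2 - (k + 1) * q by nra.
  have m1 : k + 2 - (k + 1) * q <= 2 * k + 3 by nra.
  have := mulr_ge0 w0 m0; have := ler_pM w0 m0 w1 m1; rewrite mul1r.
  rewrite -mulrA; move: (w * _) => t; rewrite ler_norml; lra.
have Q : `|(enorm z ^+ 2)^-1 * q ^+ K.+1| <= 3 ^+ K.+1 / enorm z ^+ K.+1.
  rewrite normrM normfV (gtr0_norm Z20) normrX mulrC ler_pdivrMr//.
  have h1 : `|q| <= 3 * (enorm v / enorm z).
    by apply: (le_trans q1); apply: ler_wpM2r; [rewrite divr_ge0// ltW|lra].
  have h2 : `|q| ^+ K.+1 <= (3 * (enorm v / enorm z)) ^+ K.+1.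
    by rewrite lerXn2r// nnegrE// mulr_ge0// divr_ge0// ltW.
  apply: (le_trans h2); rewrite exprMn expr_div_n mulrA -mulrA -[X in _ <= X]mulrA.
  apply: ler_wpM2l; first by rewrite exprn_ge0.
  rewrite mulrC; apply: ler_wpM2l; first by rewrite invr_ge0 exprn_ge0// ltW.
  (* g^{K+1} = g^K g is at most |z|^2, which cancels the prefactor |z|^{-2}. *)
  apply: (@le_trans _ _ (g ^+ K.+1)); first by rewrite lerXn2r// nnegrE.
  rewrite exprSr expr2; apply: ler_pM => //; first by rewrite exprn_ge0.
  exact: le_trans (ler_eXnr (leq_trans (isT : 1 <= 3)%N K3) g1) gK.
apply: (le_trans (ler_pM (normr_ge0 _) (normr_ge0 _) Q M1)).
(* 39 = 13 * 3, and the division by D >= 9/25 is covered by 39 <= 110 * 9/25. *)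
rewrite [X in X <= _](_ : _ = 39 * (K%:R * 3 ^+ K / enorm z ^+ K.+1)); last by rewrite (exprS 3 K); ring.
rewrite [X in _ <= X]mulrAC; apply: ler_wpM2r; last by lra.
apply: divr_ge0; last by rewrite exprn_ge0// ltW.
by apply: mulr_ge0 => //; rewrite exprn_ge0.
Qed.

(** A crude polynomial bound, for |v| > g: there the decay of the density compensates any polynomial
    and the series is not expected to approximate the kernel. *)
Lemma multipole_sum_le z v K : 1 <= enorm z -> `|multipole_sum z K v| <= K.+1%:R * ((4 * K%:R + 6) * (1 + enorm v) ^+ (2 * K + 2)).
Proof.
move=> z1; have z0 := lt_le_trans ltr01 z1; have r0 := enorm_ge0 v.
have Z2 : 1 <= enorm z ^+ 2 by rewrite exprn_ege1.
have r1 : 1 <= 1 + enorm v by rewrite lerDl.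
have Z20 := lt_le_trans ltr01 Z2.
apply: (@le_trans _ _ (\sum_(0 <= n < K.+1) ((4 * K%:R + 6) * (1 + enorm v) ^+ (2 * K + 2)))); last first.
  by rewrite sumr_const_nat subn0 [K.+1%:R * _]mulr_natl.
apply: (le_trans (ler_norm_sum _ _ _)); apply: ler_sum_nat => n /andP[_ nK].
have -> : (enorm z ^+ (2 * n + 2))^-1 * ((2 - 4 * n.+1%:R * (z.1 - v.1) ^+ 2 / enorm z ^+ 2) * (2 * dotp z v - enorm v ^+ 2) ^+ n) =
   (2 - 4 * n.+1%:R * (z.1 - v.1) ^+ 2 / enorm z ^+ 2) * (((2 * dotp z v - enorm v ^+ 2) / enorm z ^+ 2) ^+ n * (enorm z ^+ 2)^-1).
  by rewrite exprD exprM invfM expr_div_n; ring.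
have h1 : `|(2 * dotp z v - enorm v ^+ 2) / enorm z ^+ 2| <= (1 + enorm v) ^+ 2.
  rewrite normrM normfV (gtr0_norm Z20) ler_pdivrMr//.
  apply: (le_trans (ler_normB _ _)); rewrite normrM ger0_norm// [`|enorm v ^+ 2|]ger0_norm ?sqr_ge0//.
  have hd := dotp_le z v; have z2 : enorm z <= enorm z ^+ 2 by rewrite expr2 ler_peMr// ltW.
  have := ler_wpM2r r0 z2; have := ler_wpM2l (sqr_ge0 (enorm v)) Z2.
  move: (enorm z ^+ 2) Z20 (`|dotp z v|) hd => w w0 d hd; move: (enorm v) r0 hd => r r0 hd; rewrite mulr1 => e1 e2.
  rewrite (_ : (1 + r) ^+ 2 * w = w + 2 * (w * r) + r ^+ 2 * w); last by ring.
  by lra.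
have h2 : `|2 - 4 * n.+1%:R * (z.1 - v.1) ^+ 2 / enorm z ^+ 2| <= (4 * K%:R + 6) * (1 + enorm v) ^+ 2.
  have hb : 0 <= (z.1 - v.1) ^+ 2 / enorm z ^+ 2 <= (1 + enorm v) ^+ 2.
    rewrite divr_ge0 ?sqr_ge0//= ler_pdivrMr// -exprMn -[(z.1 - v.1) ^+ 2]real_normK ?num_real// lerXn2r// ?nnegrE ?mulr_ge0 ?enorm_ge0 ?(le_trans ler01 r1)//.
    apply: (le_trans (enorm1_le (z - v))); apply: (le_trans (enormB _ _)).
    by rewrite mulrDl mul1r lerD2l ler_peMr.
  rewrite -mulrA; move: (_ / _) hb => w /andP[w0 w1].
  have nk : n.+1%:R <= K%:R + 1 :> R by rewrite natr1 ler_nat.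
  have n0 : 0 <= n.+1%:R :> R by [].
  have R1 : 1 <= (1 + enorm v) ^+ 2 by rewrite exprn_ege1.
  move: (n.+1%:R : R) (K%:R : R) ((1 + enorm v) ^+ 2) nk n0 R1 w1 => m k Y nk n0 R1 w1.
  have := ler_pM n0 w0 nk w1; have := mulr_ge0 n0 w0; rewrite -mulrA; move: (m * w) => t t0 t1.
  by rewrite ler_norml; nra.
have R2 : 1 <= (1 + enorm v) ^+ 2 by rewrite exprn_ege1.
have h3 : `|((2 * dotp z v - enorm v ^+ 2) / enorm z ^+ 2) ^+ n * (enorm z ^+ 2)^-1| <= ((1 + enorm v) ^+ 2) ^+ K.
  rewrite normrM normrX -[X in _ <= X]mulr1; apply: ler_pM => //.
  - apply: (@le_trans _ _ ((1 + enorm v) ^+ 2 ^+ n)).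
      by rewrite lerXn2r// nnegrE// (le_trans ler01).
    exact: ler_weXn2l.
  - by rewrite normfV (gtr0_norm Z20) invf_le1.
rewrite normrM; apply: (le_trans (ler_pM (normr_ge0 _) (normr_ge0 _) h2 h3)).
by rewrite -mulrA -exprM -exprD addnC.
Qed.

Lemma exp_pow1 (m : nat) (r a : R) : 0 <= r -> 0 < a -> a <= 1 / 4 -> (1 + r) ^+ m <= 2 * m`!%:R * a^-1 ^+ m * expR (a * r).
Proof.
move=> r0 a0 a1; have h := exp_pow m (mulr_ge0 (ltW a0) (addr_ge0 ler01 r0)).
have -> : (1 + r) ^+ m = a^-1 ^+ m * (a * (1 + r)) ^+ m by rewrite -exprMn mulrA mulVf ?mul1r// gt_eqF.
have ai : 0 <= a^-1 ^+ m by rewrite exprn_ge0// invr_ge0 ltW.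
apply: (le_trans (ler_wpM2l ai h)); rewrite mulrDr mulr1 expRD.
have e2 : expR a <= 2.
  have := expR_ge1Dx (- a); rewrite expRN => q.
  have e0 := expR_gt0 a; have := ler_wpM2r (ltW e0) q; rewrite mulVf ?gt_eqF//.
  by move: (expR a) e0 => e e0; nra.
rewrite [X in X <= _](_ : _ = m`!%:R * a^-1 ^+ m * expR (a * r) * expR a); last by move: (expR a) (expR _) => u w; ring.
rewrite [X in _ <= X](_ : _ = m`!%:R * a^-1 ^+ m * expR (a * r) * 2); last by ring.
by apply: ler_wpM2l => //; rewrite mulr_ge0 ?expR_ge0// mulr_ge0.
Qed.
End series.

(** * Pointwise error of the expansion under the integral *)

Section kernel_series_bound.
Variable R : realType.
Local Notation leb := (@lebesgue_measure R).

(** Here the constant of the statement is met: the three factors from (2K+2)! to (2K+5)! dominate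
    (K+1)(4K+6), and 4/nu <= 1 + 8 nu^{-2} since nu <= 1. *)
Lemma econst_le (nu : R) K : 0 < nu -> nu <= 1 ->
  K.+1%:R * ((4 * K%:R + 6) * ((2 * K + 2)`!%:R * (nu / 4)^-1 ^+ (2 * K + 2))) <= expansion_const nu K /\
  1 <= expansion_const nu K.
Proof.
move=> n0 n1; rewrite /expansion_const.
have ni : 1 <= nu^-1 by rewrite invf_ge1.
have n2 : nu ^- 2 = nu^-1 * nu^-1 by rewrite expr2 invfM.
have b1 : 1 <= 1 + 8 * nu ^- 2 by rewrite lerDl n2 !mulr_ge0// invr_ge0 ltW.
have b2 : (nu / 4)^-1 <= 1 + 8 * nu ^- 2.
  by rewrite invfM invrK n2; move: (nu^-1) ni => m ni; nra.
have f1 : 1 <= ((2 * K + 5)`!)%:R :> R by rewrite ler1n fact_gt0.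
split; last by rewrite -[X in X <= _]mulr1; apply: ler_pM => //; rewrite exprn_ege1.
rewrite !mulrA; apply: ler_pM.
- by rewrite !mulr_ge0// addr_ge0.
- by rewrite exprn_ge0// invr_ge0 divr_ge0// ltW.
- have -> : (K.+1%:R * (4 * K%:R + 6) * (2 * K + 2)`!%:R : R) = (K.+1 * (4 * K + 6) * (2 * K + 2)`!)%:R.
    by rewrite !natrM natrD natrM.
  rewrite ler_nat (_ : (2 * K + 5 = (2 * K + 2).+3)%N); last by lia.
  by rewrite !factS !mulnA leq_mul2r; apply/orP; right; nia.
- apply: (@le_trans _ _ ((1 + 8 * nu ^- 2) ^+ (2 * K + 2))).
    by rewrite lerXn2r// nnegrE ?(le_trans ler01 b1)// invr_ge0 divr_ge0// ltW.
  by apply: ler_weXn2l => //; lia.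
Qed.

Definition series_error (nu C g Z : R) (K : nat) : R :=
  110 * (K%:R * 3 ^+ K / Z ^+ K.+1) + expR (- (nu / 4 * g)) * (2 + C + 2 * (K.+1%:R * ((4 * K%:R + 6) * ((2 * K + 2)`!%:R * (nu / 4)^-1 ^+ (2 * K + 2))))).

(** For |v| <= g, [k0_near] and [limit_kernel_series] compare both terms with the limit kernel. For
    |v| > g the two terms are bounded separately, and half of the decay of F pays for them. *)
Lemma kernel_series_bound (c nu C Cf g F : R) (z v : R * R) K :
  enorm (c, 0) <= 1 / 10 -> 0 < nu -> nu <= 1 -> nu ^+ 2 = 1 - c ^+ 2 -> 0 <= C -> 0 <= Cf ->
  (forall t w, 0 < t -> t * `|k0 c t w| <= C) -> (3 <= K)%N -> 4 <= enorm z -> 1 <= g -> g ^+ K <= enorm z ->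
  `|F| <= Cf * expR (- (nu * enorm v)) ->
  `|F * (nu ^+ 3 / pi * k0 c (expR (- (nu / 4 * g))) (nu * (z - v).1, (z - v).2) - multipole_sum z K v)| <=
    Cf * series_error nu C g (enorm z) K * expR (- (nu / 2 * enorm v)).
Proof.
move=> hc n0 n1 nE C0 Cf0 hC K3 z4 g1 gK hF.
set t := expR (- (nu / 4 * g)); have t0 : 0 < t := expR_gt0 _.
have v0 := enorm_ge0 v; have z0 : 0 < enorm z by apply: lt_le_trans z4.
set A := K.+1%:R * ((4 * K%:R + 6) * ((2 * K + 2)`!%:R * (nu / 4)^-1 ^+ (2 * K + 2))).
have A0 : 0 <= A.
  apply: mulr_ge0 => //; apply: mulr_ge0; first by rewrite addr_ge0.
  by apply: mulr_ge0 => //; rewrite exprn_ge0// invr_ge0 divr_ge0// ltW.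
have H0 : 0 <= K%:R * 3 ^+ K / enorm z ^+ K.+1.
  apply: divr_ge0; last by rewrite exprn_ge0// ltW.
  by apply: mulr_ge0 => //; rewrite exprn_ge0.
have EG : series_error nu C g (enorm z) K = 110 * (K%:R * 3 ^+ K / enorm z ^+ K.+1) + t * (2 + C + 2 * A) by [].
rewrite normrM -[Cf * series_error _ _ _ _ _ * _]mulrA.
apply: (@le_trans _ _ (Cf * expR (- (nu * enorm v)) * `|nu ^+ 3 / pi * k0 c t (nu * (z - v).1, (z - v).2) - multipole_sum z K v|)).
  exact: ler_wpM2r.
rewrite -(mulrA Cf); apply: ler_wpM2l => //; rewrite EG.
have [vg|vg] := leP (enorm v) g.
  have [lo hi] := limit_kernel_series K3 z4 g1 gK vg.
  have lo5 : 144 / 25 <= enorm (z - v) ^+ 2.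
    apply: le_trans lo; have : 4 * 4 <= enorm z * enorm z by apply: ler_pM.
    by rewrite expr2; lra.
  have d0 : 0 < enorm (z - v).
    rewrite lt_neqAle enorm_ge0 andbT eq_sym; apply/eqP => E; move: lo5; rewrite E expr0n/=; lra.
  have near := k0_near hc n0 nE t0 d0.
  have near2 : 56 * t / enorm (z - v) ^+ 4 <= 2 * t.
    rewrite ler_pdivrMr ?exprn_gt0// (_ : enorm (z - v) ^+ 4 = enorm (z - v) ^+ 2 ^+ 2); last by rewrite -exprM.
    have h : 28 <= enorm (z - v) ^+ 2 ^+ 2.
      have k5 : 0 <= 144 / 25 :> R by rewrite divr_ge0.
      apply: (@le_trans _ _ ((144 / 25) ^+ 2)); first by rewrite expr_div_n ler_pdivlMr ?exprn_gt0// -!natrX -natrM ler_nat.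
      by rewrite lerXn2r ?nnegrE// sqr_ge0.
    by move: (_ ^+ 2 ^+ 2) h => w h; nra.
  have hb : `|nu ^+ 3 / pi * k0 c t (nu * (z - v).1, (z - v).2) - multipole_sum z K v| <= 110 * (K%:R * 3 ^+ K / enorm z ^+ K.+1) + t * (2 + C + 2 * A).
    rewrite -[X in `|X|](subrKA (limit_kernel (z - v))).
    apply: (le_trans (ler_normD _ _)); rewrite addrC; apply: lerD => //.
    apply: (le_trans near); apply: (le_trans near2); rewrite mulrC ler_wpM2l ?(ltW t0)//.
    by rewrite -addrA lerDl addr_ge0// mulr_ge0.
  rewrite [X in X <= _]mulrC; apply: (ler_pM (normr_ge0 _) (expR_ge0 _) hb).
  by rewrite ler_expR lerN2; apply: ler_wpM2r => //; lra.
have kb : `|nu ^+ 3 / pi * k0 c t (nu * (z - v).1, (z - v).2)| <= C / t.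
  rewrite normrM ler_pdivlMr// -mulrA [_ * t]mulrC; apply: le_trans (hC t _ t0).
  apply: ler_piMl; first by rewrite mulr_ge0// ltW.
  rewrite ger0_norm ?divr_ge0 ?pi_ge0 ?exprn_ge0 ?(ltW n0)// ler_pdivrMr ?pi_gt0// mul1r.
  apply: (@le_trans _ _ 1); first by rewrite exprn_ile1 ?(ltW n0).
  by have := @pi_ge2 R; lra.
have pb := multipole_sum_le v K (le_trans (ler1n R 4) z4).
(* For |v| > g half of the decay of F is at most e^{-nu g/2} = t^2: one factor t cancels the 1/t of
   the kernel bound and one remains. *)
have e1 : expR (- (nu * enorm v)) <= t * t * expR (- (nu / 2 * enorm v)).
  rewrite /t -!expRD ler_expR.
  by have : nu * g <= nu * enorm v by [rewrite ler_pM2l// ltW]; lra.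
have e2 : expR (- (nu * enorm v)) * expR (nu / 4 * enorm v) <= t * expR (- (nu / 2 * enorm v)).
  rewrite /t -!expRD ler_expR.
  by have : nu * g <= nu * enorm v by [rewrite ler_pM2l// ltW]; lra.
have pw : (1 + enorm v) ^+ (2 * K + 2) <= 2 * (2 * K + 2)`!%:R * (nu / 4)^-1 ^+ (2 * K + 2) * expR (nu / 4 * enorm v).
  by apply: exp_pow1 => //; [rewrite divr_gt0|lra].
have P1 : expR (- (nu * enorm v)) * `|multipole_sum z K v| <= t * (2 * A) * expR (- (nu / 2 * enorm v)).
  apply: (le_trans (ler_wpM2l (expR_ge0 _) pb)).
  have pp0 : 0 <= K.+1%:R * (4 * K%:R + 6) :> R by rewrite mulr_ge0// addr_ge0.
  have := ler_wpM2l pp0 pw => q; apply: (le_trans (ler_wpM2l (expR_ge0 _) _)); first by rewrite mulrA; exact: q.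
  rewrite [X in X <= _](_ : _ = 2 * A * (expR (- (nu * enorm v)) * expR (nu / 4 * enorm v))); last first.
    by rewrite /A; move: (expR _) (expR _) ((_)`!%:R) (_ ^+ _) (K.+1%:R : R) (K%:R : R) => u w x y k1 k; ring.
  rewrite [X in _ <= X](_ : _ = 2 * A * (t * expR (- (nu / 2 * enorm v)))); last by ring.
  by apply: ler_wpM2l => //; rewrite mulr_ge0.
have P2 : expR (- (nu * enorm v)) * (C / t) <= t * C * expR (- (nu / 2 * enorm v)).
  apply: (le_trans (ler_wpM2r (divr_ge0 C0 (ltW t0)) e1)).
  by rewrite le_eqVlt; apply/orP; left; apply/eqP; field; rewrite gt_eqF.
apply: (le_trans (ler_wpM2l (expR_ge0 _) (ler_normB _ _))); rewrite mulrDr.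
apply: (le_trans (lerD (ler_wpM2l (expR_ge0 _) kb) (lexx _))); apply: (le_trans (lerD P2 P1)).
rewrite -mulrDl; apply: ler_wpM2r; first exact: expR_ge0.
rewrite -mulrDr; apply: ler_wpDl; first by rewrite mulr_ge0.
by apply: ler_wpM2l; [exact: ltW|rewrite lerD2r lerDr].
Qed.

(** The bound is brought to the form of the statement: |z| is replaced by the smaller |y|, and the
    rate nu/4 by nu^2/8. *)
Lemma series_error_le (nu C g Z y : R) K : 0 < nu -> nu <= 1 -> 0 <= C -> 0 <= g -> 0 < y -> y <= Z ->
  series_error nu C g Z K <= (110 + (4 + C)) * (K%:R * 3 ^+ K / y ^+ K.+1 + expansion_const nu K * expR (- (nu ^+ 2 / 8 * g))).
Proof.
move=> n0 n1 C0 g0 y0 yZ; have [h1 h2] := econst_le K n0 n1; rewrite /series_error.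
set A := K.+1%:R * _; rewrite -/A in h1; set E := expansion_const nu K; rewrite -/E in h1 h2.
have k0 : 0 <= K%:R * 3 ^+ K :> R by apply: mulr_ge0 => //; rewrite exprn_ge0.
have a1 : K%:R * 3 ^+ K / Z ^+ K.+1 <= K%:R * 3 ^+ K / y ^+ K.+1.
  apply: ler_wpM2l => //; rewrite lef_pV2 ?posrE ?exprn_gt0//; last exact: lt_le_trans yZ.
  by rewrite lerXn2r// nnegrE ltW// (lt_le_trans y0).
have a2 : expR (- (nu / 4 * g)) <= expR (- (nu ^+ 2 / 8 * g)).
  rewrite ler_expR lerN2; apply: ler_wpM2r => //.
  have : nu ^+ 2 <= nu by rewrite expr2 ler_piMr// ltW.
  lra.
have b1 : 0 <= K%:R * 3 ^+ K / y ^+ K.+1 by rewrite divr_ge0// exprn_ge0// ltW.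
have E0 : 0 <= E by lra.
have m1 : 2 + C + 2 * A <= (4 + C) * E.
  have : C * 1 <= C * E by apply: ler_wpM2l.
  by lra.
have p1 : expR (- (nu / 4 * g)) * (2 + C + 2 * A) <= expR (- (nu ^+ 2 / 8 * g)) * ((4 + C) * E).
  apply: (@le_trans _ _ (expR (- (nu / 4 * g)) * ((4 + C) * E))); first by apply: ler_wpM2l => //; exact: expR_ge0.
  by apply: ler_wpM2r => //; rewrite mulr_ge0// addr_ge0.
have c1 : 0 <= E * expR (- (nu ^+ 2 / 8 * g)) by rewrite mulr_ge0 ?expR_ge0.
have c2 : 0 <= (4 + C) * (K%:R * 3 ^+ K / y ^+ K.+1) by rewrite mulr_ge0// addr_ge0.
move: a1 p1 b1 c1 c2; move: (K%:R * _ / y ^+ _) (K%:R * _ / Z ^+ _) (expR (- (nu ^+ 2 / 8 * g))) (expR _ * (_ + _)) => u w e q a1 p1 b1 c1 c2.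
apply: (le_trans (lerD (ler_wpM2l _ a1) p1)) => //.
rewrite (_ : (110 + (4 + C)) * (u + E * e) = 110 * u + e * ((4 + C) * E) + (4 + C) * u + 110 * (E * e)); last by ring.
by rewrite -[X in _ <= X]addrA lerDl addr_ge0// mulr_ge0.
Qed.
End kernel_series_bound.

(** * Integration of the expansion and conclusion *)

Section final.
Variable R : realType.
Local Notation leb := (@lebesgue_measure R).

(** The kernel is the cosine transform of a Gaussian-dominated symbol with finite first moment.
    Continuity is what the substitution in the plane asks for. *)
Lemma k0_cont (c t : R) : enorm (c, 0) <= 1 / 10 -> 0 < t -> continuous (k0 c t).
Proof.
move=> hc t0; have t2 : 0 < t / 2 by rewrite divr_gt0.
pose m (x : R * R) := pp ord0 ord0 x / Aq (c, 0) x * GA (c, 0) t x.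
have E : k0 c t = FC m.
  apply/funext => w; apply: eq_Rint => x; rewrite /J /m !expr0 !mul1r addr0; ring.
have mm : measurable_fun setT m.
  apply: measurable_funM; first by apply: sym_meas => //; exact: pp_cont.
  by apply: continuous2_measurable; exact: GA_cont.
have mb x : `|m x| <= 2 * gg (t / 2) (t / 2) x.
  rewrite /m normrM (ger0_norm (GA_ge0 _ _ _)); apply: ler_pM => //; [exact: GA_ge0|exact: pp_sym|exact: GA_le].
have i1 : itg (leb2 R) m by apply: itg2_le mm mb (itgZl 2 (gg_itg t2 t2)).
have i2 : itg (leb2 R) (fun x => m x * enorm x).
  apply: (@itg2_le _ _ (fun x => 2 * (`|x.1 ^+ 1 * x.2 ^+ 0 * gg (t / 2) (t / 2) x| + `|x.1 ^+ 0 * x.2 ^+ 1 * gg (t / 2) (t / 2) x|))).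
  - by apply: measurable_funM => //; apply: continuous2_measurable; exact: enorm_cont.
  - move=> x; rewrite normrM (ger0_norm (enorm_ge0 _)) !expr0 !expr1 mulr1 mul1r (normrM x.1) (normrM x.2) (ger0_norm (gg_ge0 _ _ x)) -mulrDl.
    rewrite [X in _ <= X]mulrCA [X in X <= _]mulrC.
    exact: (ler_pM (enorm_ge0 x) (normr_ge0 _) (enorm_le_l1 x) (mb x)).
  - by apply: itgZl; apply: itgD; apply: itg_norm; exact: pow_gg_itg.
by rewrite E; exact: (FC_lip i1 i2).1.
Qed.

Lemma Rint_sum (N : nat) (h : nat -> R * R -> R) : (forall n, itg (leb2 R) (h n)) ->
  itg (leb2 R) (fun x => \sum_(0 <= n < N) h n x) /\
  \int[leb2 R]_x \sum_(0 <= n < N) h n x = \sum_(0 <= n < N) \int[leb2 R]_x h n x.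
Proof.
move=> ih; elim: N => [|N [IH1 IH2]].
  rewrite big_nil; split; first by under eq_fun do rewrite big_nil; exact: itg0.
  by under eq_Rint do rewrite big_nil; exact: Rint0.
have E x : \sum_(0 <= n < N.+1) h n x = \sum_(0 <= n < N) h n x + h N x by rewrite big_nat_recr.
split; first by under eq_fun do rewrite E; exact: itgD.
by under eq_Rint do rewrite E; rewrite (RintD IH1 (ih N)) IH2 big_nat_recr.
Qed.

(** The multipole integrands are polynomials in the integration variable times the density. This
    class is stable under sums and products and integrable against exponential decay, so no term has
    to be examined individually. *)
Definition poly_growth (P : R * R -> R) := continuous P /\ exists B m, 0 <= B /\ forall x, `|P x| <= B * (1 + enorm x) ^+ m.

Lemma pgD P Q : poly_growth P -> poly_growth Q -> poly_growth (fun x => P x + Q x).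
Proof.
move=> [cP [B [m [B0 hP]]]] [cQ [B' [m' [B0' hQ]]]]; split; first exact: contD2.
exists (B + B'), (m + m')%N; split=> [|x]; first exact: addr_ge0.
have r1 : 1 <= 1 + enorm x by rewrite lerDl enorm_ge0.
apply: (le_trans (ler_normD _ _)); rewrite mulrDl; apply: lerD.
  by apply: (le_trans (hP x)); apply: ler_wpM2l => //; apply: ler_weXn2l => //; exact: leq_addr.
by apply: (le_trans (hQ x)); apply: ler_wpM2l => //; apply: ler_weXn2l => //; exact: leq_addl.
Qed.

Lemma pgM P Q : poly_growth P -> poly_growth Q -> poly_growth (fun x => P x * Q x).
Proof.
move=> [cP [B [m [B0 hP]]]] [cQ [B' [m' [B0' hQ]]]]; split; first exact: contM2.
exists (B * B'), (m + m')%N; split=> [|x]; first exact: mulr_ge0.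
by rewrite normrM exprD mulrACA; apply: ler_pM.
Qed.

Lemma pg_cst (k : R) : poly_growth (fun=> k).
Proof. by split; [move=> x; exact: cvg_cst|exists `|k|, 0%N; split=> // x; rewrite expr0 mulr1]. Qed.

Lemma pgX P n : poly_growth P -> poly_growth (fun x => P x ^+ n).
Proof.
move=> pP; elim: n => [|n IH]; first exact: pg_cst.
by under eq_fun do rewrite exprS; exact: pgM.
Qed.

Lemma pg_coord j : poly_growth (pcoord j).
Proof.
split; first exact: pcoord_cont.
exists 1, 1%N; split=> // x; rewrite mul1r expr1; apply: (le_trans (pcoord_le j x)); by rewrite lerDr.
Qed.

Lemma pg_itg (P F : R * R -> R) (Cf nu : R) : poly_growth P -> continuous F -> 0 < nu -> nu <= 1 -> 0 <= Cf ->
  (forall x, `|F x| <= Cf * expR (- (nu * enorm x))) -> itg (leb2 R) (fun x => P x * F x).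
Proof.
move=> [cP [B [m [B0 hP]]]] cF n0 n1 Cf0 hF.
have a0 : 0 < nu / 4 by rewrite divr_gt0.
have a1 : nu / 4 <= 1 / 4 by lra.
apply: (@itg2_le _ _ (fun x => B * (2 * m`!%:R * (nu / 4)^-1 ^+ m) * Cf * expw (nu / 4) x)).
- by apply: continuous2_measurable; exact: contM2.
- move=> x; have r0 := enorm_ge0 x; rewrite normrM.
  apply: (le_trans (ler_pM (normr_ge0 _) (normr_ge0 _) (hP x) (hF x))).
  have h := ler_wpM2l B0 (exp_pow1 m r0 a0 a1).
  have c0 : 0 <= Cf * expR (- (nu * enorm x)) by rewrite mulr_ge0 ?expR_ge0.
  apply: (le_trans (ler_wpM2r c0 h)).
  have e : expR (nu / 4 * enorm x) * expR (- (nu * enorm x)) <= expw (nu / 4) x.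
    have h2 := exp_enorm_le x (ltW (divr_gt0 n0 (ltr0Sn R 1))).
    apply: (@le_trans _ _ (expR (- (nu / 2 * enorm x)))).
      rewrite -expRD ler_expR; have : 0 <= nu * enorm x by rewrite mulr_ge0// ltW.
      by move: (enorm x) => r; lra.
    by move: h2; rewrite (_ : nu / 2 / 2 = nu / 4); [exact|field].
  have k0 : 0 <= B * (2 * m`!%:R * (nu / 4)^-1 ^+ m) * Cf.
    apply: mulr_ge0 => //; apply: mulr_ge0 => //; apply: mulr_ge0; first exact: mulr_ge0.
    by rewrite exprn_ge0// invr_ge0 ltW.
  have := ler_wpM2l k0 e; apply: le_trans; rewrite le_eqVlt; apply/orP; left; apply/eqP.
  by move: (expR _) (expR _) (_ ^-1 ^+ m) (m`!%:R : R) => u v w q; ring.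
- by apply: itgZl; exact: expw_itg.
Qed.

Lemma cont_scale1 (nu : R) : continuous (fun v : R * R => (nu * v.1, v.2)).
Proof.
move=> v.
have h : (fun w : R * R => nu * w.1) w @[w --> v] --> nu * v.1 by apply: cvgMr; exact: cvg_fst.
have h2 : (fun w : R * R => w.2) w @[w --> v] --> v.2 by exact: cvg_snd.
exact: (cvg_pair h h2).
Qed.

Lemma nu_bounds (c nu : R) : `|c| <= 1 / 10 -> nu = Num.sqrt (1 - c ^+ 2) ->
  [/\ 0 < nu, nu <= 1, nu ^+ 2 = 1 - c ^+ 2, 2 / 5 <= nu / 2 & nu ^+ 2 / 8 <= nu / 4] /\
  (4 * pi * nu ^+ 2)^-1 <= 1.
Proof.
move=> hc nuE; have c2 : c ^+ 2 <= 1 / 100.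
  have h : `|c| ^+ 2 <= (1 / 10) ^+ 2 by rewrite lerXn2r// nnegrE; lra.
  by move: h; rewrite (real_normK (num_real c)) expr_div_n; lra.
have c20 := sqr_ge0 c.
have nu2 : nu ^+ 2 = 1 - c ^+ 2 by rewrite nuE sqr_sqrtr//; lra.
have nu00 : 0 <= nu by rewrite nuE sqrtr_ge0.
have nu1 : nu <= 1 by rewrite -(@ler_pXn2r _ 2)// ?nnegrE// nu2 expr1n; lra.
have nu9 : 9 / 10 <= nu.
  by rewrite -(@ler_pXn2r _ 2)// ?nnegrE ?divr_ge0// nu2 expr_div_n; lra.
have nu0 : 0 < nu by lra.
have le2 : nu ^+ 2 <= nu by rewrite expr2 ler_piMr.
split; first by split=> //; lra.
have p2 := @pi_ge2 R.
rewrite invf_le1; last by rewrite !mulr_gt0 ?pi_gt0// exprn_gt0.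
have : 4 * 2 * (9 / 10) ^+ 2 <= 4 * pi * nu ^+ 2 :> R.
  by apply: ler_pM; rewrite ?exprn_ge0 ?mulr_ge0 ?divr_ge0// ?ler_wpM2l// lerXn2r ?nnegrE ?divr_ge0.
by rewrite expr_div_n; lra.
Qed.

(** Everything is stated before multiplication by c^2, so that the truncation error too will carry
    that factor. *)
Lemma expansion_bound (Cf B : R) : 0 <= Cf -> exists2 CC : R, 0 <= CC &
  forall (c nu : R) (U : R * R -> R[i]) (K : nat) (y : R * R),
   `|c| <= 1 / 10 -> nu = Num.sqrt (1 - c ^+ 2) -> exp_decaying (sqmod U) ->
   (forall x, `|sqmod U x| <= Cf * expR (- enorm x)) -> (forall xi, om xi ^+ 4 * fa (sqmod U) xi <= B) ->
   (3 <= K)%N -> 4 <= enorm y ->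
   `|c4 R * MI (Msym ord0 ord0 0 0 (c, 0)) (sqmod U) 0 y - (4 * pi * nu ^+ 2)^-1 * expansion_sum nu U K (nu^-1 * y.1, y.2)|
   <= CC * (K%:R * 3 ^+ K / enorm y ^+ K.+1 + expansion_const nu K * expR (- (nu ^+ 2 / 8 * (enorm y `^ K%:R^-1)))).
Proof.
move=> Cf0; have [C C0 hk] := @damped_kernel_bound R ord0 ord0 0 0.
pose IW := \int[leb2 R]_x W x; pose E1 := \int[leb2 R]_x expw (1 / 5) x.
have E10 : 0 <= E1 by apply: Rint_ge0 => x; exact: expw_ge0.
exists (`|3 * B * IW| + Cf * (110 + (4 + C)) * E1).
  by rewrite addr_ge0// mulr_ge0// mulr_ge0// !addr_ge0.
move=> c nu U K y hc nuE ef hf hB K3 y4; set f := sqmod U.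
have [[nu0 nu1 nu2 nu25 nu84] q1] := nu_bounds hc nuE.
have nu00 := ltW nu0; have nn : nu != 0 by rewrite gt_eqF.
have nu21 : nu ^+ 2 <= 1 by rewrite expr_le1.
have ha : 0 < 1 / 2 :> R by rewrite divr_gt0.
have q5 : 0 < 1 / 5 :> R by rewrite divr_gt0.
have a25 : 0 <= 2 / 5 :> R by rewrite divr_ge0.
have c41 : c4 R <= 1.
  by apply: (le_trans (c4_le R)); rewrite ler_pdivrMr// mul1r ler1n.
have pn : pi != 0 :> R by rewrite gt_eqF// pi_gt0.
have q0 : 0 < 4 * pi * nu ^+ 2 by rewrite !mulr_gt0 ?pi_gt0// exprn_gt0.
have ec : enorm (c, 0) <= 1 / 10 by rewrite /enorm /dotp/= mulr0 addr0 -expr2 sqrtr_sqr.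
have y0 : 0 < enorm y by apply: lt_le_trans y4.
have y1 : 1 <= enorm y by apply: le_trans y4; exact: ler1n.
pose z := (nu^-1 * y.1, y.2); rewrite -/z.
have yz : enorm y <= enorm z.
  rewrite enorm_le ?enorm_ge0// enorm2 /z/= lerD2r exprMn ler_peMl ?sqr_ge0//.
  by rewrite exprn_ege1// invf_ge1.
have z4 : 4 <= enorm z := le_trans y4 yz.
have Kn : K%:R != 0 :> R by rewrite pnatr_eq0; apply: contraTneq K3 => ->.
(* Radius of the zone in which the series is used. As g^K = |y| <= |z|, the hypothesis of
   [limit_kernel_series] on z holds. *)
set g := enorm y `^ K%:R^-1.
have gK : g ^+ K = enorm y.
  by rewrite -powR_mulrn ?powR_ge0// -powRrM mulVf// powRr1// ltW.
have g1 : 1 <= g.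
  have K0 : (0 < K)%N by apply: leq_trans K3.
  rewrite leNgt; apply/negP => gl; have : g ^+ K < 1 by rewrite exprn_ilt1 ?powR_ge0// -lt0n.
  by rewrite gK ltNge y1.
(* The truncation error is O(t) while the kernel is only bounded by C/t; this t is the fourth root
   of the decay e^{-nu g} of the density at the edge of the zone. *)
pose t := expR (- (nu / 4 * g)); have t0 : 0 < t := expR_gt0 _.
have hC (s : R) w : 0 < s -> s * `|k0 c s w| <= C.
  by move=> s0; have [h _] := hk (c, 0) 0 s w ec s0; move: h; rewrite !add0n sqr_sqrtr// ltW.
have [i1 h1] := @multiplier_trunc R ord0 ord0 0 0 (c, 0) f B 0 t y ec t0 ef hB.
have sf : smooth f by case: ef.
have cf : continuous f by exact: (@smooth_cont _ _ [::] sf).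
pose F (v : R * R) := f (nu * v.1, v.2).
have cF : continuous F.
  by move=> v; apply: (@continuous_comp _ _ _ (fun v : R * R => (nu * v.1, v.2)) f); [exact: cont_scale1|exact: cf].
have ev (v : R * R) : nu * enorm v <= enorm (nu * v.1, v.2).
  rewrite -(@ler_pXn2r _ 2)// ?nnegrE ?mulr_ge0 ?enorm_ge0// exprMn !enorm2/= exprMn mulrDr lerD2l.
  by rewrite ler_piMl ?sqr_ge0.
have hF v : `|F v| <= Cf * expR (- (nu * enorm v)).
  by apply: (le_trans (hf _)); apply: ler_wpM2l => //; rewrite ler_expR lerN2.
have cG : continuous (fun x => f x * k0 c t (y - x)).
  apply: contM2 => // x; apply: (@continuous_comp _ _ _ (fun x : R * R => y - x) (k0 c t)); last exact: k0_cont.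
  by apply: cvgB; [exact: cvg_cst|exact: cvg_id].
have ie a : itg leb (fun x => a * expR (- (1 / 2 * `|x|))) by apply: itgZl; exact: expR_abs_itg.
have ce a : continuous (fun x : R => a * expR (- (1 / 2 * `|x|))).
  move=> x; apply: cvgM; first exact: cvg_cst.
  apply: (@continuous_comp _ _ _ (fun x : R => - (1 / 2 * `|x|)) expR); last exact: continuous_expR.
  by apply: cvgN; apply: cvgM; [exact: cvg_cst|exact: norm_continuous].
have GE x : `|f x * k0 c t (y - x)| <= (Cf * (C / t) * expR (- (1 / 2 * `|x.1|))) * (1 * expR (- (1 / 2 * `|x.2|))).
  have e : expR (- enorm x) <= expw (1 / 2) x by have := @exp_enorm_le R 1 x ler01; rewrite (mul1r (enorm x)).
  have hkx : `|k0 c t (y - x)| <= C / t by rewrite ler_pdivlMr// mulrC; exact: hC.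
  rewrite normrM; apply: (le_trans (ler_pM (normr_ge0 _) (normr_ge0 _) (hf x) hkx)).
  have := ler_wpM2l (mulr_ge0 Cf0 (divr_ge0 C0 (ltW t0))) e; rewrite /expw.
  rewrite mulrAC [X in _ -> is_true (_ <= X)](_ : _ = Cf * (C / t) * (expR (- (1 / 2 * `|x.1|)) * expR (- (1 / 2 * `|x.2|)))); last by move: (expR _) (expR _) => a b; ring.
  by rewrite mulrAC.
(* The dilation x = (nu v_1, v_2) puts the kernel in Euclidean form, with y replaced by z; its
   Jacobian nu, together with pi/nu^3 and [c4], yields the prefactor 1/(4 pi nu^2). *)
have [i2 E2] := @subst_plane R (fun x => f x * k0 c t (y - x)) _ _ nu 1 0 nu0 ltr01 cG (ce _) (ce _) (ie _) (ie _) GE.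
have arg (v : R * R) : y - (nu * v.1 + (0 : R * R).1, 1 * v.2 + (0 : R * R).2) = (nu * (z - v).1, (z - v).2).
  rewrite /z /= !addr0 mul1r; case: (y) => y1' y2' /=; congr (_, _).
  by rewrite mulrDr mulrN mulrA divff// mul1r.
have EF v : f (nu * v.1 + (0 : R * R).1, 1 * v.2 + (0 : R * R).2) = F v by rewrite /F/= !addr0 mul1r.
have i2' : itg (leb2 R) (fun v => F v * k0 c t (nu * (z - v).1, (z - v).2)).
  by move: i2; under eq_fun do rewrite arg EF.
have E2' : \int[leb2 R]_x (f x * k0 c t (y - x)) = nu * \int[leb2 R]_v (F v * k0 c t (nu * (z - v).1, (z - v).2)).
  move: E2; under eq_Rint do rewrite arg EF.
  by rewrite mulr1 => ->; rewrite mulrA divff// mul1r.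
have pz j : poly_growth (fun v : R * R => pcoord j z - pcoord j v).
  have := pgD (pg_cst (pcoord j z)) (pgM (pg_cst (-1)) (pg_coord j)).
  by under eq_fun do rewrite mulN1r.
have pX : poly_growth (fun v : R * R => 2 * dotp z v - enorm v ^+ 2).
  have p0 := pg_coord ord0; have p1 := pg_coord ord_max.
  have := pgD (pgM (pg_cst 2) (pgD (pgM (pg_cst z.1) p0) (pgM (pg_cst z.2) p1))) (pgM (pg_cst (-1)) (pgD (pgX 2 p0) (pgX 2 p1))).
  have E v : 2 * (z.1 * pcoord ord0 v + z.2 * pcoord ord_max v) + -1 * (pcoord ord0 v ^+ 2 + pcoord ord_max v ^+ 2) = 2 * dotp z v - enorm v ^+ 2.
    by rewrite mulN1r enorm2.
  by under eq_fun do rewrite E.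
pose T (n : nat) (v : R * R) := (2 - 4 * n.+1%:R * (z.1 - v.1) ^+ 2 / enorm z ^+ 2) * (2 * dotp z v - enorm v ^+ 2) ^+ n * F v.
have iT n : itg (leb2 R) (T n).
  apply: (@pg_itg (fun v => (2 - 4 * n.+1%:R * (z.1 - v.1) ^+ 2 / enorm z ^+ 2) * (2 * dotp z v - enorm v ^+ 2) ^+ n) F Cf nu) => //.
  apply: pgM; last exact: pgX.
  have := pgD (pg_cst 2) (pgM (pg_cst (- (4 * n.+1%:R / enorm z ^+ 2))) (pgX 2 (pz ord0))).
  have E v : 2 + - (4 * n.+1%:R / enorm z ^+ 2) * (pcoord ord0 z - pcoord ord0 v) ^+ 2 = 2 - 4 * n.+1%:R * (z.1 - v.1) ^+ 2 / enorm z ^+ 2.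
    by rewrite /pcoord/= mulNr mulrAC.
  by under eq_fun do rewrite E.
have [i3 E3] := @Rint_sum K.+1 (fun n v => (enorm z ^+ (2 * n + 2)%N)^-1 * T n v) (fun n => itgZl _ (iT n)).
have EP v : \sum_(0 <= n < K.+1) ((enorm z ^+ (2 * n + 2)%N)^-1 * T n v) = F v * multipole_sum z K v.
  rewrite /multipole_sum mulr_sumr; apply: eq_bigr => n _; rewrite /T.
  by move: (_ ^-1) (2 - _) (_ ^+ n) (F v) => p q r s; ring.
have i3' : itg (leb2 R) (fun v => F v * multipole_sum z K v) by move: i3; under eq_fun do rewrite EP.
have ES : expansion_sum nu U K z = \int[leb2 R]_v (F v * multipole_sum z K v).
  rewrite -(@eq_Rint _ _ _ (leb2 R) _ _ EP) E3 /expansion_sum; apply: eq_bigr => n _.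
  by rewrite (RintZl _ (iT n)).
pose D := \int[leb2 R]_v (F v * (nu ^+ 3 / pi * k0 c t (nu * (z - v).1, (z - v).2) - multipole_sum z K v)).
have ED : D = nu ^+ 3 / pi * \int[leb2 R]_v (F v * k0 c t (nu * (z - v).1, (z - v).2)) - expansion_sum nu U K z.
  rewrite ES -(RintZl _ i2') -(RintB (itgZl _ i2') i3'); apply: eq_Rint => v.
  by move: (k0 _ _ _) (multipole_sum _ _ _) (F v) => a b d; ring.
have iD : itg (leb2 R) (fun v => F v * (nu ^+ 3 / pi * k0 c t (nu * (z - v).1, (z - v).2) - multipole_sum z K v)).
  have E v : F v * (nu ^+ 3 / pi * k0 c t (nu * (z - v).1, (z - v).2) - multipole_sum z K v) = nu ^+ 3 / pi * (F v * k0 c t (nu * (z - v).1, (z - v).2)) - F v * multipole_sum z K v by ring.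
  by under eq_fun do rewrite E; exact: itgB (itgZl _ i2') i3'.
have G0 : 0 <= Cf * series_error nu C g (enorm z) K.
  apply: (@le_trans _ _ (`|F 0 * (nu ^+ 3 / pi * k0 c t (nu * (z - 0).1, (z - 0).2) - multipole_sum z K 0)|)) => //.
  have := kernel_series_bound ec nu0 nu1 nu2 C0 Cf0 hC K3 z4 g1 (eq_ind_r (fun r => r <= enorm z) yz gK) (hF 0).
  have en0 : enorm (0 : R * R) = 0 by rewrite /enorm /dotp/= !mulr0 addr0 sqrtr0.
  have e0 : expR (- (nu / 2 * enorm (0 : R * R))) = 1 by rewrite en0 mulr0 oppr0 expR0.
  by rewrite e0 (mulr1 (Cf * _)).
(* The remaining decay rate nu/2 is at least 2/5, which gives a majorant independent of c. *)
have bD : `|D| <= Cf * series_error nu C g (enorm z) K * E1.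
  rewrite -(RintZl _ (expw_itg q5)); apply: (@Rint_bound _ _ _ (leb2 R)); [exact: itg_meas iD|by apply: itgZl; exact: expw_itg|move=> v].
  apply: (le_trans (kernel_series_bound ec nu0 nu1 nu2 C0 Cf0 hC K3 z4 g1 (eq_ind_r (fun r => r <= enorm z) yz gK) (hF v))).
  apply: ler_wpM2l => //; have := exp_enorm_le v a25; rewrite (_ : 2 / 5 / 2 = 1 / 5); last by field.
  apply: le_trans; rewrite ler_expR lerN2; apply: ler_wpM2r => //; exact: enorm_ge0.
have -> : c4 R * MI (Msym ord0 ord0 0 0 (c, 0)) f 0 y - (4 * pi * nu ^+ 2)^-1 * expansion_sum nu U K z =
   c4 R * (MI (Msym ord0 ord0 0 0 (c, 0)) f 0 y - \int[leb2 R]_x (f x * k0 c t (y - x))) + (4 * pi * nu ^+ 2)^-1 * D.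
  rewrite ED E2' /c4; move: (\int[leb2 R]_v _) (expansion_sum _ _ _ _) (MI _ _ _ _) => a b m.
  by move: (pi : R) pn => p pn; field; rewrite nn pn.
have Q0 : 0 <= (4 * pi * nu ^+ 2)^-1 by rewrite invr_ge0 ltW.
have [e1 e2] := econst_le K nu0 nu1.
have gl := series_error_le K nu0 nu1 C0 (le_trans ler01 g1) y0 yz.
have H0 : 0 <= K%:R * 3 ^+ K / enorm y ^+ K.+1.
  apply: divr_ge0; last by rewrite exprn_ge0// ltW.
  by apply: mulr_ge0 => //; rewrite exprn_ge0.
apply: (le_trans (ler_normD _ _)); rewrite [X in _ <= X]mulrDl; apply: lerD.
  rewrite normrM (ger0_norm (c4_ge0 R)).
  apply: (@le_trans _ _ (t * `|3 * B * IW|)).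
    apply: (@le_trans _ _ (1 * (t * (3 * B * IW)))).
      exact: (ler_pM (c4_ge0 R) (normr_ge0 _) c41 h1).
    by rewrite mul1r; apply: ler_wpM2l; [exact: ltW|exact: ler_norm].
  rewrite mulrC; apply: ler_wpM2l => //; apply: ler_wpDl => //.
  apply: (@le_trans _ _ (1 * expR (- (nu ^+ 2 / 8 * g)))); last by apply: ler_wpM2r => //; exact: expR_ge0.
  rewrite mul1r ler_expR lerN2; apply: ler_wpM2r; first exact: le_trans g1.
  exact: nu84.
rewrite normrM (ger0_norm Q0); apply: (le_trans (ler_pM Q0 (normr_ge0 _) q1 bD)); rewrite mul1r.
apply: (le_trans (ler_wpM2r E10 (ler_wpM2l Cf0 gl))).
by rewrite le_eqVlt; apply/orP; left; apply/eqP; move: (K%:R * _ / _) (expansion_const _ _ * _) => a b; ring.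
Qed.
End final.

Theorem lemma4 (R : realType) (cs : R) (Q : R * R -> R)
    (U : R * R -> R * R -> R[i]) (N : R * R -> R * R -> R)
    (V : R * R -> R * R -> R * R)
    (hcs : 0 < cs < 1) (hQ : nls_soliton Q)
    (hUNV : solitary_profiles cs Q U N V) :
  exists2 ct : R, 0 < ct < cs &
    (forall m : nat * nat, exists2 C : R, 0 < C &
       forall c y : R * R, enorm c < ct -> 4 <= enorm y ->
         `|pderiv m (N c) y|
           <= C * (expR (- enorm y)
                   + enorm c ^+ 2 / enorm y ^+ (mdeg m + 2)) /\
         `|pderiv m (fun x => (V c x).1) y| + `|pderiv m (fun x => (V c x).2) y|
           <= C * (enorm c / enorm y ^+ (mdeg m + 2))) /\
    (exists2 C : R, 0 < C &
       forall (c : R) (K : nat) (y : R * R),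
         `|c| < ct -> (3 <= K)%N -> 4 <= enorm y ->
         let nu := Num.sqrt (1 - c ^+ 2) in
         let z := (nu^-1 * y.1, y.2) in
         `|N (c, 0) y
           + c ^+ 2 / (4 * pi * nu ^+ 2) * expansion_sum nu (U (c, 0)) K z|
         <= C * (c ^+ 2 * K%:R * 3 ^+ K / enorm y ^+ K.+1
                 + expR (- enorm y)
                 + c ^+ 2 * expansion_const nu K
                   * expR (- (nu ^+ 2 / 8) * (enorm y `^ K%:R^-1)))).
Proof.
have [ct [ct0 ct1 ef hB hC]] := profiles_uniform_bounds hcs hQ hUNV.
exists ct => //; split=> [m|]; first exact: (far_field_bounds hUNV ct0 ct1 ef hB hC m).
have [Cf Cf0 hf] := hC [::]; have [B _ hb] := hB 4%N.
have [CC CC0 hE] := expansion_bound B Cf0.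
exists (1 + Cf + CC) => [|c K y hc K3 hy]; first by rewrite -addrA ltr_pwDl ?addr_ge0.
cbv zeta; set nu := Num.sqrt _; set z := (nu^-1 * _, _).
have en : enorm (c, 0) = `|c| by rewrite /enorm /dotp/= mulr0 addr0 -expr2 sqrtr_sqr.
have hc' : enorm (c, 0) < ct by rewrite en.
have [_ ctcs] := andP ct0; have c1 : `|c| <= 1 / 10 := ltW (lt_le_trans hc ct1).
have ec : enorm (c, 0) <= 1 / 10 by rewrite en.
have efc := ef _ hc'; have h := hE c nu (U (c, 0)) K y c1 erefl efc (hf _ hc') (hb _ hc') K3 hy.
(* At velocity (c, 0) the numerator is c^2 xi_1^2, so c^2 factors out of the whole nonlocal term. *)
have E : MI (symN (c, 0)) (sqmod (U (c, 0))) 0 y = c ^+ 2 * MI (Msym ord0 ord0 0 0 (c, 0)) (sqmod (U (c, 0))) 0 y.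
  rewrite /MI -RintZl; last first.
    apply: (@mi_itg _ 0 _ _ 2 0 y efc); first exact: Msym_meas.
    by move=> xi; rewrite -[X in _ * _ ^+ X]/(0 + 0)%N; exact: Msym_le.
  apply: eq_Rint => xi; rewrite /symN /Msym /pp /pcoord/= {1}/dotp/= mul0r addr0 !expr0 !mulr1 exprMn -expr2.
  by rewrite !mulrA.
rewrite (N_MI hUNV y (lt_trans hc' ctcs) (edec_itg efc)) E.
set s := expansion_sum _ _ _ _ in h *; set X := K%:R * _ / _ in h; set Y := _ * expR _ in h.
have hx : `|sqmod (U (c, 0)) y| <= Cf * expR (- enorm y) := hf _ hc' y.
set M := MI _ _ _ _ in h *; set F := sqmod _ _ in hx *.
(* The local term -F yields the e^{-|y|} of the statement; the rest is c^2 times the error of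
   [expansion_bound]. *)
rewrite [X in `|X|](_ : _ = - F - c ^+ 2 * (c4 R * M - (4 * pi * nu ^+ 2)^-1 * s)); last first.
  by move: (_ ^-1) => q; ring.
have c20 := sqr_ge0 c.
apply: (le_trans (ler_normB _ _)); rewrite normrN (normrM (c ^+ 2)) (ger0_norm c20).
apply: (le_trans (lerD hx (ler_wpM2l c20 h))).
have X0 : 0 <= X.
  by apply: divr_ge0; rewrite ?mulr_ge0 ?exprn_ge0 ?enorm_ge0.
have Y0 : 0 <= Y.
  apply: mulr_ge0; rewrite ?expR_ge0// /expansion_const mulr_ge0// exprn_ge0// addr_ge0// mulr_ge0//.
  by rewrite invr_ge0 exprn_ge0// sqrtr_ge0.
rewrite [X in _ <= _ * X](_ : _ = c ^+ 2 * (X + Y) + expR (- enorm y)); last first.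
  rewrite mulNr /X /Y; move: (expR _) (expR _) (expansion_const _ _) => a b d; ring.
have P0 := mulr_ge0 c20 (addr_ge0 X0 Y0); have e0 := expR_ge0 (- enorm y).
rewrite mulrCA; have := mulr_ge0 Cf0 P0; have := mulr_ge0 CC0 e0.
by move: P0 e0; move: (c ^+ 2 * _) (expR _) => p e; lra.
Qed.
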